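(* Let $M$ be a complete noncompact $n$-dimensional Alexandrov space with nonnegative curvature. Suppose that $\mathrm{ob}_\infty(M)=\pi/2$. Then the following hold. (1) If $M$ has no boundary, then $1\text{-}\mathrm{inj}(M(\infty))\ge\pi/2$. (2) If $M$ has nonempty boundary, then $M$ is isometric to the Euclidean half space $\mathbb R^n_+$.
   Context: Alexandrov spaces of curvature $\ge\kappa$ are taken in the sense of Burago–Gromov–Perelman and are assumed finite-dimensional. $|x,y|$ denotes distance; boundary is in the sense of Alexandrov geometry. A minimal geodesic is an isometric embedding of an interval. For a point $p$, $\Sigma_p$ is the space of directions at $p$ with its angle metric $\angle$. For $p\ne q$, $\Uparrow_p^q\subset\Sigma_p$ is the set of all directions at $p$ of minimal geodesics from $p$ to $q$, and $\uparrow_p^q$ denotes an element of $\Uparrow_p^q$. For a set $A\subset \Sigma_p$, $\angle(A,\xi)$ is the distance in $\Sigma_p$ from $\xi$ to $A$. For $p\ne q\in M$ define $$\mathrm{ob}_\infty(p,q)=\limsup_{x\to\infty}\max\{\angle(\Uparrow_p^q,\uparrow_p^x),\angle(\Uparrow_q^p,\uparrow_q^x)\}-\pi/2$$ (the limsup is as $x$ leaves every bounded set, over all choices of $\uparrow_p^x\in\Uparrow_p^x$, $\uparrow_q^x\in\Uparrow_q^x$), and $\mathrm{ob}_\infty(M)=\liminf_{|p,q|\to0}\mathrm{ob}_\infty(p,q)\in[0,\pi/2]$, over pairs $p\ne q$ in $M$. The ideal boundary $M(\infty)$ of $M$ is the (angle-metric) space such that the asymptotic cone $M_\infty=\lim_{\epsilon\to0}(\epsilon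 M,p)$ (pointed Gromov–Hausdorff limit, independent of $p$) is isometric to the Euclidean cone over $M(\infty)$. For an Alexandrov space $N$ with curvature bounded below and $\xi\in\Sigma_p(N)$, the opposite direction $-\xi$, if it exists, is the element of $\Sigma_p(N)$ with $\angle(\xi,-\xi)=\pi$. The one-side injectivity radius $1\text{-}\mathrm{inj}(N)$ is the supremum of those $r\ge0$ such that for every $p\in N$ and every $\xi\in\Sigma_p(N)$ there exists a minimal geodesic of length $\ge r$ in $N$ starting from $p$ in the direction of at least one of $\xi$ or $-\xi$ (the latter if it exists). *)

(* Defs.v *)
From HB Require Import structures.
From mathcomp Require Import all_boot all_order all_algebra.
From mathcomp Require Import all_classical all_reals all_analysis.
From mathcomp Require Import ring lra.

Set Implicit Arguments.
Unset Strict Implicit.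
Unset Printing Implicit Defensive.

Import Order.TTheory GRing.Theory Num.Theory.
Import numFieldTopology.Exports numFieldNormedType.Exports.

Local Open Scope classical_set_scope.
Local Open Scope ring_scope.

Definition complete_metric (R : realType) (X : metricType R) : Prop :=
  forall F : set_system X, ProperFilter F -> cauchy F -> exists x : X, F --> x.

(* Burago-Gromov-Perelman's form of "the metric is intrinsic": approximate
   shortest chains with arbitrarily small steps.  For complete spaces it is
   equivalent to the distance being the infimum of lengths of curves. *)
Definition intrinsic_metric (R : realType) (X : metricType R) : Prop :=
  forall (x y : X) (delta : R), 0 < delta ->
    exists (k : nat) (z : nat -> X),
      [/\ z 0%N = x, z k = y,
          forall i, (i < k)%N -> mdist (z i) (z i.+1) < delta
        & \sum_(i < k) mdist (z i) (z i.+1) < mdist x y + delta].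

Definition diam (R : realType) (X : metricType R) (U : set X) : R :=
  sup [set mdist x y | x in U & y in U].

Definition hausdorff_content (R : realType) (X : metricType R) (s delta : R) :
    \bar R :=
  ereal_inf [set (\sum_(0 <= i <oo) ((diam (U i)) `^ s)%:E)%E |
    U in [set U : nat -> set X | \bigcup_i U i = setT /\
      forall i x y, U i x -> U i y -> mdist x y <= delta]].

Definition hausdorff_measure (R : realType) (X : metricType R) (s : R) :
    \bar R :=
  ereal_sup [set hausdorff_content X s delta | delta in [set d : R | 0 < d]].

Definition hausdorff_dim (R : realType) (X : metricType R) : \bar R :=
  ereal_inf [set s%:E | s in [set s : R | 0 < s /\ hausdorff_measure X s = 0%E]].

(* Angle at the vertex a of the Euclidean triangle with the side lengths of
   (a, b, c); meaningful for b <> a and c <> a. *)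
Definition comparison_angle (R : realType) (X : metricType R) (a b c : X) : R :=
  acos ((mdist a b ^+ 2 + mdist a c ^+ 2 - mdist b c ^+ 2) /
        (2 * mdist a b * mdist a c)).

(* The local quadruple condition of Burago-Gromov-Perelman, for the comparison
   plane of curvature 0. *)
Definition nonneg_curvature (R : realType) (X : metricType R) : Prop :=
  forall x : X, exists2 r : R, 0 < r &
    forall a b c d : X, ball x r a -> ball x r b -> ball x r c -> ball x r d ->
      uniq [:: a; b; c; d] ->
      comparison_angle a b c + comparison_angle a c d + comparison_angle a d b
        <= 2 * pi.

Definition alexandrov_nonneg (R : realType) (n : nat) (X : metricType R) :
    Prop :=
  [/\ complete_metric X, intrinsic_metric X, nonneg_curvature X
    & hausdorff_dim X = (n%:R)%:E].

(* Only the restriction of [gpath] to [0, glen] is meaningful. *)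
Record geodesic (R : realType) (X : metricType R) (p : X) := Geodesic {
  glen : R ;
  gpath : R -> X ;
  glen_gt0 : 0 < glen ;
  gpath0 : gpath 0 = p ;
  gpath_isometry : forall s t, 0 <= s <= glen -> 0 <= t <= glen ->
    mdist (gpath s) (gpath t) = `|s - t| }.

Definition gend (R : realType) (X : metricType R) (p : X) (g : geodesic p) : X :=
  gpath g (glen g).

(* Upper angle; in an Alexandrov space the limsup is a limit. *)
Definition angle (R : realType) (X : metricType R) (p : X) (g h : geodesic p) :
    R :=
  fine (limf_esup
    (fun st : R * R => (comparison_angle p (gpath g st.1) (gpath h st.2))%:E)
    (filter_prod (0 : R)^'+ (0 : R)^'+)).

(* The space of directions Sigma_p, i.e. the metric completion of the geodesics
   from p, with geodesics at angle 0 identified, for the distance [angle].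
   Upper angles form a bounded pseudometric, so by the Kuratowski embedding
   g |-> angle g this completion is the closure of the image of that map for
   the sup distance: a direction is represented by its angle to each geodesic. *)
Record directions (R : realType) (X : metricType R) (p : X) := Direction {
  dir_angle : geodesic p -> R ;
  dir_closure : forall e : R, 0 < e -> exists g : geodesic p,
    forall h, `|dir_angle h - angle g h| <= e }.

Definition dir_dist (R : realType) (X : metricType R) (p : X)
    (xi eta : directions p) : R :=
  sup [set `|dir_angle xi h - dir_angle eta h| | h in [set: geodesic p]].

Fact dir_of_closure (R : realType) (X : metricType R) (p : X) (g : geodesic p)
    (e : R) : 0 < e -> exists g' : geodesic p,
    forall h, `|angle g h - angle g' h| <= e.
Proof. by move=> e0; exists g => h; rewrite subrr normr0 ltW. Qed.

Definition dir (R : realType) (X : metricType R) (p : X) (g : geodesic p) :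
  directions p := Direction (@dir_of_closure R X p g).

Lemma geodesic_dist (R : realType) (X : metricType R) (p : X)
  (g : geodesic p) (s : R) : 0 < s <= glen g -> mdist p (gpath g s) = s.
Proof.
move=> /andP[s0 sg]; rewrite -[X in mdist X _](gpath0 g) gpath_isometry.
- by rewrite sub0r normrN gtr0_norm.
- by rewrite lexx ltW ?glen_gt0.
- by rewrite sg ltW.
Qed.

Lemma comparison_angle_bound (R : realType) (X : metricType R) (p : X)
  (g h : geodesic p) (s t : R) : 0 < s <= glen g -> 0 < t <= glen h ->
  0 <= comparison_angle p (gpath g s) (gpath h t) <= pi.
Proof.
move=> sg th; have /andP[s0 _] := sg; have /andP[t0 _] := th.
have ds := geodesic_dist sg; have dt := geodesic_dist th.
have := metric_triangle (gpath g s) p (gpath h t).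
have := metric_triangle p (gpath g s) (gpath h t).
have := metric_triangle p (gpath h t) (gpath g s).
rewrite (metric_sym (gpath g s) p) (metric_sym (gpath h t) (gpath g s)).
rewrite /comparison_angle ds dt; set d := mdist _ (gpath h t) => d1 d2 d3.
have st0 : 0 < 2 * s * t by rewrite !mulr_gt0.
have d0 : 0 <= d by exact: mdist_ge0.
have B : -1 <= (s ^+ 2 + t ^+ 2 - d ^+ 2) / (2 * s * t) <= 1.
  rewrite ler_pdivlMr // ler_pdivrMr // !expr2.
  by apply/andP; split; nra.
by rewrite acos_ge0 // acos_lepi.
Qed.

Lemma angle_bound (R : realType) (X : metricType R) (p : X)
  (g h : geodesic p) : 0 <= angle g h <= pi.
Proof.
have near0 (q : geodesic p) : (0 : R)^'+ [set s | 0 < s <= glen q].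
  near=> u; rewrite /=; apply/andP; split => //.
  by near: u; apply: nbhs_right_le; exact: glen_gt0.
rewrite /angle; set f := fun st : R * R => _; set F := filter_prod _ _.
have F0 : F [set st : R * R | 0 < st.1 <= glen g /\ 0 < st.2 <= glen h].
  exists ([set s | 0 < s <= glen g], [set t | 0 < t <= glen h]) => //=.
have L1 : (limf_esup f F <= pi%:E)%E.
  apply: ereal_inf_le; eexists.
    by eexists; [exact: F0 | reflexivity].
  apply: ge_ereal_sup => _ [st /= [sg th] <-].
  by rewrite lee_fin; case/andP: (comparison_angle_bound sg th).
have L0 : (0 <= limf_esup f F)%E.
  apply: le_ereal_inf_tmp => _ [A FA <-].
  have [st [/= [sg th] Ast]] := filter_ex (filterI F0 FA).
  apply: (@le_trans _ _ (f st)).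
    by rewrite lee_fin; case/andP: (comparison_angle_bound sg th).
  by apply: ereal_sup_ubound; exists st.
by move: L0 L1; case: limf_esup => [r| |] //=; rewrite !lee_fin => -> ->.
Unshelve. all: by end_near.
Qed.

Lemma dir_dist_has_sup (R : realType) (X : metricType R) (p : X)
  (xi eta : directions p) :
  has_sup [set `|dir_angle xi h - dir_angle eta h| | h in [set: geodesic p]].
Proof.
have [g0 H1] := dir_closure xi ltr01; have [g1 H2] := dir_closure eta ltr01.
split; first by exists `|dir_angle xi g0 - dir_angle eta g0|, g0.
exists (pi + 2) => _ [h _ <-].
have /andP[a0 a1] := angle_bound g0 h; have /andP[b0 b1] := angle_bound g1 h.
have := H1 h; have := H2 h; rewrite !ler_norml => /andP[? ?] /andP[? ?].
by apply/andP; split; lra.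
Qed.

Lemma dir_dist_ge (R : realType) (X : metricType R) (p : X)
  (xi eta : directions p) (h : geodesic p) :
  `|dir_angle xi h - dir_angle eta h| <= dir_dist xi eta.
Proof.
apply: sup_upper_bound; first exact: dir_dist_has_sup.
by exists h.
Qed.

Lemma dir_dist_le (R : realType) (X : metricType R) (p : X)
  (xi eta : directions p) (c : R) :
  (forall h, `|dir_angle xi h - dir_angle eta h| <= c) -> dir_dist xi eta <= c.
Proof.
move=> H; apply: ge_sup; first by case: (dir_dist_has_sup xi eta).
by move=> _ [h _ <-].
Qed.

HB.instance Definition _ (R : realType) (X : metricType R) (p : X) :=
  gen_eqMixin (directions p).
HB.instance Definition _ (R : realType) (X : metricType R) (p : X) :=
  gen_choiceMixin (directions p).

Section directions_metric.
Context (R : realType) (X : metricType R) (p : X).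

Let dir_dist_pos (xi eta : directions p) : 0 <= dir_dist xi eta.
Proof.
have [g _] := dir_closure xi ltr01.
exact: le_trans (normr_ge0 _) (dir_dist_ge xi eta g).
Qed.

Let dir_distxx (xi : directions p) : dir_dist xi xi = 0.
Proof.
apply/eqP; rewrite eq_le dir_dist_pos andbT.
by apply: dir_dist_le => h; rewrite subrr normr0.
Qed.

Let dir_dist_eq0 (xi eta : directions p) : dir_dist xi eta = 0 -> xi = eta.
Proof.
move=> xi0; have fE : dir_angle xi = dir_angle eta.
  apply/funext => h; apply/eqP; rewrite -subr_eq0 -normr_le0 -xi0.
  exact: dir_dist_ge.
case: xi eta fE {xi0} => [f Hf] [f' Hf'] /= fE; move: Hf'; rewrite -fE => Hf'.
by congr Direction; exact: Prop_irrelevance.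
Qed.

Let dir_dist_sym (xi eta : directions p) : dir_dist xi eta = dir_dist eta xi.
Proof.
by congr sup; apply: eq_imagel => h _; rewrite distrC.
Qed.

Let dir_dist_triangle (eta xi zeta : directions p) :
  dir_dist xi zeta <= dir_dist xi eta + dir_dist eta zeta.
Proof.
apply: dir_dist_le => h; apply: le_trans (ler_distD (dir_angle eta h) _ _) _.
by apply: lerD; exact: dir_dist_ge.
Qed.

HB.instance Definition _ := isMetric.Build R (directions p)
  dir_distxx dir_dist_eq0 dir_dist_sym dir_dist_triangle.

End directions_metric.

Definition dirs_to (R : realType) (X : metricType R) (p q : X) :
    set (directions p) :=
  [set xi | exists2 g : geodesic p, gend g = q & dir g = xi].
Arguments dirs_to {R X} p q _.

(* p is a boundary point of the 1-manifold X: an open embedding of [0, 1[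
   into X sends 0 to p. *)
Definition boundary_point1 (R : realType) (X : metricType R) (p : X) : Prop :=
  exists f : R -> X,
    [/\ f 0 = p, {within [set` `[0, 1[], continuous f},
        {in `[0, 1[ &, injective f}
      & forall V : set R, open V -> open (f @` (V `&` [set` `[0, 1[]))].

(* Induction on the dimension n of X; the directions at a point of X form an
   (n - 1)-dimensional space. *)
Fixpoint boundary_point (R : realType) (n : nat) (X : metricType R) (p : X) :
    Prop :=
  match n with
  | 0 => False
  | 1 => boundary_point1 p
  | n'.+1 => exists xi : directions p, boundary_point n' xi
  end.

Definition boundary (R : realType) (n : nat) (X : metricType R) : set X :=
  [set p | boundary_point n p].
Arguments boundary {R} n X _.

Definition dist_to_set (R : realType) (X : metricType R) (A : set X) (x : X) :
    \bar R :=
  ereal_inf [set (mdist a x)%:E | a in A].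

(* A holds eventually as x leaves every bounded set: ~` A is bounded. *)
Definition at_infinity (R : realType) (X : metricType R) : set_system X :=
  [set A | exists r : R, forall x y, ~ A x -> ~ A y -> mdist x y <= r].
Arguments at_infinity {R} X _.

Definition ob_infty (R : realType) (X : metricType R) (p q : X) : \bar R :=
  (limf_esup
    (fun x => ereal_sup
      [set Order.max (dist_to_set (dirs_to p q) xi)
                     (dist_to_set (dirs_to q p) eta)
        | xi in dirs_to p x & eta in dirs_to q x])
    (at_infinity X) - (pi / 2)%:E)%E.

(* The filter of |p, q| -> 0 with p <> q, uniformly on X. *)
Definition near_diagonal (R : realType) (X : metricType R) :
    set_system (X * X) :=
  [set A | exists2 d : R, 0 < d &
    forall p q, p <> q -> mdist p q < d -> A (p, q)].
Arguments near_diagonal {R} X _.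

Definition ob_infty_space (R : realType) (X : metricType R) : \bar R :=
  limf_einf (fun pq : X * X => ob_infty pq.1 pq.2) (near_diagonal X).

(* (C, o) is the pointed Gromov-Hausdorff limit of (eps X, p) as eps -> 0+:
   the balls of radius r of eps X around p admit eta-approximations to C. *)
Definition asymptotic_cone (R : realType) (X : metricType R) (p : X)
    (C : metricType R) (o : C) : Prop :=
  complete_metric C /\
  forall r eta : R, 0 < r -> 0 < eta -> \forall eps \near (0 : R)^'+,
    exists f : X -> C,
      [/\ f p = o,
          forall x y, eps * mdist p x < r -> eps * mdist p y < r ->
            `|mdist (f x) (f y) - eps * mdist x y| < eta
        & forall z, mdist o z < r - eta ->
            exists2 x, eps * mdist p x < r & mdist (f x) z < eta].

Definition cone_dist (R : realType) (N : metricType R) (u v : R * N) : R :=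
  Num.sqrt (u.1 ^+ 2 + v.1 ^+ 2 -
            2 * u.1 * v.1 * cos (Num.min (mdist u.2 v.2) pi)).

(* C is isometric to the Euclidean cone over N.  All the pairs (0, xi) name the
   apex o, which is mentioned separately because N may be empty. *)
Definition is_euclidean_cone (R : realType) (C N : metricType R) : Prop :=
  exists (o : C) (c : R * N -> C),
    [/\ forall xi, c (0, xi) = o,
        forall u v, 0 <= u.1 -> 0 <= v.1 -> mdist (c u) (c v) = cone_dist u v
      & forall x, x = o \/ exists2 u, 0 <= u.1 & c u = x].

(* N is (a copy of) the ideal boundary of X.  Since the cone only depends on
   distances truncated at pi, N is normalized to carry its angle metric, whose
   values are at most pi; this determines N up to isometry. *)
Definition is_ideal_boundary (R : realType) (X N : metricType R) : Prop :=
  (forall x y : N, mdist x y <= pi) /\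
  exists (C : metricType R) (p : X) (o : C),
    asymptotic_cone p o /\ is_euclidean_cone C N.

Definition extends_to (R : realType) (N : metricType R) (p : N)
    (xi : directions p) (r : R) : Prop :=
  exists2 g : geodesic p, dir g = xi & r <= glen g.

(* r = 0 is always admissible, geodesics of length 0 being allowed there; the
   supremum is +oo when N has no directions at all, e.g. when N is discrete. *)
Definition one_side_inj (R : realType) (N : metricType R) : \bar R :=
  ereal_sup [set r%:E | r in [set r : R | 0 <= r /\
    (0 < r -> forall (p : N) (xi : directions p),
      extends_to xi r \/
      exists2 eta : directions p, mdist xi eta = pi & extends_to eta r)]].

Definition euclidean_dist (R : realType) (n : nat) (v w : 'rV[R]_n) : R :=
  Num.sqrt (\sum_(i < n) (v 0 i - w 0 i) ^+ 2).

(* i.+1 = n selects the last coordinate. *)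
Definition half_space (R : realType) (n : nat) : set 'rV[R]_n :=
  [set v | forall i : 'I_n, i.+1 = n -> 0 <= v 0 i].
Arguments half_space R n _ : clear implicits.

Definition isometric_to_half_space (R : realType) (n : nat) (X : metricType R) :
    Prop :=
  exists f : X -> 'rV[R]_n,
    (forall x y, euclidean_dist (f x) (f y) = mdist x y) /\
    range f = half_space R n.

(* Main.v *)
From HB Require Import structures.
Require Import Defs.
From mathcomp Require Import all_boot all_order all_algebra.
From mathcomp Require Import all_classical all_reals all_analysis.
From mathcomp Require Import ring lra.
Import Order.TTheory GRing.Theory Num.Theory.
Import numFieldTopology.Exports numFieldNormedType.Exports.
Set Implicit Arguments.
Unset Strict Implicit.
Unset Printing Implicit Defensive.
Local Open Scope classical_set_scope.
Local Open Scope ring_scope.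

(** The proof isolates one property of [M]. In a [ray_space] every interior point [m] of a shortest
    path from [a] to [b] has the following property: the half from [m] to [a], or the half from [m]
    to [b], continues beyond its end as a shortest path of any prescribed length. The hypothesis on
    [ob_infty_space] gives this ([ray_space_of_obtuse]). Take [q] close to [m] on the path. Some
    very distant point is seen from [m], or from [q], in a direction almost opposite to the other of
    the two points. Adjacent angles add up to pi, so this is almost the direction of one half, and
    hinge comparison turns the limit of such long paths into continuations of that half. The
    dichotomy passes to limits of rescaled spaces ([limit_ray_space]), hence to asymptotic cones and
    to tangent cones.

    The comparison geometry behind it is developed from the local quadruple condition. Finite
    Hausdorff dimension bounds packings ([packing_bound]), so the space is proper and geodesic. The
    quadruple condition gives Stewart's inequality locally, and [stewart_global] makes it global.

    For the first claim, let [C] be the Euclidean cone over the ideal boundary. Over a geodesic of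
    the base starting at [p] there is a flat sector of [C]; draw in it the line perpendicular to the
    radius at the unit point over [p]. If this line continues forwards, the geodesic of the base is
    prolonged to every length below pi / 2. If it continues backwards, there is a geodesic of any
    such length in the opposite direction ([sector_dich], [cone_one_side]). Limits of geodesics then
    treat directions that are not directions of geodesics.

    For the second claim, the same dichotomies show that a direction without an antipode is
    extendible: indefinitely in a ray space, and up to length pi in the base of a cone that is a ray
    space. The directions at a boundary point form a unit hemisphere. This is proved along the
    iterated spaces of directions that define the boundary: a boundary point of a 1-manifold has a
    single direction, and if the directions at a point of a cone base form a hemisphere then so does
    the base ([hemisphere_step]). Directions in the open hemisphere have no antipode, so the
    exponential map is defined on a whole half space. Comparison makes it 1-Lipschitz, and it
    preserves the distances to the origin. [half_space_rigidity] shows that such a bijection onto a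
    ray space is an isometry: every direction of the bounding hyperplane is carried to a line, and
    distances to points of lines are Euclidean. *)

Local Notation d := mdist.

(** * Limits along a nonprincipal ultrafilter *)

Lemma ulf_exists : exists G : set_system nat, UltraFilter G /\ \oo `<=` G.
Proof. exact: ultraFilterLemma. Qed.
(** One ultrafilter is fixed for the whole proof. Every bounded real sequence converges along it
    ([Ubnd]), and of two alternatives that cover all indices one holds along it ([Uor]), so that no
    subsequences have to be chosen. *)
Definition ulf : set_system nat := projT1 (cid ulf_exists).

#[global] Instance ulf_ultra : UltraFilter ulf.
Proof. by rewrite /ulf; case: cid => G []. Qed.
#[global] Instance ulf_proper : ProperFilter ulf.
Proof. exact: ultra_proper. Qed.

Lemma ulf_ge (N : nat) : ulf [set n | (N <= n)%N].
Proof.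
rewrite /ulf; case: cid => G [/= _ H]; apply: H.
by exists N.
Qed.

Lemma ulf_or (A : set nat) : ulf A \/ ulf (~` A).
Proof. exact: in_ultra_setVsetC. Qed.

Section limits.
Context {R : realType}.
Implicit Types (u v : nat -> R) (a b l : R).

Definition Ulim u l := u @ ulf --> l.

Lemma UP u l : Ulim u l <->
  forall e : R, 0 < e -> ulf [set n | `|l - u n| < e].
Proof. by split => /cvgrPdist_lt. Qed.

Lemma Ucst a : Ulim (fun=> a) a. Proof. exact: cvg_cst. Qed.
Lemma UD u v a b : Ulim u a -> Ulim v b -> Ulim (fun n => u n + v n) (a + b).
Proof. exact: cvgD. Qed.
Lemma UN u a : Ulim u a -> Ulim (fun n => - u n) (- a).
Proof. exact: cvgN. Qed.
Lemma UM u v a b : Ulim u a -> Ulim v b -> Ulim (fun n => u n * v n) (a * b).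
Proof. exact: cvgM. Qed.
Lemma UX u a k : Ulim u a -> Ulim (fun n => u n ^+ k) (a ^+ k).
Proof.
move=> h; elim: k => [|k IH]; first exact: Ucst.
rewrite exprS; under [X in Ulim X]eq_fun do rewrite exprS.
exact: UM.
Qed.
Lemma UV u a : a != 0 -> Ulim u a -> Ulim (fun n => (u n)^-1) (a^-1).
Proof. exact: cvgV. Qed.
Lemma Ule u v a b : Ulim u a -> Ulim v b -> ulf [set n | u n <= v n] -> a <= b.
Proof. by move=> ua vb uv; apply: (ler_cvg_to ua vb). Qed.
Lemma Uuniq u a b : Ulim u a -> Ulim u b -> a = b.
Proof.
move=> ua ub; apply/eqP; rewrite eq_le.
by rewrite (Ule ua ub) ?(Ule ub ua) //; apply: filterE => n /=.
Qed.
Lemma Usq u v w l : Ulim u l -> Ulim w l ->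
  ulf [set n | u n <= v n <= w n] -> Ulim v l.
Proof. by move=> ul wl h; apply: (squeeze_cvgr h). Qed.
Lemma Ueq u v l : (forall n, u n = v n) -> Ulim u l -> Ulim v l.
Proof. by move=> /funext ->. Qed.
Lemma Ucomp (f : R -> R) u a : {for a, continuous f} -> Ulim u a ->
  Ulim (fun n => f (u n)) (f a).
Proof. by move=> fa ua; apply: continuous_cvg. Qed.

Lemma Uinv : Ulim (fun n => n.+1%:R^-1) (0 : R).
Proof.
apply/UP => e e0; near=> n.
rewrite /= sub0r normrN gtr0_norm ?invr_gt0 ?ltr0n //.
rewrite invf_plt ?posrE ?ltr0n //.
have : (Num.truncn e^-1).+1%:R <= n.+1%:R :> R.
  rewrite ler_nat ltnS; near: n; exact: ulf_ge.
by apply: lt_le_trans; exact: truncnS_gt.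
Unshelve. all: by end_near. Qed.

Lemma Ubnd u a b : (forall n, a <= u n <= b) -> exists2 l, Ulim u l & a <= l <= b.
Proof.
move=> uab; have := @segment_compact R a b; rewrite compact_ultra.
move=> /(_ [set A | ulf (u @^-1` A)]).
have UF : UltraFilter [set A | ulf (u @^-1` A)].
  have PF : ProperFilter (u @ ulf) by exact: fmap_proper_filter.
  split; first exact: PF.
  move=> G GP /= sG; apply/seteqP; split=> // A GA.
  have [//|h] := ulf_or (u @^-1` A).
  have : G (A `&` ~` A) by apply: filterI => //; exact: (sG (~` A)).
  by rewrite setICr => /filter_not_empty.
have h : ulf (u @^-1` `[a, b]).
  by apply: filterE => n /=; rewrite in_itv /=; exact: uab.
move=> /(_ UF h) [l [/= lab ul]].
exists l; first exact: ul.
by move: lab; rewrite in_itv.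
Qed.

Lemma Uor (A B : set nat) : ulf (A `|` B) -> ulf A \/ ulf B.
Proof.
move=> AB; have [|h] := ulf_or A; first by left.
by right; apply: filterS (filterI AB h) => n [] [].
Qed.

End limits.
Arguments Ucst {R} a.
Arguments UX {R u a} k _.

(** * Convergence, shortest paths and ray spaces *)

Section metric.
Context {R : realType} {X : metricType R}.
Implicit Types (x y z a b m w : X).

Definition ucv (u : nat -> X) x := Ulim (fun n => d x (u n)) (0 : R).

Lemma ucvP u x : ucv u x <-> forall e : R, 0 < e -> ulf [set n | d x (u n) < e].
Proof.
rewrite /ucv; split=> [/UP h e e0|h].
  apply: filterS (h _ e0) => n /=.
  by rewrite sub0r normrN ger0_norm ?mdist_ge0.
by apply/UP => e /h; apply: filterS => n /=; rewrite sub0r normrN ger0_norm ?mdist_ge0.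
Qed.

Lemma ucv_cst x : ucv (fun=> x) x.
Proof. by rewrite /ucv mdistxx; exact: Ucst. Qed.

Lemma ucv_d u v x y : ucv u x -> ucv v y -> Ulim (fun n => d (u n) (v n)) (d x y).
Proof.
move=> ux vy.
have h0 : Ulim (fun n => d x y - (d x (u n) + d y (v n))) (d x y).
  have := UD (Ucst (d x y)) (UN (UD ux vy)); by rewrite addr0 subr0.
have h1 : Ulim (fun n => d x y + (d x (u n) + d y (v n))) (d x y).
  have := UD (Ucst (d x y)) (UD ux vy); by rewrite !addr0.
apply: (Usq h0 h1); apply: filterE => n /=.
have := metric_triangle x (u n) y; have := metric_triangle (u n) (v n) y.
have := metric_triangle (u n) x (v n); have := metric_triangle x y (v n).
rewrite (metric_sym (u n) x) (metric_sym (v n) y).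
by move=> *; apply/andP; split; lra.
Qed.

Lemma ucv_le u v x (e : nat -> R) : ucv u x -> Ulim e 0 ->
  ulf [set n | d (u n) (v n) <= e n] -> ucv v x.
Proof.
move=> ux e0 h; have h1 := UD ux e0; rewrite addr0 in h1.
apply: (Usq (Ucst 0) h1); apply: filterS h => n /= h.
rewrite mdist_ge0 /=; apply: le_trans (metric_triangle _ (u n) _) _.
by rewrite lerD2l.
Qed.

Lemma ucv_uniq u x y : ucv u x -> ucv u y -> x = y.
Proof.
move=> ux uy; have := ucv_d ux uy; under eq_fun do rewrite mdistxx.
by move=> /(Uuniq (Ucst 0)) /esym /mdist_positivity.
Qed.


End metric.

(** Sequential form of the compactness of closed balls, with limits along [ulf] in place of
    subsequences. *)
Definition proper_metric {R : realType} (X : metricType R) :=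
  forall (u : nat -> X) x (r : R), (forall n, d x (u n) <= r) -> exists y, ucv u y.

(* [m] lies on a shortest path from [a] to [b]. *)
Definition btw {R : realType} {X : metricType R} (a m b : X) :=
  d a m + d m b = d a b.

(* Stewart's formula of the Euclidean plane, as an inequality: the global form of nonnegative curvature. *)
Definition stewart {R : realType} (X : metricType R) :=
  forall a m b x : X, btw a m b ->
    d m b * d a x ^+ 2 + d a m * d b x ^+ 2 - d a m * d m b * d a b
      <= d a b * d m x ^+ 2.

Definition ext_by {R : realType} {X : metricType R} (L : R) (m b : X) :=
  exists w, d m w = d m b + L /\ d b w = L.

(** Continuation beyond [b] of a shortest path from [m], to every length but without asking for one
    common ray; in this form it is stable under limits ([ext_lim]). *)
Definition ext {R : realType} {X : metricType R} (m b : X) :=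
  forall L : R, 0 <= L -> ext_by L m b.

Definition segment {R : realType} {X : metricType R} (a b : X) (g : R -> X) :=
  [/\ g 0 = a, g (d a b) = b & forall s t, 0 <= s <= d a b -> 0 <= t <= d a b ->
    d (g s) (g t) = `|s - t|].

(** The interface between the obtuseness hypothesis and the rest: [rs_ext] is all that is kept of
    the hypothesis, and the four properties together pass to asymptotic and tangent cones. *)
Record ray_space {R : realType} (X : metricType R) : Prop := RaySpace {
  rs_proper : proper_metric X ;
  rs_segment : forall a b : X, exists g, segment a b g ;
  rs_stewart : stewart X ;
  rs_ext : forall a m b : X, btw a m b -> a <> m -> m <> b -> ext m a \/ ext m b }.

Section nonbranching.
Context {R : realType} {X : metricType R}.
Implicit Types (x y z a b m w : X).

Lemma btwC a m b : btw a m b -> btw b m a.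
Proof. by rewrite /btw (metric_sym b m) (metric_sym m a) (metric_sym b a) addrC. Qed.

Lemma d_gt0 x y : x <> y -> 0 < d x y.
Proof. by move=> xy; rewrite mdist_gt0; apply/eqP. Qed.

Lemma btw_l a x m b : btw a x m -> btw a m b -> btw x m b.
Proof.
rewrite /btw => h1 h2; apply/eqP; rewrite eq_le metric_triangle andbT.
have := metric_triangle a x b; lra.
Qed.

Lemma btw_t a x m b : btw a x m -> btw a m b -> btw a x b.
Proof.
move=> h1 h2; have := btw_l h1 h2; move: h1 h2; rewrite /btw; lra.
Qed.

Lemma seg_point a b (t : R) : (forall a b : X, exists g, segment a b g) ->
  0 <= t <= d a b -> exists m, [/\ d a m = t, d m b = d a b - t & btw a m b].
Proof.
move=> /(_ a b) [g [g0 g1 gi]] t01; exists (g t).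
have D0 : 0 <= d a b by exact: mdist_ge0.
have h1 : d a (g t) = t.
  rewrite -{1}g0 gi ?lexx ?D0 //; rewrite sub0r normrN ger0_norm //.
  by case/andP: t01.
have h2 : d (g t) b = d a b - t.
  rewrite -{1}g1 gi ?lexx ?D0 // distrC ger0_norm ?subr_ge0 //.
  by case/andP: t01.
by split => //; rewrite /btw h1 h2 subrKC.
Qed.

Hypothesis St : stewart X.

(** Stewart's inequality for [m] between [a] and [b], tested at the point [b'], leaves only d a m
    times the square of d b b' on one side and 0 on the other. *)
Lemma nonbranching a m b b' : btw a m b -> btw a m b' -> a <> m ->
  d m b = d m b' -> b = b'.
Proof.
move=> h h' am e; have := St b' h; have := d_gt0 am.
rewrite -h -h' -e; set p := d a m; set q := d m b; move=> p0 H.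
have q0 : 0 <= q by exact: mdist_ge0.
apply: mdist_positivity.
have /eqP : d b b' ^+ 2 = 0.
  apply/eqP; rewrite eq_le sqr_ge0 andbT -(ler_pM2l p0) mulr0; lra.
by rewrite sqrf_eq0 => /eqP.
Qed.

(* Shortest paths which extend past their end point are unique. *)
Lemma unique_of_btw a m b x y : btw a m b -> m <> b ->
  btw a x m -> btw a y m -> d a x = d a y -> x = y.
Proof.
move=> h mb hx hy e.
have h1 := btwC (btw_l hx h); have h2 := btwC (btw_l hy h).
apply: (nonbranching h1 h2) => //; first by move/esym.
by move: hx hy; rewrite /btw (metric_sym m x) (metric_sym m y); lra.
Qed.

End nonbranching.

Section more_nonbranching.
Context {R : realType} {X : metricType R}.
Implicit Types (x y z a b m w : X).

Lemma btw_r a m x b : btw a m b -> btw m x b -> btw a m x.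
Proof. by move=> h1 h2; apply: btwC; apply: btw_l (btwC h2) (btwC h1). Qed.

Lemma ext_lim (u v : nat -> X) x y (L : R) : proper_metric X -> ucv u x -> ucv v y ->
  ulf [set n | ext_by L (u n) (v n)] -> ext_by L x y.
Proof.
move=> pX ux vy h.
pose good n w := [/\ d (u n) w = d (u n) (v n) + L, d (v n) w = L & d y (v n) < 1].
have /choice [w wP] : forall n, exists w, (exists w', good n w') -> good n w.
  move=> n; have [[w' h']|h'] := pselect (exists w', good n w'); first by exists w'.
  by exists y => h''.
(* Properness asks for a bound at every index, whereas the extensions exist and are bounded only
   along the ultrafilter; elsewhere the value is [y]. *)
pose w' n := if pselect (good n (w n)) then w n else y.
have [z wz] : exists z, ucv w' z.
  apply: (pX w' y (1 + `|L|)) => k; rewrite /w'.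
  case: pselect => [|h1] /=; last by rewrite mdistxx addr_ge0.
  move=> [_ h2 h3].
  apply: le_trans (metric_triangle _ (v k) _) _; rewrite h2 lerD ?ler_norm //.
  exact: ltW.
have wg : ulf [set n | good n (w' n)].
  have h1 := (ucvP _ _).1 vy 1 ltr01.
  apply: filterS (filterI h h1) => n /= [[w0 [h3 h4]] h2].
  rewrite /w'; case: pselect => // h'; case: h'; apply: wP; by exists w0.
exists z; split.
  apply: (Uuniq (ucv_d ux wz)).
  apply: (Usq (UD (ucv_d ux vy) (Ucst L)) (UD (ucv_d ux vy) (Ucst L))).
  by apply: filterS wg => k /= [e1 e2 e3]; rewrite e1 lexx.
apply: (Uuniq (ucv_d vy wz)); apply: (Usq (Ucst L) (Ucst L)).
by apply: filterS wg => k /= [e1 e2 e3]; rewrite e2 lexx.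
Qed.

(** The form in which the dichotomy is used at an end point. It is applied at points [m j] tending
    to [q]: either the continuation beyond [a] holds along the ultrafilter and passes to the limit,
    or at some [m j] the path continues backwards beyond [q]. *)
Lemma ext_dich (RX : ray_space X) (q a : X) (m : nat -> X) : ucv m q ->
  (forall j, btw q (m j) a) -> (forall j, q <> m j) -> (forall j, m j <> a) ->
  ext q a \/ exists j, ext (m j) q.
Proof.
move=> mq bt qm ma.
have [h|h] := ulf_or [set j | ext (m j) a].
  left=> L L0; apply: (ext_lim (rs_proper RX) mq (ucv_cst a)).
  by apply: filterS h => j; exact.
right; have [j hj] := filter_ex h; exists j.
by have [] := rs_ext RX (bt j) (@qm j) (@ma j).
Qed.
End more_nonbranching.

(** * Euclidean vectors *)

Section vectors.
Context {R : realType} {n : nat}.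
Implicit Types (x y z : 'rV[R]_n) (c : R).

Definition dot x y : R := \sum_i x 0 i * y 0 i.

Lemma dotC x y : dot x y = dot y x.
Proof. by apply: eq_bigr => i _; rewrite mulrC. Qed.
Lemma dotDl x y z : dot (x + y) z = dot x z + dot y z.
Proof. by rewrite -big_split; apply: eq_bigr => i _ /=; rewrite mxE mulrDl. Qed.
Lemma dotZl c x z : dot (c *: x) z = c * dot x z.
Proof. by rewrite big_distrr; apply: eq_bigr => i _ /=; rewrite mxE mulrA. Qed.
Lemma dotNl x z : dot (- x) z = - dot x z.
Proof. by rewrite -scaleN1r dotZl mulN1r. Qed.
Lemma dotDr x y z : dot z (x + y) = dot z x + dot z y.
Proof. by rewrite dotC dotDl !(dotC z). Qed.
Lemma dotZr c x z : dot z (c *: x) = c * dot z x.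
Proof. by rewrite dotC dotZl dotC. Qed.
Lemma dotNr x z : dot z (- x) = - dot z x.
Proof. by rewrite dotC dotNl dotC. Qed.
Lemma dot0l z : dot 0 z = 0.
Proof. by rewrite -(scale0r 0) dotZl mul0r. Qed.
Lemma dot0r z : dot z 0 = 0. Proof. by rewrite dotC dot0l. Qed.
Definition dotE := (dotDl, dotDr, dotNl, dotNr, dotZl, dotZr, dot0l, dot0r).
Lemma dot_ge0 x : 0 <= dot x x.
Proof. by apply: sumr_ge0 => i _; rewrite -expr2 sqr_ge0. Qed.
Lemma dot_eq0 x : dot x x = 0 -> x = 0.
Proof.
move=> /eqP; rewrite psumr_eq0; last by move=> i _; rewrite -expr2 sqr_ge0.
move=> /allP h; apply/rowP => i; rewrite mxE; apply/eqP.
by have := h i; rewrite mem_index_enum -expr2 sqrf_eq0; exact.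
Qed.

Definition nv x := Num.sqrt (dot x x).
Lemma nv_ge0 x : 0 <= nv x. Proof. exact: sqrtr_ge0. Qed.
Lemma nv_sq x : nv x ^+ 2 = dot x x. Proof. by rewrite sqr_sqrtr ?dot_ge0. Qed.
Lemma nvZ c x : nv (c *: x) = `|c| * nv x.
Proof.
by rewrite /nv dotZl dotZr mulrA -expr2 sqrtrM ?sqr_ge0 // sqrtr_sqr.
Qed.
Lemma nvN x : nv (- x) = nv x.
Proof. by rewrite -scaleN1r nvZ normrN normr1 mul1r. Qed.
Lemma nv_le x (c : R) : 0 <= c -> dot x x <= c ^+ 2 -> nv x <= c.
Proof. by move=> c0; rewrite -nv_sq ler_sqr ?nnegrE ?nv_ge0. Qed.

Definition vcv (u : nat -> 'rV[R]_n) x :=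
  forall i, Ulim (fun k => u k 0 i) (x 0 i).

Lemma Usum (I : finType) (F : I -> nat -> R) (f : I -> R) :
  (forall i, Ulim (F i) (f i)) -> Ulim (fun k => \sum_i F i k) (\sum_i f i).
Proof.
move=> h; elim: (index_enum I) => [|i s IH].
  by rewrite big_nil; under eq_fun do rewrite big_nil; exact: Ucst.
by rewrite big_cons; under eq_fun do rewrite big_cons; exact: UD.
Qed.

Lemma vcv_cst x : vcv (fun=> x) x. Proof. by move=> i; exact: Ucst. Qed.
Lemma vcvD u v x y : vcv u x -> vcv v y -> vcv (fun k => u k + v k) (x + y).
Proof.
move=> h1 h2 i; rewrite mxE; under eq_fun do rewrite mxE; exact: UD.
Qed.
Lemma vcvN u x : vcv u x -> vcv (fun k => - u k) (- x).
Proof. by move=> h i; rewrite mxE; under eq_fun do rewrite mxE; exact: UN. Qed.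
Lemma vcvZ (c : nat -> R) c0 u x : Ulim c c0 -> vcv u x ->
  vcv (fun k => c k *: u k) (c0 *: x).
Proof.
by move=> h1 h2 i; rewrite mxE; under eq_fun do rewrite mxE; exact: UM.
Qed.
Lemma vcv_dot u v x y : vcv u x -> vcv v y ->
  Ulim (fun k => dot (u k) (v k)) (dot x y).
Proof. by move=> h1 h2; apply: Usum => i; exact: UM. Qed.

Lemma vcv_bnd u (C : R) : (forall k, dot (u k) (u k) <= C) -> exists x, vcv u x.
Proof.
move=> h.
have /choice [f fP] : forall i, exists l : R, Ulim (fun k => u k 0 i) l.
  move=> i; have [k|l h1 _] := @Ubnd R (fun k => u k 0 i) (- (C + 1)) (C + 1).
    have h1 : (u k 0 i) ^+ 2 <= C.
      apply: le_trans (h k); rewrite /dot (bigD1 i) //= -expr2 lerDl.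
      by apply: sumr_ge0 => j _; rewrite -expr2 sqr_ge0.
    by apply/andP; split; nra.
  by exists l.
by exists (\row_i f i) => i; rewrite mxE.
Qed.
End vectors.
Arguments vcv_cst {R n} x.

(** * Rigidity of short maps from a half space onto a ray space *)

Section half_space_rigidity.
Context {R : realType} {n : nat} {M : metricType R}.
Variables (n0 : 'rV[R]_n) (e : 'rV[R]_n -> M).
Implicit Types (X Y Z A B v w z : 'rV[R]_n) (s t a : R).
Local Notation H X := (0 <= dot X n0).
Hypothesis RM : ray_space M.
Hypothesis n01 : dot n0 n0 = 1.
Hypothesis e_lip : forall X Y, H X -> H Y -> d (e X) (e Y) <= nv (X - Y).
Hypothesis e_rad : forall X, H X -> d (e 0) (e X) = nv X.
Hypothesis e_onto : forall x, exists2 X, H X & e X = x.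
Hypothesis e_inj : forall X Y, H X -> H Y -> e X = e Y -> X = Y.

Let St := rs_stewart RM.

Let H0 : H (0 : 'rV[R]_n). Proof. by rewrite dot0l. Qed.

Lemma hsr_lip2 X Y : H X -> H Y -> d (e X) (e Y) ^+ 2 <= dot (X - Y) (X - Y).
Proof. by move=> hX hY; rewrite -nv_sq ler_sqr ?nnegrE ?nv_ge0 ?mdist_ge0 ?e_lip. Qed.

Lemma hsr_cv (u : nat -> 'rV[R]_n) X : vcv u X -> (forall k, H (u k)) -> H X /\ ucv (e \o u) (e X).
Proof.
move=> uX Hu.
have HX : H X.
  by apply: (Ule (Ucst 0) (vcv_dot uX (vcv_cst n0))); apply: filterE.
split=> //.
have h : Ulim (fun k => Num.sqrt (dot (X - u k) (X - u k))) 0.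
  have h1 := vcvD (vcv_cst X) (vcvN uX); rewrite subrr in h1.
  have h2 := vcv_dot h1 h1; rewrite dot0l in h2.
  rewrite -[0 in X in Ulim _ X]sqrtr0; apply: Ucomp h2; exact: sqrt_continuous.
apply: (Usq (Ucst 0) h); apply: filterE => k /=.
by rewrite mdist_ge0 /=; exact: e_lip.
Qed.

Lemma hsr_cvE (u : nat -> 'rV[R]_n) (C : R) : (forall k, H (u k)) ->
  (forall k, dot (u k) (u k) <= C) ->
  exists2 X, vcv u X & H X /\ ucv (e \o u) (e X).
Proof. by move=> Hu /vcv_bnd [X uX]; exists X => //; exact: hsr_cv. Qed.

Definition lerpv A B (l : R) := A + l *: (B - A).

Lemma H_lerp A B l : 0 <= l <= 1 -> H A -> H B -> H (lerpv A B l).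
Proof. by move=> /andP[l0 l1] hA hB; rewrite /lerpv !dotE; nra. Qed.

Lemma lerpvB A B l m : lerpv A B l - lerpv A B m = (l - m) *: (B - A).
Proof. by rewrite /lerpv scalerBl opprD addrACA subrr add0r. Qed.

(* Since [e] is 1-Lipschitz, it is isometric on a segment as soon as it
   preserves the distance between the end points. *)
Lemma hsr_seg A B l m : H A -> H B -> d (e A) (e B) = nv (B - A) ->
  0 <= l <= 1 -> 0 <= m <= 1 ->
  d (e (lerpv A B l)) (e (lerpv A B m)) = `|l - m| * nv (B - A).
Proof.
move=> HA HB iso.
wlog lm : l m / l <= m => [h l01 m01|].
  have [lm|/ltW lm] := leP l m; first exact: h.
  by rewrite metric_sym distrC; exact: h.
move=> l01 m01; have /andP[l0 l1] := l01; have /andP[m0 m1] := m01.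
have h1 := e_lip HA (H_lerp l01 HA HB).
have h2 := e_lip (H_lerp l01 HA HB) (H_lerp m01 HA HB).
have h3 := e_lip (H_lerp m01 HA HB) HB.
have EA : lerpv A B 0 = A by rewrite /lerpv scale0r addr0.
have EB : lerpv A B 1 = B by rewrite /lerpv scale1r subrKC.
have E1 : A - lerpv A B l = (0 - l) *: (B - A) by rewrite -lerpvB EA.
have E3 : lerpv A B m - B = (m - 1) *: (B - A) by rewrite -lerpvB EB.
rewrite E1 nvZ sub0r normrN ger0_norm // in h1.
rewrite lerpvB nvZ in h2.
rewrite E3 nvZ distrC ger0_norm ?subr_ge0 // in h3.
have t1 := metric_triangle (e A) (e (lerpv A B l)) (e B).
have t2 := metric_triangle (e (lerpv A B l)) (e (lerpv A B m)) (e B).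
rewrite iso in t1; apply/eqP; rewrite eq_le h2 /=.
rewrite distrC ger0_norm ?subr_ge0 //; lra.
Qed.

Lemma hsr_btw A B l m k : H A -> H B -> d (e A) (e B) = nv (B - A) ->
  0 <= l <= m -> m <= k <= 1 ->
  btw (e (lerpv A B l)) (e (lerpv A B m)) (e (lerpv A B k)).
Proof.
move=> HA HB iso /andP[l0 lm] /andP[mk k1].
have m0 := le_trans l0 lm; have k0 := le_trans m0 mk.
have m1 := le_trans mk k1; have l1 := le_trans lm m1.
rewrite /btw !hsr_seg ?l0 ?m0 ?k0 //.
rewrite !ler0_norm ?subr_le0 //; last exact: le_trans lm mk.
by rewrite -mulrDl; congr (_ * _); lra.
Qed.

Lemma hsr_rad X s t : H X -> 0 <= s -> 0 <= t ->
  d (e (s *: X)) (e (t *: X)) = `|s - t| * nv X.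
Proof.
move=> HX s0 t0.
have HZ r : 0 <= r -> H (r *: X) by move=> r0; rewrite dotZl mulr_ge0.
wlog st : s t s0 t0 / s <= t => [h|].
  have [st|/ltW st] := leP s t; first exact: h.
  by rewrite metric_sym distrC; exact: h.
have h1 := e_lip (HZ _ s0) (HZ _ t0); rewrite -scalerBl nvZ in h1.
have h2 := e_rad (HZ _ s0); have h3 := e_rad (HZ _ t0).
have t1 := metric_triangle (e 0) (e (s *: X)) (e (t *: X)).
rewrite h2 h3 !nvZ !ger0_norm // in t1.
apply/eqP; rewrite eq_le h1 /= distrC ger0_norm ?subr_ge0 //; lra.
Qed.

Lemma hsr_rad0 X : H X -> d (e 0) (e X) ^+ 2 = dot X X.
Proof. by move=> hX; rewrite e_rad // nv_sq. Qed.

Definition edge z := dot z z = 1 /\ dot z n0 = 0.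
(** Pythagoras between a point of the normal ray and the ray of an edge direction. For edge
    directions one inequality is [e_lip], so the point is as far from that ray as it can be. *)
Definition Et t z := forall s, 0 <= s -> d (e (t *: n0)) (e (s *: z)) ^+ 2 = s ^+ 2 + t ^+ 2.
Definition Einf z := edge z /\ forall t, 0 < t -> Et t z.
Definition line z := edge z /\ forall s t, d (e (s *: z)) (e (t *: z)) = `|s - t|.

Lemma H_t t : 0 <= t -> H (t *: n0). Proof. by rewrite dotZl n01 mulr1. Qed.
Lemma H_e z t : edge z -> H (t *: z). Proof. by move=> [_ h]; rewrite dotZl h mulr0. Qed.
Hint Resolve H_t : core.

(** Stewart's inequality on the normal segment from 0 through t' n0 to t n0, tested on the edge ray,
    gives the lower bound. *)
Lemma Et_mono t t' z : edge z -> 0 < t' <= t -> Et t z -> Et t' z.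
Proof.
move=> ez /andP[t'0 tt'] h s s0; have t0 : 0 < t by lra.
have n01' : nv n0 = 1 by rewrite /nv n01 sqrtr1.
have d1 := @hsr_rad n0 0 t' (ltac:(by rewrite n01)) (lexx _) (ltW t'0).
have d2 := @hsr_rad n0 t' t (ltac:(by rewrite n01)) (ltW t'0) (ltW t0).
have d3 := @hsr_rad n0 0 t (ltac:(by rewrite n01)) (lexx _) (ltW t0).
rewrite n01' mulr1 sub0r normrN gtr0_norm // scale0r in d1.
rewrite n01' mulr1 distrC ger0_norm ?subr_ge0 // in d2.
rewrite n01' mulr1 sub0r normrN gtr0_norm // scale0r in d3.
have bt : btw (e 0) (e (t' *: n0)) (e (t *: n0)) by rewrite /btw d1 d2 d3; lra.
have := St (e (s *: z)) bt; rewrite d1 d2 d3 (h _ s0) hsr_rad0; last exact: H_e.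
have := @hsr_lip2 (t' *: n0) (s *: z) (H_t (ltW t'0)) (H_e _ ez).
case: ez => [z1 z0]; rewrite !dotE n01 z1 (dotC n0) z0.
set D := d _ _ => u1 u2; apply/eqP; rewrite eq_le; apply/andP; split; first lra.
rewrite -(ler_pM2l t0); lra.
Qed.

Lemma Et_lim t (z : nat -> 'rV[R]_n) z0 : 0 < t -> (forall k, edge (z k)) -> edge z0 ->
  vcv z z0 -> ulf [set k | Et t (z k)] -> Et t z0.
Proof.
move=> t0 ez ez0 zz0 h s s0.
have h1 := vcvZ (Ucst s) zz0.
have [_ h2] := hsr_cv h1 (fun k => H_e s (ez k)).
have h3 := UX 2 (ucv_d (ucv_cst (e (t *: n0))) h2).
apply: (Uuniq h3); apply: (Usq (Ucst _) (Ucst _)).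
by apply: filterS h => k /(_ _ s0) /= ->; rewrite lexx.
Qed.

(** The points [y k] go to infinity from t n0, and the bound on their norms says that they leave at
    an angle of at most pi / 2 with the way down to 0. The limit [z] of their directions inherits
    Pythagoras from Stewart's inequality on the rays from 0 to [y k]. Since [e] is 1-Lipschitz, this
    already forces [z] to have no normal component. *)
Lemma asymptotic_edge t (y : nat -> 'rV[R]_n) : 0 < t -> (forall k, H (y k)) ->
  (forall k, d (e (t *: n0)) (e (y k)) = k%:R) ->
  (forall k, dot (y k) (y k) <= k%:R ^+ 2 + t ^+ 2) ->
  exists z, [/\ edge z, Et t z & forall v, (forall k, dot (y k) v = 0) -> dot z v = 0].
Proof.
move=> t0 Hy dy yk.
have n01' : nv n0 = 1 by rewrite /nv n01 sqrtr1.
pose D k := nv (y k); pose zk k := (D k)^-1 *: y k.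
have dt : d (e 0) (e (t *: n0)) = t.
  by rewrite e_rad ?H_t 1?ltW // nvZ n01' mulr1 gtr0_norm.
have Dge k : k%:R - t <= D k.
  have := metric_triangle (e (t *: n0)) (e 0) (e (y k)).
  by rewrite dy metric_sym dt (e_rad (Hy k)) -/(D k); lra.
have Dbig : ulf [set k | (k.+1)%:R / 2 <= D k /\ 0 < D k].
  near=> k.
  have : (Num.truncn (2 * t + 1)).+1%:R <= k%:R :> R.
    by rewrite ler_nat; near: k; exact: ulf_ge.
  have := truncnS_gt (2 * t + 1); have := Dge k.
  by rewrite /= -(natr1 k) => *; split; lra.
have zk1 k : dot (zk k) (zk k) <= 1.
  rewrite !dotE -nv_sq -/(D k).
  have [->|D0] := eqVneq (D k) 0; first by rewrite invr0 !mul0r.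
  by rewrite expr2 mulKf // mulVf.
have Hz k : H (zk k) by rewrite dotZl mulr_ge0 ?invr_ge0 ?nv_ge0.
have [z zz [Hzz _]] := hsr_cvE Hz zk1.
have z1 : dot z z = 1.
  apply: (Uuniq (vcv_dot zz zz)); apply: (Usq (Ucst 1) (Ucst 1)).
  apply: filterS Dbig => k /= [_ D0].
  rewrite !dotE -nv_sq -/(D k) expr2 mulKf ?gt_eqF // mulVf ?gt_eqF //.
  by rewrite lexx.
have key s : 0 <= s -> s ^+ 2 + t ^+ 2 <= d (e (t *: n0)) (e (s *: z)) ^+ 2.
  move=> s0.
  have Hs k : H (s *: zk k) by rewrite dotZl mulr_ge0.
  have [_ h2] := hsr_cv (vcvZ (Ucst s) zz) Hs.
  have h3 := UX 2 (ucv_d (ucv_cst (e (t *: n0))) h2).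
  (* Stewart's inequality loses 2 s t^2 / D k, and D k is at least (k + 1) / 2. *)
  have h4 := UM (Ucst (- (4 * s * t ^+ 2))) (@Uinv R).
  have h5 := UD (Ucst (s ^+ 2 + t ^+ 2)) h4; rewrite mulr0 addr0 in h5.
  apply: (Ule h5 h3).
  have Ds : ulf [set k | s <= D k].
    near=> k.
    have : (Num.truncn (s + t)).+1%:R <= k%:R :> R.
      by rewrite ler_nat; near: k; exact: ulf_ge.
    by have := truncnS_gt (s + t); have := Dge k => /= *; lra.
  apply: filterS (filterI Dbig Ds) => k /= [[Dk D0] sD].
  have yE : y k = D k *: zk k by rewrite scalerA mulfV ?gt_eqF // scale1r.
  have nz : nv (zk k) = 1 by rewrite nvZ gtr0_norm ?invr_gt0 // mulVf ?gt_eqF.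
  have e1 := @hsr_rad (zk k) 0 s (Hz k) (lexx _) s0.
  rewrite nz mulr1 sub0r normrN ger0_norm // scale0r in e1.
  have e2 := @hsr_rad (zk k) s (D k) (Hz k) s0 (ltW D0).
  rewrite nz mulr1 distrC ger0_norm ?subr_ge0 // -yE in e2.
  have e3 := e_rad (Hy k); rewrite -/(D k) in e3.
  have bt : btw (e 0) (e (s *: zk k)) (e (y k)) by rewrite /btw e1 e2 e3; lra.
  have := St (e (t *: n0)) bt; rewrite e1 e2 e3 dt.
  rewrite (metric_sym (e (y k))) dy (metric_sym (e (s *: zk k))).
  set E := d _ _; have := yk k; rewrite -nv_sq -/(D k) => h6 h7.
  have h8 : D k * (k.+1%:R)^-1 >= 2^-1.
    by rewrite ler_pdivlMr ?ltr0n // mulrC.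
  have st0 : 0 <= s * t ^+ 2 by rewrite mulr_ge0 ?sqr_ge0.
  rewrite -(ler_pM2l D0); move: h8; set j := (k.+1%:R : R)^-1 => h8.
  have h9 := ler_wpM2l s0 h6; have h10 := ler_wpM2l st0 h8.
  lra.
have z0 : dot z n0 = 0.
  have := key 1 ler01; have := @hsr_lip2 (t *: n0) (1 *: z) (H_t (ltW t0)).
  rewrite dotZl mul1r => /(_ Hzz); rewrite !dotE n01 z1 (dotC n0) => h1 h2.
  by apply/eqP; rewrite eq_le Hzz andbT; rewrite -(pmulr_rle0 _ t0); lra.
exists z; split; first by split.
  move=> s s0; apply/eqP; rewrite eq_le key // andbT.
  have := @hsr_lip2 (t *: n0) (s *: z) (H_t (ltW t0)) (H_e _ (conj z1 z0)).
  by rewrite !dotE n01 z1 (dotC n0) z0; lra.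
move=> v yv; apply: (Uuniq (vcv_dot zz (vcv_cst v))).
by apply: Ueq (Ucst 0) => k; rewrite dotZl yv mulr0.
Unshelve. all: by end_near. Qed.
Let n0nv : nv n0 = 1. Proof. by rewrite /nv n01 sqrtr1. Qed.

Let dn0 s t : 0 <= s -> 0 <= t -> d (e (s *: n0)) (e (t *: n0)) = `|s - t|.
Proof. by move=> s0 t0; rewrite hsr_rad ?n01 // n0nv mulr1. Qed.

Let dn00 t : 0 <= t -> d (e 0) (e (t *: n0)) = t.
Proof. by move=> t0; rewrite e_rad ?H_t // nvZ n0nv mulr1 ger0_norm. Qed.

Lemma edgeN z : edge z -> edge (- z).
Proof. by move=> [h1 h2]; split; rewrite !dotE ?h1 ?h2 ?oppr0 ?opprK. Qed.

Lemma lineN z : line z -> line (- z).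
Proof.
move=> [ez h]; split; first exact: edgeN.
by move=> s t; rewrite !scalerN -!scaleNr h opprK addrC distrC.
Qed.

(** A Busemann argument. The distance from X to -r z is at most Euclidean, so the triangle
    inequality along the line bounds its distance to r z from below. Stewart's inequality for T z
    between 0 and r z then gives the Euclidean lower bound at T z as r grows. *)
Lemma line_plane_ge z X (T : R) : line z -> H X -> 0 <= T ->
  dot (X - T *: z) (X - T *: z) <= d (e X) (e (T *: z)) ^+ 2.
Proof.
move=> [ez hz] HX T0; have [z1 z0] := ez.
rewrite leNgt; apply/negP => hlt.
set Q := dot (X - T *: z) (X - T *: z) in hlt.
set D := d _ _ in hlt.
pose al := dot X z; pose N := dot X X.
have QE : Q = N - 2 * T * al + T ^+ 2.
  by rewrite /Q !dotE z1 (dotC z) -/al -/N; ring.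
have c0 : 0 <= N - al ^+ 2.
  by have := dot_ge0 (X - al *: z); rewrite !dotE z1 (dotC z) -/al -/N; lra.
pose C := T * N + 3 * T * (N - al ^+ 2).
(* So large that r times the supposed defect Q - D^2 exceeds the error [C], which does not depend on
   r. *)
pose r := T + 2 * `|al| + 1 + C / (Q - D ^+ 2).
have dl0 : 0 < Q - D ^+ 2 by rewrite subr_gt0.
have N0 : 0 <= N by exact: dot_ge0.
have C0 : 0 <= C by rewrite /C addr_ge0 ?mulr_ge0.
have Cq : 0 <= C / (Q - D ^+ 2) by rewrite divr_ge0 // ltW.
have aal := normr_ge0 al.
have rT : T <= r by rewrite /r; lra.
have r1 : 2 * `|al| + 1 <= r by rewrite /r; lra.
have rC : C < r * (Q - D ^+ 2) by rewrite -ltr_pdivrMr // /r; lra.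
have /andP[al1 al2] : - `|al| <= al <= `|al| by rewrite -ler_norml.
have dT : d (e 0) (e (T *: z)) = T.
  by have := hz 0 T; rewrite scale0r sub0r normrN ger0_norm.
have dr : d (e 0) (e (r *: z)) = r.
  by have := hz 0 r; rewrite scale0r sub0r normrN ger0_norm //; lra.
have dTr : d (e (T *: z)) (e (r *: z)) = r - T.
  by rewrite hz distrC ger0_norm ?subr_ge0.
have bt : btw (e 0) (e (T *: z)) (e (r *: z)) by rewrite /btw dT dr dTr; lra.
have := St (e X) bt; rewrite dT dr dTr hsr_rad0 //.
rewrite (metric_sym (e (T *: z))) (metric_sym (e (r *: z))) -/D -/N => h1.
have h2 : 2 * r <= d (e X) (e (r *: z)) + nv (X + r *: z).
  have h := e_lip HX (H_e (- r) ez); rewrite scaleNr opprK in h.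
  have := metric_triangle (e (r *: z)) (e X) (e (- r *: z)).
  rewrite hz opprK ger0_norm; last by lra.
  by rewrite (metric_sym (e (r *: z))) scaleNr; lra.
set E := d (e X) (e (r *: z)) in h1 h2.
set q := nv _ in h2.
have q2 : q ^+ 2 = N + 2 * r * al + r ^+ 2.
  by rewrite nv_sq !dotE z1 (dotC z) -/al -/N; ring.
have h3 : 2 * (r + al) * q <= q ^+ 2 + (r + al) ^+ 2.
  by have := sqr_ge0 (q - (r + al)); lra.
have ra : 0 < r + al by lra.
have ra' : 0 < r - al by lra.
(* q <= (r + al) + (N - al^2)/(2 (r + al)), then E^2 >= 2 (r - al) E - (r - al)^2 *)
have h4 : E ^+ 2 >= (r - al) ^+ 2 - 3 * (N - al ^+ 2).
  have h5 : 2 * (r - al) * E <= E ^+ 2 + (r - al) ^+ 2.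
    by have := sqr_ge0 (E - (r - al)); lra.
  have h6 : 2 * (r - al) * (2 * r - q) <= 2 * (r - al) * E.
    apply: ler_wpM2l; first by rewrite mulr_ge0 // ltW.
    lra.
  have h7 : 2 * (r - al) * q <= 2 * (r - al) * (r + al) + 3 * (N - al ^+ 2).
    rewrite -(ler_pM2l ra).
    have h8 : (r - al) * (2 * (r + al) * q) <= (r - al) * (2 * (r + al) ^+ 2 + (N - al ^+ 2)).
      apply: ler_wpM2l; first exact: ltW.
      by apply: le_trans h3 _; rewrite q2; lra.
    have h9 : (r - al) * (N - al ^+ 2) <= 3 * (r + al) * (N - al ^+ 2).
      by apply: ler_wpM2r => //; lra.
    lra.
  lra.
have h10 := ler_wpM2l T0 h4.
rewrite QE in rC; rewrite /C in rC.
have Ta : 0 <= T * al ^+ 2 by rewrite mulr_ge0 ?sqr_ge0.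
by lra.
Qed.

Lemma line_plane z X (T : R) : line z -> H X -> d (e X) (e (T *: z)) = nv (X - T *: z).
Proof.
move=> lz HX; have [ez _] := lz.
apply/eqP; rewrite eq_le e_lip ?H_e //=.
apply: nv_le; first exact: mdist_ge0.
have [T0|/ltW T0] := leP 0 T; first exact: line_plane_ge.
have -> : T *: z = (- T) *: (- z) by rewrite scalerN scaleNr opprK.
by apply: line_plane_ge; rewrite ?oppr_ge0 //; exact: lineN.
Qed.

(** Stewart's inequality is tested at every point r v of the line, where distances are Euclidean.
    The terms in r^2 cancel and what remains is affine in r with a constant sign, so the coefficient
    of r vanishes: the coordinate along a line is affine on shortest paths. *)
Lemma line_affine v X Y Z : line v -> H X -> H Y -> H Z -> btw (e X) (e Y) (e Z) ->
  d (e X) (e Z) * dot Y v = d (e Y) (e Z) * dot X v + d (e X) (e Y) * dot Z v.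
Proof.
move=> lv HX HY HZ bt; have [[v1 v0] _] := lv.
set b := d (e Y) (e Z); set a := d (e X) (e Y); set c := d _ _.
have key r : b * (dot X X - 2 * r * dot X v + r ^+ 2) + a * (dot Z Z - 2 * r * dot Z v + r ^+ 2)
     - a * b * c <= c * (dot Y Y - 2 * r * dot Y v + r ^+ 2).
  have := St (e (r *: v)) bt; rewrite -/a -/b -/c !line_plane // !nv_sq.
  rewrite !dotE v1 !(dotC v) => h; apply: le_trans (le_trans _ h) _; lra.
have ab : a + b = c := bt.
pose L := c * dot Y v - (b * dot X v + a * dot Z v).
pose K := c * dot Y Y - b * dot X X - a * dot Z Z + a * b * c.
have h r : 0 <= K - 2 * r * L by rewrite /K /L -ab; have := key r; rewrite -ab; lra.
apply/eqP; rewrite -subr_eq0 -/L; apply/negPn/negP => L0.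
have := h ((K + 1) / (2 * L)).
have -> : 2 * ((K + 1) / (2 * L)) * L = K + 1 by field.
lra.
Qed.

Lemma lip_ivt (f : R -> R) (K : R) :
  (forall x y, 0 <= x <= 1 -> 0 <= y <= 1 -> `|f x - f y| <= K * `|x - y|) ->
  f 0 <= 0 -> 0 <= f 1 -> exists2 c, 0 <= c <= 1 & f c = 0.
Proof.
move=> lip f0 f1; pose cl x : R := Num.max 0 (Num.min x 1).
have cl01 x : 0 <= cl x <= 1.
  by rewrite /cl le_max lexx /= ge_max ler01 ge_min lexx orbT.
have K0 : 0 <= K.
  have := lip 0 1; rewrite !lexx ler01 => /(_ isT isT).
  by rewrite sub0r normrN1 mulr1; apply: le_trans.
have cllip x y : `|cl x - cl y| <= `|x - y|.
  have mx (p q : R) : `|Num.max 0 p - Num.max 0 q| <= `|p - q|.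
    case: (leP 0 p) => hp; case: (leP 0 q) => hq //; rewrite ?subr0 ?sub0r ?subrr ?normr0 //.
    - by rewrite !ger0_norm ?subr_ge0; lra.
    - by rewrite normrN ger0_norm // ler0_norm; lra.
  have mn (p q : R) : `|Num.min p 1 - Num.min q 1| <= `|p - q|.
    case: (leP p 1) => hp; case: (leP q 1) => hq //; rewrite ?subrr ?normr0 //.
    - by rewrite !ler0_norm ?subr_le0; lra.
    - by rewrite !ger0_norm ?subr_ge0; lra.
  exact: le_trans (mx _ _) (mn _ _).
pose g x := f (cl x).
have gc : continuous g.
  move=> x; apply/cvgrPdist_lt => eps eps0; near=> y.
  apply: le_lt_trans (lip _ _ (cl01 _) (cl01 _)) _.
  apply: le_lt_trans (_ : _ <= (K + 1) * `|x - y|) _.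
    by rewrite ler_pM ?normr_ge0 ?cllip // lerDl.
  rewrite mulrC -ltr_pdivlMr ?ltr_wpDl //.
  near: y; apply: cvgr_dist_lt; rewrite ?divr_gt0 ?ltr_wpDl //.
have [c c01 gc0] : exists2 c, c \in `[0, 1] & g c = 0.
  apply: IVT => //; first exact: continuous_subspaceT.
  have g0 : g 0 = f 0 by rewrite /g /cl min_l // maxxx.
  have g1 : g 1 = f 1 by rewrite /g /cl minxx max_r.
  by rewrite g0 g1 ge_min f0 le_max f1 orbT.
by exists (cl c).
Unshelve. all: by end_near. Qed.
Section edge_existence.
Variables (t : R) (w : 'rV[R]_n).
Hypotheses (t0 : 0 < t) (ew : edge w) (wV : forall v, line v -> dot w v = 0).

Let H2t : H ((2 * t) *: n0). Proof. by apply: H_t; rewrite mulr_ge0 // ltW. Qed.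

(* A point near [t *: n0] which is equidistant from [0] and [2 t n0]. *)
Lemma equidistant_point (h : R) : 0 < h <= t -> exists X,
  [/\ H X, X <> t *: n0, dot (X - t *: n0) (X - t *: n0) <= h ^+ 2,
      d (e X) (e 0) = d (e X) (e ((2 * t) *: n0))
    & forall v, line v -> dot X v = 0].
Proof.
move=> /andP[h0 ht]; have [w1 w0] := ew.
pose A := (t + h) *: n0; pose B := (t - h) *: n0; pose W := t *: n0 + h *: w.
have HA : H A by apply: H_t; lra.
have HB : H B by apply: H_t; lra.
have HW : H W by rewrite !dotE n01 w0; lra.
(* [f] is negative at A and positive at B, so it vanishes on the segment from A to W or on that from
   B to W. Neither of these contains t n0. *)
pose f X := d (e X) (e ((2 * t) *: n0)) - d (e X) (e 0).
have fA : f A = - (2 * h).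
  rewrite /f (metric_sym _ (e 0)) dn00; last lra.
  rewrite dn0; [|lra|lra]; rewrite ler0_norm; lra.
have fB : f B = 2 * h.
  rewrite /f (metric_sym _ (e 0)) dn00; last lra.
  rewrite dn0; [|lra|lra]; rewrite ler0_norm; lra.
have lip P Q : H P -> H Q -> forall x y, 0 <= x <= 1 -> 0 <= y <= 1 ->
    `|f (lerpv P Q x) - f (lerpv P Q y)| <= 2 * nv (Q - P) * `|x - y|.
  move=> HP HQ x y x01 y01.
  have Hx := H_lerp x01 HP HQ; have Hy := H_lerp y01 HP HQ.
  have := e_lip Hx Hy; rewrite lerpvB nvZ => D.
  rewrite /f; set X := lerpv P Q x in Hx D *; set Y := lerpv P Q y in Hy D *.
  have t1 := metric_triangle (e X) (e Y) (e 0).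
  have t2 := metric_triangle (e Y) (e X) (e 0).
  have t3 := metric_triangle (e X) (e Y) (e ((2 * t) *: n0)).
  have t4 := metric_triangle (e Y) (e X) (e ((2 * t) *: n0)).
  rewrite (metric_sym (e Y) (e X)) in t2 t4.
  rewrite ler_norml; apply/andP; split; lra.
have fin P (c : R) (sg : R) : `|sg| = 1 -> P = t *: n0 + (sg * h) *: n0 -> f P <> 0 ->
    0 <= c <= 1 -> f (lerpv P W c) = 0 -> let X := lerpv P W c in
    [/\ H X, X <> t *: n0, dot (X - t *: n0) (X - t *: n0) <= h ^+ 2,
      d (e X) (e 0) = d (e X) (e ((2 * t) *: n0))
    & forall v, line v -> dot X v = 0].
  move=> sg1 PE fP c01 fc X; have /andP[c0 c1] := c01.
  have sg2 : sg ^+ 2 = 1 by rewrite -real_normK ?num_real // sg1 expr1n.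
  have cn0 : c != 0.
    by apply: contra_notN fP => /eqP cE; move: fc; rewrite cE /lerpv scale0r addr0.
  have XE : X - t *: n0 = ((1 - c) * sg * h) *: n0 + (c * h) *: w.
    rewrite /X /lerpv PE /W; apply/rowP => i; rewrite !mxE; ring.
  split.
  - apply: H_lerp => //; rewrite PE !dotE n01.
    by have := ler_norm (- sg); rewrite normrN sg1 => ?; nra.
  - move=> XX; have : dot (X - t *: n0) w = 0 by rewrite XX subrr dot0l.
    rewrite XE !dotE w1 (dotC n0) w0 mulr0 add0r mulr1 => /eqP.
    by rewrite mulf_eq0 (negPf cn0) (gt_eqF h0).
  - rewrite XE !dotE n01 w1 (dotC n0) w0.
    apply: (@le_trans _ _ (((1 - c) ^+ 2 * sg ^+ 2 + c ^+ 2) * h ^+ 2)); first lra.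
    rewrite sg2 ler_piMl ?sqr_ge0 //; nra.
  - by move: fc; rewrite /f; lra.
  - move=> v lv; have [[_ v0] _] := lv.
    by rewrite -(subrK (t *: n0) X) XE !dotE (wV lv) (dotC n0) v0; ring.
have [fW|/ltW fW] := leP (f W) 0; last first.
  have [||c c01 fc] := @lip_ivt (fun x => f (lerpv A W x)) _ (lip _ _ HA HW).
  - by rewrite /lerpv scale0r addr0 fA; lra.
  - by rewrite /lerpv scale1r subrKC.
  exists (lerpv A W c); apply: (fin A c 1) => //; first by rewrite normr1.
    by rewrite mul1r -scalerDl.
  by rewrite fA; lra.
have lip' x y : 0 <= x <= 1 -> 0 <= y <= 1 ->
    `|- f (lerpv B W x) - - f (lerpv B W y)| <= 2 * nv (W - B) * `|x - y|.
  by move=> h1 h2; have := lip _ _ HB HW x y h1 h2; rewrite distrC opprK addrC.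
have [||c c01 fc] := @lip_ivt (fun x => - f (lerpv B W x)) _ lip'.
- by rewrite /lerpv scale0r addr0 fB; lra.
- by rewrite /lerpv scale1r subrKC; lra.
exists (lerpv B W c); apply: (fin B c (-1)) => //; first by rewrite normrN1.
- by rewrite mulN1r -scalerDl.
- by rewrite fB; lra.
- by lra.
Qed.

(** The path from t n0 to a nearby point equidistant from 0 and 2 t n0 is almost perpendicular to
    the normal ray. By the dichotomy it continues to length [K], beyond that point or backwards
    beyond t n0. In both cases Stewart's inequality gives Pythagoras up to K h, and [line_affine]
    keeps the end orthogonal to all lines. *)
Lemma horizontal_point_approx (K h : R) : 0 < h <= t -> h <= K -> exists Y,
  [/\ H Y, d (e (t *: n0)) (e Y) = K, dot Y Y <= K ^+ 2 + t ^+ 2 + K * h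
    & forall v, line v -> dot Y v = 0].
Proof.
move=> h0t hK; have [X [HX Xt Xh Xeq XV]] := equidistant_point h0t.
have /andP[h0 ht] := h0t.
have Ht := H_t (ltW t0).
set m := e (t *: n0); set q := e X.
have mq : m <> q by move=> /e_inj => /(_ Ht HX) /esym.
pose r := d m q; have r0 : 0 < r by exact: d_gt0.
have rh : r <= h.
  have := e_lip HX Ht; rewrite metric_sym -/r => /le_trans; apply.
  by apply: nv_le => //; exact: ltW.
have tV v : line v -> dot (t *: n0) v = 0.
  by move=> [[_ v0] _]; rewrite dotZl dotC v0 mulr0.
pose D := d q (e 0).
have dpm : d m (e 0) = t by rewrite metric_sym dn00 ?ltW.
have dm2 : d m (e ((2 * t) *: n0)) = t.
  by rewrite dn0 ?mulr_ge0 ?ltW // ler0_norm; lra.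
have dp2 : d (e 0) (e ((2 * t) *: n0)) = 2 * t by rewrite dn00 ?mulr_ge0 ?ltW.
have D2 : D ^+ 2 <= t ^+ 2 + r ^+ 2.
  have bt : btw (e 0) m (e ((2 * t) *: n0)).
    by rewrite /btw dp2 (metric_sym _ m) dpm dm2; lra.
  have := St q bt; rewrite (metric_sym _ m) dpm dm2 dp2.
  rewrite (metric_sym (e 0)) (metric_sym (e ((2 * t) *: n0))) -Xeq -/D -/r.
  by move=> h1; rewrite -(ler_pM2l t0); lra.
have Dt : t <= D.
  have := metric_triangle (e 0) q (e ((2 * t) *: n0)).
  by rewrite dp2 (metric_sym _ q) -Xeq -/D; lra.
pose s k : R := r / k.+2%:R.
have s01 k : 0 < s k < r.
  by rewrite divr_gt0 //= ltr_pdivrMr // ltr_pMr // ltr1n.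
have /choice [mm mmP] : forall k, exists x, [/\ d m x = s k, d x q = r - s k & btw m x q].
  move=> k; apply: (seg_point (rs_segment RM)).
  by have /andP[? ?] := s01 k; rewrite !ltW.
have mmc : ucv mm m.
  have h1 := UM (Ucst r) (@Uinv R); rewrite mulr0 in h1.
  apply: (Usq (Ucst 0) h1); apply: filterE => k /=.
  have [-> _ _] := mmP k; have /andP[s0 _] := s01 k; rewrite ltW //= /s.
  by rewrite ler_pM2l // lef_pV2 ?posrE ?ltr0n // ler_nat.
have mbt k : btw m (mm k) q by have [_ _ ?] := mmP k.
have mm1 k : m <> mm k.
  move=> Em; have [h1 _ _] := mmP k; have /andP[+ _] := s01 k.
  by rewrite -h1 -Em mdistxx ltxx.
have mm2 k : mm k <> q.
  move=> Em; have [h1 _ _] := mmP k; have /andP[_ +] := s01 k.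
  by rewrite -h1 Em ltxx.
have [E|[k E]] := ext_dich RM mmc mbt mm1 mm2.
- have [y [y1 y2]] := E (K - r) (ltac:(lra)); have [Y HY YE] := e_onto y.
  exists Y; rewrite YE; have dK : d m y = K by rewrite y1 -/r; lra.
  have bt : btw m q y by rewrite /btw y2 dK -/r; lra.
  split=> //.
    rewrite -hsr_rad0 // YE; have := St (e 0) bt; rewrite y2 dK dpm -/D -/r.
    rewrite (metric_sym y) => h1; rewrite -(ler_pM2l r0).
    have h2 := ler_wpM2l (ltac:(lra) : 0 <= K) D2.
    have h3 : 0 <= r * (K * h) by rewrite !mulr_ge0 ?(ltW r0) ?(ltW h0) //; lra.
    by lra.
  move=> v lv; have := line_affine lv Ht HX HY; rewrite YE => /(_ bt).
  rewrite (tV _ lv) (XV _ lv) mulr0 mulr0 add0r => /esym/eqP.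
  by rewrite mulf_eq0 (gt_eqF r0) /= => /eqP.
have [k1 k2 kbt] := mmP k; have /andP[s0 sr] := s01 k.
have K0 : 0 <= K by lra.
have [y [y1 y2]] := E K K0; have [Y HY YE] := e_onto y.
have [Z HZ ZE] := e_onto (mm k).
rewrite (metric_sym _ m) k1 in y1.
have bt : btw y m (mm k).
  by rewrite /btw (metric_sym y m) y2 k1 (metric_sym y) y1; lra.
exists Y; rewrite YE; split => //.
  rewrite -hsr_rad0 // YE; have := St (e 0) bt.
  rewrite (metric_sym y m) y2 k1 (metric_sym y (mm k)) y1 dpm (metric_sym y).
  have := St (e 0) kbt; rewrite k1 k2 dpm -/D -/r.
  set F := d (e 0) y; set G := d (mm k) (e 0) => h1 h2.
  have h3 : t ^+ 2 <= D ^+ 2 by rewrite ler_sqr ?nnegrE ?(ltW t0) // (le_trans _ Dt) // ltW.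
  have h4 : t ^+ 2 - s k * (r - s k) <= G ^+ 2.
    rewrite -(ler_pM2l r0); have := ler_wpM2l (ltW s0) h3; lra.
  have h5 := ler_wpM2l K0 h4.
  have h6 : K * s k * r <= K * s k * h by rewrite ler_wpM2l // mulr_ge0 // ltW.
  by rewrite -(ler_pM2l s0); lra.
move=> v lv.
have z0 : dot Z v = 0.
  have := line_affine lv Ht HZ HX; rewrite ZE => /(_ kbt).
  rewrite (tV _ lv) (XV _ lv) !mulr0 addr0 => /eqP.
  by rewrite mulf_eq0 (gt_eqF r0) /= => /eqP.
have := line_affine lv HY Ht HZ; rewrite YE ZE => /(_ bt).
rewrite (tV _ lv) z0 !mulr0 addr0 k1 => /esym/eqP.
by rewrite mulf_eq0 (gt_eqF s0) /= => /eqP.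
Qed.

Lemma horizontal_point (k : nat) : exists Y,
  [/\ H Y, d (e (t *: n0)) (e Y) = k%:R, dot Y Y <= k%:R ^+ 2 + t ^+ 2
    & forall v, line v -> dot Y v = 0].
Proof.
case: k => [|k].
  exists (t *: n0); split; first exact: H_t (ltW t0).
  - by rewrite mdistxx.
  - by rewrite !dotE n01; lra.
  - by move=> v [[_ v0] _]; rewrite dotZl dotC v0 mulr0.
set K : R := k.+1%:R; have K1 : 1 <= K by rewrite ler1n.
pose c := Num.min t 1; have c0 : 0 < c by rewrite lt_min t0 ltr01.
pose h j : R := c / j.+1%:R.
have hj j : 0 < h j <= c.
  by rewrite divr_gt0 //= ler_pdivrMr // ler_pMr // ler1n.
have ct : c <= t by rewrite ge_min lexx.
have c1 : c <= 1 by rewrite ge_min lexx orbT.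
have /choice [Y YP] : forall j, exists Y, [/\ H Y, d (e (t *: n0)) (e Y) = K,
    dot Y Y <= K ^+ 2 + t ^+ 2 + K * h j & forall v, line v -> dot Y v = 0].
  move=> j; have /andP[h0 hc] := hj j.
  by apply: horizontal_point_approx; [rewrite h0 (le_trans hc)|exact: le_trans hc (le_trans c1 _)].
have [|j|Z YZ [HZ eZ]] := @hsr_cvE Y (K ^+ 2 + t ^+ 2 + K).
- by move=> j; have [] := YP j.
- have [_ _ h1 _] := YP j; apply: le_trans h1 _; rewrite lerD2l.
  by have /andP[h0 hc] := hj j; rewrite ler_piMr; lra.
exists Z; split=> //.
- apply: (Uuniq (ucv_d (ucv_cst _) eZ)); apply: (Usq (Ucst K) (Ucst K)).
  by apply: filterE => j /=; have [_ -> _ _] := YP j; rewrite lexx.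
- have h1 := UM (Ucst (K * c)) (@Uinv R).
  have h2 := UD (Ucst (K ^+ 2 + t ^+ 2)) h1; rewrite mulr0 addr0 in h2.
  apply: (Ule (vcv_dot YZ YZ) h2); apply: filterE => j /=.
  by have [_ _ + _] := YP j; rewrite /h mulrA.
- move=> v lv; apply: (Uuniq (vcv_dot YZ (vcv_cst v))).
  by apply: Ueq (Ucst 0) => j; have [_ _ _ ->] := YP j.
Qed.
End edge_existence.
(** Perpendicular paths of unbounded length at height k + 1 have an asymptotic edge direction, which
    satisfies [Et] there and, by [Et_mono], at all lower heights. A limit over k satisfies it at
    every height. *)
Lemma Einf_exists w : edge w -> (forall v, line v -> dot w v = 0) ->
  exists2 z, Einf z & forall v, line v -> dot z v = 0.
Proof.
move=> ew wV.
have /choice [z zP] : forall k : nat, exists z,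
    [/\ edge z, Et k.+1%:R z & forall v, line v -> dot z v = 0].
  move=> k; have k0 : 0 < k.+1%:R :> R by rewrite ltr0n.
  have /choice [Y YP] := horizontal_point k0 ew wV.
  have [|||z [ez Ez zV]] := @asymptotic_edge _ Y k0.
  - by move=> j; have [] := YP j.
  - by move=> j; have [] := YP j.
  - by move=> j; have [] := YP j.
  exists z; split=> // v lv; apply: zV => j; have [_ _ _ h] := YP j; exact: h.
have [|z0 zz] := @vcv_bnd _ _ z 1.
  by move=> k; have [[-> _] _ _] := zP k.
have ez0 : edge z0.
  split; first by apply: (Uuniq (vcv_dot zz zz)); apply: Ueq (Ucst 1) => k; have [[-> _] _ _] := zP k.
  by apply: (Uuniq (vcv_dot zz (vcv_cst n0))); apply: Ueq (Ucst 0) => k; have [[_ ->] _ _] := zP k.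
exists z0.
  split=> // t t0; apply: (Et_lim t0 _ ez0 zz); first by move=> k; have [] := zP k.
  apply: filterS (ulf_ge (Num.truncn t).+1) => k /= hk.
  have [h1 h2 _] := zP k; apply: Et_mono h2 => //.
  rewrite t0 /= (le_trans (ltW (truncnS_gt t))) // ler_nat.
  exact: leq_trans hk _.
move=> v lv; apply: (Uuniq (vcv_dot zz (vcv_cst v))).
by apply: Ueq (Ucst 0) => k; have [_ _ ->] := zP k.
Qed.

Lemma Einf_axes z (a b : R) : Einf z -> 0 < a -> 0 < b ->
  d (e (a *: n0)) (e (b *: z)) = nv (b *: z - a *: n0).
Proof.
move=> [[z1 z0] h] a0 b0.
rewrite /nv -[d _ _]ger0_norm ?mdist_ge0 // -sqrtr_sqr h //; last exact: ltW.
congr Num.sqrt; rewrite !dotE n01 z1 (dotC n0) z0; ring.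
Qed.

(* Bound on the points reached from [e (s1 z)] by a geodesic: with [w] straight
   above the edge point, the angle there is at most [pi / 2]. *)
Lemma above_edge_bound z (s1 a : R) W : Einf z -> 0 < s1 -> 0 < a -> H W ->
  d (e (s1 *: z)) (e W) = 1 ->
  d (e W) (e (s1 *: z + a *: n0)) ^+ 2 <= a ^+ 2 + 1.
Proof.
move=> Ez s10 a0 HW dW; have [[z1 z0] hz] := Ez.
have HB : H (s1 *: z) by apply: H_e; case: Ez.
pose h k : R := (k.+2%:R)^-1.
have h01 k : 0 < h k <= 1 by rewrite invr_gt0 ltr0n /= invf_le1 ?ltr0n // ler1n.
have /choice [X XP] : forall k, exists X, [/\ H X, d (e (s1 *: z)) (e X) = h k,
    d (e X) (e W) = 1 - h k & btw (e (s1 *: z)) (e X) (e W)].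
  move=> k; have [|x [x1 x2 x3]] := @seg_point _ _ (e (s1 *: z)) (e W) (h k) (rs_segment RM).
    by rewrite dW; have /andP[? ?] := h01 k; rewrite ltW.
  by have [X HX XE] := e_onto x; exists X; rewrite XE -dW.
have HX k : H (X k) by have [] := XP k.
have Xb k : dot (X k) (X k) <= (s1 + 1) ^+ 2.
  rewrite -hsr_rad0 // ler_pXn2r ?nnegrE ?mdist_ge0 //; last lra.
  apply: le_trans (metric_triangle _ (e (s1 *: z)) _) _.
  have [_ -> _ _] := XP k; have /andP[_ ?] := h01 k.
  by rewrite lerD // e_rad // nvZ /nv z1 sqrtr1 mulr1 gtr0_norm.
have [X0 XX [HX0 eX]] := hsr_cvE HX Xb.
have hc : Ulim h 0.
  apply: (Usq (Ucst 0) (@Uinv R)); apply: filterE => k /=.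
  by rewrite invr_ge0 ler0n /= lef_pV2 ?posrE ?ltr0n // ler_nat.
have X0E : X0 = s1 *: z.
  apply: e_inj => //; apply: (ucv_uniq eX).
  by apply: Ueq hc => k /=; have [_ -> _ _] := XP k.
have eX' := vcvD XX (vcv_cst (a *: n0)).
have HXa k : H (X k + a *: n0) by rewrite !dotE n01; have := HX k; lra.
have [_ eXa] := hsr_cv eX' HXa; rewrite X0E in eXa.
apply: (Ule (UX 2 (ucv_d (ucv_cst (e W)) eXa)) (Ucst _)); apply: filterE => k /=.
have [_ k1 k2 kb] := XP k; have /andP[hk0 hk1] := h01 k.
set w' := e (X k + a *: n0).
have l1 : d (e (X k)) w' <= a.
  apply: le_trans (e_lip (HX k) (HXa k)) _.
  by rewrite opprD addrA subrr sub0r nvN nvZ n0nv mulr1 gtr0_norm.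
have l2 : a <= d (e (s1 *: z)) w'.
  apply/ler_addgt0Pr => eps eps0.
  pose C := (s1 + 1) ^+ 2; pose T := a + C / eps + 1.
  have C0 : 0 < C by rewrite exprn_gt0 //; lra.
  have Ce : 0 < C / eps by rewrite divr_gt0.
  have T0 : 0 < T by rewrite /T; lra.
  have HT : H (T *: n0) by apply: H_t; exact: ltW.
  have t1 := metric_triangle (e (T *: n0)) w' (e (s1 *: z)).
  have t2 : T <= d (e (T *: n0)) (e (s1 *: z)).
    rewrite -(ler_pXn2r (ltn0Sn 1)) ?nnegrE ?mdist_ge0 ?(ltW T0) //.
    by rewrite hz //; [have := sqr_ge0 s1; lra|exact: ltW].
  have t3 : d (e (T *: n0)) w' <= T - a + eps.
    apply: le_trans (e_lip HT (HXa k)) _; apply: nv_le; first by rewrite /T; lra.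
    have := Xb k; rewrite -/C; have := HX k; rewrite !dotE n01 (dotC n0) => x1 x2.
    have eC : C <= 2 * (T - a) * eps.
      have : C <= (T - a) * eps.
        have -> : T - a = C / eps + 1 by rewrite /T; ring.
        by rewrite mulrDl divfK ?gt_eqF // mul1r lerDl ltW.
      have : 0 <= (T - a) * eps by rewrite mulr_ge0 ?ltW // /T; lra.
      lra.
    have x3 : 0 <= 2 * (T - a) * dot (X k) n0 by rewrite !mulr_ge0 // /T; lra.
    have x4 := sqr_ge0 eps; lra.
  by rewrite (metric_sym w') in t1; lra.
have := St w' kb; rewrite k1 k2 dW.
have s1' : d (e (X k)) w' ^+ 2 <= a ^+ 2 by rewrite ler_sqr ?nnegrE ?mdist_ge0 // ltW.
have s2' : a ^+ 2 <= d (e (s1 *: z)) w' ^+ 2 by rewrite ler_sqr ?nnegrE ?mdist_ge0 // ltW.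
move=> u1; have u2 := ler_wpM2l (_ : 0 <= 1 - h k) s2'.
have u3 : (1 - h k) * a ^+ 2 <= (1 - h k) * d (e (s1 *: z)) w' ^+ 2 by apply: u2; lra.
rewrite -(ler_pM2l hk0).
have u4 : 0 <= h k * h k by rewrite mulr_ge0 ?ltW.
lra.
Qed.

(** The given interior point q lies on the segment from A = t1 n0 to an edge point B = s1 z, on
    which [e] is isometric. The dichotomy at q continues the path to A, as claimed, or a path that
    runs on through B. The second is excluded because a detour over a point slightly above B would
    be shorter. *)
Lemma Einf_ext z (a0 s0 t1 : R) : Einf z -> 0 < a0 -> 0 < s0 -> a0 < t1 ->
  ext (e (a0 *: n0 + s0 *: z)) (e (t1 *: n0)).
Proof.
move=> Ez a00 s00 at1; have [ez hz] := Ez; have [z1 z0] := ez.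
have t10 : 0 < t1 by lra.
have ta0 : 0 < t1 - a0 by lra.
pose s1 := s0 * t1 / (t1 - a0); pose lq := (t1 - a0) / t1.
have s10 : 0 < s1 by rewrite divr_gt0 ?mulr_gt0.
have lq0 : 0 < lq by rewrite divr_gt0.
have lq1 : lq < 1 by rewrite ltr_pdivrMr // mul1r; lra.
pose A := t1 *: n0; pose B := s1 *: z.
have HA : H A by apply: H_t; exact: ltW.
have HB : H B by exact: H_e.
have isoAB : d (e A) (e B) = nv (B - A) by exact: Einf_axes.
pose D : R := nv (B - A).
change (d (e A) (e B) = D) in isoAB.
have D0 : 0 < D.
  rewrite -isoAB; apply: d_gt0 => /e_inj => /(_ HA HB) AB.
  have : dot A n0 = dot B n0 by rewrite AB.
  by rewrite !dotE n01 z0; lra.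
have qE : a0 *: n0 + s0 *: z = lerpv A B lq.
  rewrite /lerpv /A /B /lq /s1; apply/rowP => i; rewrite !mxE; field.
  by rewrite !gt_eqF.
rewrite qE; pose mj (j : nat) := lq * (1 - (j.+2%:R)^-1).
have inv2 (j : nat) : 0 < (j.+2%:R^-1 : R) < 1.
  by rewrite invr_gt0 ltr0n /= invf_lt1 ?ltr0n // ltr1n.
have mj0 j : 0 < mj j < lq.
  have /andP[i0 i1] := inv2 j; rewrite /mj; apply/andP; split.
    by rewrite mulr_gt0 // subr_gt0.
  by rewrite gtr_pMr // ltrBlDr ltrDl.
have mjq : ucv (fun j => e (lerpv A B (mj j))) (e (lerpv A B lq)).
  have h1 := UM (Ucst (lq * D)) (@Uinv R); rewrite mulr0 in h1.
  apply: (Usq (Ucst 0) h1); apply: filterE => j /=; have /andP[j0 j1] := mj0 j.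
  rewrite mdist_ge0 /= hsr_seg //; [|lra|lra].
  rewrite ger0_norm ?subr_ge0 ?(ltW j1) // -/D /mj.
  have -> : lq - lq * (1 - j.+2%:R^-1) = lq * j.+2%:R^-1 by ring.
  rewrite [leLHS]mulrAC; apply: ler_wpM2l; first by rewrite mulr_ge0 ?ltW.
  by rewrite lef_pV2 ?posrE ?ltr0n // ler_nat.
have EA : lerpv A B 0 = A by rewrite /lerpv scale0r addr0.
have EB : lerpv A B 1 = B by rewrite /lerpv scale1r subrKC.
have b1 j : btw (e (lerpv A B lq)) (e (lerpv A B (mj j))) (e A).
  have /andP[j0 j1] := mj0 j; rewrite -{3}EA; apply: btwC.
  by apply: hsr_btw => //; lra.
have n1 j : e (lerpv A B lq) <> e (lerpv A B (mj j)).
  move=> E; have /andP[j0 j1] := mj0 j.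
  have := @hsr_seg A B lq (mj j) HA HB isoAB; rewrite E mdistxx => h.
  have : 0 = `|lq - mj j| * D by apply: h; lra.
  move=> /esym/eqP; rewrite mulf_eq0 (gt_eqF D0) orbF normr_eq0; lra.
have n2 j : e (lerpv A B (mj j)) <> e A.
  move=> E; have /andP[j0 j1] := mj0 j.
  have := @hsr_seg A B (mj j) 0 HA HB isoAB; rewrite EA E mdistxx => h.
  have : 0 = `|mj j - 0| * D by apply: h; lra.
  move=> /esym/eqP; rewrite mulf_eq0 (gt_eqF D0) orbF normr_eq0; lra.
(* Otherwise a path from [mm] continues through q; by nonbranching it reaches B, and it is followed
   to the point [W] at distance 1 beyond B. *)
have [//|[j E]] := ext_dich RM mjq b1 n1 n2; exfalso.
have /andP[j0 j1] := mj0 j.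
pose l := (1 - lq) * D; have l0 : 0 < l by rewrite mulr_gt0 // subr_gt0.
set q := e (lerpv A B lq) in E n1 n2 b1 mjq *; set mm := e (lerpv A B (mj j)) in E.
have dqB : d q (e B) = l.
  rewrite /q -{2}EB hsr_seg //; [|lra|lra].
  by rewrite ler0_norm ?opprB // subr_le0 ltW.
have [w0 [w1 w2]] := E (l + 1) (ltac:(lra)).
have mqw : btw mm q w0 by rewrite /btw w1 w2.
have mqB : btw mm q (e B) by rewrite -EB; apply: hsr_btw => //; lra.
have [|p [p1 p2 pb]] := @seg_point _ _ q w0 l (rs_segment RM).
  by rewrite w2; lra.
have mqp : btw mm q p by apply: btw_r mqw pb.
have pE : p = e B by apply: (nonbranching St mqp mqB); [move/esym; exact: n1|rewrite p1 dqB].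
rewrite pE w2 in p1 p2 pb.
have [W HW WE] := e_onto w0.
have dBW : d (e B) (e W) = 1 by rewrite WE p2; ring.
(* The height above B that minimizes the bound on u + v obtained by linearizing the two squares
   around l and 1. *)
pose a := a0 / (1 + l) ; have a_gt0 : 0 < a by rewrite divr_gt0 //; lra.
have k1 := above_edge_bound Ez s10 a_gt0 HW dBW.
have HC : H (B + a *: n0) by rewrite !dotE z0 n01; lra.
have k2 : d q (e (B + a *: n0)) ^+ 2 <= l ^+ 2 - 2 * a * a0 + a ^+ 2.
  apply: le_trans (hsr_lip2 _ HC) _; first by apply: H_lerp => //; lra.
  have -> : l ^+ 2 = dot (lerpv A B lq - B) (lerpv A B lq - B).
    by rewrite -{2 4}EB lerpvB -nv_sq nvZ ler0_norm ?subr_le0 ?(ltW lq1) // -/D /l; ring.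
  rewrite -qE /B !dotE n01 z1 (dotC n0) z0.
  lra.
have t := metric_triangle q (e (B + a *: n0)) w0.
rewrite w2 -WE (metric_sym (e _) (e W)) in t.
set u := d q _ in t k2; set v := d (e W) _ in t k1.
have k3 := sqr_ge0 (u - l); have k4 := sqr_ge0 (v - 1).
have aE : a * (1 + l) = a0 by rewrite /a divfK // gt_eqF //; lra.
have k5 : 2 * l * (l + 1) <= 2 * l * (u + v) by rewrite ler_wpM2l // mulr_ge0 // ltW.
have k6 : 2 * l * v <= l * (v ^+ 2 + 1) by have := ler_wpM2l (ltW l0) (ltac:(lra) : 2 * v <= v ^+ 2 + 1); lra.
have k7 := ler_wpM2l (ltW l0) k1.
have k8 : 2 * a * a0 <= a ^+ 2 + l * a ^+ 2 by lra.
have k9 : a ^+ 2 + l * a ^+ 2 = a * a0 by rewrite -aE; ring.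
have : 0 < a * a0 by rewrite mulr_gt0.
lra.
Qed.

(** In the limit of [Einf_ext] as the heights tend to 0, the path from s z to 0 continues beyond 0
    by any r. Its end has norm r and lies at distance s + r from s z; since [e] is 1-Lipschitz this
    leaves only -r z. *)
Lemma Einf_line z : Einf z -> line z.
Proof.
move=> Ez; have [ez hz] := Ez; have [z1 z0] := ez.
have nz : nv z = 1 by rewrite /nv z1 sqrtr1.
have key s r : 0 < s -> 0 <= r -> d (e (s *: z)) (e ((- r) *: z)) = s + r.
  move=> s0 r0.
  have [w [w1 w2]] : ext_by r (e (s *: z)) (e 0).
    have h1 := @Uinv R.
    have c1 : vcv (fun k => k.+1%:R^-1 *: n0 + s *: z) (s *: z).
      by rewrite -[s *: z in X in vcv _ X]add0r -(scale0r n0); apply: vcvD (vcv_cst _); apply: vcvZ => //; exact: vcv_cst.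
    have c2 : vcv (fun k => (2 / k.+1%:R) *: n0) 0.
      rewrite -(scale0r n0) -(mulr0 2); apply: vcvZ; last exact: vcv_cst.
      exact: UM (Ucst 2) h1.
    have H1 k : H ((k.+1%:R^-1 : R) *: n0 + s *: z).
      by rewrite !dotE n01 z0 mulr0 addr0 mulr1.
    have H2 k : H ((2 / k.+1%:R : R) *: n0) by rewrite !dotE n01 mulr1 divr_ge0.
    have [_ d1] := hsr_cv c1 H1; have [_ d2] := hsr_cv c2 H2.
    apply: (ext_lim (rs_proper RM) d1 d2); apply: filterE => k /=.
    apply: Einf_ext => //.
    by rewrite ltr_pMl ?ltr1n // invr_gt0 ltr0n.
  have [Y HY YE] := e_onto w; rewrite -YE in w1 w2.
  have ds : d (e (s *: z)) (e 0) = s.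
    by rewrite metric_sym e_rad ?H_e // nvZ nz mulr1 gtr0_norm.
  rewrite ds in w1; rewrite -w1.
  have Y2 : dot Y Y = r ^+ 2 by rewrite -hsr_rad0 // w2.
  have h := hsr_lip2 (H_e s ez) HY; rewrite w1 !dotE z1 Y2 (dotC z) in h.
  suff -> : Y = (- r) *: z by [].
  apply/eqP; rewrite -subr_eq0; apply/eqP; apply: dot_eq0.
  apply/eqP; rewrite eq_le dot_ge0 andbT !dotE z1 Y2 (dotC z).
  rewrite -(ler_pM2l s0); have := ler_wpM2l r0 (ltac:(lra) : s * dot Y z <= - (s * r)); lra.
split=> // s t; wlog st : s t / t <= s => [h|].
  have [st|/ltW st] := leP t s; first exact: h.
  by rewrite metric_sym distrC; exact: h.
rewrite ger0_norm ?subr_ge0 //.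
have HeN r : H ((- r) *: z) by exact: H_e.
have [t0|t0] := leP t 0.
  have [s0|s0] := ltP 0 s; first by have := key s (- t) s0; rewrite opprK oppr_ge0; apply.
  have E r : r *: z = (- r) *: (- z) by rewrite scalerN scaleNr opprK.
  rewrite (E s) (E t) hsr_rad ?oppr_ge0 ?dotNl ?z0 ?oppr0 //.
  by rewrite nvN nz mulr1 opprK ler0_norm; lra.
have s0 : 0 < s by lra.
have Hz : H z by rewrite z0.
by rewrite (hsr_rad Hz (ltW s0) (ltW t0)) nz mulr1 ger0_norm ?subr_ge0.
Qed.

(** By [line_plane] the segment from 2 s a z1 to 2 s b z2 is carried isometrically, and s w is its
    midpoint. Stewart's inequality seen from t n0 gives the lower half of Pythagoras for w, so w
    satisfies [Einf] and is a line. *)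
Lemma line_comb z1 z2 (a b : R) : line z1 -> line z2 ->
  dot (a *: z1 + b *: z2) (a *: z1 + b *: z2) = 1 -> line (a *: z1 + b *: z2).
Proof.
move=> l1 l2.
have [w wE0] : exists w, w = a *: z1 + b *: z2 by exists (a *: z1 + b *: z2).
rewrite -wE0 => w1.
have [[z11 z10] _] := l1; have [[z21 z20] _] := l2.
have ew : edge w by split=> //; rewrite wE0 !dotE z10 z20; ring.
apply: Einf_line; split=> // t t0 s s0.
have Hw := H_e s ew; have Ht := H_t (ltW t0).
have e1 : edge z1 by []. have e2 : edge z2 by [].
pose A := (2 * s * a) *: z1; pose B := (2 * s * b) *: z2.
have HA : H A by exact: H_e. have HB : H B by exact: H_e.
have iso : d (e A) (e B) = nv (B - A) by rewrite metric_sym line_plane.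
have wE : s *: w = lerpv A B 2^-1.
  by rewrite /lerpv /A /B wE0; apply/rowP => i; rewrite !mxE; field.
have bt : btw (e A) (e (s *: w)) (e B).
  have EA : lerpv A B 0 = A by rewrite /lerpv scale0r addr0.
  have EB : lerpv A B 1 = B by rewrite /lerpv scale1r subrKC.
  by rewrite wE -{1}EA -{3}EB; apply: hsr_btw => //; lra.
apply/eqP; rewrite eq_le; apply/andP; split.
  apply: le_trans (hsr_lip2 Ht Hw) _; have [_ w0] := ew.
  by rewrite !dotE n01 w1 (dotC n0) w0; lra.
have dA : d (e (t *: n0)) (e A) ^+ 2 = t ^+ 2 + (2 * s * a) ^+ 2.
  by rewrite line_plane // nv_sq !dotE n01 z11 (dotC n0) z10; ring.
have dB : d (e (t *: n0)) (e B) ^+ 2 = t ^+ 2 + (2 * s * b) ^+ 2.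
  by rewrite line_plane // nv_sq !dotE n01 z21 (dotC n0) z20; ring.
have dAw : d (e A) (e (s *: w)) = 2^-1 * nv (B - A).
  have EA : lerpv A B 0 = A by rewrite /lerpv scale0r addr0.
  by rewrite wE -{1}EA hsr_seg // ?lexx ?ler01 //; [rewrite sub0r normrN ger0_norm //; lra|lra].
have dwB : d (e (s *: w)) (e B) = 2^-1 * nv (B - A).
  by move: bt; rewrite /btw dAw iso; lra.
have := St (e (t *: n0)) bt; rewrite iso dAw dwB.
rewrite (metric_sym (e A)) (metric_sym (e B)) dA dB (metric_sym (e (s *: w))).
set X := d _ _; set N := nv _ => h.
have N2 : N ^+ 2 + 4 * s ^+ 2 = 2 * (2 * s * a) ^+ 2 + 2 * (2 * s * b) ^+ 2.
  rewrite nv_sq /A /B !dotE z11 z21 (dotC z2 z1); move: w1; rewrite wE0 !dotE z11 z21 (dotC z2 z1) => w1.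
  have /= h1 := congr1 (fun x => 4 * s ^+ 2 * x) w1; lra.
have [N0|N0] := eqVneq N 0.
  have AB : B - A = 0 by apply: dot_eq0; rewrite -nv_sq -/N N0 expr0n.
  have BA : B = A by apply/eqP; rewrite -subr_eq0 AB.
  have wA : s *: w = A by rewrite wE /lerpv AB scaler0 addr0.
  have : s ^+ 2 = (2 * s * a) ^+ 2.
    have /= := congr1 (fun x => dot x x) wA; rewrite /A !dotE w1 z11 => h1; lra.
  by rewrite /X wA dA => ->; rewrite addrC.
have Np : 0 < N by rewrite lt_neqAle eq_sym N0 nv_ge0.
rewrite -(ler_pM2l Np); have /= h1 := congr1 (fun x => N * x) N2; lra.
Qed.

(** Unit combinations of lines are lines, so an edge direction that is not one has a nonzero
    component orthogonal to all of them, found by maximizing the inner product with lines.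
    [Einf_exists] then yields a line orthogonal to all lines, in particular to itself. *)
Lemma line_all v : edge v -> line v.
Proof.
move=> ev; apply: contrapT => nlv.
have [w [ew wV]] : exists w, edge w /\ forall v, line v -> dot w v = 0.
  have [[u0 lu0]|nV] := pselect (exists u, line u); last first.
    by exists v; split=> // u lu; exfalso; apply: nV; exists u.
  pose S := [set dot v u | u in line].
  have CS u : line u -> dot v u <= 1.
    move=> [[u1 _] _]; have [v1 _] := ev.
    by have := dot_ge0 (v - u); rewrite !dotE u1 v1 (dotC u); lra.
  have supS : has_sup S.
    by split; [exists (dot v u0), u0|exists 1 => _ [u lu <-]; exact: CS].
  pose c := sup S.
  have ub u : line u -> dot v u <= c by move=> lu; apply: sup_upper_bound => //; exists u.
  have c0 : 0 <= c by have := ub _ lu0; have := ub _ (lineN lu0); rewrite dotNr; lra.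
  have /choice [u uP] : forall k : nat, exists u, line u /\ c - (k.+1%:R)^-1 < dot v u.
    move=> k; have [|_ [u lu <-] h] := @sup_adherent _ S (k.+1%:R)^-1 _ supS.
      by rewrite invr_gt0.
    by exists u.
  have [|z uz] := @vcv_bnd _ _ u 1; first by move=> k; have [[[-> _] _] _] := uP k.
  have lz : line z.
    have ez : edge z.
      split; first by apply: (Uuniq (vcv_dot uz uz)); apply: Ueq (Ucst 1) => k; have [[[-> _] _] _] := uP k.
      by apply: (Uuniq (vcv_dot uz (vcv_cst n0))); apply: Ueq (Ucst 0) => k; have [[[_ ->] _] _] := uP k.
    split=> // s t.
    have [_ h1] := hsr_cv (vcvZ (Ucst s) uz) (fun k => H_e s (let: conj (conj h _) _ := uP k in h)).
    have [_ h2] := hsr_cv (vcvZ (Ucst t) uz) (fun k => H_e t (let: conj (conj h _) _ := uP k in h)).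
    apply: (Uuniq (ucv_d h1 h2)); apply: Ueq (Ucst _) => k /=.
    by have [[_ ->] _] := uP k.
  have zc : dot v z = c.
    apply/eqP; rewrite eq_le ub //=.
    have h := UD (Ucst c) (UN (@Uinv R)); rewrite subr0 in h.
    apply: (Ule h (vcv_dot (vcv_cst v) uz)); apply: filterE => k /=.
    by have [_ /ltW] := uP k.
  have [[z1 z0] _] := lz; have [v1 v0] := ev.
  have [w wE] : exists w, w = v - c *: z by exists (v - c *: z).
  have wz : dot w z = 0 by rewrite wE !dotE zc z1; ring.
  have wp : 0 < dot w w.
    rewrite lt_neqAle dot_ge0 andbT eq_sym; apply: contra_notN nlv => /eqP/dot_eq0/eqP.
    rewrite wE subr_eq0 => /eqP vE.
    have vE' : v = c *: z + 0 *: z by rewrite scale0r addr0.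
    by rewrite vE'; apply: line_comb => //; rewrite -vE'.
  have wV u1 : line u1 -> dot w u1 = 0.
    move=> lu; apply: contrapT => /eqP wu.
    have [[u11 u10] _] := lu.
    pose g := dot u1 z; have [y yE] : exists y, y = u1 - g *: z by exists (u1 - g *: z).
    have vy : dot v y = dot w u1 by rewrite yE wE !dotE zc -/g (dotC z u1) -/g; ring.
    have yz : dot y z = 0 by rewrite yE !dotE z1 -/g; ring.
    have y2 : 0 < dot y y.
      rewrite lt_neqAle dot_ge0 andbT eq_sym; apply: contraNN wu => /eqP/dot_eq0 y0.
      by rewrite -vy y0 dot0r.
    pose f := dot v y; have f0 : 0 < f ^+ 2 by rewrite lt_neqAle sqr_ge0 andbT eq_sym sqrf_eq0 /f vy.
    (* moving from the maximizer [z] in the direction of [f y] increases [dot v] *)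
    have [x xE] : exists x, x = z + (f / (c + 1)) *: y by exists (z + (f / (c + 1)) *: y).
    have x2 : dot x x = 1 + (f / (c + 1)) ^+ 2 * dot y y.
      by rewrite xE !dotE z1 (dotC z y) yz; ring.
    have fy0 : 0 <= (f / (c + 1)) ^+ 2 * dot y y by rewrite mulr_ge0 ?sqr_ge0 ?dot_ge0.
    have xp : 0 < dot x x by rewrite x2; lra.
    have yle1 : dot y y <= 1.
      by rewrite yE !dotE u11 z1 (dotC z u1) -/g; have := sqr_ge0 g; lra.
    have vx : dot v x = c + f ^+ 2 / (c + 1) by rewrite xE !dotE zc -/f; ring.
    have nx : 0 < nv x by rewrite sqrtr_gt0.
    have lx : line ((nv x)^-1 *: x).
      have -> : (nv x)^-1 *: x = ((nv x)^-1 * (1 - f / (c + 1) * g)) *: z + ((nv x)^-1 * (f / (c + 1))) *: u1.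
        by rewrite xE yE; apply/rowP => i; rewrite !mxE; ring.
      apply: line_comb => //.
      have -> : ((nv x)^-1 * (1 - f / (c + 1) * g)) *: z + ((nv x)^-1 * (f / (c + 1))) *: u1 = (nv x)^-1 *: x.
        by rewrite xE yE; apply/rowP => i; rewrite !mxE; ring.
      by rewrite !dotE -nv_sq expr2 mulKf ?gt_eqF // mulVf ?gt_eqF.
    have := ub _ lx; rewrite dotZr ler_pdivrMl // vx => h1.
    have c1 : 0 < c + 1 by lra.
    have h2 : (c + f ^+ 2 / (c + 1)) ^+ 2 <= c ^+ 2 * dot x x.
      have -> : c ^+ 2 * dot x x = (nv x * c) ^+ 2 by rewrite exprMn nv_sq mulrC.
      have fc : 0 <= c + f ^+ 2 / (c + 1) by rewrite addr_ge0 // divr_ge0 ?sqr_ge0 // ltW.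
      by rewrite ler_pXn2r ?nnegrE ?mulr_ge0 ?nv_ge0.
    rewrite x2 in h2.
    pose i := (c + 1)^-1; have i0 : 0 < i by rewrite invr_gt0.
    have ic : i * (c + 1) = 1 by rewrite mulVf // gt_eqF.
    have h3 : (f / (c + 1)) ^+ 2 * dot y y * c ^+ 2 <= (f * i) ^+ 2 * c ^+ 2.
      by rewrite ler_wpM2r ?sqr_ge0 // ler_piMr ?sqr_ge0.
    have h4 : 2 * c * (f ^+ 2 * i) + (f ^+ 2 * i) ^+ 2 <= (f * i) ^+ 2 * c ^+ 2.
      by move: h2 h3; rewrite -/i => h2 h3; lra.
    have ci : c * i <= 1 by lra.
    have h5 : (f * i) ^+ 2 * c ^+ 2 <= c * i * f ^+ 2.
      have := ler_wpM2r (ltW f0) (ler_wpM2l (mulr_ge0 c0 (ltW i0)) ci) => h5; lra.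
    have h6 : 0 < (f ^+ 2 * i) ^+ 2 by rewrite exprn_gt0 // mulr_gt0.
    have h7 : 0 <= c * i * f ^+ 2 by apply: mulr_ge0 (ltW f0); apply: mulr_ge0 (ltW i0).
    lra.
  exists ((nv w)^-1 *: w); have nw : 0 < nv w by rewrite sqrtr_gt0.
  split; last by move=> u1 lu; rewrite dotZl wV // mulr0.
  split; first by rewrite !dotE -nv_sq expr2 mulKf ?gt_eqF // mulVf ?gt_eqF.
  by rewrite wE !dotE v0 z0; ring.
have [z Ez zV] := Einf_exists ew wV.
have lz := Einf_line Ez; have := zV _ lz; have [[-> _] _] := lz.
by move=> /eqP; rewrite oner_eq0.
Qed.

Lemma edge_plane X Z : H X -> dot Z n0 = 0 -> d (e X) (e Z) = nv (X - Z).
Proof.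
move=> HX Z0; have [->|Zn] := eqVneq Z 0.
  by rewrite subr0 metric_sym e_rad.
have nZ : 0 < nv Z.
  rewrite lt_neqAle nv_ge0 andbT eq_sym; apply: contra Zn => /eqP h.
  by apply/eqP; apply: dot_eq0; rewrite -nv_sq h expr0n.
have -> : Z = nv Z *: ((nv Z)^-1 *: Z) by rewrite scalerA mulfV ?gt_eqF // scale1r.
apply: line_plane => //; apply: line_all; split; last by rewrite dotZl Z0 mulr0.
by rewrite !dotE -nv_sq expr2 mulKf ?gt_eqF // mulVf ?gt_eqF.
Qed.

(** Two points of different heights lie on a Euclidean line that meets the edge at some Z. Their
    distances to Z are Euclidean, so the triangle inequality bounds their mutual distance from
    below. Equal heights are reached by raising one point slightly. *)
Theorem half_space_rigidity X Y : H X -> H Y -> d (e X) (e Y) = nv (X - Y).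
Proof.
have main P Q : H P -> dot P n0 < dot Q n0 -> nv (P - Q) <= d (e P) (e Q).
  move=> HP PQ; have HQ : H Q by lra.
  pose dl := dot Q n0 - dot P n0; have dl0 : 0 < dl by rewrite subr_gt0.
  pose l := - (dot P n0 / dl); pose Z := P + l *: (Q - P).
  have Z0 : dot Z n0 = 0.
    rewrite /Z !dotE -/dl /l mulNr divfK ?subrr // gt_eqF //.
  have l0 : l <= 0 by rewrite oppr_le0 divr_ge0 // ltW.
  have ZP : d (e P) (e Z) = - l * nv (P - Q).
    rewrite edge_plane //.
    have -> : P - Z = l *: (P - Q) by rewrite /Z; apply/rowP => i; rewrite !mxE; ring.
    by rewrite nvZ ler0_norm.
  have ZQ : d (e Q) (e Z) = (1 - l) * nv (P - Q).
    rewrite edge_plane //.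
    have -> : Q - Z = (l - 1) *: (P - Q) by rewrite /Z; apply/rowP => i; rewrite !mxE; ring.
    by rewrite nvZ ler0_norm ?opprB //; lra.
  have := metric_triangle (e Q) (e P) (e Z).
  by rewrite ZP ZQ (metric_sym (e Q)); lra.
move=> HX HY; apply/eqP; rewrite eq_le e_lip //=.
have [h|h|h] := ltgtP (dot X n0) (dot Y n0); first exact: main.
  by rewrite metric_sym -nvN opprB; exact: main.
apply/ler_addgt0Pr => eps eps0.
pose Y' := Y + eps *: n0.
have HY' : H Y' by rewrite !dotE n01; lra.
have h1 := main X Y' HX (ltac:(rewrite !dotE n01; lra)).
have h2 := metric_triangle (e X) (e Y) (e Y').
have h3 : d (e Y) (e Y') <= eps.
  apply: le_trans (e_lip HY HY') _.
  by rewrite opprD addrA subrr sub0r nvN nvZ n0nv mulr1 gtr0_norm.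
have h4 : nv (X - Y) <= nv (X - Y').
  rewrite -ler_sqr ?nnegrE ?nv_ge0 // !nv_sq !dotE n01 !(dotC n0) h.
  by have := sqr_ge0 eps; lra.
lra.
Qed.

End half_space_rigidity.

Lemma ulf_fin (I : finType) (P : I -> nat -> Prop) :
  (forall i, ulf [set n | P i n]) -> ulf [set n | forall i, P i n].
Proof.
move=> h; have : ulf [set n | forall i, i \in index_enum I -> P i n].
  elim: (index_enum I) => [|i s IH]; first by apply: filterE.
  apply: filterS (filterI (h i) IH) => n /= [h1 h2] j.
  by rewrite inE => /predU1P[->|/h2].
by apply: filterS => n /= hn i; apply: hn; exact: mem_index_enum.
Qed.

(** * Stewart's inequality from the quadruple condition *)

Section quadruple.
Context {R : realType} {X : metricType R}.
Implicit Types (a b c m x y : X).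

Definition cca a b c : R := (d a b ^+ 2 + d a c ^+ 2 - d b c ^+ 2) / (2 * d a b * d a c).

Lemma ccaC a b c : cca a b c = cca a c b.
Proof. by rewrite /cca (metric_sym b c) mulrAC [in LHS](addrC (d a b ^+ 2)). Qed.

Lemma cca_bound a b c : a <> b -> a <> c -> -1 <= cca a b c <= 1.
Proof.
move=> ab ac; have ab0 := d_gt0 ab; have ac0 := d_gt0 ac.
have t1 := metric_triangle b a c; have t2 := metric_triangle a b c.
have t3 := metric_triangle a c b.
rewrite (metric_sym b a) in t1; rewrite (metric_sym c b) in t3.
have D0 : 0 <= d b c := mdist_ge0 _ _.
rewrite /cca ler_pdivlMr ?ler_pdivrMr ?mulr_gt0 //.
by apply/andP; split; nra.
Qed.

Lemma cos_comparison a b c : a <> b -> a <> c -> cos (comparison_angle a b c) = cca a b c.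
Proof. by move=> ab ac; rewrite /comparison_angle acosK // in_itv /= cca_bound. Qed.

Lemma comparison_in a b c : a <> b -> a <> c -> 0 <= comparison_angle a b c <= pi.
Proof.
by move=> ab ac; have h := cca_bound ab ac; rewrite acos_ge0 // acos_lepi.
Qed.

(** When t3 is close to pi, the other two angles add up to hardly more than pi. The error is
    measured through the cosine and sine of pi - t3, so that it can be applied to points that are
    only almost between two others. *)
Lemma cos_sum_ge (t1 t2 t3 : R) : 0 <= t1 <= pi -> 0 <= t2 <= pi -> 0 <= t3 <= pi ->
  t1 + t2 + t3 <= 2 * pi -> - (1 + cos t3) - sin t3 <= cos t1 + cos t2.
Proof.
move=> h1 h2 h3 hs; have /andP[t10 t1p] := h1; have /andP[t20 t2p] := h2.
have /andP[t30 t3p] := h3.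
have s3 : 0 <= sin t3 by exact: sin_ge0_pi.
have s2 : 0 <= sin t2 by exact: sin_ge0_pi.
pose f := pi - t3.
have cf : cos f = - cos t3 by rewrite /f cosB cospi sinpi; ring.
have sf : sin f = sin t3 by rewrite /f sinB cospi sinpi; ring.
have dec (x y : R) : 0 <= x <= pi -> 0 <= y <= pi -> x <= y -> cos y <= cos x.
  by move=> hx hy xy; rewrite leNgt ltr_cos ?in_itv //= -leNgt.
have [h|h] := leP f t2.
  have : cos (pi - (t2 - f)) <= cos t1.
    by apply: dec => //; rewrite /f in h *; lra.
  rewrite cosB cospi sinpi cosB cf sf => h4.
  have c2 := cos_le1 t2; have c2' := cos_geN1 t2.
  have c3 := cos_le1 t3; have c3' := cos_geN1 t3.
  have s2' := sin_le1 t2.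
  have u1 : 0 <= (1 + cos t3) * (1 + cos t2) by rewrite mulr_ge0 //; lra.
  have u2 : 0 <= sin t3 * (1 - sin t2) by rewrite mulr_ge0 //; lra.
  lra.
have : cos f <= cos t2 by apply: dec; [exact: h2|rewrite /f; lra|exact: ltW].
have := cos_geN1 t1; lra.
Qed.

Definition quad (O : set X) := forall a b c e, O a -> O b -> O c -> O e ->
  uniq [:: a; b; c; e] ->
  comparison_angle a b c + comparison_angle a c e + comparison_angle a e b <= 2 * pi.

Lemma quad_cca (O : set X) m a b x : quad O -> O m -> O a -> O b -> O x ->
  m <> a -> m <> b -> m <> x -> a <> b -> a <> x -> b <> x ->
  - (1 + cca m a b) - Num.sqrt (2 * (1 + cca m a b)) <= cca m a x + cca m b x.
Proof.
move=> q Om Oa Ob Ox ma mb mx ab ax bx.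
have u : uniq [:: m; x; a; b].
  rewrite /= !inE !negb_or; move/eqP: ma; move/eqP: mb; move/eqP: mx; move/eqP: ab.
  move/eqP: ax; move/eqP: bx; rewrite (eq_sym a x) (eq_sym b x).
  by move=> -> -> -> -> -> ->.
have := q m x a b Om Ox Oa Ob u.
have := @cos_sum_ge (comparison_angle m x a) (comparison_angle m b x) (comparison_angle m a b).
rewrite !comparison_in // !cos_comparison // => h hs.
have {h} := h isT isT isT (ltac:(lra)).
rewrite (ccaC m x a) => h; apply: le_trans h; rewrite lerD2l lerN2.
have /andP[c1 c2] := cca_bound ma mb.
have s0 : 0 <= sin (comparison_angle m a b) by rewrite sin_ge0_pi // comparison_in.
rewrite -[leLHS]ger0_norm // -sqrtr_sqr ler_sqrt.
  have := cos2Dsin2 (comparison_angle m a b); rewrite cos_comparison //; nra.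
by rewrite mulr_ge0 //; lra.
Qed.

(* The two adjacent angles at [m], cleared of denominators. *)
Lemma quad_stewart_err (O : set X) m a b x k : k = 1 + cca m a b -> quad O -> O m -> O a -> O b -> O x ->
  m <> a -> m <> b -> m <> x -> a <> b -> a <> x -> b <> x ->
  d m b * d a x ^+ 2 + d a m * d b x ^+ 2 - d a m * d m b * (d a m + d m b)
    - 2 * (d a m * d m b * d m x) * (k + Num.sqrt (2 * k)) <= (d a m + d m b) * d m x ^+ 2.
Proof.
move=> kE q Om Oa Ob Ox ma mb mx ab ax bx.
have := quad_cca q Om Oa Ob Ox ma mb mx ab ax bx; rewrite -kE /cca (metric_sym a m).
have := d_gt0 ma; have := d_gt0 mb; have := d_gt0 mx.
set e := k + _; set A := d a x; set B := d b x.
set p := d m x; set r := d m b; set s := d m a => p0 r0 s0 h.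
have h2 : - e <= (s ^+ 2 + p ^+ 2 - A ^+ 2) / (2 * s * p) + (r ^+ 2 + p ^+ 2 - B ^+ 2) / (2 * r * p).
  by move: h; rewrite /e; lra.
have srp : 0 < 2 * (s * r * p) by rewrite !mulr_gt0.
have := ler_wpM2l (ltW srp) h2.
have -> : 2 * (s * r * p) * ((s ^+ 2 + p ^+ 2 - A ^+ 2) / (2 * s * p) + (r ^+ 2 + p ^+ 2 - B ^+ 2) / (2 * r * p))
   = r * (s ^+ 2 + p ^+ 2 - A ^+ 2) + s * (r ^+ 2 + p ^+ 2 - B ^+ 2).
  by field; rewrite !gt_eqF.
lra.
Qed.

Definition stewart_on (O : set X) := forall a m b x, O a -> O m -> O b -> O x -> btw a m b ->
  d m b * d a x ^+ 2 + d a m * d b x ^+ 2 - d a m * d m b * d a b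
      <= d a b * d m x ^+ 2.

(** For m between a and b the comparison angle at m is pi, so the error term of [quad_stewart_err]
    is 0. The quadruple condition concerns distinct points; coincidences are checked by hand. *)
Lemma quad_stewart (O : set X) : quad O -> stewart_on O.
Proof.
move=> q a m b x Oa Om Ob Ox bt.
have [<-|am] := pselect (a = m); first by rewrite mdistxx; lra.
have [mb|mb] := pselect (m = b); first by rewrite -mb mdistxx; lra.
have am0 := d_gt0 am; have mb0 := d_gt0 mb; rewrite /btw in bt.
have ab : a <> b by move=> ab; move: bt; rewrite ab mdistxx (metric_sym b m); lra.
have [<-|ax] := pselect (a = x).
  rewrite mdistxx (metric_sym b a) (metric_sym m a) -bt; lra.
have [<-|bx] := pselect (b = x).
  by rewrite mdistxx -bt; lra.
have [<-|mx] := pselect (m = x).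
  by rewrite mdistxx (metric_sym b m) -bt; lra.
have ma : m <> a by move/esym.
have := quad_stewart_err erefl q Om Oa Ob Ox ma mb mx ab ax bx.
have -> : cca m a b = -1.
  rewrite /cca -bt (metric_sym m a).
  have -> : d a m ^+ 2 + d m b ^+ 2 - (d a m + d m b) ^+ 2 = - (2 * d a m * d m b) by ring.
  by rewrite mulNr divff // gt_eqF // !mulr_gt0.
by rewrite subrr mulr0 sqrtr0 addr0 mulr0 subr0 -bt.
Qed.

(* Limit form of the median inequality, for almost midpoints [m k] of [c], [y]. *)
Lemma midlim (O : set X) c y (m x : nat -> X) (u A B : R) : quad O -> O c -> O y ->
  (forall k, O (m k)) -> (forall k, O (x k)) ->
  Ulim (fun k => d c (m k)) (d c y / 2) -> Ulim (fun k => d (m k) y) (d c y / 2) ->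
  Ulim (fun k => d (m k) (x k)) u -> Ulim (fun k => d c (x k)) A -> Ulim (fun k => d y (x k)) B ->
  A ^+ 2 / 2 + B ^+ 2 / 2 - d c y ^+ 2 / 4 <= u ^+ 2.
Proof.
move=> q Oc Oy Om Ox cm my mx cx yx; set D := d c y in cm my *.
have D0 : 0 <= D by exact: mdist_ge0.
have ge0 f l : Ulim (fun k => d (f k : X) (x k)) l -> 0 <= l.
  by move=> h; apply: (Ule (Ucst 0) h); apply: filterE => k /=; exact: mdist_ge0.
have u0 := ge0 _ _ mx; have A0 := ge0 _ _ cx; have B0 := ge0 _ _ yx.
have tA : A <= D / 2 + u.
  by apply: (Ule cx (UD cm mx)); apply: filterE => k /=; exact: metric_triangle.
have tB : B <= D / 2 + u.
  apply: (Ule yx (UD my mx)); apply: filterE => k /=.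
  by rewrite (metric_sym (m k) y); exact: metric_triangle.
have tD : D <= A + B.
  apply: (Ule (Ucst D) (UD cx yx)); apply: filterE => k /=.
  by rewrite (metric_sym y); exact: metric_triangle.
have tBD : B <= D + A.
  apply: (Ule yx (UD (Ucst D) cx)); apply: filterE => k /=.
  by rewrite /D (metric_sym c y); exact: metric_triangle.
have tAD : A <= D + B.
  by apply: (Ule cx (UD (Ucst D) yx)); apply: filterE => k /=; exact: metric_triangle.
have tu : u <= D / 2 + A.
  by apply: (Ule mx (UD cm cx)); apply: filterE => k /=; rewrite (metric_sym c (m k)); exact: metric_triangle.
have [Dz|Dp] := leP D 0.
  have DE : D = 0 by lra.
  have Au : A = u by lra.
  have Bu : B = u by lra.
  by rewrite Au Bu DE; lra.
have [uz|up] := leP u 0.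
  have uE : u = 0 by lra.
  have AE : A = D / 2 by lra.
  have BE : B = D / 2 by lra.
  by rewrite uE AE BE; lra.
have [Az|Ap] := leP A 0.
  have AE : A = 0 by lra.
  have BE : B = D by lra.
  have h : (D / 2) ^+ 2 <= u ^+ 2 by rewrite ler_sqr ?nnegrE; lra.
  by rewrite AE BE; lra.
have [Bz|Bp] := leP B 0.
  have BE : B = 0 by lra.
  have AE : A = D by lra.
  have h : (D / 2) ^+ 2 <= u ^+ 2 by rewrite ler_sqr ?nnegrE; lra.
  by rewrite AE BE; lra.
have pos f l : 0 < l -> Ulim f l -> ulf [set k | 0 < f k :> R].
  move=> l0 /UP /(_ _ l0); apply: filterS => k /=; rewrite ltr_norml; lra.
pose al k := d c (m k); pose be k := d (m k) y.
pose ka k : R := 1 + (al k ^+ 2 + be k ^+ 2 - D ^+ 2) / (2 * al k * be k).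
have D2 : 0 < D / 2 by lra.
have kac : Ulim ka 0.
  have h : Ulim (fun k => 2 * al k * be k) (2 * (D / 2) * (D / 2)).
    by apply: UM my; exact: UM (Ucst 2) cm.
  have hn : 2 * (D / 2) * (D / 2) != 0 by rewrite !mulf_neq0 // gt_eqF.
  have h1 := UD (Ucst 1) (UM (UD (UD (UX 2 cm) (UX 2 my)) (Ucst (- D ^+ 2))) (UV hn h)).
  have E : 1 + ((D / 2) ^+ 2 + (D / 2) ^+ 2 - D ^+ 2) * (2 * (D / 2) * (D / 2))^-1 = 0.
    by field; rewrite gt_eqF.
  by rewrite E in h1.
have ec : Ulim (fun k => ka k + Num.sqrt (2 * ka k)) 0.
  have h1 := UM (Ucst 2) kac; rewrite mulr0 in h1.
  have h2 := Ucomp (@sqrt_continuous R _) h1; rewrite sqrtr0 in h2.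
  by have := UD kac h2; rewrite addr0.
have S : ulf [set k | [/\ 0 < al k, 0 < be k, 0 < d (m k) (x k), 0 < d c (x k) & 0 < d y (x k)]].
  apply: filterS (filterI (filterI (pos _ _ D2 cm) (pos _ _ D2 my)) (filterI (pos _ _ up mx) (filterI (pos _ _ Ap cx) (pos _ _ Bp yx)))).
  by move=> k /= [[? ?] [? [? ?]]].
have L := UD (UD (UD (UM my (UX 2 cx)) (UM cm (UX 2 yx))) (UN (UM (UM cm my) (UD cm my))))
   (UN (UM (UM (Ucst 2) (UM (UM cm my) mx)) ec)).
have Rl := UM (UD cm my) (UX 2 mx).
have := Ule L Rl; rewrite mulr0 oppr0 addr0 => h.
have {h} : D / 2 * A ^+ 2 + D / 2 * B ^+ 2 - D / 2 * (D / 2) * (D / 2 + D / 2) <=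
   (D / 2 + D / 2) * u ^+ 2.
  apply: h; apply: filterS S => k /= [al0 be0 dm dc dy].
  have ne (p r : X) : 0 < d p r -> p <> r by rewrite mdist_gt0 => /eqP.
  have cy : c <> y by apply: ne.
  have := quad_stewart_err erefl q (Om k) Oc Oy (Ox k) (nesym (ne _ _ al0)) (ne _ _ be0) (ne _ _ dm) cy (ne _ _ dc) (ne _ _ dy).
  by rewrite /= {1 2}/cca -/D (metric_sym (m k) c) -/(al k) -/(be k).
by move=> h; rewrite -(ler_pM2l Dp); lra.
Qed.
End quadruple.

(** * Separated families, approximate midpoints and segments *)

Definition separated {R : realType} {X : metricType R} (s : R) (N : nat) (z : 'I_N -> X) :=
  forall i j, i != j -> s < d (z i) (z j).

(** If no ball of radius e about a point of [P] contains the sequence along the ultrafilter, then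
    finitely many terms can always be avoided by a further term, and separated families of every
    size arise. *)
Lemma packing_ulf {R : realType} {X : metricType R} (P : set X) (u : nat -> X) :
  (forall s : R, 0 < s -> exists K, forall N (z : 'I_N -> X),
     (forall i, P (z i)) -> separated s z -> (N <= K)%N) ->
  (forall n, P (u n)) -> forall e : R, 0 < e -> exists x, P x /\ ulf [set n | d x (u n) < e].
Proof.
move=> pk Pu e e0; apply: contrapT => nex.
have e2 : 0 < e / 2 by rewrite divr_gt0.
have [K hK] := pk _ e2.
have ex N : exists z : 'I_N -> X, (forall i, exists n, z i = u n) /\ separated (e / 2) z.
  elim: N => [|N [z [zu zs]]].
    by exists (fun=> u 0%N); split=> [[]|[]].
  have : ulf [set n | forall i, ~ (d (z i) (u n) < e)].
    apply: ulf_fin => i; have [h|//] := ulf_or [set n | d (z i) (u n) < e].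
    by exfalso; apply: nex; exists (z i); split=> //; have [k ->] := zu i.
  move=> /filter_ex [n hn].
  exists (fun i => if unlift ord_max i is Some j then z j else u n); split.
    by move=> i; case: unliftP => [j _|_]; [exact: zu|exists n].
  move=> i j; case: unliftP => [i' ->|->]; case: unliftP => [j' ->|->]; rewrite ?eqxx //.
  - by move=> h; apply: zs; apply/eqP => E; move: h; rewrite E eqxx.
  - by move=> _; have /negP := hn i'; rewrite -leNgt; lra.
  - by move=> _; rewrite metric_sym; have /negP := hn j'; rewrite -leNgt; lra.
have [z [zu zs]] := ex K.+1.
have : (K.+1 <= K)%N by apply: (hK _ z) => // i; have [n ->] := zu i.
by rewrite ltnn.
Qed.

Section complete.
Context {R : realType} {X : metricType R}.
Hypothesis cX : complete_metric X.

Lemma complete_ulim (u : nat -> X) :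
  (forall e : R, 0 < e -> exists x, ulf [set n | d x (u n) < e]) -> exists y, ucv u y.
Proof.
move=> h; have /cX [y uy] : cauchy (u @ ulf).
  apply: cauchy_exP => e e0; have [x hx] := h e e0; exists x.
  by rewrite /= ballEmdist.
exists y; apply/ucvP => e e0.
have := uy (ball y e) (nbhsx_ballx y e e0).
by rewrite ballEmdist.
Qed.

Lemma packing_ulim (P : set X) (u : nat -> X) :
  (forall s : R, 0 < s -> exists K, forall N (z : 'I_N -> X),
     (forall i, P (z i)) -> separated s z -> (N <= K)%N) ->
  (forall n, P (u n)) -> exists y, ucv u y.
Proof.
move=> pk Pu; apply: complete_ulim => e /(packing_ulf pk Pu) [x [_ h]]; by exists x.
Qed.
End complete.

(** A substitute for the homothety of ratio 1/2 with centre [c], which in nonnegative curvature at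
    most halves distances. It only speaks of finite families, hence it can be proved from
    approximate midpoints before segments are known to exist. *)
Definition halving {R : realType} {X : metricType R} (x0 : X) (rho : R) :=
  forall c (r s : R) (N : nat) (y : 'I_N -> X), d x0 c + r <= rho -> 0 < s ->
  (forall i, d c (y i) < r) -> separated s y ->
  exists y' : 'I_N -> X, (forall i, d c (y' i) < r / 2) /\ separated (s / 2) y'.

Lemma separated_scale {R : realType} {X : metricType R}
    (x0 c : X) (rho r s : R) (N : nat) (y : 'I_N -> X) (k : nat) :
  halving x0 rho -> d x0 c + r <= rho -> 0 < s -> 0 <= r ->
  (forall i, d c (y i) < r) -> separated s y ->
  exists y' : 'I_N -> X, (forall i, d c (y' i) < r / 2 ^+ k) /\ separated (s / 2 ^+ k) y'.
Proof.
move=> q cr s0 r0 yr ys; elim: k => [|k [y' [y1 y2]]].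
  by exists y; split; rewrite expr0 divr1.
have p0 : 0 < 2 ^+ k :> R by rewrite exprn_gt0.
have p1 : 1 <= 2 ^+ k :> R by rewrite exprn_ege1 // ler1n.
have rk : r / 2 ^+ k <= r by rewrite ler_pdivrMr // ler_peMr.
have [||y'' h] := q c _ _ _ _ _ _ y1 y2; [lra|by rewrite divr_gt0|].
by exists y''; rewrite exprSr !invfM !mulrA.
Qed.

Section intrinsic.
Context {R : realType} {X : metricType R}.
Hypothesis iX : intrinsic_metric X.

(** An approximate chain is parametrized by its partial lengths: the parameter t is sent to the
    first vertex whose partial length reaches t. *)
Lemma almost_path (a b : X) (dl : R) : 0 < dl -> exists p : R -> X,
  [/\ forall s t, 0 <= s <= t -> t <= d a b -> d (p s) (p t) <= t - s + dl,
      forall s, 0 <= s <= d a b -> d a (p s) <= s + dl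
    & forall s, 0 <= s <= d a b -> d (p s) b <= d a b - s + dl].
Proof.
move=> dl0; have [k [z [z0 zk zs zt]]] := iX a b dl0.
pose S j : R := \sum_(i < j) d (z i) (z i.+1).
have SS j : S j.+1 = S j + d (z j) (z j.+1) by rewrite /S big_ord_recr.
have dz i j : (i <= j)%N -> d (z i) (z j) <= S j - S i.
  elim: j => [|j IH]; first by rewrite leqn0 => /eqP ->; rewrite mdistxx subrr.
  rewrite leq_eqVlt => /predU1P[->|]; first by rewrite mdistxx subrr.
  rewrite ltnS => /IH h; apply: le_trans (metric_triangle _ (z j) _) _.
  by rewrite SS; lra.
have Sk : d a b <= S k by have := dz 0%N k (leq0n _); rewrite z0 zk /S big_ord0 subr0.
have S0 : S 0%N = 0 by rewrite /S big_ord0.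
have ex t : exists j, t <= d a b -> (t <= S j) && (j <= k)%N.
  by exists k => h; rewrite leqnn andbT (le_trans h).
(* The first disjunct only makes the choice of a least index possible for parameters beyond d a
   b. *)
pose P t j := (d a b < t) || ((t <= S j) && (j <= k)%N).
have exP t : exists j, P t j.
  by rewrite /P; have [h|h] := ltP (d a b) t; [exists 0%N|exists k; rewrite /= leqnn andbT (le_trans h)].
pose J t := ex_minn (exP t).
have JP t : 0 <= t <= d a b -> [/\ t <= S (J t), (J t <= k)%N & S (J t) <= t + dl].
  move=> /andP[t0 tD]; rewrite /J; case: ex_minnP => j; rewrite /P ltNge tD /= => /andP[h1 h2] hmin.
  split => //; case: j h1 h2 hmin => [|j] h1 h2 hmin; first by rewrite S0; lra.
  have : ~~ (t <= S j).
    apply/negP => h; have := hmin j; rewrite h (ltnW h2) => /(_ isT); by rewrite ltnn.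
  rewrite -ltNge SS; have := zs j h2; lra.
have Jmono s t : 0 <= s <= t -> t <= d a b -> (J s <= J t)%N.
  move=> /andP[s0 st] tD; rewrite {1}/J; case: ex_minnP => j _; apply.
  have [h1 h2 _] : [/\ t <= S (J t), (J t <= k)%N & S (J t) <= t + dl] by apply: JP; lra.
  by rewrite /P h2 (le_trans st h1) orbT.
exists (fun t => z (J t)); split.
- move=> s t st tD; have := dz _ _ (Jmono _ _ st tD); have /andP[s0 sl] := st.
  have [h1 _ _] : [/\ s <= S (J s), (J s <= k)%N & S (J s) <= s + dl] by apply: JP; lra.
  have [_ _ h2] : [/\ t <= S (J t), (J t <= k)%N & S (J t) <= t + dl] by apply: JP; lra.
  lra.
- move=> s h; have [_ _ h1] := JP s h.
  by have := dz 0%N _ (leq0n (J s)); rewrite z0 S0; lra.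
- move=> s h; have [h1 h2 _] := JP s h.
  by have := dz _ _ h2; rewrite zk; have := zt; rewrite -/(S k); lra.
Qed.

Lemma proper_segment : proper_metric X -> forall a b : X, exists g, segment a b g.
Proof.
move=> pX a b; set D := d a b; have D0 : 0 <= D by exact: mdist_ge0.
pose dl k : R := k.+1%:R^-1.
have dl1 k : dl k <= 1 by rewrite invf_le1 ?ltr0n // ler1n.
have /choice [p pP] k := @almost_path a b (dl k) (ltac:(by rewrite invr_gt0)).
have /choice [g gP] : forall t, exists x, 0 <= t <= D -> ucv (fun k => p k t) x.
  move=> t; have [h|h] := boolP (0 <= t <= D); last by exists a.
  have [k|x hx] := pX (fun k => p k t) a (D + 1); last by exists x.
  by have [_ h2 _] := pP k; have := h2 t h; have := dl1 k; rewrite -/D; lra.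
have g0 s : 0 <= s <= D -> d a (g s) <= s.
  move=> h; have h1 := UD (Ucst s) (@Uinv R); rewrite addr0 in h1.
  apply: (Ule (ucv_d (ucv_cst a) (gP _ h)) h1); apply: filterE => k /=.
  by have [_ + _] := pP k; apply.
have g1 s : 0 <= s <= D -> d (g s) b <= D - s.
  move=> h; have h1 := UD (Ucst (D - s)) (@Uinv R); rewrite addr0 in h1.
  apply: (Ule (ucv_d (gP _ h) (ucv_cst b)) h1); apply: filterE => k /=.
  by have [_ _] := pP k; apply.
have g2 s t : 0 <= s <= t -> t <= D -> d (g s) (g t) <= t - s.
  move=> h tD; have /andP[s0 st] := h.
  have h1 := UD (Ucst (t - s)) (@Uinv R); rewrite addr0 in h1.
  have hs : 0 <= s <= D by lra. have ht : 0 <= t <= D by lra.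
  apply: (Ule (ucv_d (gP _ hs) (gP _ ht)) h1); apply: filterE => k /=.
  by have [+ _ _] := pP k; apply.
have z0 (x y : X) : d x y <= 0 -> x = y.
  by move=> h; apply: mdist_positivity; apply/eqP; rewrite eq_le h mdist_ge0.
exists g; split.
- by apply/esym/z0/g0; rewrite lexx D0.
- by apply/z0; have := g1 D; rewrite subrr -/D; apply; rewrite D0 lexx.
- move=> s t; wlog st : s t / s <= t => [h hs ht|hs ht].
    by have [st|/ltW st] := leP s t; [exact: h|rewrite metric_sym distrC; exact: h].
  rewrite distrC ger0_norm ?subr_ge0 //.
  have := g0 _ hs; have := g1 _ ht; have := metric_triangle a (g s) b.
  have := metric_triangle (g s) (g t) b.
  have /andP[s0 _] := hs; have /andP[_ tD] := ht; rewrite -/D in tD.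
  have := g2 s t (ltac:(lra)) (ltac:(lra)); rewrite -/D => *.
  by apply/eqP; rewrite eq_le; apply/andP; split; lra.
Qed.

Lemma almost_midpoint (a b : X) (dl : R) : 0 < dl ->
  exists m, d a m <= d a b / 2 + dl /\ d m b <= d a b / 2 + dl.
Proof.
move=> /(almost_path a b) [p [_ h1 h2]]; exists (p (d a b / 2)).
have D0 : 0 <= d a b := mdist_ge0 _ _.
have := h1 (d a b / 2); have := h2 (d a b / 2) => u v.
have hh : 0 <= d a b / 2 <= d a b by lra.
by have := u hh; have := v hh; lra.
Qed.

(* Contracting towards [c] by a factor 1/2 at most halves distances. *)
Lemma quad_halving (x0 : X) (rho : R) : quad [set x | d x0 x < rho] -> halving x0 rho.
Proof.
move=> q c r s N y cr s0 yr ys.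
have [r0|r0] := leP r 0.
  case: N y yr ys => [|N] y yr ys; first by exists y; split=> [[]|[]].
  by have := yr ord0; have := mdist_ge0 c (y ord0); lra.
pose dl k : R := r / 2 * k.+1%:R^-1.
have dl0 k : 0 < dl k by rewrite mulr_gt0 ?invr_gt0 ?ltr0n // divr_gt0.
have dl1 k : dl k <= r / 2.
  have i1 : (k.+1%:R^-1 : R) <= 1 by rewrite invf_le1 ?ltr0n // ler1n.
  have r2 : 0 <= r / 2 by lra.
  by have := ler_wpM2l r2 i1; rewrite mulr1.
have dlc : Ulim dl 0 by have := UM (Ucst (r / 2)) (@Uinv R); rewrite mulr0.
have /choice [m mP] : forall ik : 'I_N * nat, exists m,
    d c m <= d c (y ik.1) / 2 + dl ik.2 /\ d m (y ik.1) <= d c (y ik.1) / 2 + dl ik.2.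
  by move=> ik; apply: almost_midpoint; exact: dl0.
pose mm i k := m (i, k).
have mmP i k : d c (mm i k) <= d c (y i) / 2 + dl k /\ d (mm i k) (y i) <= d c (y i) / 2 + dl k := mP (i, k).
have cm i : Ulim (fun k => d c (mm i k)) (d c (y i) / 2).
  have h1 := UD (Ucst (d c (y i) / 2)) dlc; rewrite addr0 in h1.
  have h2 := UD (Ucst (d c (y i) / 2)) (UN dlc); rewrite subr0 in h2.
  apply: (Usq h2 h1); apply: filterE => k /=; have [u v] := mmP i k.
  by have := metric_triangle c (mm i k) (y i); lra.
have my i : Ulim (fun k => d (mm i k) (y i)) (d c (y i) / 2).
  have h1 := UD (Ucst (d c (y i) / 2)) dlc; rewrite addr0 in h1.
  have h2 := UD (Ucst (d c (y i) / 2)) (UN dlc); rewrite subr0 in h2.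
  apply: (Usq h2 h1); apply: filterE => k /=; have [u v] := mmP i k.
  by have := metric_triangle c (mm i k) (y i); lra.
set O := [set x | d x0 x < rho] in q.
have Oc : O c by rewrite /O /=; lra.
have Oy i : O (y i).
  by rewrite /O /=; have := metric_triangle x0 c (y i); have := yr i; lra.
have Om i k : O (mm i k).
  rewrite /O /=; have := metric_triangle x0 c (mm i k); have [u _] := mmP i k.
  by have := yr i; have := dl1 k; lra.
have lim i j : exists l, Ulim (fun k => d (mm i k) (y j)) l.
  have [k|l h _] := @Ubnd R (fun k => d (mm i k) (y j)) 0 (2 * r); last by exists l.
  rewrite mdist_ge0 /=; have := metric_triangle (mm i k) c (y j).
  rewrite (metric_sym _ c); have [u _] := mmP i k.
  by have := yr i; have := yr j; have := dl1 k; lra.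
have lim' i j : exists l, Ulim (fun k => d (mm j k) (mm i k)) l.
  have [k|l h _] := @Ubnd R (fun k => d (mm j k) (mm i k)) 0 (2 * r); last by exists l.
  rewrite mdist_ge0 /=; have := metric_triangle (mm j k) c (mm i k).
  rewrite (metric_sym _ c); have [u _] := mmP i k; have [v _] := mmP j k.
  by have := yr i; have := yr j; have := dl1 k; lra.
(* The median inequality is used twice: for the midpoint towards y i seen from y j, then for the
   midpoint towards y j seen from the first midpoint. The distances to the centre cancel, leaving
   half the distance from y i to y j. *)
have far i j : i != j -> ulf [set k | s / 2 < d (mm j k) (mm i k)].
  move=> ij; have [B Bl] := lim i j; have [u ul] := lim' i j.
  have h1 := midlim q Oc (Oy i) (Om i) (fun=> Oy j) (cm i) (my i) Bl (Ucst _) (Ucst _).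
  have Bl' : Ulim (fun k => d (y j) (mm i k)) B by apply: Ueq Bl => k; rewrite metric_sym.
  have h2 := midlim q Oc (Oy j) (Om j) (Om i) (cm j) (my j) ul (cm i) Bl'.
  have h3 : s ^+ 2 < d (y i) (y j) ^+ 2.
    by rewrite ltr_sqr ?nnegrE ?mdist_ge0 ?(ltW s0) //; exact: ys.
  have u0 : 0 <= u by apply: (Ule (Ucst 0) ul); apply: filterE => k /=; exact: mdist_ge0.
  have su : s / 2 < u.
    by rewrite -ltr_sqr ?nnegrE //; lra.
  have /UP/(_ (u - s / 2)) := ul; rewrite subr_gt0 => /(_ su).
  by apply: filterS => k /=; rewrite ltr_norml; lra.
have near i : ulf [set k | d c (mm i k) < r / 2].
  have yr2 : 0 < r / 2 - d c (y i) / 2 by have := yr i; lra.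
  have /UP/(_ _ yr2) := cm i; apply: filterS => k /=; rewrite ltr_norml; lra.
have h : ulf [set k | forall ij : 'I_N * 'I_N, ij.1 != ij.2 -> s / 2 < d (mm ij.2 k) (mm ij.1 k)].
  apply: ulf_fin => -[i j]; have [->|ij] := eqVneq i j; first by apply: filterE => k /=; rewrite ?eqxx.
  by apply: filterS (far i j ij) => k /= ? _.
have [k [/= h1 h2]] := filter_ex (filterI h (ulf_fin near)).
exists (mm^~ k); split=> // i j ij.
by have := h1 (j, i); rewrite eq_sym => /(_ ij).
Qed.

End intrinsic.

(** * Packing bounds from finite Hausdorff dimension *)

Section packing.
Context {R : realType} {X : metricType R}.

(* Positive weights dominating the [s]-th powers of the diameters, so that each set of the
   cover counts. *)
Definition null_cover (s : R) := forall k : R, 0 < k ->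
  exists (U : nat -> set X) (w : nat -> R),
    [/\ forall x, exists i, U i x, forall i, 0 < w i,
        forall m, \sum_(i < m) w i <= k
      & forall i x y, U i x -> U i y -> d x y `^ s <= w i].

Lemma geometric_half (m : nat) : \sum_(i < m) (2^-1 : R) ^+ i.+2 <= 2^-1.
Proof.
have E : \sum_(i < m) (2^-1 : R) ^+ i.+2 = 2^-1 - 2^-1 ^+ m.+1.
  elim: m => [|m IH]; first by rewrite big_ord0 expr1 subrr.
  by rewrite big_ord_recr /= IH !exprS; lra.
by rewrite E gerBl exprn_ge0.
Qed.

Lemma null_cover_dim (n : nat) : hausdorff_dim X = (n%:R)%:E ->
  exists2 s : R, 0 < s & null_cover s.
Proof.
move=> hd; have : (ereal_inf [set s%:E | s in [set s : R | (0 < s)%R /\ hausdorff_measure X s = 0%E]] < (n%:R + 1)%:E)%E.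
  by rewrite -/(hausdorff_dim X) hd lte_fin ltrDl.
move=> /ereal_inf_lt [_ [s /= [s0 hs] <-] _]; exists s => // k k0.
have : (hausdorff_content X s 1 < (k / 2)%:E)%E.
  apply: (@le_lt_trans _ _ 0%E); last by rewrite lte_fin divr_gt0.
  by rewrite -hs; apply: ereal_sup_ubound; exists 1 => //=.
move=> /ereal_inf_lt [_ [U /= [UT Ud] <-] hU].
(* The geometric term makes every weight positive and costs at most k / 2 in total. *)
pose w i := (diam (U i)) `^ s + k * 2^-1 ^+ i.+2.
exists U, w; split.
- move=> x; have : setT x by []. by rewrite -UT => -[i _ Ux]; exists i.
- by move=> i; rewrite ltr_wpDl ?powR_ge0 // mulr_gt0 // exprn_gt0.
- move=> m; rewrite big_split /= -mulr_sumr.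
  have h1 : \sum_(i < m) diam (U i) `^ s <= k / 2.
    rewrite -lee_fin; apply: le_trans (ltW hU).
    rewrite -sumEFin -(big_mkord xpredT (fun i => ((diam (U i)) `^ s)%:E)).
    by apply: nneseries_lim_ge => i _ _; rewrite lee_fin powR_ge0.
  have := ler_wpM2l (ltW k0) (geometric_half m); lra.
- move=> i x y Ux Uy; apply: le_trans (_ : diam (U i) `^ s <= _); last first.
    by rewrite lerDl mulr_ge0 ?(ltW k0) // exprn_ge0.
  have dxy : d x y <= diam (U i).
    apply: sup_upper_bound; last by exists x => //; exists y.
    split; first by exists (d x y); exists x => //; exists y.
    by exists 1 => _ [a Ua [b Ub <-]]; exact: Ud Ua Ub.
  by apply: ge0_ler_powR; rewrite ?nnegrE ?mdist_ge0 ?(ltW s0) // (le_trans _ dxy) ?mdist_ge0.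
Qed.

Hypothesis cX : complete_metric X.
Variables (s : R) (s0 : 0 < s) (nc : null_cover s).

Section nested.
Variables (x0 : X) (r e q sg : R) (j N : nat) (y : 'I_N -> X).
Variables (U : nat -> set X) (w : nat -> R).
Hypotheses (r0 : 0 < r) (e0 : 0 < e) (e1 : e <= 1).
Hypothesis qE : q = (2 ^+ j)^-1.
Hypothesis qe : q <= e / 16.
Hypothesis sgE : sg = q `^ s.
Hypothesis Ns : 1 <= N%:R * sg.
Hypothesis quadX : halving x0 (4 * r).
Hypothesis yr : forall i, d x0 (y i) < r.
Hypothesis ys : separated (e * r) y.
Let rho l : R := e * r / 4 * q ^+ l.
Hypothesis cover : forall x, exists i, U i x.
Hypothesis w0 : forall i, 0 < w i.
Hypothesis ws : forall m, \sum_(i < m) w i <= sg * rho 0 `^ s.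
Hypothesis Uw : forall i x y, U i x -> U i y -> d x y `^ s <= w i.

Let q0 : 0 < q. Proof. by rewrite qE invr_gt0 exprn_gt0. Qed.
Let er0 : 0 < e * r / 4. Proof. by rewrite divr_gt0 ?mulr_gt0. Qed.
Let rho0 l : 0 < rho l. Proof. by rewrite /rho mulr_gt0 // exprn_gt0. Qed.
Let rhoS l : rho l.+1 = q * rho l. Proof. by rewrite /rho exprS; ring. Qed.
Let sg0 : 0 < sg. Proof. by rewrite sgE powR_gt0. Qed.
Let rhoSs l : rho l.+1 `^ s = sg * rho l `^ s.
Proof. by rewrite rhoS powRM ?(ltW q0) ?(ltW (rho0 l)) // sgE. Qed.

Let hits (i : nat) c l := `[< exists x, U i x /\ d c x <= rho l >].
(** The invariant of a nested sequence of balls: the members of the cover that meet the l-th ball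
    weigh at most [sg] times the s-th power of its radius. *)
Let Inv l c := d x0 c + rho l <= r /\
  forall m, \sum_(i < m | hits i c l) w i <= sg * rho l `^ s.

Let Inv0 : Inv 0 x0.
Proof.
split.
  by rewrite mdistxx add0r /rho expr0 mulr1; have := ler_wpM2r (ltW r0) e1; have := r0; lra.
move=> m; apply: le_trans (ws m); rewrite big_mkcond /=.
by apply: ler_sum => i _; case: ifP => // _; exact: ltW.
Qed.

(** Repeated halving of the separated family places N well separated balls of the next radius in the
    given one. A member of the cover that met two of them would have a diameter too large for its
    weight, so the weights split among the balls, and one of the N balls receives at most the
    fraction 1 / N of the total, which is at most [sg]. *)
Let InvS l c : Inv l c -> exists c', d c c' + rho l.+1 <= rho l /\ Inv l.+1 c'.
Proof.
move=> [Ic Is].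
have cr : d x0 c + 2 * r <= 4 * r by have := rho0 l; have := r0; move: Ic; lra.
have er : 0 < e * r by rewrite mulr_gt0.
have yc i : d c (y i) < 2 * r.
  have := metric_triangle c x0 (y i); rewrite (metric_sym c x0).
  by have := yr i; have := rho0 l; move: Ic; lra.
have r20 : 0 <= 2 * r by rewrite mulr_ge0 // ltW.
have [z [z1 z2]] := separated_scale (j * l.+1) quadX cr er r20 yc ys.
have p2 : (2 ^+ (j * l.+1))^-1 = q ^+ l.+1 by rewrite qE exprM exprVn.
rewrite p2 in z1 z2.
have zsep i i' : i != i' -> 4 * rho l.+1 < d (z i) (z i').
  by move=> ii; have := z2 i i' ii; rewrite /rho; lra.
have qq : q ^+ l.+1 <= e / 16 * q ^+ l by rewrite exprS ler_wpM2r // exprn_ge0 // ltW.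
have zin i : d c (z i) + rho l.+1 <= rho l.
  have h := z1 i; have h2 : 2 * r * q ^+ l.+1 <= rho l / 2.
    by have := ler_wpM2l r20 qq; rewrite /rho; lra.
  have h3 : rho l.+1 <= rho l / 2.
    have h4 : q <= 1 / 2 by have := qe; have := e1; lra.
    by have := ler_wpM2r (ltW (rho0 l)) h4; rewrite rhoS; lra.
  lra.
apply: contrapT => nex.
have /choice [mi miP] : forall i, exists m, sg * rho l.+1 `^ s < \sum_(k < m | hits k (z i) l.+1) w k.
  move=> i; apply: contrapT => h; apply: nex; exists (z i); split; first exact: zin.
  split; first by have := metric_triangle x0 c (z i); have := zin i; lra.
  by move=> m; rewrite leNgt; apply/negP => hm; apply: h; exists m.
pose m := \max_i mi i.
have mP i : sg * rho l.+1 `^ s < \sum_(k < m | hits k (z i) l.+1) w k.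
  apply: lt_le_trans (miP i) _.
  rewrite -!(big_mkord (fun k => hits k (z i) l.+1) w).
  have h : (mi i <= m)%N by exact: leq_bigmax.
  rewrite [leRHS](big_cat_nat (n := mi i)) //= lerDl.
  by apply: sumr_ge0 => k _; exact: ltW.
have lift_hit k i : hits k (z i) l.+1 -> hits k c l.
  move=> /asboolP [x [Ux dx]]; apply/asboolP; exists x; split=> //.
  by apply: le_trans (metric_triangle _ (z i) _) _; have := zin i; lra.
have once k i i' : hits k (z i) l.+1 -> hits k (z i') l.+1 -> i = i'.
  move=> h h'; apply/eqP; apply/negPn/negP => ii.
  have hk := lift_hit _ _ h.
  have := Is k.+1; rewrite big_mkcond big_ord_recr /= hk => h1.
  have h2 : w k <= sg * rho l `^ s.
    apply: le_trans h1; rewrite lerDr; apply: sumr_ge0 => k' _.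
    by case: ifP => // _; exact: ltW.
  move: h h' => /asboolP [x [Ux dx]] /asboolP [x' [Ux' dx']].
  have h3 := le_trans (Uw Ux Ux') h2; rewrite -rhoSs in h3.
  have h4 : rho l.+1 < d x x'.
    have t1 := metric_triangle (z i) x (z i'); have t2 := metric_triangle x x' (z i').
    rewrite (metric_sym x') in t2; have := zsep _ _ ii; have := rho0 l.+1; lra.
  have := gt0_ltr_powR s0 _ _ h4; rewrite !nnegrE mdist_ge0 (ltW (rho0 _)).
  by move=> /(_ isT isT); lra.
have tot : \sum_(i < N) \sum_(k < m | hits k (z i) l.+1) w k <= sg * rho l `^ s.
  apply: le_trans (Is m).
  rewrite (exchange_big_dep (fun k : 'I_m => hits k c l)) /=; last by move=> i k _; exact: lift_hit.
  apply: ler_sum => k hk.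
  have [/existsP [i hi]|] := boolP [exists i, hits k (z i) l.+1].
    rewrite (bigD1 i) //= big1 ?addr0 // => i' /andP[h1 h2].
    by have := once _ _ _ h1 hi => E; rewrite E eqxx in h2.
  rewrite negb_exists => /forallP h0; rewrite big1; first exact: ltW.
  by move=> i hi; have := h0 i; rewrite hi.
have N0 : (0 < N)%N.
  by case: (N) Ns => //; rewrite mul0r ler10.
have : N%:R * (sg * rho l.+1 `^ s) < \sum_(i < N) \sum_(k < m | hits k (z i) l.+1) w k.
  rewrite mulr_natl -[N in X in X < _]card_ord -sumr_const.
  apply: ltr_sum => [|i _]; last exact: mP.
  by apply/hasP; exists (Ordinal N0); rewrite ?mem_index_enum.
rewrite rhoSs => h; have := lt_le_trans h tot.
have P0 : 0 < sg * rho l `^ s by rewrite mulr_gt0 // powR_gt0.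
by have := ler_wpM2r (ltW P0) Ns; lra.
Qed.

(** The nested balls shrink to a point, by completeness. A member of the cover containing this point
    meets all of them, so its weight is below a sequence tending to 0, although it is positive. *)
Lemma nested_balls_absurd : False.
Proof.
have /choice [f fP] : forall lc : nat * X, exists c', Inv lc.1 lc.2 -> d lc.2 c' + rho lc.1.+1 <= rho lc.1 /\ Inv lc.1.+1 c'.
  move=> [l c]; have [I|nI] := pselect (Inv l c); last by exists c.
  by have [c' h] := InvS I; exists c'.
pose c := fix c l := if l is l'.+1 then f (l', c l') else x0.
have Ic l : Inv l (c l).
  elim: l => [|l IH]; first exact: Inv0.
  by have [_ h] := fP (l, c l) IH.
have cS l : d (c l) (c l.+1) + rho l.+1 <= rho l by have [h _] := fP (l, c l) (Ic l).
have cm l m : (l <= m)%N -> d (c l) (c m) + rho m <= rho l.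
  elim: m => [|m IH]; first by rewrite leqn0 => /eqP ->; rewrite mdistxx add0r.
  rewrite leq_eqVlt => /predU1P[<-|]; first by rewrite mdistxx add0r.
  rewrite ltnS => /IH h; have := metric_triangle (c l) (c m) (c m.+1).
  by have := cS m; lra.
have geo (a b : R) : 0 < a < 1 -> 0 < b -> forall eps, 0 < eps -> exists l, b * a ^+ l < eps.
  move=> /andP[a0 a1] b0 eps eps0.
  have : (a ^+ l) @[l --> \oo] --> 0 by apply: cvg_expr; rewrite gtr0_norm.
  move=> /cvgrPdist_lt /(_ (eps / b) (divr_gt0 eps0 b0)) [l _ /(_ l (leqnn l))] /=.
  rewrite sub0r normrN gtr0_norm ?exprn_gt0 // ltr_pdivlMr // mulrC => h.
  by exists l.
have q1 : 0 < q < 1 by rewrite q0 /=; have := qe; have := e1; lra.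
have [z cz] : exists z, ucv c z.
  apply: (complete_ulim cX) => eps eps0.
  have [l hl] := geo _ _ q1 er0 _ eps0; exists (c l).
  apply: filterS (ulf_ge l) => m /= /cm h; apply: le_lt_trans hl.
  by rewrite -/(rho l); have := rho0 m; lra.
have dz l : d (c l) z <= rho l.
  apply: (Ule (ucv_d (ucv_cst (c l)) cz) (Ucst _)).
  by apply: filterS (ulf_ge l) => m /= /cm; have := rho0 m; lra.
have [i Uz] := cover z.
have wi l : w i <= sg * rho l `^ s.
  have [_ h] := Ic l; apply: le_trans (h i.+1).
  rewrite big_mkcond big_ord_recr /=.
  have -> : hits i (c l) l by apply/asboolP; exists z.
  rewrite lerDr; apply: sumr_ge0 => k _; case: ifP => // _; exact: ltW.
have pw l : rho l `^ s = sg ^+ l * rho 0 `^ s.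
  by elim: l => [|l IH]; rewrite ?expr0 ?mul1r // rhoSs IH exprS mulrA.
have sg1 : 0 < sg < 1.
  have p1 : (1 : R) `^ s = 1 by rewrite powR1.
  rewrite sg0 /= sgE -[ltRHS]p1; have /andP[_ ?] := q1.
  by apply: (gt0_ltr_powR s0); rewrite ?nnegrE ?ler01 ?(ltW q0).
have P0 : 0 < sg * rho 0 `^ s by rewrite mulr_gt0 // powR_gt0.
have [l hl] := geo _ _ sg1 P0 _ (w0 i).
have := wi l; rewrite pw.
have -> : sg * (sg ^+ l * rho 0 `^ s) = sg * rho 0 `^ s * sg ^+ l by ring.
by rewrite leNgt hl.
Qed.
End nested.

(** Too many separated points, copied at ever smaller scales by halving, would generate a set of
    dimension at least s. The bound on N is the inverse of q^s, where the ratio q is a power of 1/2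
    below e / 16. *)
Lemma packing_bound (e : R) : 0 < e -> exists K : nat, forall x0 (r : R), 0 < r ->
  halving x0 (4 * r) -> forall N (y : 'I_N -> X),
  (forall i, d x0 (y i) < r) -> separated (e * r) y -> (N <= K)%N.
Proof.
move=> ep; pose e' := Num.min e 1.
have e'0 : 0 < e' by rewrite lt_min ep ltr01.
have e'1 : e' <= 1 by rewrite ge_min lexx orbT.
have e'e : e' <= e by rewrite ge_min lexx.
pose j := (Num.truncn (16 / e')).+1; pose q : R := (2 ^+ j)^-1.
have j0 : 16 / e' < j%:R by exact: truncnS_gt.
have q0 : 0 < q by rewrite invr_gt0 exprn_gt0.
have qe : q <= e' / 16.
  rewrite -[leRHS]invrK invf_div lef_pV2 ?posrE ?exprn_gt0 ?divr_gt0 //.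
  apply: le_trans (ltW j0) _; rewrite -natrX ler_nat; exact: ltnW (ltn_expl _ _).
pose sg := q `^ s; have sg0 : 0 < sg by rewrite powR_gt0.
exists (Num.truncn sg^-1) => x0 r r0 qX N y yr ys.
rewrite leqNgt; apply/negP => KN.
have Ns : 1 <= N%:R * sg.
  rewrite -ler_pdivrMr // div1r; apply: le_trans (ltW (truncnS_gt _)) _.
  by rewrite ler_nat.
have ys' : separated (e' * r) y.
  by move=> i i' ii; apply: le_lt_trans (ys _ _ ii); rewrite ler_wpM2r // ltW.
have [] := nc (_ : 0 < sg * (e' * r / 4 * q ^+ 0) `^ s).
  by rewrite mulr_gt0 // powR_gt0 // !mulr_gt0 // ?invr_gt0.
move=> U [w [c1 w0 ws Uw]].
exact: (nested_balls_absurd r0 e'0 e'1 erefl qe erefl Ns qX yr ys' c1 w0 ws Uw).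
Qed.
End packing.

(** * The Hopf-Rinow theorem *)

Section hopf_rinow.
Context {R : realType} {X : metricType R}.
Hypotheses (cX : complete_metric X) (iX : intrinsic_metric X).
Hypothesis locX : forall x : X, exists2 r : R, 0 < r &
  forall u : nat -> X, (forall n, d x (u n) < r) -> exists y, ucv u y.

Lemma ucv_eventually (P : set X) (u : nat -> X) : P !=set0 ->
  (forall v, (forall n, P (v n)) -> exists y, ucv v y) -> ulf [set n | P (u n)] ->
  exists y, ucv u y.
Proof.
move=> [x0 Px0] h uP; pose v n := if `[< P (u n) >] then u n else x0.
have [|y vy] := h v.
  by move=> n; rewrite /v; case: asboolP.
exists y; apply: (ucv_le vy (Ucst 0)); apply: filterS uP => n /= Pu.
by rewrite /v; case: asboolP => // _; rewrite mdistxx.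
Qed.

Lemma almost_near (a b : X) (r dl : R) : 0 < dl -> 0 <= r -> d a b <= r + dl ->
  exists v, d a v <= r /\ d v b <= 3 * dl.
Proof.
move=> dl0 r0 ab; have [h|h] := leP (d a b) (2 * dl).
  by exists a; rewrite mdistxx; split=> //; lra.
have [p [_ p1 p2]] := almost_path iX a b dl0.
have ht : 0 <= d a b - 2 * dl <= d a b by lra.
by exists (p (d a b - 2 * dl)); have := p1 _ ht; have := p2 _ ht => *; split; lra.
Qed.

(** The supremum rs of the radii of balls about x0 with the limit property is itself such a radius,
    since points of that ball are approximated by points slightly further inside. If no larger
    radius worked, bad sequences in slightly larger balls could be moved into the ball of radius rs;
    their limits would accumulate at a point z, and a neighbourhood of z with the limit property
    would contain almost all of one bad sequence. *)
Lemma hopf_rinow : proper_metric X.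
Proof.
move=> u0 x0 r0 ur0; apply: contrapT => nex.
pose good (r : R) := forall u : nat -> X, (forall n, d x0 (u n) <= r) -> exists y, ucv u y.
have goodW r r' : r <= r' -> good r' -> good r.
  by move=> rr h u hu; apply: h => n; exact: le_trans (hu n) rr.
pose S := [set r : R | 0 <= r /\ good r].
have S0 : S 0.
  split=> // u hu; exists x0; rewrite /ucv; apply: Ueq (Ucst 0) => n.
  by apply/eqP; rewrite eq_le mdist_ge0 hu.
have Sub r : S r -> r <= r0.
  by move=> [_ gr]; rewrite leNgt; apply/negP => rr; apply: nex; apply: (goodW _ _ (ltW rr) gr).
have supS : has_sup S by split; [exists 0|exists r0].
set rs := sup S.
have rs0 : 0 <= rs by exact: sup_upper_bound.
have gless r : 0 <= r -> r < rs -> good r.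
  move=> r_ge rr; have [|r' [_ gr'] h] := @sup_adherent _ S (rs - r) _ supS; first lra.
  by apply: goodW gr'; rewrite -/rs in h; lra.
have grs : good rs.
  move=> u hu; apply: (complete_ulim cX) => e e0.
  have [re|re] := leP rs (e / 2).
    by exists x0; apply: filterE => n /=; have := hu n; lra.
  have e4 : 0 < e / 5 by lra.
  have r4 : 0 <= rs - e / 5 by lra.
  have /choice [v vP] : forall n, exists v, d x0 v <= rs - e / 5 /\ d v (u n) <= 3 * (e / 5).
    by move=> n; apply: almost_near => //; have := hu n; lra.
  have r5 : rs - e / 5 < rs by lra.
  have [|y vy] := gless (rs - e / 5) r4 r5 v; first by move=> n; have [] := vP n.
  exists y; have /ucvP/(_ _ e4) := vy; apply: filterS => n /= h.
  by have [_ h2] := vP n; have := metric_triangle y (v n) (u n); lra.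
suff [r rr gr] : exists2 r, rs < r & good r.
  have : r <= rs by apply: sup_upper_bound => //; split=> //; lra.
  lra.
apply: contrapT => nr; pose dl k : R := k.+1%:R^-1.
have dl0 k : 0 < dl k by rewrite invr_gt0.
have /choice [u uP] : forall k, exists u : nat -> X, (forall n, d x0 (u n) <= rs + dl k) /\ ~ exists y, ucv u y.
  move=> k; apply: contrapT => h; apply: nr; exists (rs + dl k); first by rewrite ltrDl.
  by move=> u hu; apply: contrapT => h2; apply: h; exists u.
have /choice [v vP] : forall kn : nat * nat, exists v, d x0 v <= rs /\ d v (u kn.1 kn.2) <= 3 * dl kn.1.
  by move=> [k n] /=; apply: almost_near => //; have [h _] := uP k; exact: h.
have /choice [w wP] : forall k, exists w, ucv (fun n => v (k, n)) w.
  by move=> k; apply: grs => n; have [h _] := vP (k, n).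
have [z wz] : exists z, ucv w z.
  apply: grs => k; apply: (Ule (ucv_d (ucv_cst x0) (wP k)) (Ucst rs)).
  by apply: filterE => n /=; have [h _] := vP (k, n).
have [r rp hr] := locX z.
have r3 : 0 < r / 3 by lra.
have /ucvP/(_ _ r3) h1 := wz.
have h2 : ulf [set k | 3 * dl k < r / 3].
  have := UM (Ucst 3) (@Uinv R); rewrite mulr0 => /UP/(_ _ r3); apply: filterS => k /=.
  by rewrite sub0r normrN ger0_norm // mulr_ge0 // ltW // dl0.
have [k [/= k1 k2]] := filter_ex (filterI h1 h2).
have [_] := uP k; apply.
apply: (@ucv_eventually [set y | d z y < r]) => //; first by exists z; rewrite /= mdistxx.
have /ucvP/(_ _ r3) := wP k; apply: filterS => n /= h.
have [_ h3] := vP (k, n); rewrite /= in h3.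
have := metric_triangle z (w k) (u k n); have := metric_triangle (w k) (v (k, n)) (u k n).
lra.
Qed.
End hopf_rinow.

Definition uniform_packing {R : realType} (X : metricType R) :=
  forall e : R, 0 < e -> exists K : nat, forall (x0 : X) (r : R), 0 < r ->
  forall N (y : 'I_N -> X), (forall i, d x0 (y i) < r) -> separated (e * r) y -> (N <= K)%N.

(** * Alexandrov spaces are proper and geodesic *)

Section alexandrov.
Context {R : realType} {n : nat} {X : metricType R}.
Hypothesis AX : alexandrov_nonneg n X.

Lemma local_quad (x : X) : exists2 r : R, 0 < r & quad [set y | d x y < r].
Proof.
have [_ _ nX _] := AX; have [r r0 h] := nX x; exists r => // a b c e Oa Ob Oc Oe.
by apply: h; rewrite ballEmdist.
Qed.

Lemma alexandrov_proper : proper_metric X.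
Proof.
have [cX iX nX dX] := AX; have [s s0 nc] := null_cover_dim dX.
apply: hopf_rinow => // x; have [r r0 q] := local_quad x.
have r4 : 0 < r / 4 by lra.
exists (r / 4) => // u hu; apply: (@packing_ulim _ _ cX [set y | d x y < r / 4]) => // sg sg0.
have [K hK] := packing_bound cX s0 nc (divr_gt0 sg0 r4).
exists K => N z zr zs; apply: (hK x (r / 4) r4 _ N z zr).
  have -> : 4 * (r / 4) = r by field.
  exact: quad_halving.
by rewrite divfK // gt_eqF.
Qed.

Lemma alexandrov_segment (a b : X) : exists g, segment a b g.
Proof. by have [_ iX _ _] := AX; apply: proper_segment => //; exact: alexandrov_proper. Qed.

Lemma stewart_halving : stewart X -> forall (x0 : X) (rho : R), halving x0 rho.
Proof.
move=> St x0 rho c r s N y cr s0 yr ys.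
have /choice [m mP] : forall i, exists m, [/\ d c m = d c (y i) / 2, d m (y i) = d c (y i) - d c (y i) / 2 & btw c m (y i)].
  move=> i; apply: (seg_point alexandrov_segment).
  by have := mdist_ge0 c (y i); lra.
exists m; split=> [i|i j ij]; first by have [-> _ _] := mP i; have := yr i; lra.
have [i1 i2 ib] := mP i; have [j1 j2 jb] := mP j.
have := St _ _ _ (m i) jb; have := St _ _ _ (y j) ib; rewrite i1 i2 j1 j2 (metric_sym (y j) (m i)) (metric_sym (m j)).
have yij := ys _ _ ij.
have [ci|ci] := eqVneq (d c (y i)) 0.
  have cE := mdist_positivity _ _ ci.
  have mE : c = m i by apply: mdist_positivity; rewrite i1 ci mul0r.
  by rewrite -mE => _ _; rewrite -cE in yij; rewrite j1; lra.
have [cj|cj] := eqVneq (d c (y j)) 0.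
  have cE := mdist_positivity _ _ cj.
  have mE : c = m j by apply: mdist_positivity; rewrite j1 cj mul0r.
  by rewrite -mE => _ _; rewrite -cE metric_sym in yij; rewrite metric_sym i1; lra.
have ci0 : 0 < d c (y i) by rewrite lt_neqAle eq_sym ci mdist_ge0.
have cj0 : 0 < d c (y j) by rewrite lt_neqAle eq_sym cj mdist_ge0.
set a := d c (y i) in ci0 *; set b := d c (y j) in cj0 *.
set u := d (m i) (y j); set v := d (m i) (m j); set w := d (y i) (y j) in yij *.
move=> h1 h2.
have h3 : w ^+ 2 / 2 + b ^+ 2 / 2 - a ^+ 2 / 4 <= u ^+ 2 by rewrite -(ler_pM2l ci0); lra.
have h4 : a ^+ 2 / 8 + u ^+ 2 / 2 - b ^+ 2 / 4 <= v ^+ 2 by rewrite -(ler_pM2l cj0); lra.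
have h5 : s ^+ 2 < w ^+ 2 by rewrite ltr_sqr ?nnegrE ?mdist_ge0 // ltW.
have v0 : 0 <= v := mdist_ge0 _ _.
by rewrite -ltr_sqr ?nnegrE ?divr_ge0 ?(ltW s0) //; lra.
Qed.

(** With the global Stewart inequality the halving property holds in balls of every radius, so the
    packing number depends only on the ratio of separation to radius. This scale invariance is what
    passes to asymptotic and tangent cones. *)
Lemma alexandrov_packing : stewart X -> uniform_packing X.
Proof.
move=> St e e0; have [cX iX nX dX] := AX; have [s s0 nc] := null_cover_dim dX.
have [K hK] := packing_bound cX s0 nc e0.
by exists K => x0 r r0 N y yr ys; apply: (hK x0 r r0 _ N y yr ys); exact: stewart_halving.
Qed.

(* A uniform radius for the local condition on bounded sets. *)
Lemma uniform_quad (x0 : X) (r : R) : exists2 e : R, 0 < e &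
  forall x, d x0 x <= r -> quad [set y | d x y < e].
Proof.
apply: contrapT => nex.
have /choice [x xP] : forall k : nat, exists x, d x0 x <= r /\ ~ quad [set y | d x y < k.+1%:R^-1].
  move=> k; apply: contrapT => h; apply: nex; exists (k.+1%:R^-1); first by rewrite invr_gt0.
  by move=> x xr; apply: contrapT => h2; apply: h; exists x.
have [z xz] := alexandrov_proper (fun k => let: conj h _ := xP k in h).
have [e e0 q] := local_quad z.
have e2 : 0 < e / 2 by lra.
have /ucvP/(_ _ e2) h1 := xz; have /UP/(_ _ e2) h2 := @Uinv R.
have [k [/= k1 k2]] := filter_ex (filterI h1 h2).
have [_] := xP k; apply=> a b c f Oa Ob Oc Of.
rewrite sub0r normrN gtr0_norm ?invr_gt0 // in k2.
have sub y : d (x k) y < k.+1%:R^-1 -> d z y < e.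
  by move=> h; have := metric_triangle z (x k) y; have := lt_trans h k2; lra.
by apply: q; apply: sub.
Qed.
End alexandrov.

(** * Comparison angles along two geodesics *)

Section hinges.
Context {R : realType} {X : metricType R}.
Implicit Types (p x y : X).

Definition kap p (g h : geodesic p) (s t : R) := cca p (gpath g s) (gpath h t).

Lemma gpath_neq p (g : geodesic p) s : 0 < s <= glen g -> p <> gpath g s.
Proof.
move=> h E; have := geodesic_dist h; rewrite -E mdistxx => E'.
by move: h; rewrite -E' ltxx.
Qed.

Lemma kap_bound p (g h : geodesic p) s t : 0 < s <= glen g -> 0 < t <= glen h ->
  -1 <= kap g h s t <= 1.
Proof. by move=> hs ht; apply: cca_bound; apply: gpath_neq. Qed.

Lemma kapE p (g h : geodesic p) s t : 0 < s <= glen g -> 0 < t <= glen h ->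
  kap g h s t = (s ^+ 2 + t ^+ 2 - d (gpath g s) (gpath h t) ^+ 2) / (2 * s * t).
Proof. by move=> hs ht; rewrite /kap /cca !geodesic_dist. Qed.

Lemma kap_dist p (g h : geodesic p) s t : 0 < s <= glen g -> 0 < t <= glen h ->
  d (gpath g s) (gpath h t) ^+ 2 = s ^+ 2 + t ^+ 2 - 2 * s * t * kap g h s t.
Proof.
move=> hs ht; rewrite kapE //; field.
by case/andP: hs => /gt_eqF -> _; case/andP: ht => /gt_eqF -> _.
Qed.

(** Monotonicity of comparison angles, written in cosines, which are rational in the distances: the
    comparison angle does not grow when the sides do. *)
Definition mono_hinge p (g h : geodesic p) (s0 t0 : R) :=
  [/\ 0 < s0 <= glen g, 0 < t0 <= glen h &
   forall s s' t t', 0 < s <= s' -> s' <= s0 -> 0 < t <= t' -> t' <= t0 ->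
     kap g h s t <= kap g h s' t'].

Lemma cos_angle_in p (g h : geodesic p) : acos (cos (angle g h)) = angle g h.
Proof. by rewrite cosK // in_itv /= angle_bound. Qed.

(** By monotonicity the infimum of the comparison cosines is their limit at the vertex, so its
    arccosine is the limsup that defines [angle]. The first conclusion is then the hinge
    comparison. *)
Lemma angle_mono p (g h : geodesic p) s0 t0 : mono_hinge g h s0 t0 ->
  (forall s t, 0 < s <= s0 -> 0 < t <= t0 -> cos (angle g h) <= kap g h s t) /\
  (forall e : R, 0 < e -> exists s t, [/\ 0 < s <= s0, 0 < t <= t0 & kap g h s t < cos (angle g h) + e]).
Proof.
move=> [hs0 ht0 mono]; have /andP[s0p s0g] := hs0; have /andP[t0p t0h] := ht0.
pose S := [set k | exists s t, [/\ 0 < s <= s0, 0 < t <= t0 & k = kap g h s t]].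
have kb s t : 0 < s <= s0 -> 0 < t <= t0 -> -1 <= kap g h s t <= 1.
  move=> /andP[s1 s2] /andP[t1 t2]; apply: kap_bound.
    by rewrite s1 (le_trans s2).
  by rewrite t1 (le_trans t2).
have Sinf : has_inf S.
  split.
    exists (kap g h s0 t0), s0, t0; split=> //; [by rewrite s0p lexx|by rewrite t0p lexx].
  by exists (-1) => _ [s [t [hs ht ->]]]; have /andP[] := kb s t hs ht.
pose A := inf S.
have AS s t : 0 < s <= s0 -> 0 < t <= t0 -> A <= kap g h s t.
  by move=> hs ht; apply: ge_inf; [case: Sinf|exists s, t].
have Aadh (e : R) : 0 < e -> exists s t, [/\ 0 < s <= s0, 0 < t <= t0 & kap g h s t < A + e].
  by move=> e0; have [_ [s [t [hs ht ->]]] h1] := inf_adherent e0 Sinf; exists s, t.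
have A1 : A <= 1.
  have := AS s0 t0; rewrite s0p t0p !lexx => /(_ isT isT) /le_trans; apply.
  by have := kb s0 t0; rewrite s0p t0p !lexx => /(_ isT isT) /andP[].
have AN1 : -1 <= A.
  apply: lb_le_inf; first by case: Sinf.
  by move=> _ [s [t [hs ht ->]]]; have /andP[] := kb s t hs ht.
have acosle (x y : R) : -1 <= x <= 1 -> -1 <= y <= 1 -> x <= y -> acos y <= acos x.
  move=> hx hy xy; rewrite leNgt -ltr_cos ?in_itv /= ?acos_ge0 ?acos_lepi //.
  by rewrite !acosK ?in_itv //= -leNgt.
suff E : angle g h = acos A.
  by rewrite E acosK ?in_itv /= ?AN1 //; split.
rewrite /angle; set f := fun st : R * R => _; set F := filter_prod _ _.
have near0 (q : R) : 0 < q -> (0 : R)^'+ [set s | 0 < s <= q].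
  move=> q0; near=> u; rewrite /=; apply/andP; split => //.
  by near: u; apply: nbhs_right_le.
have FO a b : 0 < a -> 0 < b -> F [set st : R * R | 0 < st.1 <= a /\ 0 < st.2 <= b].
  move=> a0 b0; exists ([set s | 0 < s <= a], [set t | 0 < t <= b]) => //=.
  by split; exact: near0.
have fE s t : f (s, t) = (acos (kap g h s t))%:E by [].
have L1 : (limf_esup f F <= (acos A)%:E)%E.
  apply: ereal_inf_le; eexists; first by eexists; [exact: (FO s0 t0)|reflexivity].
  apply: ge_ereal_sup => _ [[s t] /= [hs ht] <-].
  by rewrite fE lee_fin; apply: acosle; [rewrite AN1|exact: kb|exact: AS].
have L2 (th : R) : 0 <= th -> th < acos A -> (th%:E <= limf_esup f F)%E.
  move=> th0 thA; have thp : 0 <= th <= pi.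
    by rewrite th0 /= (le_trans (ltW thA)) // acos_lepi // AN1.
  have cth : A < cos th.
    rewrite -[A](@acosK R) ?in_itv /= ?AN1 // ltr_cos ?in_itv //= acos_ge0 ?acos_lepi ?AN1 //.
  have [s1 [t1 [hs1 ht1 h1]]] := Aadh (cos th - A) (ltac:(by rewrite subr_gt0)).
  rewrite addrC subrK in h1.
  apply: le_ereal_inf_tmp => _ [B FB <-].
  have /andP[s1p s1s] := hs1; have /andP[t1p t1t] := ht1.
  have FF : Filter F by exact: filter_prod_filter.
  have [[s t] [/= [hs ht] Bst]] := filter_ex (filterI (FO _ _ s1p t1p) FB).
  apply: (@le_trans _ _ (f (s, t))); last by apply: ereal_sup_ubound; exists (s, t).
  have /andP[sp ss] := hs; have /andP[tp tt] := ht.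
  rewrite fE lee_fin -[th]cosK ?in_itv //.
  apply: acosle; first by apply: kb; rewrite ?sp ?tp /=; [exact: le_trans ss s1s|exact: le_trans tt t1t].
    by rewrite cos_geN1 cos_le1.
  by apply: le_trans (ltW h1); exact: mono.
have pA : 0 <= acos A by rewrite acos_ge0 // AN1.
apply/eqP; rewrite eq_le; move: L1 L2 (angle_bound g h); rewrite /angle -/f -/F.
case: limf_esup => [l| |] //=.
- rewrite lee_fin => -> /= L2 /andP[l0 _]; rewrite leNgt; apply/negP => lh.
  have h2 : l < (l + acos A) / 2 < acos A by lra.
  have := L2 ((l + acos A) / 2) (ltac:(lra)) (ltac:(lra)); rewrite lee_fin; lra.
- move=> _ L2 _; have [a0|a0] := ltP 0 (acos A); first by have := L2 0 (lexx _) a0.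
  by move=> *; apply/andP; split; lra.
Unshelve. all: by end_near. Qed.

(* Two geodesics which are opposite near their common origin. *)
Definition opposite p (g h : geodesic p) := exists2 t0 : R, 0 < t0 &
  forall t, 0 < t <= t0 -> [/\ t <= glen g, t <= glen h & d (gpath g t) (gpath h t) = 2 * t].

Lemma opposite_sym p (g h : geodesic p) : opposite g h -> opposite h g.
Proof.
by move=> [t0 tp H]; exists t0 => // t /H [h1 h2 h3]; split=> //; rewrite metric_sym.
Qed.

Definition local_stewart p := exists2 r : R, 0 < r & stewart_on [set y | d p y < r].

(** Stewart's inequality for a point of g between p and a later point of g, tested at a point of h,
    is monotonicity in one side after division. The other side follows by exchanging the
    geodesics. *)
Lemma stewart_mono (O : set X) p (g h : geodesic p) s0 t0 : stewart_on O -> O p ->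
  0 < s0 <= glen g -> 0 < t0 <= glen h ->
  (forall s, 0 < s <= s0 -> O (gpath g s)) -> (forall t, 0 < t <= t0 -> O (gpath h t)) ->
  mono_hinge g h s0 t0.
Proof.
move=> St Op hs0 ht0 Og Oh; split=> //.
have /andP[s0p s0g] := hs0; have /andP[t0p t0h] := ht0.
have half q (g1 h1 : geodesic q) s s' t : stewart_on O -> O q -> 0 < s <= s' -> s' <= glen g1 ->
   0 < t <= glen h1 -> O (gpath g1 s) -> O (gpath g1 s') -> O (gpath h1 t) ->
   kap g1 h1 s t <= kap g1 h1 s' t.
  move=> _ Oq /andP[sp ss] sg ht O1 O2 O3; have /andP[tp tl] := ht.
  have s'p := lt_le_trans sp ss.
  have hs : 0 < s <= glen g1 by rewrite sp (le_trans ss).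
  have hs' : 0 < s' <= glen g1 by rewrite s'p.
  have d1 := geodesic_dist hs; have d2 := geodesic_dist hs'; have d3 := geodesic_dist ht.
  have d4 : d (gpath g1 s) (gpath g1 s') = s' - s.
    rewrite gpath_isometry ?(ltW sp) ?(ltW s'p) /= ?sg ?(le_trans ss sg) //.
    by rewrite distrC ger0_norm ?subr_ge0.
  have bt : btw q (gpath g1 s) (gpath g1 s') by rewrite /btw d1 d2 d4; lra.
  have := St _ _ _ _ Oq O1 O2 O3 bt; rewrite d1 d2 d3 d4 => h2.
  rewrite !kapE // ler_pdivrMr ?mulr_gt0 // mulrAC ler_pdivlMr ?mulr_gt0 //.
  have t20 : 0 <= 2 * t by rewrite mulr_ge0 // ltW.
  have := ler_wpM2l t20 h2; lra.
move=> s s' t t' /andP[sp ss] s's0 /andP[tp tt] t't0.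
have s'p := lt_le_trans sp ss; have t'p := lt_le_trans tp tt.
apply: (@le_trans _ _ (kap g h s' t)).
  apply: half => //; rewrite ?sp ?ss ?tp ?(le_trans s's0) ?(le_trans tt) ?(le_trans t't0) //.
  - by apply: Og; rewrite sp (le_trans ss).
  - by apply: Og; rewrite s'p.
  - by apply: Oh; rewrite tp (le_trans tt).
rewrite /kap ccaC [leRHS]ccaC; apply: half => //.
- by rewrite tp.
- exact: le_trans t't0 _.
- by rewrite s'p (le_trans s's0).
- by apply: Oh; rewrite tp (le_trans tt).
- by apply: Oh; rewrite t'p.
- by apply: Og; rewrite s'p.
Qed.

Lemma local_mono p (g h : geodesic p) : local_stewart p -> exists2 t0, 0 < t0 & mono_hinge g h t0 t0.
Proof.
move=> [r r0 St]; pose t0 := Num.min (r / 2) (Num.min (glen g) (glen h)).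
have t0p : 0 < t0 by rewrite !lt_min !glen_gt0 !andbT divr_gt0.
have tr : t0 < r by rewrite gt_min; apply/orP; left; lra.
have tg : t0 <= glen g by rewrite !ge_min lexx orbT.
have th : t0 <= glen h by rewrite !ge_min lexx !orbT.
exists t0 => //; apply: (stewart_mono St) => //.
- by rewrite /= mdistxx.
- by rewrite t0p.
- by rewrite t0p.
- by move=> s /andP[sp st]; rewrite /= geodesic_dist ?sp ?(le_trans st) //; exact: le_lt_trans st tr.
- by move=> s /andP[sp st]; rewrite /= geodesic_dist ?sp ?(le_trans st) //; exact: le_lt_trans st tr.
Qed.

Lemma angle_sym p (g h : geodesic p) : local_stewart p -> cos (angle g h) = cos (angle h g).
Proof.
suff main (g1 h1 : geodesic p) : local_stewart p -> cos (angle g1 h1) <= cos (angle h1 g1).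
  by move=> L; apply/eqP; rewrite eq_le !main.
move=> L; have [t0 t0p m1] := local_mono g1 h1 L; have [t1 t1p m2] := local_mono h1 g1 L.
apply/ler_addgt0Pr => e e0.
have [_ /(_ e e0) [s [t [hs ht h2]]]] := angle_mono m2.
have [/(_ (Num.min t t0) (Num.min s t0)) h1' _] := angle_mono m1.
have /andP[sp s1] := hs; have /andP[tp tt1] := ht.
apply: (@le_trans _ _ (kap g1 h1 (Num.min t t0) (Num.min s t0))).
  by apply: h1'; rewrite lt_min ?sp ?tp t0p ge_min lexx orbT.
apply: le_trans (ltW h2); rewrite /kap ccaC.
have [_ _ mono] := m2; apply: (mono) => //.
- by rewrite lt_min sp t0p ge_min lexx.
- by rewrite lt_min tp t0p ge_min lexx.
Qed.

(* Adjacent angles add up to at most [pi]. *)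
Lemma adjacent_cos p (k g h : geodesic p) : local_stewart p -> opposite g h ->
  0 <= cos (angle k g) + cos (angle k h).
Proof.
move=> L [t1 t1p op]; have [r r0 St] := L.
have [a ap m1] := local_mono k g L; have [b bp m2] := local_mono k h L.
rewrite leNgt; apply/negP => neg.
pose e := - (cos (angle k g) + cos (angle k h)) / 2.
have e0 : 0 < e by rewrite /e; lra.
have [_ /(_ e e0) [s [t [/andP[sp sa] /andP[tp ta] hg]]]] := angle_mono m1.
have [_ /(_ e e0) [s' [t' [/andP[s'p s'b] /andP[t'p t'b] hh]]]] := angle_mono m2.
pose S := Num.min (Num.min s s') (r / 2); pose T := Num.min (Num.min t t') (Num.min t1 (r / 2)).
have Sp : 0 < S by rewrite !lt_min sp s'p; lra.
have Tp : 0 < T by rewrite !lt_min tp t'p t1p; lra.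
have Ss : S <= s by rewrite !ge_min lexx.
have Ss' : S <= s' by rewrite !ge_min lexx orbT.
have Sr : S < r by rewrite !gt_min; apply/orP; right; lra.
have Tt : T <= t by rewrite !ge_min lexx.
have Tt' : T <= t' by rewrite !ge_min lexx orbT.
have Tt1 : T <= t1 by rewrite !ge_min lexx !orbT.
have Tr : T < r by rewrite !gt_min; apply/orP; right; apply/orP; right; lra.
have [/andP[_ ak] _ mo1] := m1; have [/andP[_ bk] _ mo2] := m2.
have k1 : kap k g S T <= kap k g s t by apply: mo1 => //; rewrite ?Sp ?Tp.
have k2 : kap k h S T <= kap k h s' t' by apply: mo2 => //; rewrite ?Sp ?Tp.
have [Tg Th dT] := op T (ltac:(by rewrite Tp)).
have hS : 0 < S <= glen k by rewrite Sp (le_trans Ss) // (le_trans sa).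
have hTg : 0 < T <= glen g by rewrite Tp.
have hTh : 0 < T <= glen h by rewrite Tp.
have bt : btw (gpath g T) p (gpath h T).
  by rewrite /btw dT (metric_sym (gpath g T)) !geodesic_dist //; ring.
have := St (gpath g T) p (gpath h T) (gpath k S); rewrite /= mdistxx !geodesic_dist //.
move=> /(_ Tr r0 Tr Sr bt); rewrite dT (metric_sym _ p) geodesic_dist //.
rewrite (metric_sym (gpath g T)) (metric_sym (gpath h T)) !kap_dist // => h3.
have ST : 0 < S * T * T by rewrite !mulr_gt0.
have : 0 <= (S * T * T) * (kap k g S T + kap k h S T) by lra.
rewrite pmulr_rge0 // => h4.
by move: hg hh; rewrite /e; lra.
Qed.

Lemma cos_self p (g : geodesic p) : angle g g = 0.
Proof.
have m : mono_hinge g g (glen g) (glen g).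
  split; rewrite ?glen_gt0 ?lexx // => s s' t t' /andP[sp ss] s'g /andP[tp tt] t'g.
  have E a b : 0 < a <= glen g -> 0 < b <= glen g -> kap g g a b = 1.
    move=> ha hb; have /andP[ap ag] := ha; have /andP[bp bg] := hb.
    rewrite kapE // gpath_isometry; [|by rewrite (ltW ap)|by rewrite (ltW bp)].
    by rewrite real_normK ?num_real //; field; rewrite !gt_eqF.
  have s'p := lt_le_trans sp ss; have t'p := lt_le_trans tp tt.
  by rewrite !E // ?sp ?tp ?s'p ?t'p ?(le_trans ss) ?(le_trans tt).
have [_ h] := angle_mono m.
rewrite -cos_angle_in; suff -> : cos (angle g g) = 1 by rewrite acos1.
apply/eqP; rewrite eq_le cos_le1 /=; apply/ler_addgt0Pr => e e0.
have [s [t [/andP[sp sg] /andP[tp tg] h1]]] := h e e0.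
apply: le_trans (ltW h1); rewrite kapE ?sp ?tp // gpath_isometry ?(ltW sp) ?(ltW tp) //.
rewrite real_normK ?num_real //.
have -> : (s ^+ 2 + t ^+ 2 - (s - t) ^+ 2) / (2 * s * t) = 1 by field; rewrite !gt_eqF.
by [].
Qed.

Lemma geodesic_of_segment (p q : X) (f : R -> X) : segment p q f -> p <> q ->
  exists g : geodesic p, [/\ glen g = d p q, gend g = q & gpath g = f].
Proof.
move=> [f0 f1 fi] pq; exists (Geodesic (d_gt0 pq) f0 fi); split=> //.
Qed.

Lemma geodesic_forward p (g : geodesic p) (u : R) : 0 <= u < glen g ->
  exists k : geodesic (gpath g u), glen k = glen g - u /\ (forall t, gpath k t = gpath g (u + t)).
Proof.
move=> /andP[u0 ug].
have l0 : 0 < glen g - u by rewrite subr_gt0.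
have p0 : gpath g (u + 0) = gpath g u by rewrite addr0.
have pi s t : 0 <= s <= glen g - u -> 0 <= t <= glen g - u ->
    d (gpath g (u + s)) (gpath g (u + t)) = `|s - t|.
  move=> hs ht; rewrite gpath_isometry; [|lra|lra].
  by congr `|_|; ring.
by exists (@Geodesic _ _ _ _ (fun t => gpath g (u + t)) l0 p0 pi).
Qed.

Lemma geodesic_backward p (g : geodesic p) (u : R) : 0 < u <= glen g ->
  exists k : geodesic (gpath g u), glen k = u /\ (forall t, gpath k t = gpath g (u - t)).
Proof.
move=> /andP[u0 ug].
have p0 : gpath g (u - 0) = gpath g u by rewrite subr0.
have pi s t : 0 <= s <= u -> 0 <= t <= u ->
    d (gpath g (u - s)) (gpath g (u - t)) = `|s - t|.
  move=> hs ht; rewrite gpath_isometry; [|lra|lra].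
  by rewrite distrC; congr `|_|; ring.
by exists (@Geodesic _ _ _ _ (fun t => gpath g (u - t)) u0 p0 pi).
Qed.

Lemma forward_backward_opposite p (g : geodesic p) u (f b : geodesic (gpath g u)) :
  0 < u < glen g -> glen f = glen g - u -> (forall t, gpath f t = gpath g (u + t)) ->
  glen b = u -> (forall t, gpath b t = gpath g (u - t)) -> opposite f b.
Proof.
move=> /andP[u0 ug] lf pf lb pb; exists (Num.min u (glen g - u)).
  by rewrite lt_min u0 subr_gt0.
move=> t /andP[t0]; rewrite le_min => /andP[tu tg].
rewrite lf lb pf pb; split=> //; rewrite gpath_isometry; [|lra|lra].
by rewrite ger0_norm; lra.
Qed.
End hinges.

Lemma opposite_of_btw {R : realType} {X : metricType R} (a m b : X) (ga gb : geodesic m) :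
  btw a m b -> a <> m -> m <> b -> glen ga = d m a -> gend ga = a -> glen gb = d m b -> gend gb = b ->
  opposite ga gb.
Proof.
move=> bt am mb la ea lb eb; have bt' := bt; rewrite /btw in bt'.
have am0 := d_gt0 am; have mb0 := d_gt0 mb; rewrite (metric_sym a) in am0.
exists (Num.min (d m a) (d m b)); first by rewrite lt_min am0.
move=> t /andP[t0]; rewrite le_min => /andP[ta tb].
rewrite la lb ta tb; split=> //.
have da : d (gpath ga t) a = d m a - t.
  have -> : d (gpath ga t) a = `|t - glen ga|.
    by rewrite -ea /gend gpath_isometry ?(ltW t0) ?la ?ta ?lexx ?mdist_ge0.
  by rewrite distrC la ger0_norm ?subr_ge0.
have db : d (gpath gb t) b = d m b - t.
  have -> : d (gpath gb t) b = `|t - glen gb|.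
    by rewrite -eb /gend gpath_isometry ?(ltW t0) ?lb ?tb ?lexx ?mdist_ge0.
  by rewrite distrC lb ger0_norm ?subr_ge0.
have t1 := metric_triangle a (gpath ga t) b.
have t2 := metric_triangle (gpath ga t) (gpath gb t) b.
have t3 := metric_triangle (gpath ga t) m (gpath gb t).
rewrite (metric_sym (gpath ga t) m) !geodesic_dist ?t0 ?la ?lb // in t3.
rewrite (metric_sym a (gpath ga t)) da in t1; rewrite db in t2; rewrite (metric_sym a m) in bt'.
by apply/eqP; rewrite eq_le; apply/andP; split; lra.
Qed.

(** * From local to global comparison *)

Section globalization.
Context {R : realType} {X : metricType R}.
Hypothesis segX : forall a b : X, exists g, segment a b g.
Hypothesis locX : forall x : X, local_stewart x.

(* Hinge comparison at vertices in a ball, for hinges with sides of total length less than [l]. *)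
Definition hinge_below (z : X) (rho l : R) := forall x, d z x <= rho ->
  forall (g h : geodesic x) s t, 0 < s <= glen g -> 0 < t <= glen h -> s + t < l ->
  cos (angle g h) <= kap g h s t.

(* Square of the third side of the model hinge. *)
Definition hinge_sq (x : X) (g h : geodesic x) (s t : R) : R := s ^+ 2 + t ^+ 2 - 2 * s * t * cos (angle g h).

(** The vertex of a hinge that violates comparison is moved to a point x' of its longer side. The
    small hinges at x and at x' have total length below 2 l / 3, so they satisfy comparison; as
    adjacent angles add up to at most pi, the model third side does not increase. Meanwhile the
    total length of the two sides drops by an amount controlled by the violation. *)
Lemma hinge_step (z : X) (rho l H0 : R) (p q x : X) (g h : geodesic x) s t :
  0 < l -> hinge_below z (rho + 2 * l) (2 / 3 * l) -> d z p <= rho + l -> H0 < d p q ^+ 2 ->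
  0 < s <= glen g -> 0 < t <= glen h -> gpath g s = p -> gpath h t = q -> s <= t ->
  s + t < l -> hinge_sq g h s t <= H0 ->
  exists (x' : X) (g' h' : geodesic x') (s' t' : R),
   [/\ [/\ 0 < s' <= glen g', 0 < t' <= glen h', gpath g' s' = p & gpath h' t' = q],
       s' + t' <= s + t - (d p q ^+ 2 - H0) / (36 * l) & hinge_sq g' h' s' t' <= H0].
Proof.
move=> l0 HB zp H0D hs ht gp hq st stl hH.
have /andP[s0 sg] := hs; have /andP[t0 tg] := ht.
have dxp : d x p = s by rewrite -gp geodesic_dist.
have dxq : d x q = t by rewrite -hq geodesic_dist.
have zx : d z x <= rho + 2 * l.
  by have := metric_triangle z p x; rewrite (metric_sym p x) dxp; lra.
have [short|long] := ltP (s + t) (2 / 3 * l).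
  have := HB x zx g h s t hs ht short => h1.
  have := kap_dist hs ht; rewrite gp hq => h2.
  have := ler_wpM2l (_ : 0 <= 2 * s * t) h1; rewrite !mulr_ge0 ?(ltW s0) ?(ltW t0) // => /(_ isT).
  by move: hH; rewrite /hinge_sq; lra.
(* As s < l / 2, both s + ta and s + 2 ta stay below 2 l / 3, while ta exceeds l / 18. *)
pose ta := (2 / 3 * l - s) / 3.
have ta0 : l / 18 < ta by rewrite /ta; lra.
have tat : ta < t by rewrite /ta; lra.
have tap : 0 < ta by lra.
have hta : 0 < ta <= glen h by rewrite tap /=; lra.
pose x' := gpath h ta.
have dxx' : d x x' = ta by rewrite geodesic_dist.
have dx'q : d x' q = t - ta.
  by rewrite -hq gpath_isometry; [rewrite distrC ger0_norm; lra|lra|lra].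
have cH : cos (angle g h) <= kap g h s ta by apply: (HB x zx) => //; rewrite /ta; lra.
have [px'|px'] := pselect (x' = p).
  have tas : s = ta by rewrite -dxx' -dxp -px'.
  have dpq : d p q = t - s by rewrite tas -dx'q px'.
  have := cos_le1 (angle g h) => c1.
  have st0 : 0 <= 2 * s * t by rewrite !mulr_ge0 ?(ltW s0) ?(ltW t0).
  have := ler_wpM2l st0 c1; move: hH H0D; rewrite /hinge_sq dpq; lra.
have [f sf] := segX x' p; have [k [lk ek pk]] := geodesic_of_segment sf px'.
have w0 : 0 < d x' p := d_gt0 px'.
have hta' : 0 <= ta < glen h by rewrite (ltW tap) /= (lt_le_trans tat).
have [fw [lfw pfw]] := geodesic_forward hta'.
have [bw [lbw pbw]] := geodesic_backward hta.
set w := d x' p in lk w0.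
have kp : gpath k w = p by rewrite -lk -ek.
have wt : w <= s + ta.
  by have := metric_triangle x' x p; rewrite (metric_sym x' x) dxx' dxp -/w; lra.
have hw : 0 < w <= glen k by rewrite lk w0 lexx.
have zx' : d z x' <= rho + 2 * l.
  have h1 := metric_triangle z p x'; rewrite (metric_sym p) -/w in h1.
  by move: wt; rewrite /ta; lra.
have hb : 0 < ta <= glen bw by rewrite tap lbw lexx.
have cb : cos (angle k bw) <= kap k bw w ta by apply: (HB x' zx') => //; rewrite /ta in wt *; lra.
have bx : gpath bw ta = x by rewrite pbw subrr gpath0.
have op : opposite fw bw.
  by apply: (@forward_backward_opposite _ _ _ h ta) => //; rewrite tap (lt_le_trans tat).
have adj := adjacent_cos k (locX x') op.
have ftq : gpath fw (t - ta) = q by rewrite pfw addrC subrK.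
have hf : 0 < t - ta <= glen fw by rewrite subr_gt0 tat lfw /= lerD2r.
exists x', k, fw, w, (t - ta).
(* both sides equal the square of the third side of the model triangle *)
have dsx := kap_dist hs hta; rewrite gp -/x' (metric_sym p) -/w in dsx.
have dbx := kap_dist hw hb; rewrite kp bx (metric_sym p) dxp in dbx.
have E1 : hinge_sq k fw w (t - ta) <= w ^+ 2 + (t - ta) ^+ 2 + 2 * w * (t - ta) * kap k bw w ta.
  have w2 : 0 <= 2 * w * (t - ta) by rewrite !mulr_ge0 ?(ltW w0) // subr_ge0 ltW.
  have := ler_wpM2l w2 cb; have := mulr_ge0 w2 adj; rewrite /hinge_sq; lra.
have E2 : s ^+ 2 + t ^+ 2 - 2 * s * t * kap g h s ta <= hinge_sq g h s t.
  have s2 : 0 <= 2 * s * t by rewrite !mulr_ge0 ?(ltW s0) ?(ltW t0).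
  by have := ler_wpM2l s2 cH; rewrite /hinge_sq; lra.
have E3 : w ^+ 2 + (t - ta) ^+ 2 + 2 * w * (t - ta) * kap k bw w ta =
          s ^+ 2 + t ^+ 2 - 2 * s * t * kap g h s ta.
  have k1 : 2 * s * kap g h s ta = (s ^+ 2 + ta ^+ 2 - w ^+ 2) / ta.
    by rewrite dsx; field; rewrite gt_eqF.
  have k2 : 2 * w * kap k bw w ta = (w ^+ 2 + ta ^+ 2 - s ^+ 2) / ta.
    by rewrite dbx; field; rewrite gt_eqF.
  have -> : 2 * w * (t - ta) * kap k bw w ta = (t - ta) * (2 * w * kap k bw w ta) by ring.
  have -> : 2 * s * t * kap g h s ta = t * (2 * s * kap g h s ta) by ring.
  by rewrite k1 k2; field; rewrite gt_eqF.
split; [by split|..]; last by lra.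
have D2 : d p q ^+ 2 <= (s + t) ^+ 2.
  rewrite ler_sqr ?nnegrE ?mdist_ge0 //; last lra.
  by have := metric_triangle p x q; rewrite (metric_sym p x) dxp dxq.
have F : (s + t) ^+ 2 - (s ^+ 2 + t ^+ 2 - 2 * s * t * kap g h s ta) = t / ta * ((s + ta) ^+ 2 - w ^+ 2).
  by rewrite dsx; field; rewrite gt_eqF.
have tt : t / ta <= 18 by rewrite ler_pdivrMr //; lra.
have drop : (s + ta) ^+ 2 - w ^+ 2 <= 2 * l * (s + ta - w).
  have : (s + ta - w) * (s + ta + w) <= (s + ta - w) * (2 * l).
    by apply: ler_wpM2l; lra.
  lra.
have dr0 : 0 <= (s + ta) ^+ 2 - w ^+ 2.
  have : 0 <= (s + ta - w) * (s + ta + w) by apply: mulr_ge0; lra.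
  lra.
have h1 := ler_wpM2r dr0 tt.
have h2 : d p q ^+ 2 - H0 <= (s + ta - w) * (36 * l) by lra.
have h3 : (d p q ^+ 2 - H0) / (36 * l) <= s + ta - w by rewrite ler_pdivrMr // mulr_gt0.
lra.
Qed.

(** Starting from a violation, [hinge_step] could be repeated for ever with the same end points,
    each time lowering the total side length by at least the fixed amount e0, while this length
    stays positive. *)
Lemma hinge_enlarge (z : X) (rho l : R) : 0 < l ->
  hinge_below z (rho + 2 * l) (2 / 3 * l) -> hinge_below z rho l.
Proof.
move=> l0 HB x zx g h s t hs ht stl; rewrite leNgt; apply/negP => lt.
have /andP[s0 sg] := hs; have /andP[t0 tg] := ht.
pose p := gpath g s; pose q := gpath h t; pose H0 := hinge_sq g h s t.
have H0D : H0 < d p q ^+ 2.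
  rewrite /H0 /hinge_sq kap_dist //.
  have st0 : 0 < 2 * s * t by rewrite !mulr_gt0.
  by have := ltr_pM2l st0 (kap g h s t) (cos (angle g h)); rewrite lt; lra.
have dxp : d x p = s by rewrite geodesic_dist.
have dxq : d x q = t by rewrite geodesic_dist.
have zp : d z p <= rho + l by have := metric_triangle z x p; lra.
have zq : d z q <= rho + l by have := metric_triangle z x q; lra.
pose e0 := (d p q ^+ 2 - H0) / (36 * l).
have e00 : 0 < e0 by rewrite divr_gt0 ?subr_gt0 ?mulr_gt0.
have main (n : nat) : forall (x : X) (g h : geodesic x) s t, 0 < s <= glen g -> 0 < t <= glen h ->
    gpath g s = p -> gpath h t = q -> s + t < l -> hinge_sq g h s t <= H0 -> s + t < n%:R * e0 -> False.
  elim: n => [|n IH] x1 g1 h1 s1 t1 hs1 ht1 gp hq st1 hH stn.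
    by case/andP: hs1 => + _; case/andP: ht1 => + _; rewrite mul0r in stn; lra.
  have [st|/ltW ts] := leP s1 t1.
    have [x' [g' [h' [s' [t' [[a b c f] sum hH']]]]]] := hinge_step l0 HB zp H0D hs1 ht1 gp hq st st1 hH.
    apply: (IH x' g' h' s' t') => //; first by move: sum; rewrite -/e0; lra.
    by move: sum stn; rewrite -/e0 -natr1; lra.
  have H0D' : H0 < d q p ^+ 2 by rewrite metric_sym.
  have ts1 : t1 + s1 < l by rewrite addrC.
  have hH1 : hinge_sq h1 g1 t1 s1 <= H0 by move: hH; rewrite /hinge_sq (angle_sym g1 h1) //; lra.
  have [x' [g' [h' [s' [t' [[a b c f] sum hH']]]]]] := hinge_step l0 HB zq H0D' ht1 hs1 hq gp ts ts1 hH1.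
  rewrite (metric_sym q) -/e0 in sum.
  apply: (IH x' h' g' t' s') => //; first by lra.
    by move: hH'; rewrite /hinge_sq (angle_sym g' h') //; lra.
  by move: stn; rewrite -natr1; lra.
apply: (main (Num.truncn (l / e0)).+1 x g h s t) => //.
apply: lt_trans stl _; rewrite -ltr_pdivrMr //; exact: truncnS_gt.
Qed.

Lemma hinge_local (z : X) (rho e : R) :
  (forall x, d z x <= rho -> stewart_on [set y | d x y < e]) -> 0 < e -> hinge_below z rho e.
Proof.
move=> St e0 x zx g h s t hs ht ste.
have /andP[s0 sg] := hs; have /andP[t0 tg] := ht.
have m : mono_hinge g h s t.
  apply: (stewart_mono (St x zx)) => //; first by rewrite /= mdistxx.
    by move=> u /andP[u0 us]; rewrite /= geodesic_dist ?u0 ?(le_trans us) //; lra.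
  by move=> u /andP[u0 us]; rewrite /= geodesic_dist ?u0 ?(le_trans us) //; lra.
have [h1 _] := angle_mono m.
by apply: h1; rewrite ?s0 ?t0 lexx.
Qed.

Hypothesis unifX : forall (z : X) (rho : R), exists2 e : R, 0 < e &
  forall x, d z x <= rho -> stewart_on [set y | d x y < e].

Lemma hinge_global (x : X) (g h : geodesic x) s t : 0 < s <= glen g -> 0 < t <= glen h ->
  cos (angle g h) <= kap g h s t.
Proof.
move=> hs ht; have /andP[s0 sg] := hs; have /andP[t0 tg] := ht.
pose l := s + t + 1; have l0 : 0 < l by rewrite /l; lra.
(* Each enlargement from 2 l' / 3 to l' needs the smaller hinges in a ball wider by 2 l'; the radii
   2 l (2/3)^k add up to 6 l. *)
have [e e0 St] := unifX x (6 * l).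
have main (k : nat) : forall rho l', 0 < l' -> (2 / 3) ^+ k * l' <= e -> rho + 6 * l' <= 6 * l ->
    hinge_below x rho l'.
  elim: k => [|k IH] rho l' l'0 kl rl.
    rewrite expr0 mul1r in kl; move=> y xy g1 h1 s1 t1 hs1 ht1 st1.
    have St' y' : d x y' <= rho -> stewart_on [set u | d y' u < e].
      by move=> h1'; apply: St; lra.
    by apply: (hinge_local St' e0 xy) => //; lra.
  apply: hinge_enlarge => //; apply: IH; [by rewrite mulr_gt0 // divr_gt0| |by lra].
  by rewrite mulrA -exprSr.
have [k hk] : exists k, (2 / 3) ^+ k * l <= e.
  have : (((2 / 3) : R) ^+ k) @[k --> \oo] --> 0 by apply: cvg_expr; rewrite gtr0_norm; lra.
  move=> /cvgrPdist_lt /(_ (e / l) (divr_gt0 e0 l0)) [k _ /(_ k (leqnn k))] /=.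
  rewrite sub0r normrN gtr0_norm ?exprn_gt0 ?divr_gt0 // ltr_pdivlMr // => h1.
  by exists k; exact: ltW.
apply: (main k 0 l l0 hk _ x) => //; [by lra|by rewrite mdistxx|by rewrite /l; lra].
Qed.

(** The cosines of the two angles that a third geodesic makes at m with opposite directions have
    nonnegative sum; global hinge comparison carries this over to the comparison cosines. *)
Lemma stewart_global : stewart X.
Proof.
move=> a m b x bt.
have [<-|am] := pselect (a = m); first by rewrite mdistxx; lra.
have [mb|mb] := pselect (m = b); first by rewrite -mb mdistxx; lra.
have am0 := d_gt0 am; have mb0 := d_gt0 mb; have bt' := bt; rewrite /btw in bt'.
have [<-|mx] := pselect (m = x).
  by rewrite mdistxx (metric_sym b m) -bt'; lra.
have ma : m <> a by move/esym.
have [fa sa] := segX m a; have [ga [la ea pa]] := geodesic_of_segment sa ma.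
have [fb sb] := segX m b; have [gb [lb eb pb]] := geodesic_of_segment sb mb.
have [fx sx] := segX m x; have [gx [lx ex px]] := geodesic_of_segment sx mx.
have op := opposite_of_btw bt am mb la ea lb eb.
have adj := adjacent_cos gx (locX m) op.
have hx : 0 < d m x <= glen gx by rewrite lx d_gt0 //= lexx.
have ha : 0 < d m a <= glen ga by rewrite la d_gt0 //= lexx.
have hb : 0 < d m b <= glen gb by rewrite lb d_gt0 //= lexx.
have k1 := hinge_global hx ha; have k2 := hinge_global hx hb.
have d1 := kap_dist hx ha; have d2 := kap_dist hx hb.
have eax : gpath ga (d m a) = a by rewrite -la -ea.
have ebx : gpath gb (d m b) = b by rewrite -lb -eb.
have exx : gpath gx (d m x) = x by rewrite -lx -ex.
rewrite exx eax (metric_sym x a) in d1; rewrite exx ebx (metric_sym x b) in d2.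
rewrite d1 d2 -bt' (metric_sym a m).
set u := d m x in d1 d2 *; set p := d m a in d1 d2 *; set q := d m b in d1 d2 *.
have upq : 0 <= u * p * q by rewrite !mulr_ge0 ?mdist_ge0.
have s0 : 0 <= kap gx ga u p + kap gx gb u q by lra.
have := mulr_ge0 upq s0; lra.
Qed.
End globalization.

Section alexandrov_global.
Context {R : realType} {n : nat} {X : metricType R}.
Hypothesis AX : alexandrov_nonneg n X.

Lemma alexandrov_stewart : stewart X.
Proof.
apply: stewart_global; first exact: alexandrov_segment AX.
  by move=> x; have [r r0 /quad_stewart h] := local_quad AX x; exists r.
move=> z rho; have [e e0 h] := uniform_quad AX z rho.
by exists e => // x /h /quad_stewart.
Qed.
End alexandrov_global.

(** * Angles and the metric of the space of directions *)

Section angles.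
Context {R : realType} {X : metricType R}.
Implicit Types (p x y : X).

Definition tends_kap p (g h : geodesic p) (A : R) := forall e : R, 0 < e ->
  exists s0, [/\ 0 < s0, s0 <= glen g, s0 <= glen h &
    forall s t, 0 < s <= s0 -> 0 < t <= s0 -> `|kap g h s t - A| < e].

(** Angles exist as genuine limits of comparison angles. This is assumed in place of Stewart's
    inequality so that the results also apply to the base of a cone, where that inequality is only
    at hand in the cone itself. *)
Definition angled p := forall g h : geodesic p, tends_kap g h (cos (angle g h)).

Lemma tends_kap_bound p (g h : geodesic p) A : tends_kap g h A -> -1 <= A <= 1.
Proof.
move=> H; have main e : 0 < e -> -1 - e <= A <= 1 + e.
  move=> /H [s0 [s00 sg sh /(_ s0 s0)]]; rewrite s00 lexx => /(_ isT isT).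
  have : -1 <= kap g h s0 s0 <= 1 by apply: kap_bound; rewrite s00.
  by move=> /andP[h1 h2]; rewrite ltr_norml => /andP[h3 h4]; apply/andP; split; lra.
apply/andP; split; rewrite leNgt; apply/negP => lt.
  by have := main ((-1 - A) / 2) (ltac:(lra)); lra.
by have := main ((A - 1) / 2) (ltac:(lra)); lra.
Qed.

Lemma acos_anti (x y : R) : -1 <= x <= 1 -> -1 <= y <= 1 -> x <= y -> acos y <= acos x.
Proof.
move=> hx hy xy; rewrite leNgt -ltr_cos ?in_itv /= ?acos_ge0 ?acos_lepi //.
by rewrite !acosK ?in_itv //= -leNgt.
Qed.

Lemma cos_anti (x y : R) : 0 <= x <= pi -> 0 <= y <= pi -> cos x <= cos y -> y <= x.
Proof. by move=> hx hy; rewrite leNgt => h; rewrite leNgt -ltr_cos ?in_itv. Qed.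

Lemma angle_lim p (g h : geodesic p) A : tends_kap g h A -> angle g h = acos A.
Proof.
move=> H; have A1 := tends_kap_bound H.
rewrite /angle; set f := fun st : R * R => _; set F := filter_prod _ _.
have near0 (q : R) : 0 < q -> (0 : R)^'+ [set s | 0 < s <= q].
  move=> q0; near=> u; rewrite /=; apply/andP; split => //.
  by near: u; apply: nbhs_right_le.
have FO a : 0 < a -> F [set st : R * R | 0 < st.1 <= a /\ 0 < st.2 <= a].
  move=> a0; exists ([set s | 0 < s <= a], [set t | 0 < t <= a]) => //=.
  by split; exact: near0.
have fE s t : f (s, t) = (acos (kap g h s t))%:E by [].
have FF : Filter F by exact: filter_prod_filter.
have pA : 0 <= acos A <= pi by rewrite acos_ge0 // acos_lepi.
have U1 (th : R) : acos A < th -> (limf_esup f F <= th%:E)%E.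
  move=> thA; have [thp|thp] := leP th pi; last first.
    have [s0 [s00 sg sh _]] := H 1 ltr01.
    apply: ereal_inf_le; eexists; first by eexists; [exact: (FO _ s00)|reflexivity].
    apply: ge_ereal_sup => _ [[s t] /= [/andP[sp ss] /andP[tp ts]] <-].
    rewrite fE lee_fin (le_trans _ (ltW thp)) // acos_lepi //.
    by apply: kap_bound; rewrite ?sp ?tp /=; [exact: le_trans ss sg|exact: le_trans ts sh].
  have thI : 0 <= th <= pi by rewrite thp andbT (le_trans _ (ltW thA)) //; case/andP: pA.
  have cth : 0 < A - cos th.
    by rewrite subr_gt0 -[ltRHS](@acosK R) ?in_itv //= ltr_cos ?in_itv.
  have [s0 [s00 sg sh hs]] := H _ cth.
  apply: ereal_inf_le; eexists; first by eexists; [exact: (FO _ s00)|reflexivity].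
  apply: ge_ereal_sup => _ [[s t] /= [hs0 ht0] <-].
  have := hs s t hs0 ht0; rewrite ltr_norml => /andP[h1 _].
  have /andP[sp ss] := hs0; have /andP[tp ts] := ht0.
  rewrite fE lee_fin -[th]cosK ?in_itv //; apply: acos_anti; last by lra.
    by rewrite cos_geN1 cos_le1.
  by apply: kap_bound; rewrite ?sp ?tp /=; [exact: le_trans ss sg|exact: le_trans ts sh].
have L1 (th : R) : 0 <= th -> th < acos A -> (th%:E <= limf_esup f F)%E.
  move=> th0 thA; have thI : 0 <= th <= pi.
    by rewrite th0 (le_trans (ltW thA)) //; case/andP: pA.
  have cth : 0 < cos th - A.
    by rewrite subr_gt0 -[ltLHS](@acosK R) ?in_itv //= ltr_cos ?in_itv.
  have [s0 [s00 sg sh hs]] := H _ cth.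
  apply: le_ereal_inf_tmp => _ [B FB <-].
  have [[s t] [/= [hs0 ht0] Bst]] := filter_ex (filterI (FO _ s00) FB).
  apply: (@le_trans _ _ (f (s, t))); last by apply: ereal_sup_ubound; exists (s, t).
  have := hs s t hs0 ht0; rewrite ltr_norml => /andP[_ h1].
  have /andP[sp ss] := hs0; have /andP[tp ts] := ht0.
  rewrite fE lee_fin -[th]cosK ?in_itv //; apply: acos_anti; last by lra.
    by apply: kap_bound; rewrite ?sp ?tp /=; [exact: le_trans ss sg|exact: le_trans ts sh].
  by rewrite cos_geN1 cos_le1.
apply/eqP; rewrite eq_le; move: U1 L1 (angle_bound g h); rewrite /angle -/f -/F.
case: limf_esup => [l| |] //=.
- move=> U1 L1 /andP[l0 _]; apply/andP; split; rewrite leNgt; apply/negP => lh.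
    by have := U1 ((l + acos A) / 2) (ltac:(lra)); rewrite lee_fin; lra.
  by have := L1 ((l + acos A) / 2) (ltac:(lra)) (ltac:(lra)); rewrite lee_fin; lra.
- by move=> /(_ (acos A + 1) (ltac:(lra))); rewrite leye_eq.
- move=> _ L1 _; case/andP: pA => p0 _; rewrite p0 leNgt; apply/negP => lh.
  by have := L1 0 (lexx _) lh; rewrite leeNy_eq.
Unshelve. all: by end_near. Qed.

Lemma angled_stewart p : stewart X -> angled p.
Proof.
move=> St g h e e0.
have m : mono_hinge g h (glen g) (glen h).
  by apply: (@stewart_mono _ _ setT) => //; rewrite ?glen_gt0 ?lexx // => a q b x _ _ _ _; exact: St.
have [h1 /(_ e e0) [s [t [/andP[sp sg] /andP[tp th] h2]]]] := angle_mono m.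
exists (Num.min s t); split.
- by rewrite lt_min sp.
- by rewrite ge_min sg.
- by rewrite ge_min th orbT.
move=> s' t'; rewrite !le_min => /andP[s'p /andP[s's s't]] /andP[t'p /andP[t's t't]].
have [_ _ mo] := m.
have := h1 s' t'; rewrite s'p t'p (le_trans s's) // (le_trans t't) // => /(_ isT isT).
have : kap g h s' t' <= kap g h s t by apply: mo => //; rewrite ?s'p ?t'p.
by rewrite ltr_norml => ? ?; apply/andP; split; lra.
Qed.

Lemma angle_hinge p (g h : geodesic p) s t : stewart X -> 0 < s <= glen g -> 0 < t <= glen h ->
  cos (angle g h) <= kap g h s t.
Proof.
move=> St hs ht; have m : mono_hinge g h (glen g) (glen h).
  by apply: (@stewart_mono _ _ setT) => //; rewrite ?glen_gt0 ?lexx // => a q b x _ _ _ _; exact: St.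
by have [h1 _] := angle_mono m; exact: h1.
Qed.

Lemma angle_eq p (g h : geodesic p) A : tends_kap g h A -> cos (angle g h) = A.
Proof. by move=> H; rewrite (angle_lim H) acosK // in_itv /= (tends_kap_bound H). Qed.

Lemma tends_kap_sym p (g h : geodesic p) A : tends_kap g h A -> tends_kap h g A.
Proof.
move=> H e /H [s0 [s00 sg sh H0]]; exists s0; split=> // s t hs ht.
by have := H0 t s ht hs; rewrite /kap ccaC.
Qed.

Lemma angleC p (g h : geodesic p) : angled p -> angle g h = angle h g.
Proof.
by move=> H; rewrite -cos_angle_in -[RHS]cos_angle_in -(angle_eq (tends_kap_sym (H g h))).
Qed.

Lemma Ule0 (u : nat -> R) (a : R) : Ulim u 0 -> 0 < a -> ulf [set k | u k <= a].
Proof.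
move=> /UP h /h; apply: filterS => k /=; rewrite sub0r normrN => H.
by apply: le_trans (ltW H); exact: ler_norm.
Qed.

Lemma tends_kap_Ulim p (g h : geodesic p) A (u v : nat -> R) : tends_kap g h A ->
  (forall k, 0 < u k) -> (forall k, 0 < v k) -> Ulim u 0 -> Ulim v 0 ->
  Ulim (fun k => kap g h (u k) (v k)) A.
Proof.
move=> H u0 v0 uu vv; apply/UP => e /H [s0 [s00 _ _ h0]].
apply: filterS (filterI (Ule0 uu s00) (Ule0 vv s00)) => k /= [h1 h2].
by rewrite distrC h0 ?u0 ?v0.
Qed.

Lemma Usqrt (u : nat -> R) (a : R) : Ulim u a -> Ulim (fun k => Num.sqrt (u k)) (Num.sqrt a).
Proof. by apply: Ucomp; exact: sqrt_continuous. Qed.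

Lemma tangent_dist p (g h : geodesic p) A (a b : R) (u : nat -> R) : tends_kap g h A ->
  0 < a -> 0 < b -> (forall k, 0 < u k) -> Ulim u 0 ->
  Ulim (fun k => d (gpath g (a * u k)) (gpath h (b * u k)) / u k)
       (Num.sqrt (a ^+ 2 + b ^+ 2 - 2 * a * b * A)).
Proof.
move=> H a0 b0 u0 uu.
have Uc c : Ulim (fun k => c * u k) 0 by rewrite -(mulr0 c); exact: UM (Ucst c) uu.
have Hk := tends_kap_Ulim H (fun k => mulr_gt0 a0 (u0 k)) (fun k => mulr_gt0 b0 (u0 k)) (Uc a) (Uc b).
have := Usqrt (UD (Ucst (a ^+ 2 + b ^+ 2)) (UN (UM (Ucst (2 * a * b)) Hk))) => H1.
apply: (Usq H1 H1).
apply: filterS (filterI (Ule0 (Uc a) (glen_gt0 g)) (Ule0 (Uc b) (glen_gt0 h))) => k /= [hg hh].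
have ha : 0 < a * u k <= glen g by rewrite hg mulr_gt0.
have hb : 0 < b * u k <= glen h by rewrite hh mulr_gt0.
suff -> : a ^+ 2 + b ^+ 2 - 2 * a * b * kap g h (a * u k) (b * u k) =
  (d (gpath g (a * u k)) (gpath h (b * u k)) / u k) ^+ 2.
  by rewrite sqrtr_sqr ger0_norm ?lexx // divr_ge0 ?mdist_ge0 // ltW.
by rewrite expr_div_n kap_dist //; field; rewrite gt_eqF.
Qed.

Lemma Uinv_gt0 (k : nat) : 0 < k.+1%:R^-1 :> R.
Proof. by rewrite invr_gt0. Qed.

Lemma angle_triangle p (g h k : geodesic p) : angled p -> angle g k <= angle g h + angle h k.
Proof.
move=> H; rewrite leNgt; apply/negP => lt.
have := angle_bound g h; have := angle_bound h k; have := angle_bound g k.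
have T1 := H g h; have T2 := H h k; have T3 := H g k.
set al := angle g h in T1 lt *; set be := angle h k in T2 lt *; set ga := angle g k in T3 lt *.
move=> /andP[g0 g1] /andP[b0 b1] /andP[a0 a1].
pose si := (al + be) / 2; pose de := (al - be) / 2.
have alE : al = si + de by rewrite /si /de; field.
have beE : be = si - de by rewrite /si /de; field.
have cs : 0 < cos si by apply: cos_gt0_pihalf; rewrite /si; apply/andP; split; lra.
have cd : 0 < cos de by apply: cos_gt0_pihalf; rewrite /de; apply/andP; split; lra.
have sa : 0 <= sin al by apply: sin_ge0_pi; rewrite a0.
have sb : 0 <= sin be by apply: sin_ge0_pi; rewrite b0.
(* the ray of [h] crosses the chord between the unit points of [g] and [k] at distance [r] *)
pose r := cos si / cos de; have r0 : 0 < r by rewrite divr_gt0.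
have cdn : cos de != 0 by rewrite gt_eqF.
have ss : sin si ^+ 2 = 1 - cos si ^+ 2 by rewrite -(cos2Dsin2 si); ring.
have sd : sin de ^+ 2 = 1 - cos de ^+ 2 by rewrite -(cos2Dsin2 de); ring.
have ca : cos al = cos si * cos de - sin si * sin de by rewrite alE cosD.
have cb : cos be = cos si * cos de + sin si * sin de by rewrite beE cosB.
have sal : sin al = sin si * cos de + cos si * sin de by rewrite alE sinD.
have sbe : sin be = sin si * cos de - cos si * sin de by rewrite beE sinB.
have D1 : 1 ^+ 2 + r ^+ 2 - 2 * 1 * r * cos al = (sin al / cos de) ^+ 2.
  rewrite [RHS]expr_div_n sal sqrrD !exprMn ss sd ca /r; field; exact: cdn.
have D2 : r ^+ 2 + 1 ^+ 2 - 2 * r * 1 * cos be = (sin be / cos de) ^+ 2.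
  rewrite [RHS]expr_div_n sbe sqrrB !exprMn ss sd cb /r; field; exact: cdn.
have u0 := Uinv_gt0.
have L1 := tangent_dist T1 ltr01 r0 u0 Uinv; rewrite D1 sqrtr_sqr ger0_norm ?divr_ge0 ?(ltW cd) // in L1.
have L2 := tangent_dist T2 r0 ltr01 u0 Uinv; rewrite D2 sqrtr_sqr ger0_norm ?divr_ge0 ?(ltW cd) // in L2.
have L3 := tangent_dist T3 ltr01 ltr01 u0 Uinv.
have : Num.sqrt (1 ^+ 2 + 1 ^+ 2 - 2 * 1 * 1 * cos ga) <= sin al / cos de + sin be / cos de.
  apply: (Ule L3 (UD L1 L2)); apply: filterE => j /=.
  by rewrite -mulrDl ler_pM2r ?invr_gt0 ?Uinv_gt0 //; exact: metric_triangle.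
have -> : sin al / cos de + sin be / cos de = 2 * sin si by rewrite sal sbe; field; exact: cdn.
have s0 : 0 <= sin si by apply: sin_ge0_pi; rewrite /si; apply/andP; split; lra.
have c1 := cos_le1 ga.
rewrite -ler_sqr ?nnegrE ?sqrtr_ge0 ?mulr_ge0 // sqr_sqrtr; last by rewrite !expr2; lra.
rewrite exprMn ss => h1.
have cab : cos (al + be) = 2 * cos si ^+ 2 - 1.
  by rewrite (_ : al + be = si + si) ?cosD -?expr2 ?ss; [ring|rewrite /si; field].
have : ga <= al + be.
  by apply: cos_anti; [lra|apply/andP; split; lra|rewrite cab; lra].
lra.
Qed.

Lemma dir_dist_angle p (g h : geodesic p) : angled p -> d (dir g) (dir h) = angle g h.
Proof.
move=> H; apply/eqP; rewrite eq_le; apply/andP; split.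
  apply: dir_dist_le => k /=; rewrite ler_norml.
  have := angle_triangle g h k H; have := angle_triangle h g k H.
  by rewrite (angleC h g) // => *; apply/andP; split; lra.
by have := dir_dist_ge (dir g) (dir h) h; rewrite /= cos_self subr0; apply: le_trans; exact: ler_norm.
Qed.

Lemma dir_approx p (xi : directions p) (e : R) : 0 < e -> exists g : geodesic p, d xi (dir g) <= e.
Proof. by move=> /(dir_closure xi) [g hg]; exists g; exact: dir_dist_le. Qed.

Lemma dir_dist_pi p (xi eta : directions p) : angled p -> d xi eta <= pi.
Proof.
move=> H; apply/ler_addgt0Pr => e e0; have e2 : 0 < e / 2 by lra.
have [g hg] := dir_approx xi e2; have [h hh] := dir_approx eta e2.
have := metric_triangle xi (dir g) eta; have := metric_triangle (dir g) (dir h) eta.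
by rewrite (metric_sym (dir h)) dir_dist_angle //; have := angle_bound g h; lra.
Qed.

Lemma opposite_angle p (g h : geodesic p) : opposite g h -> angle g h = pi.
Proof.
move=> [t0 t00 op]; rewrite (@angle_lim _ _ _ (-1)) ?acosN1 // => e e0.
have tk : tends_kap g h (-1).
  move=> e1 e10; exists t0; have [h1 h2 _] := op t0 (ltac:(by rewrite t00 lexx)); split=> //.
  move=> s t /andP[sp ss] /andP[tp ts]; suff -> : kap g h s t = -1 by rewrite subrr normr0.
  have := @kap_bound _ _ _ g h s t; rewrite sp tp (le_trans ss) // (le_trans ts) //.
  move=> /(_ isT isT) /andP[kb _]; apply/eqP; rewrite eq_le kb andbT.
  (* [p] is between the two points, at distances [s] and [t] *)
  pose m := Num.max s t.
  have mt : 0 < m <= t0 by rewrite lt_max sp ge_max ss ts.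
  have [mg mh dm] := op m mt; have /andP[m0 mt0] := mt.
  have sm : s <= m by rewrite le_max lexx.
  have tm : t <= m by rewrite le_max lexx orbT.
  have t1 := metric_triangle (gpath g m) (gpath g s) (gpath h m).
  have t2 := metric_triangle (gpath g s) (gpath h t) (gpath h m).
  rewrite gpath_isometry ?(ltW m0) ?(ltW sp) ?mg ?(le_trans sm) //= ger0_norm ?subr_ge0 // in t1.
  rewrite (gpath_isometry (g := h)) ?(ltW m0) ?(ltW tp) ?mh ?(le_trans tm) //= distrC ger0_norm ?subr_ge0 // in t2.
  have hst : s + t <= d (gpath g s) (gpath h t) by lra.
  rewrite kapE ?sp ?tp ?(le_trans ss) ?(le_trans ts) // ler_pdivrMr ?mulr_gt0 //.
  have st0 : 0 <= s + t by lra.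
  by move: hst; rewrite -ler_sqr ?nnegrE ?mdist_ge0 //; lra.
exact: tk.
Qed.

Lemma angle_agree p (g h : geodesic p) (t0 : R) : angled p -> 0 < t0 -> t0 <= glen g -> t0 <= glen h ->
  (forall t, 0 <= t <= t0 -> gpath g t = gpath h t) -> dir g = dir h.
Proof.
move=> H t00 tg th gh; apply: mdist_positivity; rewrite dir_dist_angle //.
rewrite (@angle_lim _ g h 1) ?acos1 // => e e0; exists t0; split=> // s t /andP[sp ss] /andP[tp tt].
suff -> : kap g h s t = 1 by rewrite subrr normr0.
rewrite kapE ?sp ?tp ?(le_trans ss) ?(le_trans tt) //.
rewrite -gh ?(ltW tp) // gpath_isometry ?(ltW sp) ?(ltW tp) ?(le_trans ss) ?(le_trans tt) //.
by rewrite real_normK ?num_real //; field; rewrite !gt_eqF.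
Qed.

Lemma opposite_sum_adjacent p (k g h : geodesic p) : angled p -> opposite g h ->
  0 <= cos (angle k g) + cos (angle k h) -> angle k g + angle k h = pi.
Proof.
move=> H op; have := angle_triangle g k h H.
rewrite (opposite_angle op) (angleC g k) // => h1 h2; apply/eqP; rewrite eq_le h1 andbT.
have /andP[a0 a1] := angle_bound k g; have /andP[b0 b1] := angle_bound k h.
have : cos (pi - angle k h) <= cos (angle k g) by rewrite cosB cospi sinpi; lra.
have C : 0 <= pi - angle k h <= pi by apply/andP; split; lra.
by move=> /(cos_anti C); rewrite a0 a1 => /(_ isT); lra.
Qed.

Lemma opposite_sum p (k g h : geodesic p) : angled p -> local_stewart p -> opposite g h ->
  angle k g + angle k h = pi.
Proof. by move=> H L op; apply: opposite_sum_adjacent => //; exact: adjacent_cos. Qed.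

Lemma direction_angle p (xi : directions p) (g : geodesic p) : angled p -> d xi (dir g) = dir_angle xi g.
Proof.
move=> H; apply/eqP; rewrite eq_le; apply/andP; split; last first.
  by have := dir_dist_ge xi (dir g) g; rewrite /= cos_self subr0; apply: le_trans; exact: ler_norm.
apply/ler_addgt0Pr => e e0; have e2 : 0 < e / 2 by lra.
have [h hh] := dir_approx xi e2; have := metric_triangle xi (dir h) (dir g).
rewrite (dir_dist_angle h g H).
have : `|dir_angle xi g - angle h g| <= d xi (dir h) := dir_dist_ge xi (dir h) g.
by rewrite ler_norml => /andP[? ?] ?; lra.
Qed.
End angles.

(** * Limits of geodesics and of directions *)

Section tame.
Context {R : realType} {X : metricType R}.
Implicit Types (p x y : X).

Lemma gpath_dist p (g : geodesic p) s : 0 <= s <= glen g -> d p (gpath g s) = s.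
Proof.
move=> /andP[]; rewrite le_eqVlt => /predU1P[<- _|s0 sg]; first by rewrite gpath0 mdistxx.
by rewrite geodesic_dist // s0.
Qed.

Record tame p : Prop := Tame {
  tm_angled : angled p ;
  tm_proper : proper_metric X ;
  (* 5 exceeds [pi ^ 2 / 2], the constant that suffices for curvature at least 1. *)
  tm_hinge : exists2 s1 : R, 0 < s1 & forall (g h : geodesic p) s, 0 < s <= s1 ->
    s <= glen g -> s <= glen h ->
    d (gpath g s) (gpath h s) ^+ 2 <= 5 * s ^+ 2 * (1 - cos (angle g h)) }.

Lemma tame_stewart p : stewart X -> proper_metric X -> tame p.
Proof.
move=> St pX; split=> //; first exact: angled_stewart.
exists 1 => // g h s /andP[s0 _] sg sh.
have hg : 0 < s <= glen g by rewrite s0.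
have hh : 0 < s <= glen h by rewrite s0.
rewrite kap_dist //; have := angle_hinge St hg hh => k1.
have s2 : 0 <= s ^+ 2 by exact: sqr_ge0.
have := ler_wpM2l s2 k1; have := mulr_ge0 s2 (_ : 0 <= 1 - cos (angle g h)).
by rewrite subr_ge0 cos_le1 => /(_ isT); lra.
Qed.

Lemma cos_ge1 (x : R) : 0 <= x <= pi -> 1 <= cos x -> x = 0.
Proof.
move=> hx c1; rewrite -[x]cosK ?in_itv //.
by rewrite (_ : cos x = 1) ?acos1 //; apply/eqP; rewrite eq_le cos_le1.
Qed.

Lemma limit_geodesic p (g : nat -> geodesic p) (r : R) : proper_metric X -> 0 < r ->
  (forall k, r <= glen (g k)) -> exists g0 : geodesic p, glen g0 = r /\
    forall s, 0 <= s <= r -> ucv (fun k => gpath (g k) s) (gpath g0 s).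
Proof.
move=> pX r0 rg.
have /choice [f fP] : forall s : R, exists y, 0 <= s <= r -> ucv (fun k => gpath (g k) s) y.
  move=> s; have [/andP[s0 sr]|] := pselect (0 <= s <= r); last by exists p.
  have [|y yP] := pX (fun k => gpath (g k) s) p r; last by exists y.
  by move=> k; rewrite gpath_dist // s0 (le_trans sr).
have f0 : f 0 = p.
  have := fP 0; rewrite lexx ltW // => /(_ isT) h; apply: (ucv_uniq h).
  by under eq_fun do rewrite gpath0; exact: ucv_cst.
have fi s t : 0 <= s <= r -> 0 <= t <= r -> d (f s) (f t) = `|s - t|.
  move=> hs ht; apply: (Uuniq (ucv_d (fP s hs) (fP t ht))).
  apply: Ueq (Ucst `|s - t|) => k; rewrite gpath_isometry //.
    by case/andP: hs => -> h; exact: le_trans h _.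
  by case/andP: ht => -> h; exact: le_trans h _.
by exists (Geodesic r0 f0 fi).
Qed.

(** In the hinge bound for g k and g i, let i run along the ultrafilter: this bounds the distance
    from g k to the limit g0 by the angle between dir (g k) and xi. Dividing by the scale, the angle
    between g k and g0 tends to 0. *)
Lemma limit_direction p (xi : directions p) (g : nat -> geodesic p) (g0 : geodesic p) (r : R) :
  tame p -> 0 < r -> r <= glen g0 -> (forall k, r <= glen (g k)) -> ucv (fun k => dir (g k)) xi ->
  (forall s, 0 < s <= r -> ucv (fun k => gpath (g k) s) (gpath g0 s)) -> dir g0 = xi.
Proof.
move=> [An pX [s1 s10 hin]] r0 rg0 rg gx gg.
have cosU (eta : directions p) : Ulim (fun k => cos (d eta (dir (g k)))) (cos (d eta xi)).
  by apply: Ucomp; [exact: continuous_cos|exact: ucv_d (ucv_cst _) gx].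
have B k : 1 - 5 / 2 * (1 - cos (d (dir (g k)) xi)) <= cos (angle (g k) g0).
  have rs0 : 0 < Num.min r s1 by rewrite lt_min r0.
  have u0 (j : nat) : 0 < Num.min r s1 * j.+1%:R^-1 by rewrite mulr_gt0 ?Uinv_gt0.
  have uu : Ulim (fun j => Num.min r s1 * j.+1%:R^-1) (0 : R).
    by rewrite -(mulr0 (Num.min r s1)); exact: UM (Ucst _) Uinv.
  have K := tends_kap_Ulim (An (g k) g0) u0 u0 uu uu.
  apply: (Ule (Ucst _) K); apply: filterE => j /=; set s := Num.min r s1 * _.
  have sm : s <= Num.min r s1.
    by rewrite /s ler_piMr ?invf_le1 ?ltr0n ?ler1n // ltW.
  have sr : s <= r by rewrite (le_trans sm) // ge_min lexx.
  have ss1 : s <= s1 by rewrite (le_trans sm) // ge_min lexx orbT.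
  have s0 : 0 < s := u0 j.
  have D : d (gpath (g k) s) (gpath g0 s) ^+ 2 <= 5 * s ^+ 2 * (1 - cos (d (dir (g k)) xi)).
    have c1 := ucv_d (ucv_cst (gpath (g k) s)) (gg s (ltac:(by rewrite s0))).
    apply: (Ule (UX 2 c1) (UM (Ucst (5 * s ^+ 2)) (UD (Ucst 1) (UN (cosU (dir (g k))))))).
    apply: filterE => i /=; rewrite dir_dist_angle //; apply: hin.
    + by rewrite s0.
    + exact: le_trans sr _.
    + exact: le_trans sr _.
  rewrite kapE ?s0 ?(le_trans sr) // ler_pdivlMr ?mulr_gt0 //.
  by move: D; rewrite !expr2; lra.
have h1 : 1 <= cos (d xi (dir g0)).
  have U1 := cosU xi; rewrite mdistxx cos0 in U1.
  have U2 : Ulim (fun k => cos (angle (g k) g0)) (cos (d xi (dir g0))).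
    have E j : cos (d (dir (g j)) (dir g0)) = cos (angle (g j) g0) by rewrite dir_dist_angle.
    apply: (Ueq E).
    by apply: Ucomp; [exact: continuous_cos|exact: ucv_d gx (ucv_cst _)].
  have U3 := UD (Ucst 1) (UN (UM (Ucst (5 / 2)) (UD (Ucst 1) (UN U1)))).
  rewrite subrr mulr0 subr0 in U3.
  by apply: (Ule U3 U2); apply: filterE => k /=; rewrite metric_sym; exact: B.
apply: mdist_positivity; rewrite metric_sym; apply: cos_ge1 => //.
by rewrite mdist_ge0 dir_dist_pi.
Qed.

Lemma tame_limit_extends p (xi : directions p) (r : R) : tame p -> 0 < r ->
  (forall e : R, 0 < e -> exists h : geodesic p, r <= glen h /\ d xi (dir h) <= e) -> extends_to xi r.
Proof.
move=> T r0 H; have /choice [h hP] : forall k : nat, exists h : geodesic p, r <= glen h /\ d xi (dir h) <= k.+1%:R^-1.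
  by move=> k; apply: H; exact: Uinv_gt0.
have [g0 [lg0 hg0]] := limit_geodesic (tm_proper T) r0 (fun k => (hP k).1).
exists g0; last by rewrite lg0.
apply: (limit_direction T r0 _ (fun k => (hP k).1)); rewrite ?lg0 //.
  apply: (@ucv_le _ _ (fun=> xi) _ xi (fun k => k.+1%:R^-1)); [exact: ucv_cst|exact: Uinv|].
  by apply: filterE => k /=; have [] := hP k.
by move=> s /andP[s0 sr]; apply: hg0; rewrite ltW.
Qed.

Lemma dir_eq_agree p : tame p -> exists2 s1 : R, 0 < s1 &
  forall (g h : geodesic p) s, dir g = dir h -> 0 < s <= s1 -> s <= glen g -> s <= glen h ->
    gpath g s = gpath h s.
Proof.
move=> [An pX [s1 s10 hin]]; exists s1 => // g h s gh hs sg sh.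
apply: mdist_positivity; have := hin g h s hs sg sh.
rewrite -dir_dist_angle // gh mdistxx cos0 subrr mulr0 => h1; apply/eqP.
by rewrite -sqrf_eq0 eq_le sqr_ge0 h1.
Qed.

Lemma geodesic_concat p (g : geodesic p) b : (exists f, segment (gend g) b f) -> btw p (gend g) b ->
  exists h : geodesic p, [/\ glen h = d p b, gend h = b & forall t, 0 <= t <= glen g -> gpath h t = gpath g t].
Proof.
move=> [f [f0 f1 fi]]; rewrite /btw; set l := glen g.
have l0 : 0 < l := glen_gt0 g.
have dl : d p (gend g) = l by rewrite geodesic_dist // l0 lexx.
rewrite dl; set D := d (gend g) b => lD; have D0 : 0 <= D := mdist_ge0 _ _.
pose k (t : R) := if t <= l then gpath g t else f (t - l).
have L0 : 0 < d p b by rewrite -lD; lra.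
have k0 : k 0 = p by rewrite /k ltW // gpath0.
have cross s t : 0 <= s <= l -> l < t -> t <= d p b -> d (gpath g s) (f (t - l)) = t - s.
  move=> /andP[s0 sl] lt td.
  have e1 : d (gpath g s) (gend g) = l - s.
    by rewrite gpath_isometry ?lexx ?s0 ?(ltW l0) // distrC ger0_norm ?subr_ge0.
  have e2 : d (gend g) (f (t - l)) = t - l.
    rewrite -[X in d X _]f0 fi ?lexx ?D0 -/D //=; last by apply/andP; split; lra.
    by rewrite sub0r normrN ger0_norm; lra.
  have e3 : d (f (t - l)) b = D - (t - l).
    rewrite -[X in d _ X]f1 fi ?lexx ?D0 -/D //=; last by apply/andP; split; lra.
    by rewrite distrC ger0_norm; lra.
  have e4 : d p (gpath g s) = s.
    by rewrite gpath_dist // s0.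
  have t1 := metric_triangle (gpath g s) (gend g) (f (t - l)).
  have t2 := metric_triangle p (gpath g s) b.
  have t3 := metric_triangle (gpath g s) (f (t - l)) b.
  by apply/eqP; rewrite eq_le; apply/andP; split; lra.
have ki s t : 0 <= s <= d p b -> 0 <= t <= d p b -> d (k s) (k t) = `|s - t|.
  move=> /andP[s0 s1] /andP[t0 t1]; rewrite /k.
  have [sl|sl] := leP s l; have [tl|tl] := leP t l.
  - by rewrite gpath_isometry ?s0 ?t0.
  - rewrite cross ?s0 // distrC ger0_norm //; lra.
  - rewrite metric_sym cross ?t0 // ger0_norm //; lra.
  - rewrite fi -/D; [|apply/andP; split; lra|apply/andP; split; lra].
    by congr `|_|; ring.
exists (Geodesic L0 k0 ki); split=> //.
- rewrite /gend /= /k; have [h|h] := leP (d p b) l; last by rewrite -lD (addrC l) addrK -/D f1.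
  have D00 : D = 0 by lra.
  by rewrite -lD D00 addr0; apply: mdist_positivity; rewrite -/(gend g) -/D.
- by move=> t /andP[_ tl]; rewrite /= /k tl.
Qed.

Lemma geodesic_restrict p (g : geodesic p) (l : R) : 0 < l <= glen g ->
  exists h : geodesic p, glen h = l /\ gpath h = gpath g.
Proof.
move=> /andP[l0 lg].
have ki s t : 0 <= s <= l -> 0 <= t <= l -> d (gpath g s) (gpath g t) = `|s - t|.
  by move=> /andP[s0 sl] /andP[t0 tl]; rewrite gpath_isometry ?s0 ?t0 ?(le_trans sl) ?(le_trans tl).
by exists (Geodesic l0 (gpath0 g) ki).
Qed.

Definition pack_at p := forall e : R, 0 < e -> exists K : nat, exists2 s1 : R, 0 < s1 &
  forall s, 0 < s <= s1 -> forall N (y : 'I_N -> X),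
    (forall i, d p (y i) <= s) -> separated (e * s) y -> (N <= K)%N.

Lemma Ugt (u : nat -> R) (a b : R) : Ulim u a -> b < a -> ulf [set k | b < u k].
Proof.
move=> /UP h ba; have /h : 0 < a - b by lra.
by apply: filterS => k /=; rewrite ltr_norml => /andP[_]; lra.
Qed.

(** Directions separated by e are approximated by geodesics with mutual angles at least e / 3. Their
    points at a small common distance s from p are more than c s / 2 apart, where c is the chord of
    the angle e / 3 in the unit circle. *)
Lemma direction_packing p : angled p -> pack_at p -> forall e : R, 0 < e -> exists K : nat,
  forall N (z : 'I_N -> directions p), separated e z -> (N <= K)%N.
Proof.
move=> An pk e e0.
have [e1|pie] := leP e pi; last first.
  exists 1%N => N z sz; rewrite leqNgt; apply/negP => N1.
  pose i0 : 'I_N := Ordinal (ltnW N1); pose i1 : 'I_N := Ordinal N1.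
  have := sz i0 i1 isT; have := dir_dist_pi (z i0) (z i1) An; lra.
pose e' := e / 3.
have ep : 0 <= e' <= pi by apply/andP; split; rewrite /e'; lra.
have c0 : 0 < 2 - 2 * cos e'.
  have : cos e' < 1 by rewrite -cos0 ltr_cos ?in_itv /= ?lexx ?pi_ge0 ?ep // /e'; lra.
  lra.
set c := Num.sqrt (2 - 2 * cos e'); have cp : 0 < c by rewrite sqrtr_gt0.
have c20 : 0 < c / 2 by lra.
have [K [s1 s10 hK]] := pk _ c20.
exists K => N z sz.
have e30 : 0 < e / 3 by lra.
have /choice [g gz] : forall i, exists g, d (z i) (dir g) <= e / 3 by move=> i; exact: dir_approx.
have ang i j : i != j -> cos (angle (g i) (g j)) <= cos e'.
  move=> /sz h1; apply: contrapT => /negP; rewrite -ltNge => h2.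
  have /andP[a0 a1] := angle_bound (g i) (g j).
  have : angle (g i) (g j) <= e' by apply: cos_anti; rewrite ?a0 //; exact: ltW.
  rewrite -dir_dist_angle //; have := gz i; have := gz j.
  have := metric_triangle (z i) (dir (g i)) (z j); have := metric_triangle (dir (g i)) (dir (g j)) (z j).
  by rewrite (metric_sym (dir (g j)) (z j)) /e'; lra.
have U1 : ulf [set k | forall ij : 'I_N * 'I_N, ij.1 != ij.2 ->
    c / 2 < d (gpath (g ij.1) (1 * k.+1%:R^-1)) (gpath (g ij.2) (1 * k.+1%:R^-1)) / k.+1%:R^-1].
  apply: ulf_fin => [[i j]] /=; have [->|ij] := eqVneq i j; first by apply: filterE.
  have L := tangent_dist (An (g i) (g j)) ltr01 ltr01 Uinv_gt0 Uinv.
  have h1 : c / 2 < Num.sqrt (1 ^+ 2 + 1 ^+ 2 - 2 * 1 * 1 * cos (angle (g i) (g j))).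
    apply: lt_le_trans (_ : c <= _); first by lra.
    by apply: ler_wsqrtr; have := ang i j ij; rewrite !expr2; lra.
  by apply: filterS (Ugt L h1) => k /= h2 _.
have U2 : ulf [set k : nat | forall i : 'I_N, k.+1%:R^-1 <= glen (g i)].
  by apply: ulf_fin => i; exact: Ule0 Uinv (glen_gt0 _).
have U3 : ulf [set k : nat | k.+1%:R^-1 <= s1] := Ule0 Uinv s10.
have [k [/= [h1 h2] h3]] := filter_ex (filterI (filterI U1 U2) U3).
have k0 := Uinv_gt0 (R := R) k; set s : R := k.+1%:R^-1 in h1 h2 h3 k0.
apply: (hK s _ N (fun i => gpath (g i) s)); first by rewrite k0.
- by move=> i; rewrite geodesic_dist ?k0 /=.
- by move=> i j ij; have := h1 (i, j) ij; rewrite mul1r ltr_pdivlMr.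
Qed.

(** The limit direction is the pointwise limit of the angle functions; packing makes the convergence
    uniform, so the limit is again in the closure of the geodesics. *)
Lemma directions_ulim p (xi : nat -> directions p) : angled p -> pack_at p -> exists eta, ucv xi eta.
Proof.
move=> An pk.
have near e : 0 < e -> exists g : geodesic p, ulf [set n | d (dir g) (xi n) < e].
  move=> e0; have e2 : 0 < e / 2 by lra.
  have [|//|eta [_ he]] := @packing_ulf _ _ setT xi _ _ (e / 2) e2.
    by move=> s s0; have [K hK] := direction_packing An pk s0; exists K => N z _; exact: hK.
  have [g hg] := dir_approx eta e2; exists g.
  apply: filterS he => n /= h1; have := metric_triangle (dir g) eta (xi n).
  by rewrite (metric_sym (dir g) eta); lra.
have /choice [f fP] : forall h : geodesic p, exists l, Ulim (fun n => dir_angle (xi n) h) l.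
  move=> h; have [n|l hl _] := @Ubnd R (fun n => dir_angle (xi n) h) 0 pi; last by exists l.
  by rewrite -direction_angle // mdist_ge0 dir_dist_pi.
have lipf (g : geodesic p) e : 0 < e -> ulf [set n | d (dir g) (xi n) < e] ->
    forall h, `|f h - angle g h| <= e.
  move=> e0 hg h.
  have U : Ulim (fun n => dir_angle (xi n) h - angle g h) (f h - angle g h).
    by apply: UD => //; exact: Ucst.
  have lip n : d (dir g) (xi n) < e -> `|dir_angle (xi n) h - angle g h| <= e.
    move=> hn; have : `|dir_angle (xi n) h - angle g h| <= d (xi n) (dir g) := dir_dist_ge (xi n) (dir g) h.
    by rewrite (metric_sym (xi n)); lra.
  rewrite ler_norml; apply/andP; split.
    apply: (Ule (Ucst _) U); apply: filterS hg => n /= /lip.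
    by rewrite ler_norml => /andP[].
  apply: (Ule U (Ucst _)); apply: filterS hg => n /= /lip.
  by rewrite ler_norml => /andP[].
have fc e : 0 < e -> exists g : geodesic p, forall h, `|f h - angle g h| <= e.
  by move=> e0; have [g hg] := near e e0; exists g; exact: lipf.
exists (Direction fc); apply/ucvP => e e0.
have e3 : 0 < e / 3 by lra.
have [g hg] := near _ e3.
have h1 : d (Direction fc) (dir g) <= e / 3 by apply: dir_dist_le => h /=; exact: lipf.
apply: filterS hg => n /= h2.
have := metric_triangle (Direction fc) (dir g) (xi n); lra.
Qed.
End tame.

(** * The ray dichotomy from the obtuseness at infinity *)

Section obtuse.
Context {R : realType} {X : metricType R}.
Hypothesis X_ob : ob_infty_space X = (pi / 2)%:E.

Lemma ob_far (e r : R) : 0 < e -> exists2 dl : R, 0 < dl & forall p q : X, p <> q -> d p q < dl ->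
  exists x, r < d p x /\
   ((exists g : geodesic p, gend g = x /\ forall z, dirs_to p q z -> pi - e < d z (dir g)) \/
    (exists g : geodesic q, gend g = x /\ forall z, dirs_to q p z -> pi - e < d z (dir g))).
Proof.
move=> e0; have : ((pi / 2 - e)%:E < ob_infty_space X)%E by rewrite X_ob lte_fin; lra.
rewrite /ob_infty_space limf_einfE => /ereal_sup_gt [_ [A [dl dl0 hA] <-] lt].
exists dl => // p q pq pqd.
have : ((pi / 2 - e)%:E < ob_infty p q)%E.
  by apply: lt_le_trans lt _; apply: ereal_inf_lbound; exists (p, q) => //; exact: hA.
rewrite /ob_infty lteBrDr // -EFinD => lt1.
have : ((pi / 2 - e + pi / 2)%:E < ereal_sup [set ereal_sup
      [set Order.max (dist_to_set (dirs_to p q) xi) (dist_to_set (dirs_to q p) eta)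
        | xi in dirs_to p x & eta in dirs_to q x] | x in [set x | (r < d p x)%R]])%E.
  apply: lt_le_trans lt1 _; apply: ereal_inf_lbound; eexists; last by reflexivity.
  (* Two points at distance at most r from p are at most 2 r apart, so the points further than r
     from p form a set of the filter at infinity. *)
  exists (2 * r) => x y /negP; rewrite -leNgt => hx /negP; rewrite -leNgt => hy.
  by have := metric_triangle x p y; rewrite (metric_sym x p); lra.
move=> /ereal_sup_gt [_ [x /= rx <-]] /ereal_sup_gt [_ [xi hxi [eta heta <-]]].
have far (p' q' : X) (z' : directions p') : ((pi / 2 - e + pi / 2)%:E < dist_to_set (dirs_to p' q') z')%E ->
    forall z, dirs_to p' q' z -> pi - e < d z z'.
  move=> h z hz; have : ((pi / 2 - e + pi / 2)%:E < (d z z')%:E)%E.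
    by apply: lt_le_trans h _; apply: ereal_inf_lbound; exists z.
  by rewrite lte_fin; lra.
rewrite lt_max => /orP[] /far h; exists x; split=> //; [left|right].
  by have [g gx gxi] := hxi; exists g; split=> //; rewrite gxi.
by have [g gx gxi] := heta; exists g; split=> //; rewrite gxi.
Qed.

Hypothesis pX : proper_metric X.
Hypothesis segX : forall a b : X, exists g, segment a b g.
Hypothesis St : stewart X.

(** A long geodesic from q almost in the direction of a shortest path to c. The length k - 1,
    instead of k, allows for a base point displaced by at most 1. *)
Definition far_hinge (k : nat) (q c : X) := exists g f : geodesic q,
  [/\ gend f = c, glen f = d q c, k%:R - 1 < glen g & angle g f < k.+1%:R^-1].

(** On the long geodesic take the point at distance d q c + L from q. As the angle tends to 0, hinge
    comparison puts it at distance at most L from c in the limit, so the limit point continues the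
    path from m to c by L. *)
Lemma ext_of_hinges (q : nat -> X) (m c : X) : ucv q m -> m <> c ->
  ulf [set k | far_hinge k (q k) c] -> ext m c.
Proof.
move=> qm mc hk L L0.
pose s k := d (q k) c + L; pose t k := d (q k) c.
have /choice [w wP] : forall k, exists w, far_hinge k (q k) c -> s k <= k%:R - 1 -> q k <> c ->
    d (q k) w = s k /\ d w c ^+ 2 <= s k ^+ 2 + t k ^+ 2 - 2 * s k * t k * cos (k.+1%:R^-1).
  move=> k; have [[g [f [fc lf lg af]]]|] := pselect (far_hinge k (q k) c); last by exists c.
  exists (gpath g (s k)) => _ sk /d_gt0 qc.
  have sp : 0 < s k by rewrite /s; lra.
  have hg : 0 < s k <= glen g by rewrite sp; lra.
  have hf : 0 < t k <= glen f by rewrite /t lf lexx qc.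
  split; first by rewrite geodesic_dist.
  rewrite -fc /gend lf -/(t k) kap_dist //.
  have st0 : 0 <= 2 * s k * t k by rewrite !mulr_ge0 // ltW.
  have c1 : cos (k.+1%:R^-1) <= kap g f (s k) (t k).
    apply: le_trans (angle_hinge St hg hf).
    have /andP[a0 a1] := angle_bound g f; apply: ltW.
    have kp : 0 <= (k.+1%:R^-1 : R) <= pi.
      rewrite (ltW (Uinv_gt0 k)) /=; apply: (@le_trans _ _ 1); first by rewrite invf_le1 ?ltr0n // ler1n.
      by have := pi_ge2 R; lra.
    by rewrite ltr_cos ?in_itv /= ?a0 ?a1.
  by have := ler_wpM2l st0 c1; lra.
have tU : Ulim t (d m c) := ucv_d qm (ucv_cst c).
have sU : Ulim s (d m c + L) := UD tU (Ucst L).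
have mc0 := d_gt0 mc.
have big : ulf [set k | [/\ far_hinge k (q k) c, s k <= k%:R - 1, q k <> c & d (q k) c <= d m c + 1]].
  have h1 : ulf [set k | s k < d m c + L + 1].
    have lt1 : - (d m c + L + 1) < - (d m c + L) by lra.
    by have := Ugt (UN sU) lt1; apply: filterS => k /=; rewrite ltrN2.
  have h2 := ulf_ge (Num.truncn (d m c + L + 2)).+1.
  have h3 := Ugt tU mc0.
  apply: filterS (filterI (filterI h1 h2) (filterI h3 hk)) => k /= [[a1 a2] [a3 a4]].
  have a5 : d m c + L + 2 <= k%:R.
    by apply: ltW; apply: lt_le_trans (truncnS_gt _) _; rewrite ler_nat.
  split=> //; first by lra.
    by move=> E; move: a3; rewrite /t E mdistxx ltxx.
  by move: a1; rewrite /s; lra.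
have good : ulf [set k | [/\ d (q k) (w k) = s k,
    d (w k) c ^+ 2 <= s k ^+ 2 + t k ^+ 2 - 2 * s k * t k * cos (k.+1%:R^-1) & d (q k) c <= d m c + 1]].
  by apply: filterS big => k /= [h1 h2 h3 h4]; have [h5 h6] := wP k h1 h2 h3.
have [w0 ww] : exists w0, ucv w w0.
  apply: (@ucv_eventually _ _ [set x | d c x <= 2 * (d m c + 1) + L]).
  - by exists c; rewrite /= mdistxx; lra.
  - by move=> v vb; exact: (pX vb).
  - apply: filterS good => k /= [h1 _ h3].
    by have := metric_triangle c (q k) (w k); rewrite (metric_sym c (q k)) h1 /s; lra.
have dmw : d m w0 = d m c + L.
  apply: (Uuniq (ucv_d qm ww)); apply: (Usq sU sU).
  by apply: filterS good => k /= [-> _ _]; rewrite lexx.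
exists w0; split=> //.
have cU : Ulim (fun k : nat => cos (k.+1%:R^-1) : R) 1.
  by rewrite -[X in Ulim _ X]cos0; apply: Ucomp Uinv; exact: continuous_cos.
have up : d w0 c ^+ 2 <= L ^+ 2.
  have -> : L ^+ 2 = (d m c + L) ^+ 2 + (d m c) ^+ 2 - 2 * (d m c + L) * d m c * 1 by ring.
  apply: (Ule (UX 2 (ucv_d ww (ucv_cst c)))
    (UD (UD (UX 2 sU) (UX 2 tU)) (UN (UM (UM (UM (Ucst 2) sU) tU) cU)))).
  by apply: filterS good => k /= [_ h _].
have lo := metric_triangle m c w0.
apply/eqP; rewrite eq_le metric_sym; apply/andP; split; last by rewrite metric_sym; lra.
by rewrite -ler_sqr ?nnegrE ?mdist_ge0.
Qed.

(** For a point q just after m on the way to b, the obtuseness of the pair m, q gives a far point.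
    If it is nearly opposite to q as seen from m, its direction is nearly that of a; if it is nearly
    opposite to m as seen from q, its direction is nearly that of b. The ultrafilter selects one
    case, and [ext_of_hinges] concludes. *)
Lemma ray_space_of_obtuse : ray_space X.
Proof.
split=> // a m b bt am mb; have bt' := bt; rewrite /btw in bt'.
have ma : m <> a by move/esym.
have mb0 := d_gt0 mb.
have [fa sa] := segX m a; have [ga [la ea pa]] := geodesic_of_segment sa ma.
have [fb sb] := segX m b; have [gb [lb eb pb]] := geodesic_of_segment sb mb.
have op := opposite_of_btw bt am mb la ea lb eb.
have An (x : X) : angled x by exact: angled_stewart.
have Loc (x : X) : local_stewart x by exists 1 => // u v w y _ _ _ _; exact: St.
have main k : exists q : X, d m q <= k.+1%:R^-1 /\ (far_hinge k m a \/ far_hinge k q b).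
  have ek := Uinv_gt0 (R := R) k.
  have [dl dl0 hdl] := ob_far k%:R ek.
  pose h := Num.min (dl / 2) (Num.min (d m b / 2) k.+1%:R^-1).
  have h0 : 0 < h by rewrite !lt_min ek; lra.
  have h1 : h < dl by rewrite gt_min; apply/orP; left; lra.
  have h2 : h < d m b by rewrite !gt_min; apply/orP; right; apply/orP; left; lra.
  have h3 : h <= k.+1%:R^-1 by rewrite !ge_min lexx !orbT.
  have hl : 0 < h <= glen gb by rewrite h0 lb ltW.
  pose q := gpath gb h; have dmq : d m q = h by rewrite geodesic_dist.
  exists q; split; first by rewrite dmq.
  have mq : m <> q := gpath_neq hl.
  have [x [rx [[g [gx far]]|[g [gx far]]]]] := hdl m q mq (ltac:(by rewrite dmq)).
    have lg : glen g = d m x by rewrite -gx geodesic_dist // glen_gt0 lexx.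
    left; exists g, ga; split=> //; first by rewrite lg; lra.
    have [r [lr pr]] := geodesic_restrict hl.
    have rb : dir r = dir gb.
      by apply: (@angle_agree _ _ _ r gb h) => //; [rewrite lr|rewrite lb ltW|move=> t _; rewrite pr].
    have hd : dirs_to m q (dir gb) by exists r => //; rewrite /gend lr pr.
    have := far (dir gb) hd; rewrite dir_dist_angle // (angleC gb) //.
    have := opposite_sum g (An m) (Loc m) op; set e := k.+1%:R^-1; lra.
  have hq : 0 < h < glen gb by rewrite h0 lb.
  have hf : 0 <= h < glen gb by rewrite ltW // lb.
  have [f [lf pf]] := geodesic_forward hf.
  have [bw [lbw pbw]] := geodesic_backward hl.
  have op2 := forward_backward_opposite hq lf pf lbw pbw.
  have lg : glen g = d q x by rewrite -gx geodesic_dist // glen_gt0 lexx.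
  have fb' : gend f = b by rewrite /gend lf pf addrC subrK -eb.
  right; exists g, f; split=> //.
  - by rewrite -{1}fb' geodesic_dist // glen_gt0 lexx.
  - have h4 : h <= 1 by apply: le_trans h3 _; rewrite invf_le1 ?ltr0n // ler1n.
    by have := metric_triangle m q x; rewrite lg dmq; lra.
  have hd : dirs_to q m (dir bw) by exists bw => //; rewrite /gend lbw pbw subrr gpath0.
  have := far (dir bw) hd; rewrite dir_dist_angle // (angleC bw) //.
  by have := opposite_sum g (An q) (Loc q) op2; set e := k.+1%:R^-1; lra.
have /choice [q qP] := main.
have qm : ucv q m.
  apply: (@ucv_le _ _ (fun=> m) q m (fun k => k.+1%:R^-1)); [exact: ucv_cst|exact: Uinv|].
  by apply: filterE => k /=; have [] := qP k.
have : ulf ([set k | far_hinge k m a] `|` [set k | far_hinge k (q k) b]).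
  by apply: filterE => k /=; have [_] := qP k.
move=> /Uor[h|h]; [left|right].
  by apply: (@ext_of_hinges (fun=> m)) => //; exact: ucv_cst.
exact: (@ext_of_hinges q).
Qed.
End obtuse.

Lemma cos_decr {R : realType} (x y : R) : 0 <= x <= pi -> 0 <= y <= pi -> y <= x -> cos x <= cos y.
Proof. by move=> hx hy; rewrite leNgt => h; rewrite leNgt ltr_cos ?in_itv. Qed.

(** * A closed form of nonnegative curvature *)

Section copositive.
Context {R : realType} {X : metricType R}.

(* The three-point case of the quadratic form of Lang-Schroeder-Sturm; it characterizes nonnegative curvature by closed conditions on distances. *)
Definition cform (p x1 x2 x3 : X) (l1 l2 l3 : R) :=
  (l1 * d p x1) ^+ 2 + (l2 * d p x2) ^+ 2 + (l3 * d p x3) ^+ 2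
  + l1 * l2 * (d p x1 ^+ 2 + d p x2 ^+ 2 - d x1 x2 ^+ 2)
  + l1 * l3 * (d p x1 ^+ 2 + d p x3 ^+ 2 - d x1 x3 ^+ 2)
  + l2 * l3 * (d p x2 ^+ 2 + d p x3 ^+ 2 - d x2 x3 ^+ 2).

Definition copositive := forall p x1 x2 x3 l1 l2 l3, 0 <= l1 -> 0 <= l2 -> 0 <= l3 ->
  0 <= cform p x1 x2 x3 l1 l2 l3.

Lemma ge0_of_quadratic (a b : R) : (forall l, 0 < l -> 0 <= l * b + l ^+ 2 * a) -> 0 <= b.
Proof.
move=> H; rewrite leNgt; apply/negP => b0.
have l0 : 0 < - b / (2 * (`|a| + 1)) by rewrite divr_gt0 ?mulr_gt0 // ?ltr_wpDl ?oppr_gt0.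
have := H _ l0; set l := - b / _ in l0 *.
have e : l * (2 * (`|a| + 1)) = - b by rewrite /l divfK // mulf_neq0 // gt_eqF // ltr_wpDl.
have -> : l * b + l ^+ 2 * a = l * (b + l * a) by ring.
rewrite pmulr_rge0 // => h1; have := ler_norm a => h2.
have := ler_wpM2l (ltW l0) h2; lra.
Qed.

(** With weights d m b at a and d a m at b, betweenness makes the form vanish when the third weight
    is 0. For a small third weight the first-order coefficient must then be nonnegative, and this is
    Stewart's inequality. *)
Lemma copositive_stewart : copositive -> stewart X.
Proof.
move=> H a m b x bt.
have l1 := mdist_ge0 m b; have l2 := mdist_ge0 a m.
suff : 0 <= d m b * (d m a ^+ 2 + d m x ^+ 2 - d a x ^+ 2) + d a m * (d m b ^+ 2 + d m x ^+ 2 - d b x ^+ 2).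
  by rewrite -bt (metric_sym m a); lra.
apply: (@ge0_of_quadratic (d m x ^+ 2)) => l l0.
have := H m a b x _ _ _ l1 l2 (ltW l0); rewrite /cform -bt (metric_sym m a); lra.
Qed.

Lemma cform_apex (x1 x2 x3 : X) l1 l2 l3 : 0 <= l2 -> 0 <= l3 ->
  0 <= cform x1 x1 x2 x3 l1 l2 l3.
Proof.
move=> h2 h3; rewrite /cform mdistxx.
have t : d x2 x3 <= d x1 x2 + d x1 x3 by rewrite (metric_sym x1 x2); exact: metric_triangle.
have t2 : d x2 x3 ^+ 2 <= (d x1 x2 + d x1 x3) ^+ 2.
  by rewrite ler_sqr ?nnegrE ?addr_ge0 ?mdist_ge0.
have l23 := mulr_ge0 h2 h3; have := ler_wpM2l l23 t2.
have := sqr_ge0 (l2 * d x1 x2 - l3 * d x1 x3); lra.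
Qed.

Lemma cformC12 (p x1 x2 x3 : X) l1 l2 l3 : cform p x1 x2 x3 l1 l2 l3 = cform p x2 x1 x3 l2 l1 l3.
Proof. by rewrite /cform (metric_sym x2 x1); ring. Qed.

Lemma cformC13 (p x1 x2 x3 : X) l1 l2 l3 : cform p x1 x2 x3 l1 l2 l3 = cform p x3 x2 x1 l3 l2 l1.
Proof. by rewrite /cform (metric_sym x3 x1) (metric_sym x3 x2) (metric_sym x2 x1); ring. Qed.

Hypothesis St : stewart X.
Hypothesis segX : forall a b : X, exists g, segment a b g.

Lemma geodesic_to (p q : X) : p <> q -> exists g : geodesic p, glen g = d p q /\ gend g = q.
Proof.
by move=> pq; have [f sf] := segX p q; have [g [lg eg _]] := geodesic_of_segment sf pq; exists g.
Qed.

(** Since q is inside a path from p to x1, the angles of any direction at q with the two ends add up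
    to pi. The directions to x2 and x3 can thus be drawn in the plane on the two sides of that path,
    where they enclose at least the true angle. Hinge comparison bounds the form below by the square
    of a plane vector. *)
Lemma cform_interior (p q x1 x2 x3 : X) l1 l2 l3 : btw p q x1 -> p <> q -> q <> x1 ->
  0 <= l1 -> 0 <= l2 -> 0 <= l3 -> 0 <= cform q x1 x2 x3 l1 l2 l3.
Proof.
move=> bt pq qx1 l10 l20 l30.
have [<-|qx2] := pselect (q = x2); first by rewrite cformC12 cform_apex.
have [<-|qx3] := pselect (q = x3); first by rewrite cformC13 cform_apex.
have qp : q <> p by move/esym.
have [gp [lp ep]] := geodesic_to qp; have [g1 [le1 e1]] := geodesic_to qx1.
have [g2 [le2 e2]] := geodesic_to qx2; have [g3 [le3 e3]] := geodesic_to qx3.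
have op := opposite_of_btw bt pq qx1 lp ep le1 e1.
have An : angled q by exact: angled_stewart.
have Loc : local_stewart q by exists 1 => // u v w y _ _ _ _; exact: St.
have s2 := opposite_sum g2 An Loc op; have s3 := opposite_sum g3 An Loc op.
have t1 := angle_triangle g2 gp g3 An; have t2 := angle_triangle g2 g1 g3 An.
rewrite (angleC gp g3 An) in t1; rewrite (angleC g1 g3 An) in t2.
have b2 := angle_bound g2 gp; have b3 := angle_bound g3 gp; have b23 := angle_bound g2 g3.
have c1 : cos (angle g2 g1) = - cos (angle g2 gp).
  by rewrite (_ : angle g2 g1 = pi - angle g2 gp) ?cosB ?cospi ?sinpi; [ring|lra].
have c2 : cos (angle g3 g1) = - cos (angle g3 gp).
  by rewrite (_ : angle g3 g1 = pi - angle g3 gp) ?cosB ?cospi ?sinpi; [ring|lra].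
have a12 : angle g2 g1 = pi - angle g2 gp by lra.
have a13 : angle g3 g1 = pi - angle g3 gp by lra.
rewrite a12 a13 in t2.
set be := angle g2 gp in c1 t1 t2 b2 *; set ga := angle g3 gp in c2 t1 t2 b3 *.
have c3 : cos be * cos ga - sin be * sin ga <= cos (angle g2 g3).
  rewrite -cosD; have [bg|/ltW bg] := leP (be + ga) pi.
    by apply: cos_decr => //; apply/andP; split; lra.
  have -> : cos (be + ga) = cos (pi + pi - (be + ga)).
    by move: (be + ga) => y; rewrite -addrA addrC cosDpi cosB cospi sinpi; ring.
  by apply: cos_decr => //; [apply/andP; split; lra|lra].
have side x (k : geodesic q) y (h : geodesic q) (c : R) : gend k = x -> glen k = d q x ->
    gend h = y -> glen h = d q y -> cos (angle k h) = c ->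
    2 * d q x * d q y * c <= d q x ^+ 2 + d q y ^+ 2 - d x y ^+ 2.
  move=> ex lx ey ly <-.
  have hx : 0 < d q x <= glen k by rewrite -lx glen_gt0 lexx.
  have hy : 0 < d q y <= glen h by rewrite -ly glen_gt0 lexx.
  have xy0 : 0 <= 2 * d q x * d q y by rewrite !mulr_ge0 ?mdist_ge0.
  have := ler_wpM2l xy0 (angle_hinge St hx hy).
  by have := kap_dist hx hy; rewrite -lx -ly -/(gend k) -/(gend h) ex ey lx ly => ->; lra.
have h12 := side _ _ _ _ _ e2 le2 e1 le1 c1.
have h13 := side _ _ _ _ _ e3 le3 e1 le1 c2.
have h23 := side _ _ _ _ _ e2 le2 e3 le3 erefl.
rewrite (metric_sym x2 x1) in h12; rewrite (metric_sym x3 x1) in h13.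
rewrite /cform; set a1 := d q x1 in h12 h13 h23 *; set a2 := d q x2 in h12 h13 h23 *.
set a3 := d q x3 in h12 h13 h23 *.
have ll : 0 <= l2 * l3 * a2 * a3 by rewrite !mulr_ge0 ?mdist_ge0.
have k12 := ler_wpM2l (mulr_ge0 l10 l20) h12; have k13 := ler_wpM2l (mulr_ge0 l10 l30) h13.
have k23 := ler_wpM2l (mulr_ge0 l20 l30) h23; have k3 := ler_wpM2l ll c3.
(* the squared length of the sum of the plane vectors [l1 a1 (-1, 0)], [l2 a2 (cos be, sin be)] and [l3 a3 (cos ga, - sin ga)] *)
have sq : 0 <= (l1 * a1 - l2 * a2 * cos be - l3 * a3 * cos ga) ^+ 2
               + (l2 * a2 * sin be - l3 * a3 * sin ga) ^+ 2.
  by rewrite addr_ge0 ?sqr_ge0.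
have q2 : (l2 * a2) ^+ 2 = (l2 * a2 * cos be) ^+ 2 + (l2 * a2 * sin be) ^+ 2.
  by rewrite [(_ * cos be) ^+ 2]exprMn [(_ * sin be) ^+ 2]exprMn -mulrDr cos2Dsin2 mulr1.
have q3 : (l3 * a3) ^+ 2 = (l3 * a3 * cos ga) ^+ 2 + (l3 * a3 * sin ga) ^+ 2.
  by rewrite [(_ * cos ga) ^+ 2]exprMn [(_ * sin ga) ^+ 2]exprMn -mulrDr cos2Dsin2 mulr1.
by rewrite q2 q3; lra.
Qed.

(** The apex p is approximated by interior points of a geodesic to x1, where [cform_interior]
    applies; the form is continuous in the apex. *)
Lemma stewart_copositive : copositive.
Proof.
move=> p x1 x2 x3 l1 l2 l3 h1 h2 h3.
have [<-|px1] := pselect (p = x1); first exact: cform_apex.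
have [g [lg eg]] := geodesic_to px1.
pose u k : R := glen g / 2 * k.+1%:R^-1.
have u0 k : 0 < u k by rewrite mulr_gt0 ?Uinv_gt0 // divr_gt0 ?glen_gt0.
have ug k : u k < glen g.
  apply: (@le_lt_trans _ _ (glen g / 2)); last by have := glen_gt0 g; lra.
  by rewrite ler_piMr ?invf_le1 ?ltr0n ?ler1n // divr_ge0 // ltW ?glen_gt0.
have hu k : 0 < u k <= glen g by rewrite u0 ltW.
pose q k := gpath g (u k).
have qp : ucv q p.
  apply: (@ucv_le _ _ (fun=> p) q p u); first exact: ucv_cst.
    by rewrite -(mulr0 (glen g / 2)); exact: UM (Ucst _) Uinv.
  by apply: filterE => k /=; rewrite geodesic_dist.
have bt k : btw p (q k) x1.
  rewrite /btw /q -eg /gend geodesic_dist // geodesic_dist ?glen_gt0 ?lexx //.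
  rewrite gpath_isometry ?lexx ?ltW ?glen_gt0 ?u0 ?ug //.
  by rewrite distrC ger0_norm ?subr_ge0 ?ltW // subrKC.
have E (x : X) := ucv_d qp (ucv_cst x).
have X2 (a b : R) (v1 v2 v3 : nat -> R) A B C : Ulim v1 A -> Ulim v2 B -> Ulim v3 C ->
    Ulim (fun k => a * b * (v1 k ^+ 2 + v2 k ^+ 2 - v3 k ^+ 2)) (a * b * (A ^+ 2 + B ^+ 2 - C ^+ 2)).
  by move=> ? ? ?; apply: UM; [exact: Ucst|apply: UD; [apply: UD; exact: UX|exact/UN/UX]].
have lim : Ulim (fun k => cform (q k) x1 x2 x3 l1 l2 l3) (cform p x1 x2 x3 l1 l2 l3).
  do !apply: UD; try (by apply: UX; apply: UM; [exact: Ucst|exact: E]).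
  - by apply: X2; [exact: E|exact: E|exact: Ucst].
  - by apply: X2; [exact: E|exact: E|exact: Ucst].
  - by apply: X2; [exact: E|exact: E|exact: Ucst].
apply: (Ule (Ucst 0) lim); apply: filterE => k /=.
apply: (@cform_interior p) => //; first exact: gpath_neq (hu k).
move=> qx; have := bt k; rewrite /btw qx mdistxx addr0 -{2}qx /q geodesic_dist //.
by rewrite -lg => e; have := ug k; rewrite e ltxx.
Qed.
End copositive.

(* [rep x z]: the point [z] of the limit space is represented by the sequence [x], at the scales [lam]. *)
Record limit_system {R : realType} (X C : metricType R) (lam : nat -> R)
    (rep : (nat -> X) -> C -> Prop) : Prop := LimitSystem {
  ls_scale : forall k, 0 < lam k ;
  ls_ex : forall z, exists x, rep x z ;
  ls_dist : forall x y z w, rep x z -> rep y w -> Ulim (fun k => lam k * d (x k) (y k)) (d z w) }.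

(** Not every bounded sequence need have a limit in [C]; these closure properties are what the
    passage of segments and of continuations to the limit uses. *)
Record convex_limit {R : realType} (X C : metricType R) (lam : nat -> R)
    (rep : (nat -> X) -> C -> Prop) : Prop := ConvexLimit {
  cl_btw : forall x y m z w, rep x z -> rep y w -> (forall k, btw (x k) (m k) (y k)) -> exists u, rep m u ;
  cl_ext : forall x y m z w (L : R), rep x z -> rep y w -> z <> w ->
    (forall k, btw (x k) (y k) (m k)) -> (forall k, lam k * d (y k) (m k) <= L) -> exists u, rep m u }.

(** * Limits of rescaled ray spaces *)

Section limit_space.
Context {R : realType} {X C : metricType R} {lam : nat -> R} {rep : (nat -> X) -> C -> Prop}.
Hypothesis LS : limit_system lam rep.

Lemma limit_packing : uniform_packing X -> uniform_packing C.
Proof.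
have [l0 ex dist] := LS.
move=> pk e e0; have [K hK] := pk e e0; exists K => z0 r r0 N z zr zs.
have [x0 hx0] := ex z0; have /choice [x hx] : forall i, exists x, rep x (z i) by move=> i; exact: ex.
have U1 : ulf [set k | forall i, d (x0 k) (x i k) < r / lam k].
  apply: ulf_fin => i; have h := dist _ _ _ _ hx0 (hx i).
  have lt : - r < - d z0 (z i) by rewrite ltrN2.
  apply: filterS (Ugt (UN h) lt) => k /=; rewrite ltrN2 ltr_pdivlMr // mulrC //.
have U2 : ulf [set k | forall ij : 'I_N * 'I_N, ij.1 != ij.2 -> e * (r / lam k) < d (x ij.1 k) (x ij.2 k)].
  apply: ulf_fin => [[i j]] /=; have [->|ij] := eqVneq i j; first by apply: filterE.
  have h := dist _ _ _ _ (hx i) (hx j).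
  apply: filterS (Ugt h (zs i j ij)) => k /= + _.
  by rewrite mulrA ltr_pdivrMr // (mulrC (d _ _)).
have [k [/= h1 h2]] := filter_ex (filterI U1 U2).
apply: (hK (x0 k) (r / lam k) (divr_gt0 r0 (l0 k)) N (fun i => x i k) h1).
by move=> i j ij; exact: (h2 (i, j)).
Qed.

(** Points representing three points on a segment of the limit need not lie on a segment, so
    Stewart's inequality is not a closed condition as it stands. Copositivity is homogeneous in the
    distances and has no betweenness hypothesis, hence it passes to the limit. *)
Lemma limit_stewart : copositive (X := X) -> stewart C.
Proof.
have [l0 ex dist] := LS.
move=> H; apply: copositive_stewart => p x1 x2 x3 l1 l2 l3 h1 h2 h3.
have [q hq] := ex p; have [y1 hy1] := ex x1; have [y2 hy2] := ex x2; have [y3 hy3] := ex x3.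
have X2 (a b : R) (v1 v2 v3 : nat -> R) A B D : Ulim v1 A -> Ulim v2 B -> Ulim v3 D ->
    Ulim (fun k => a * b * (v1 k ^+ 2 + v2 k ^+ 2 - v3 k ^+ 2)) (a * b * (A ^+ 2 + B ^+ 2 - D ^+ 2)).
  by move=> ? ? ?; apply: UM; [exact: Ucst|apply: UD; [apply: UD; exact: UX|exact/UN/UX]].
have lim : Ulim (fun k => lam k ^+ 2 * cform (q k) (y1 k) (y2 k) (y3 k) l1 l2 l3) (cform p x1 x2 x3 l1 l2 l3).
  pose D (x y : nat -> X) k := lam k * d (x k) (y k).
  apply: (@Ueq _ (fun k => (l1 * D q y1 k) ^+ 2 + (l2 * D q y2 k) ^+ 2 + (l3 * D q y3 k) ^+ 2
      + l1 * l2 * (D q y1 k ^+ 2 + D q y2 k ^+ 2 - D y1 y2 k ^+ 2)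
      + l1 * l3 * (D q y1 k ^+ 2 + D q y3 k ^+ 2 - D y1 y3 k ^+ 2)
      + l2 * l3 * (D q y2 k ^+ 2 + D q y3 k ^+ 2 - D y2 y3 k ^+ 2))).
    by move=> k; rewrite /D /cform; ring.
  do !apply: UD; try (by apply: UX; apply: UM; [exact: Ucst|exact: dist]).
  - by apply: X2; exact: dist.
  - by apply: X2; exact: dist.
  - by apply: X2; exact: dist.
by apply: (Ule (Ucst 0) lim); apply: filterE => k /=; rewrite mulr_ge0 ?sqr_ge0 ?H.
Qed.

Hypothesis CL : convex_limit lam rep.

Lemma segment_dist (a b : X) g s : segment a b g -> 0 <= s <= d a b -> d a (g s) = s /\ d (g s) b = d a b - s.
Proof.
move=> [g0 g1 gi] hs; have /andP[s0 s1] := hs; have D0 := mdist_ge0 a b; split.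
  by rewrite -[X in d X _]g0 gi ?lexx ?D0 // sub0r normrN ger0_norm.
by rewrite -[X in d _ X]g1 gi ?lexx ?D0 // distrC ger0_norm ?subr_ge0.
Qed.

Lemma limit_segment : (forall a b : X, exists g, segment a b g) -> forall a b : C, exists g, segment a b g.
Proof.
have [l0 ex dist] := LS.
move=> segX a b; have [<-|ab] := pselect (a = b).
  exists (fun=> a); split=> // s t; rewrite mdistxx -!eq_le => /eqP <- /eqP <-.
  by rewrite subrr normr0.
have D0 := d_gt0 ab; set D := d a b in D0 *.
have [x hx] := ex a; have [y hy] := ex b.
have /choice [s hs] : forall k, exists g, segment (x k) (y k) g by move=> k; exact: segX.
pose T t k := t / D * d (x k) (y k).
have Tin t k : 0 <= t <= D -> 0 <= T t k <= d (x k) (y k).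
  move=> /andP[t0 tD]; rewrite /T mulr_ge0 ?divr_ge0 ?(ltW D0) ?mdist_ge0 //=.
  by rewrite ler_piMl ?mdist_ge0 // ler_pdivrMr // mul1r.
have /choice [g hg] : forall t, exists u, 0 <= t <= D -> rep (fun k => s k (T t k)) u.
  move=> t; have [ht|] := pselect (0 <= t <= D); last by exists a.
  have [|u hu] := cl_btw CL hx hy (m := fun k => s k (T t k)); last by exists u.
  by move=> k; rewrite /btw; have [-> ->] := segment_dist (hs k) (Tin t k ht); rewrite subrKC.
have same (u v : nat -> X) z w : (forall k, u k = v k) -> rep u z -> rep v w -> z = w.
  move=> uv hu hv; apply: mdist_positivity; apply: (Uuniq (dist _ _ _ _ hu hv)).
  by apply: Ueq (Ucst 0) => k; rewrite uv mdistxx mulr0.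
exists g; split.
- apply: (same _ _ _ _ _ (hg 0 _) hx); last by rewrite lexx ltW.
  by move=> k; rewrite /T !mul0r; have [-> _ _] := hs k.
- apply: (same _ _ _ _ _ (hg D _) hy); last by rewrite lexx ltW.
  by move=> k; rewrite /T divff ?gt_eqF // mul1r; have [_ -> _] := hs k.
- move=> t1 t2 ht1 ht2; apply: (Uuniq (dist _ _ _ _ (hg t1 ht1) (hg t2 ht2))).
  have E k : `|t1 - t2| / D * (lam k * d (x k) (y k)) = lam k * d (s k (T t1 k)) (s k (T t2 k)).
    have [_ _ ->] := hs k; rewrite ?Tin // /T -mulrBl normrM -mulrBl normrM (ger0_norm (mdist_ge0 _ _)).
    by rewrite normfV (gtr0_norm D0); ring.
  apply: (Ueq E); have := UM (Ucst (`|t1 - t2| / D)) (dist _ _ _ _ hx hy).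
  by rewrite divfK // gt_eqF.
Qed.

(** The path from a' to b' continues to b, hence it is the only shortest path between its ends.
    Points dividing segments between representatives of a' and b' in the right ratio therefore
    represent m, and the dichotomy can be applied to them. *)
Lemma limit_ext_shrunk (a a' m b' b : C) : ray_space X -> stewart C -> btw a a' m -> btw m b' b -> btw a m b ->
  a' <> m -> m <> b' -> b' <> b -> ext m a' \/ ext m b'.
Proof.
have [l0 ex dist] := LS; move=> [_ segX St extX] StC h1 h2 h3 am mb bb.
have h4 : btw a' m b := btw_l h1 h3.
have h5 : btw a' m b' by exact: (btw_r h4 h2).
have h6 : btw a' b' b.
  by move: h2 h4 h5; rewrite /btw; lra.
have am0 := d_gt0 am; have mb0 := d_gt0 mb.
have ab : a' <> b' by move=> E; move: h5; rewrite /btw E mdistxx (metric_sym b'); lra.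
have D0 := d_gt0 ab; set D := d a' b' in D0 *; pose th := d a' m / D.
have th01 : 0 <= th <= 1.
  by rewrite /th divr_ge0 ?mdist_ge0 //= ler_pdivrMr // mul1r /D -h5; lra.
have [x hx] := ex a'; have [y hy] := ex b'.
have /choice [n hn] : forall k, exists n, [/\ d (x k) n = th * d (x k) (y k),
     d n (y k) = d (x k) (y k) - th * d (x k) (y k) & btw (x k) n (y k)].
  move=> k; apply: (seg_point segX); have D1 := mdist_ge0 (x k) (y k).
  by case/andP: th01 => t0 t1; rewrite mulr_ge0 //= ler_piMl.
have [|n0 hn0] := cl_btw CL hx hy (m := n); first by move=> k; have [] := hn k.
have Dxy := dist _ _ _ _ hx hy; have Dxn := dist _ _ _ _ hx hn0; have Dny := dist _ _ _ _ hn0 hy.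
have e1 : d a' n0 = d a' m.
  apply: (Uuniq Dxn); have := UM (Ucst th) Dxy; rewrite /th divfK ?gt_eqF //; apply: Ueq => k.
  by have [-> _ _] := hn k; rewrite /th; ring.
have bt0 : btw a' n0 b'.
  rewrite /btw; apply: (Uuniq (UD Dxn Dny)); apply: Ueq Dxy => k.
  by have [-> -> _] := hn k; ring.
have nm : n0 = m by apply: (unique_of_btw StC h6 bb bt0 h5 e1).
rewrite nm in hn0 Dxn Dny.
have lim (u : nat -> X) c : rep u c -> m <> c -> ulf [set k | ext (n k) (u k)] -> ext m c.
  move=> hu mc hk L L0.
  have /choice [w hw] : forall k, exists w, (ext (n k) (u k) ->
      d (n k) w = d (n k) (u k) + L / lam k /\ d (u k) w = L / lam k) /\
      (btw (n k) (u k) w /\ lam k * d (u k) w <= L).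
    move=> k; have [ek|nek] := pselect (ext (n k) (u k)); last first.
      by exists (u k); rewrite /btw mdistxx mulr0 addr0.
    have [w [w1 w2]] := ek (L / lam k) (divr_ge0 L0 (ltW (l0 k))).
    exists w; split=> //; split; first by rewrite /btw w1 w2.
    by rewrite w2 mulrC divfK ?gt_eqF.
  have [| |w0 hw0] := cl_ext CL hn0 hu mc (m := w) (L := L).
  - by move=> k; have [_ []] := hw k.
  - by move=> k; have [_ []] := hw k.
  have Dnu := dist _ _ _ _ hn0 hu.
  exists w0; split.
    apply: (Uuniq (dist _ _ _ _ hn0 hw0)); have H := UD Dnu (Ucst L).
    apply: (Usq H H); apply: filterS hk => k /= ek.
    have [/(_ ek) [-> _] _] := hw k.
    by rewrite mulrDr (mulrC _ (L / _)) divfK ?gt_eqF // lexx.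
  apply: (Uuniq (dist _ _ _ _ hu hw0)); apply: (Usq (Ucst L) (Ucst L)); apply: filterS hk => k /= ek.
  have [/(_ ek) [_ ->] _] := hw k.
  by rewrite mulrC divfK ?gt_eqF // lexx.
have U : ulf ([set k | ext (n k) (x k)] `|` [set k | ext (n k) (y k)]).
  apply: filterS (filterI (Ugt Dxn am0) (Ugt Dny mb0)) => k /= [p1 p2].
  have [_ _ bk] := hn k; apply: (extX _ _ _ bk).
    by move=> E; move: p1; rewrite E mdistxx mulr0 ltxx.
  by move=> E; move: p2; rewrite E mdistxx mulr0 ltxx.
have [h|h] := Uor U.
  by left; apply: (lim x) => // /esym.
by right; exact: (lim y).
Qed.

(** The end points are replaced by points a little inside, [limit_ext_shrunk] is applied, and the
    inner points are sent back to the ends. *)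
Lemma limit_ray_space : ray_space X -> proper_metric C -> ray_space C.
Proof.
move=> RX pC; have StC := limit_stewart (stewart_copositive (rs_stewart RX) (rs_segment RX)).
have segC := limit_segment (rs_segment RX); split=> // a m b bt am mb.
have am0 := d_gt0 am; have mb0 := d_gt0 mb.
pose u k : R := k.+1%:R^-1 / 2.
have u0 k : 0 < u k by rewrite divr_gt0 ?Uinv_gt0.
have u1 k : u k < 1.
  have : k.+1%:R^-1 <= 1 :> R by rewrite invf_le1 ?ltr0n // ler1n.
  by rewrite /u ltr_pdivrMr // mul1r => /le_lt_trans; apply; lra.
have uu : Ulim u 0 by rewrite -(mul0r 2^-1); exact: UM Uinv (Ucst _).
have pick (p q : C) : 0 < d p q -> exists v : nat -> C, ucv v p /\ forall k, [/\ btw p (v k) q, v k <> p & v k <> q].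
  move=> pq0; have /choice [v hv] : forall k, exists v, [/\ d p v = u k * d p q, d v q = d p q - u k * d p q & btw p v q].
    move=> k; apply: (seg_point segC); have := u0 k; have := u1 k => h1 h2.
    by rewrite mulr_ge0 ?(ltW h2) ?(ltW pq0) //= ler_piMl ?ltW.
  exists v; split.
    apply: (@ucv_le _ _ (fun=> p) v p (fun k => u k * d p q)); first exact: ucv_cst.
      by rewrite -(mul0r (d p q)); exact: UM uu (Ucst _).
    by apply: filterE => k /=; have [-> _ _] := hv k.
  move=> k; have [e1 e2 e3] := hv k; have p1 := mulr_gt0 (u0 k) pq0.
  split=> // E; first by move: p1; rewrite -e1 E mdistxx ltxx.
  move: e2; rewrite E mdistxx => e2.
  have : u k * d p q < 1 * d p q by rewrite ltr_pM2r.
  by rewrite mul1r; lra.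
have [v [va vP]] := pick a m am0; rewrite metric_sym in mb0.
have [w [wb wP]] := pick b m mb0.
have all k : ext m (v k) \/ ext m (w k).
  have [v1 v2 v3] := vP k; have [w1 w2 w3] := wP k.
  by apply: (limit_ext_shrunk RX StC v1 (btwC w1) bt v3) => //; move/esym.
have U : ulf ([set k | ext m (v k)] `|` [set k | ext m (w k)]) by apply: filterE.
have [h|h] := Uor U.
  by left=> L L0; apply: (ext_lim pC (ucv_cst m) va); apply: filterS h => k; exact.
by right=> L L0; apply: (ext_lim pC (ucv_cst m) wb); apply: filterS h => k; exact.
Qed.
End limit_space.

(** * Asymptotic cones are ray spaces *)

Section asymptotic.
Context {R : realType} {X C : metricType R} {p : X} {o : C}.

Lemma Uscale_le1 (k : nat) : k.+1%:R^-1 <= 1 :> R.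
Proof. by rewrite invf_le1 ?ltr0n // ler1n. Qed.

Lemma ulf_large (B : R) : ulf [set k : nat | B < k%:R].
Proof.
apply: filterS (ulf_ge (Num.truncn B).+1) => k /= h.
by apply: lt_le_trans (truncnS_gt _) _; rewrite ler_nat.
Qed.

(** The Gromov-Hausdorff approximations with radius k + 1 and error 1 / (k + 1) turn the cone into a
    limit along the ultrafilter: a sequence represents the limit of its images if it stays at
    bounded rescaled distance from p. *)
Lemma asymptotic_limit : asymptotic_cone p o -> exists lam rep,
  @limit_system R X C lam rep /\ (proper_metric C -> convex_limit lam rep).
Proof.
move=> [_ near].
have /choice [lf lfP] : forall k : nat, exists lf : R * (X -> C), [/\ 0 < lf.1, lf.2 p = o,
    forall x y, lf.1 * d p x < k.+1%:R -> lf.1 * d p y < k.+1%:R ->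
      `|d (lf.2 x) (lf.2 y) - lf.1 * d x y| < k.+1%:R^-1
    & forall z, d o z < k.+1%:R - k.+1%:R^-1 ->
      exists2 x, lf.1 * d p x < k.+1%:R & d (lf.2 x) z < k.+1%:R^-1].
  move=> k; have r0 : 0 < k.+1%:R :> R by [].
  have pos : \forall eps \near (0 : R)^'+, 0 < eps by exact: nbhs_right_gt.
  have [eps [e0 [f [h1 h2 h3]]]] := filter_ex (filterI pos (near k.+1%:R k.+1%:R^-1 r0 (Uinv_gt0 k))).
  by exists (eps, f).
pose lam k := (lf k).1; pose f k := (lf k).2.
have l0 k : 0 < lam k by have [] := lfP k.
have fp k : f k p = o by have [] := lfP k.
pose rep x z := (exists B, forall k, lam k * d p (x k) <= B) /\ ucv (fun k => f k (x k)) z.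
have dist x y : (exists B, forall k, lam k * d p (x k) <= B) -> (exists B, forall k, lam k * d p (y k) <= B) ->
    ulf [set k | `|d (f k (x k)) (f k (y k)) - lam k * d (x k) (y k)| < k.+1%:R^-1].
  move=> [B hB] [B' hB']; apply: filterS (filterI (ulf_large B) (ulf_large B')) => k /= [h1 h2].
  have [_ _ h _] := lfP k; apply: h; rewrite -natr1.
    by have := hB k; rewrite /lam; lra.
  by have := hB' k; rewrite /lam; lra.
have pB : exists B, forall k, lam k * d p ((fun=> p) k) <= B by exists 0 => k; rewrite mdistxx mulr0.
exists lam, rep; split.
  split=> // [z|x y z w [xB xz] [yB yw]].
    have /choice [x hx] : forall k, exists x, lam k * d p x <= d o z + 2 /\
        (d o z < k%:R -> d (f k x) z < k.+1%:R^-1).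
      move=> k; have [_ _ h1 h2] := lfP k; have e1 := Uscale_le1 k.
      have [dk|dk] := ltP (d o z) k%:R; last first.
        by exists p; rewrite mdistxx mulr0; split=> //; have := mdist_ge0 o z; lra.
      have [|x x1 x2] := h2 z; first by rewrite -[X in X - _]natr1; set e := _^-1 in e1 *; lra.
      exists x; split=> //; have := h1 p x; rewrite mdistxx mulr0 -/(lam k) -/(f k) fp => /(_ (ltr0Sn _ _) x1).
      rewrite ltr_norml => /andP[h3 h4]; have := metric_triangle o z (f k x).
      by move: e1 x2 h3; rewrite (metric_sym z) -/(lam k) -/(f k); set e := k.+1%:R^-1; lra.
    exists x; split; first by exists (d o z + 2) => k; have [] := hx k.
    apply: (@ucv_le _ _ (fun=> z) _ z (fun k => k.+1%:R^-1)); [exact: ucv_cst|exact: Uinv|].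
    apply: filterS (ulf_large (d o z)) => k /= dk; have [_ /(_ dk) h] := hx k.
    by rewrite metric_sym ltW.
  have H := ucv_d xz yw.
  have H1 := UD H (UN Uinv); rewrite subr0 in H1; have H2 := UD H Uinv; rewrite addr0 in H2.
  apply: (Usq H1 H2); apply: filterS (dist x y xB yB) => k /=.
  by rewrite ltr_norml => /andP[]; set e := k.+1%:R^-1 in H1 H2 *; set D := d (f k _) _; set D' := _ * _ => h1 h2; apply/andP; split; lra.
move=> pC.
have bounded m : (exists B, forall k, lam k * d p (m k) <= B) -> exists u, rep m u.
  move=> mB; have [B hB] := mB; have [|v vb||u hu] := @ucv_eventually _ _ [set c | d o c <= B + 1] (fun k => f k (m k)).
  - exists o; rewrite /= mdistxx; apply: addr_ge0 => //; apply: le_trans (hB 0%N).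
    by rewrite mulr_ge0 ?mdist_ge0 // ltW.
  - exact: (pC v o (B + 1)).
  - apply: filterS (dist _ _ pB mB) => k /=; rewrite fp ltr_norml => /andP[h1 h2].
    by have := hB k; move: h2; have := Uscale_le1 k; set e := _^-1; lra.
  - by exists u.
split=> [x y m z w [[B hB] _] [[B' hB'] _] bt|x y m z w L _ [[B hB] _] _ _ hL]; apply: bounded.
  exists (B + (B + B')) => k.
  have t1 := metric_triangle p (x k) (m k); have t2 := metric_triangle (x k) p (y k).
  have t3 := bt k; rewrite /btw (metric_sym (x k) p) in t2 t3.
  have t4 : d p (m k) <= d p (x k) + (d p (x k) + d p (y k)) by have := mdist_ge0 (m k) (y k); lra.
  have := ler_wpM2l (ltW (l0 k)) t4; rewrite !mulrDr; have := hB k; have := hB' k; lra.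
exists (B + L) => k; have t1 := metric_triangle p (y k) (m k).
have := ler_wpM2l (ltW (l0 k)) t1; rewrite !mulrDr; have := hB k; have := hL k; lra.
Qed.

Lemma asymptotic_cone_ray_space : ray_space X -> uniform_packing X -> asymptotic_cone p o -> ray_space C.
Proof.
move=> RX pk AC; have [cC _] := AC; have [lam [rep [LS CL]]] := asymptotic_limit AC.
have pC : proper_metric C.
  move=> u x r ur; have r0 : 0 <= r := le_trans (mdist_ge0 _ _) (ur 0%N).
  have r1 : 0 < r + 1 by lra.
  apply: (@packing_ulim _ _ cC [set y | d x y < r + 1]) => [s s0|k]; last by rewrite /=; have := ur k; lra.
  have [K hK] := limit_packing LS pk (divr_gt0 s0 r1); exists K => N z zr zs.
  by apply: (hK x (r + 1) r1 N z zr); rewrite divfK ?gt_eqF.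
exact: (limit_ray_space LS (CL pC) RX pC).
Qed.
End asymptotic.

(** * Trigonometry of Euclidean cones *)

Section trigonometry.
Context {R : realType}.
Implicit Types (x y z A B D : R).

Lemma sin_mean x : 0 <= x -> exists2 c, 0 <= c <= x & sin x = x * cos c.
Proof.
move=> x0.
have h1 y : y \in `]0, x[ -> is_derive y 1 (@sin R) (cos y) by move=> _; exact: is_derive_sin.
have h2 : {within `[0, x], continuous (@sin R)} by apply/continuous_subspaceT => ?; exact: continuous_sin.
have [c] := MVT_segment x0 h1 h2.
rewrite in_itv /= => hc; rewrite sin0 !subr0 mulrC => h.
by exists c.
Qed.

Lemma sin_le x : 0 <= x -> sin x <= x.
Proof. by move=> x0; have [c _ ->] := sin_mean x0; rewrite ler_piMr ?cos_le1. Qed.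

Lemma sin_ge x : 0 <= x <= pi -> x * cos x <= sin x.
Proof.
move=> /andP[x0 xp]; have [c /andP[c0 cx] ->] := sin_mean x0; apply: ler_wpM2l => //.
by apply: cos_decr => //; rewrite ?x0 ?c0 ?(le_trans cx).
Qed.

Lemma sin_pos_of_lt x y : 0 <= x <= pi -> 0 <= y <= pi -> 0 < sin (x - y) -> y < x.
Proof.
move=> /andP[x0 xp] /andP[y0 yp] h; rewrite ltNge; apply/negP => xy.
have : 0 <= sin (y - x) by apply: sin_ge0_pi; apply/andP; split; lra.
by rewrite -opprB sinN; lra.
Qed.

Lemma sin_ge0_le x y : 0 <= x < pi -> 0 <= y < pi -> 0 <= sin (x - y) -> y <= x.
Proof.
move=> /andP[x0 xp] /andP[y0 yp] h; rewrite leNgt; apply/negP => xy.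
have : 0 < sin (y - x) by apply: sin_gt0_pi; apply/andP; split; lra.
by rewrite -opprB sinN; lra.
Qed.

Lemma sin_eq0_eq x y : 0 <= x < pi -> 0 <= y < pi -> sin (x - y) = 0 -> x = y.
Proof.
move=> /andP[x0 xp] /andP[y0 yp] s0; apply/eqP; rewrite eq_le; apply/andP; split; rewrite leNgt; apply/negP => lt.
  have : 0 < sin (x - y) by apply: sin_gt0_pi; apply/andP; split; lra.
  by rewrite s0 ltxx.
have : 0 < sin (y - x) by apply: sin_gt0_pi; apply/andP; split; lra.
by rewrite -opprB sinN s0 oppr0 ltxx.
Qed.

Lemma cos_inj_pi x y : 0 <= x <= pi -> 0 <= y <= pi -> cos x = cos y -> x = y.
Proof.
move=> hx hy h; apply/eqP; rewrite eq_le; apply/andP.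
by split; apply: cos_anti; rewrite ?h.
Qed.

Lemma plane_cauchy (x y p q p' q' : R) : 0 <= x -> 0 <= y -> x ^+ 2 = p ^+ 2 + q ^+ 2 ->
  y ^+ 2 = p' ^+ 2 + q' ^+ 2 -> - (p * p' + q * q') <= x * y.
Proof.
move=> x0 y0 hx hy; have xy := mulr_ge0 x0 y0.
rewrite leNgt; apply/negP => lt.
have : (x * y) ^+ 2 < (- (p * p' + q * q')) ^+ 2 by rewrite ltr_sqr ?nnegrE // (le_trans xy) // ltW.
rewrite exprMn hx hy; have := sqr_ge0 (p * q' - q * p'); lra.
Qed.

(* A point [v] between [u] and [w] in a Euclidean cone: the angles at the apex add up, and [v] has the position predicted by the plane. *)
Lemma cone_law (x y z r1 r2 r3 A B D : R) : 0 <= x -> 0 <= y -> x + y = z ->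
  0 < r1 -> 0 < r2 -> 0 < r3 -> 0 <= A <= pi -> 0 <= B <= pi -> 0 <= D <= pi -> D <= A + B ->
  x ^+ 2 = r1 ^+ 2 + r2 ^+ 2 - 2 * r1 * r2 * cos A ->
  y ^+ 2 = r2 ^+ 2 + r3 ^+ 2 - 2 * r2 * r3 * cos B ->
  z ^+ 2 = r1 ^+ 2 + r3 ^+ 2 - 2 * r1 * r3 * cos D ->
  [/\ D = A + B, z * (r2 * cos A - r1) = x * (r3 * cos D - r1), z * (r2 * sin A) = x * (r3 * sin D)
    & x * (r3 * cos B - r2) = y * (r2 - r1 * cos A) /\ x * (r3 * sin B) = y * (r1 * sin A)].
Proof.
move=> x0 y0 xyz r10 r20 r30 hA hB hD DAB hx hy hz.
have /andP[A0 A1] := hA; have /andP[B0 B1] := hB; have /andP[D0 D1] := hD.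
have sA : sin A ^+ 2 = 1 - cos A ^+ 2 by rewrite -(cos2Dsin2 A); ring.
have sB : sin B ^+ 2 = 1 - cos B ^+ 2 by rewrite -(cos2Dsin2 B); ring.
have sD : sin D ^+ 2 = 1 - cos D ^+ 2 by rewrite -(cos2Dsin2 D); ring.
have z0 : 0 <= z by lra.
have DE : D = A + B.
  have [AB|AB] := leP (A + B) pi.
    have hAB : 0 <= A + B <= pi by apply/andP; split; lra.
    have cAB : cos (A + B) <= cos D by exact: cos_decr.
    apply: cos_inj_pi => //; apply/eqP; rewrite eq_le cAB andbT.
    have := @plane_cauchy x y (r1 * cos A - r2) (- (r1 * sin A)) (r3 * cos B - r2) (r3 * sin B) x0 y0.
    rewrite hx hy sqrrN !sqrrB !exprMn sA sB => /(_ (ltac:(ring)) (ltac:(ring))) h.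
    have r13 : 0 < r1 * r3 by rewrite mulr_gt0.
    rewrite -(ler_pM2l r13) cosD.
    have : z ^+ 2 = x ^+ 2 + y ^+ 2 + 2 * (x * y) by rewrite -xyz; ring.
    by rewrite hx hy hz; lra.
  have cAB : cos A < - cos B.
    have -> : - cos B = cos (pi - B) by rewrite cosB cospi sinpi; ring.
    by rewrite ltr_cos ?in_itv /= ?A0 ?A1 //; [lra|apply/andP; split; lra].
  have px : r1 - r2 * cos A <= x.
    have [h|/ltW h] := leP (r1 - r2 * cos A) 0; first exact: le_trans h x0.
    rewrite -ler_sqr ?nnegrE // hx; have := mulr_ge0 (sqr_ge0 r2) (sqr_ge0 (sin A)).
    by rewrite sA; lra.
  have py : r3 - r2 * cos B <= y.
    have [h|/ltW h] := leP (r3 - r2 * cos B) 0; first exact: le_trans h y0.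
    rewrite -ler_sqr ?nnegrE // hy; have := mulr_ge0 (sqr_ge0 r2) (sqr_ge0 (sin B)).
    by rewrite sB; lra.
  have pz : z <= r1 + r3.
    rewrite -ler_sqr ?nnegrE ?addr_ge0 ?(ltW r10) ?(ltW r30) // hz.
    have c1 : 0 <= 1 + cos D by have := cos_geN1 D; lra.
    have := mulr_ge0 (mulr_ge0 (ltW r10) (ltW r30)) c1; lra.
  have c0 : 0 < - cos B - cos A by lra.
  by have := mulr_gt0 r20 c0; lra.
have cB : cos B = cos D * cos A + sin D * sin A by rewrite -cosB DE addrAC subrr add0r.
have sBE : sin B = sin D * cos A - cos D * sin A by rewrite -sinB DE addrAC subrr add0r.
have yE : y = z - x by lra.
have sq : (z * (r2 * cos A - r1) - x * (r3 * cos D - r1)) ^+ 2 + (z * (r2 * sin A) - x * (r3 * sin D)) ^+ 2 = 0.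
  have e1 : (z * (r2 * cos A - r1) - x * (r3 * cos D - r1)) ^+ 2 + (z * (r2 * sin A) - x * (r3 * sin D)) ^+ 2
    = z ^+ 2 * (r2 ^+ 2 * (cos A ^+ 2 + sin A ^+ 2) + r1 ^+ 2 - 2 * r1 * r2 * cos A)
      + x ^+ 2 * (r3 ^+ 2 * (cos D ^+ 2 + sin D ^+ 2) + r1 ^+ 2 - 2 * r1 * r3 * cos D)
      - z * x * (2 * r2 * r3 * (cos D * cos A + sin D * sin A) - 2 * r1 * r2 * cos A - 2 * r1 * r3 * cos D
         + 2 * r1 ^+ 2) by ring.
  rewrite e1 !cos2Dsin2 -cB.
  have e2 : 2 * r2 * r3 * cos B = r2 ^+ 2 + r3 ^+ 2 - (z - x) ^+ 2 by rewrite -yE hy; ring.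
  have e3 : 2 * r1 * r2 * cos A = r1 ^+ 2 + r2 ^+ 2 - x ^+ 2 by rewrite hx; ring.
  have e4 : 2 * r1 * r3 * cos D = r1 ^+ 2 + r3 ^+ 2 - z ^+ 2 by rewrite hz; ring.
  by rewrite e2 e3 e4; ring.
move/eqP: sq; rewrite paddr_eq0 ?sqr_ge0 // !sqrf_eq0 !subr_eq0 => /andP[/eqP q1 /eqP q2].
split=> //.
have s2A : cos A ^+ 2 + sin A ^+ 2 = 1 := cos2Dsin2 A.
split.
  have -> : x * (r3 * cos B - r2) = cos A * (x * (r3 * cos D - r1)) + sin A * (x * (r3 * sin D)) + x * r1 * cos A - x * r2.
    by rewrite cB; ring.
  rewrite -q1 -q2 yE.
  have -> : cos A * (z * (r2 * cos A - r1)) + sin A * (z * (r2 * sin A)) = z * r2 * (cos A ^+ 2 + sin A ^+ 2) - z * r1 * cos A by ring.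
  by rewrite s2A; ring.
have -> : x * (r3 * sin B) = cos A * (x * (r3 * sin D)) - sin A * (x * (r3 * cos D - r1)) - x * r1 * sin A.
  by rewrite sBE; ring.
by rewrite -q1 -q2 yE; ring.
Qed.
End trigonometry.

(** * Euclidean cones and segments of their bases *)

Record cone_over {R : realType} (C Y : metricType R) (o : C) (c : R * Y -> C) : Prop := ConeOver {
  co_pi : forall x y : Y, d x y <= pi ;
  co_apex : forall x, c (0, x) = o ;
  co_dist : forall u v, 0 <= u.1 -> 0 <= v.1 -> d (c u) (c v) = cone_dist u v ;
  co_surj : forall x, x = o \/ exists2 u, 0 <= u.1 & c u = x }.

Section cone.
Context {R : realType} {C Y : metricType R} {o : C} {c : R * Y -> C}.
Hypothesis CO : cone_over o c.
Implicit Types (x y p : Y) (r s t : R).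

Lemma angle_in x y : 0 <= d x y <= pi.
Proof. by rewrite mdist_ge0 (co_pi CO). Qed.

Lemma cone_dist2 r s x y : 0 <= r -> 0 <= s ->
  d (c (r, x)) (c (s, y)) ^+ 2 = r ^+ 2 + s ^+ 2 - 2 * r * s * cos (d x y).
Proof.
move=> r0 s0; rewrite (co_dist CO) // /cone_dist /= min_l ?(co_pi CO) // sqr_sqrtr //.
have := mulr_ge0 (mulr_ge0 r0 s0) (_ : 0 <= 1 - cos (d x y)).
by rewrite subr_ge0 cos_le1 => /(_ isT); have := sqr_ge0 (r - s); lra.
Qed.

Lemma cone_dist_apex r x : 0 <= r -> d o (c (r, x)) = r.
Proof.
move=> r0; apply/eqP; rewrite -(@eqrXn2 _ 2) ?mdist_ge0 // -(co_apex CO x) cone_dist2 //.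
by rewrite expr0n mulr0 !mul0r subr0 add0r.
Qed.

Lemma cone_point z : z <> o -> exists r x, 0 < r /\ z = c (r, x).
Proof.
move=> zo; have [//|[[r x] /= r0 rx]] := co_surj CO z.
exists r, x; split=> //; rewrite lt_neqAle r0 andbT eq_sym; apply/eqP => re.
by apply: zo; rewrite -rx re (co_apex CO).
Qed.

Lemma unit_dist2 x y : d (c (1, x)) (c (1, y)) ^+ 2 = 2 - 2 * cos (d x y).
Proof. by rewrite cone_dist2 // expr1n; ring. Qed.

Lemma unit_inj x y : c (1, x) = c (1, y) -> x = y.
Proof.
move=> e; apply: mdist_positivity; apply: cos_ge1; first exact: angle_in.
by have := unit_dist2 x y; rewrite e mdistxx expr0n /=; lra.
Qed.

(* Betweenness in the cone away from the apex. *)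
Lemma cone_btw r1 r2 r3 x1 x2 x3 : 0 < r1 -> 0 < r2 -> 0 < r3 ->
  btw (c (r1, x1)) (c (r2, x2)) (c (r3, x3)) ->
  let x := d (c (r1, x1)) (c (r2, x2)) in let y := d (c (r2, x2)) (c (r3, x3)) in
  let A := d x1 x2 in let B := d x2 x3 in let D := d x1 x3 in
  [/\ D = A + B, (x + y) * (r2 * cos A - r1) = x * (r3 * cos D - r1),
    (x + y) * (r2 * sin A) = x * (r3 * sin D)
    & x * (r3 * cos B - r2) = y * (r2 - r1 * cos A) /\ x * (r3 * sin B) = y * (r1 * sin A)].
Proof.
move=> r10 r20 r30 bt x y A B D.
have hA : 0 <= A <= pi := angle_in x1 x2; have hB : 0 <= B <= pi := angle_in x2 x3.
have hD : 0 <= D <= pi := angle_in x1 x3.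
apply: (@cone_law _ x y (x + y) r1 r2 r3 A B D) => //; rewrite ?mdist_ge0 //.
- exact: metric_triangle.
- by rewrite cone_dist2 // ltW.
- by rewrite cone_dist2 // ltW.
- by rewrite bt cone_dist2 // ltW.
Qed.

Lemma ucv_unit (u : nat -> Y) y : ucv (fun k => c (1, u k)) (c (1, y)) -> ucv u y.
Proof.
move=> h; apply/ucvP => e e0.
have [ep|pe] := ltP pi e; first by apply: filterE => k /=; apply: le_lt_trans ep; exact: co_pi CO _ _.
have he : 0 <= e <= pi by rewrite ltW.
have c0 : 0 < 2 - 2 * cos e.
  have : cos e < 1 by rewrite -cos0 ltr_cos ?in_itv //= lexx pi_ge0.
  lra.
have hs : 0 < Num.sqrt (2 - 2 * cos e) by rewrite sqrtr_gt0.
move/ucvP: h => /(_ _ hs); apply: filterS => k /=.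
rewrite -ltr_sqr ?nnegrE ?mdist_ge0 ?sqrtr_ge0 // sqr_sqrtr ?(ltW c0) // unit_dist2 => h.
rewrite ltNge; apply/negP => h2.
by have := cos_decr (angle_in y (u k)) he h2; lra.
Qed.

Lemma cone_proper : proper_metric C -> proper_metric Y.
Proof.
move=> pC u x r _; have [|z hz] := pC (fun k => c (1, u k)) o 1.
  by move=> k; rewrite cone_dist_apex ?ler01.
have z1 : d o z = 1.
  apply: (Uuniq (ucv_d (ucv_cst o) hz)); apply: Ueq (Ucst 1) => k.
  by rewrite cone_dist_apex ?ler01.
have zo : z <> o by move=> E; move: z1; rewrite E mdistxx; lra.
have [s [y [s0 zE]]] := cone_point zo.
have s1 : s = 1 by rewrite -z1 zE cone_dist_apex // ltW.
by exists y; apply: ucv_unit; move: hz; rewrite zE s1.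
Qed.

Hypothesis segC : forall a b : C, exists g, segment a b g.

(** A segment of the cone between the unit points over x and y misses the apex, because their angle
    is below pi. Its radial projection, parametrized by the angle with x, is a shortest path of the
    base, since angles at the apex add up along a segment ([cone_btw]). *)
Lemma cone_segment x y : d x y < pi -> exists g, segment x y g.
Proof.
move=> Dpi; have [<-|xy] := pselect (x = y).
  exists (fun=> x); split=> // s t; rewrite mdistxx -!eq_le => /eqP <- /eqP <-.
  by rewrite subrr normr0.
have D0 := d_gt0 xy; set D := d x y in D0 Dpi *.
have hD : 0 <= D <= pi := angle_in x y.
set p := c (1, x); set q := c (1, y); set l := d p q.
have l2 : l ^+ 2 = 2 - 2 * cos D := unit_dist2 x y.
have pq : p <> q by move=> /unit_inj.
have l0 : 0 < l := d_gt0 pq.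
have [G sG] := segC p q; have [G0 G1 Gi] := sG.
have Gd u : 0 <= u <= l -> [/\ d p (G u) = u, d (G u) q = l - u & btw p (G u) q].
  by move=> hu; have [e1 e2] := segment_dist sG hu; split=> //; rewrite /btw e1 e2 -/l subrKC.
have po : d o p = 1 by rewrite cone_dist_apex.
have qo : d o q = 1 by rewrite cone_dist_apex.
have Go u : 0 <= u <= l -> G u <> o.
  move=> hu E; have [_ _] := Gd u hu; rewrite E /btw (metric_sym p) po qo => e.
  have c1 : cos D = -1 by move: l2; rewrite /l -e; lra.
  have : cos pi < cos D by rewrite ltr_cos ?in_itv /= ?hD ?lexx ?pi_ge0.
  by rewrite c1 cospi ltxx.
have /choice [rv rvP] : forall u, exists rv : R * Y, 0 <= u <= l -> 0 < rv.1 /\ G u = c rv.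
  move=> u; have [/Go /cone_point [r [v [r0 e]]]|] := pselect (0 <= u <= l); first by exists (r, v).
  by exists (0, x).
have pos u : 0 <= u <= l -> l * ((rv u).1 * cos (d x (rv u).2) - 1) = u * (cos D - 1) /\
    l * ((rv u).1 * sin (d x (rv u).2)) = u * sin D /\ d x (rv u).2 <= D.
  move=> hu; have [r0 e] := rvP u hu; have [e1 e2 bt] := Gd u hu.
  move: bt e1 e2; rewrite e; case: (rv u) r0 => r v /= r0 bt e1 e2.
  have [h1 h2 h3 _] := cone_btw ltr01 r0 ltr01 bt.
  move: h2 h3; rewrite -/p -/q e1 e2 addrC subrK !mul1r => h2 h3.
  by rewrite h2 h3 /D h1 lerDl mdist_ge0.
(* The point of the chord seen under the angle f divides it in the ratio of sin f to sin (D - f), by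
   the law of sines. *)
pose w f := sin f + sin (D - f); pose U f := l * sin f / w f.
have wp f : 0 <= f <= D -> [/\ 0 <= sin f, 0 <= sin (D - f) & 0 < w f].
  move=> /andP[f0 fD].
  have s1 : 0 <= sin f by apply: sin_ge0_pi; rewrite f0 (le_trans fD) ?ltW.
  have s2 : 0 <= sin (D - f) by apply: sin_ge0_pi; apply/andP; split; lra.
  split=> //; rewrite /w; have [f1|f1] := ltP 0 f.
    by rewrite ltr_pwDl // sin_gt0_pi // f1 (le_lt_trans fD).
  by rewrite ltr_wpDl // sin_gt0_pi //; apply/andP; split; lra.
have Ul f : 0 <= f <= D -> 0 <= U f <= l.
  move=> /wp [s1 s2 w0]; rewrite /U divr_ge0 ?mulr_ge0 ?(ltW l0) ?(ltW w0) //=.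
  by rewrite ler_pdivrMr // ler_wpM2l ?(ltW l0) // lerDl.
have ang f : 0 <= f <= D -> d x (rv (U f)).2 = f.
  move=> hf; have [e1 [e2 e3]] := pos _ (Ul f hf); have [r0 _] := rvP _ (Ul f hf).
  have [s1 s2 w0] := wp f hf; set A := d x _ in e1 e2 e3 *.
  apply: sin_eq0_eq; first by rewrite mdist_ge0 (le_lt_trans e3).
    by case/andP: hf => -> /le_lt_trans ->.
  have : l * (rv (U f)).1 * sin (A - f) = 0.
    rewrite sinB.
    have -> : l * (rv (U f)).1 * (sin A * cos f - cos A * sin f) =
       l * ((rv (U f)).1 * sin A) * cos f - (l * ((rv (U f)).1 * cos A - 1) + l) * sin f by ring.
    rewrite e1 e2.
    have -> : U f * sin D * cos f - (U f * (cos D - 1) + l) * sin f = U f * w f - l * sin f.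
      by rewrite /w sinB; ring.
    by rewrite /U divfK ?gt_eqF // subrr.
  by move/eqP; rewrite mulf_eq0 => /orP[|/eqP //]; rewrite gt_eqF // mulr_gt0.
have main f f' : 0 <= f <= D -> 0 <= f' <= D -> U f <= U f' -> d (rv (U f)).2 (rv (U f')).2 = `|f - f'|.
  move=> hf hf' ff; have [r0 e] := rvP _ (Ul f hf); have [r0' e'] := rvP _ (Ul f' hf').
  have a := ang f hf; have a' := ang f' hf'.
  have bt : btw p (G (U f)) (G (U f')).
    have [b1 _ _] := Gd _ (Ul f hf); have [b2 _ _] := Gd _ (Ul f' hf').
    rewrite /btw b1 b2 Gi ?Ul // distrC ger0_norm ?subr_ge0 //; ring.
  move: bt a a'; rewrite e e'; case: (rv (U f)) r0 => r v; case: (rv (U f')) r0' => r' v' /= r0' r0 bt a a'.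
  have [h _ _ _] := cone_btw ltr01 r0 r0' bt; rewrite a a' in h.
  by rewrite h opprD addrA subrr sub0r normrN ger0_norm ?mdist_ge0.
have ends f z : 0 <= f <= D -> d x z + d z y = D -> G (U f) = c (1, z) -> (rv (U f)).2 = z.
  move=> hf _ e; have [r0 e2] := rvP _ (Ul f hf); move: e2; rewrite e.
  case: (rv (U f)) r0 => r v /= r0 e2; apply: unit_inj; rewrite e2.
  by have <- : r = 1 by rewrite -(cone_dist_apex v (ltW r0)) -e2 cone_dist_apex.
exists (fun f => (rv (U f)).2); split.
- apply: ends; rewrite ?lexx ?(ltW D0) // ?mdistxx ?add0r //.
  by rewrite /U sin0 mulr0 mul0r G0.
- apply: ends; rewrite ?lexx ?(ltW D0) // ?mdistxx ?addr0 //.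
  have s0 : sin D != 0 by rewrite gt_eqF // sin_gt0_pi // D0.
  by rewrite /U /w subrr sin0 addr0 mulfK.
- move=> f f' hf hf'; have [ff|/ltW ff] := leP (U f) (U f'); first exact: main.
  by rewrite metric_sym distrC main.
Qed.
End cone.

(** * Plane polar coordinates and flat sectors of a cone *)

Section polar.
Context {R : realType}.
Implicit Types (a b r t l S th : R).

Definition rad a b := Num.sqrt (a ^+ 2 + b ^+ 2).
Definition arg a b := acos (a / rad a b).

Lemma rad_sq a b : rad a b ^+ 2 = a ^+ 2 + b ^+ 2.
Proof. by rewrite sqr_sqrtr // addr_ge0 ?sqr_ge0. Qed.

Lemma rad_ge0 a b : 0 <= rad a b. Proof. exact: sqrtr_ge0. Qed.

Lemma arg_div a b : -1 <= a / rad a b <= 1.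
Proof.
have [->|r0] := eqVneq (rad a b) 0; first by rewrite invr0 mulr0; lra.
have rp : 0 < rad a b by rewrite lt_neqAle eq_sym r0 rad_ge0.
rewrite ler_pdivlMr // ler_pdivrMr // mulN1r mul1r -ler_norml.
by rewrite -ler_sqr ?nnegrE ?rad_ge0 // real_normK ?num_real // rad_sq lerDl sqr_ge0.
Qed.

Lemma arg_in a b : 0 <= arg a b <= pi.
Proof. by rewrite acos_ge0 ?acos_lepi ?arg_div. Qed.

Lemma rad_cos a b : rad a b * cos (arg a b) = a.
Proof.
rewrite acosK ?in_itv /= ?arg_div //; have [r0|r0] := eqVneq (rad a b) 0; last by rewrite mulrC divfK.
have := rad_sq a b; rewrite r0 mul0r expr0n /= => /eqP; rewrite eq_sym paddr_eq0 ?sqr_ge0 //.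
by rewrite !sqrf_eq0 => /andP[/eqP ->].
Qed.

Lemma rad_sin a b : 0 <= b -> rad a b * sin (arg a b) = b.
Proof.
move=> b0; have /andP[a0 a1] := arg_in a b.
apply/eqP; rewrite -(@eqrXn2 _ 2) ?mulr_ge0 ?rad_ge0 ?sin_ge0_pi ?a0 //.
have := cos2Dsin2 (arg a b) => /(congr1 (fun x => rad a b ^+ 2 * x)).
rewrite mulrDr -!exprMn rad_cos mulr1 rad_sq => h; apply/eqP.
by apply: (addrI (a ^+ 2)); rewrite h.
Qed.

Lemma rad_polar r t : 0 <= r -> rad (r * cos t) (r * sin t) = r.
Proof. by move=> r0; rewrite /rad !exprMn -mulrDr cos2Dsin2 mulr1 sqrtr_sqr ger0_norm. Qed.

Lemma arg_polar r t : 0 < r -> 0 <= t <= pi -> arg (r * cos t) (r * sin t) = t.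
Proof. by move=> r0 ht; rewrite /arg rad_polar ?ltW // mulrC mulKf ?gt_eqF // cosK ?in_itv. Qed.

Lemma arg10 : arg 1 0 = 0 :> R.
Proof. by have := @arg_polar 1 0 ltr01; rewrite !mul1r cos0 sin0; apply; rewrite lexx pi_ge0. Qed.

Lemma line_arg S th : 0 < th < pi -> 0 <= S ->
  0 < rad (1 + S * cos th) (S * sin th) /\ arg (1 + S * cos th) (S * sin th) < pi.
Proof.
move=> hth S0; have st := sin_gt0_pi hth.
set a := 1 + _; set b := S * _; have b0 : 0 <= b by rewrite mulr_ge0 // ltW.
have r0 : 0 < rad a b.
  rewrite lt_neqAle rad_ge0 andbT eq_sym; apply/eqP => r0.
  have := rad_cos a b; have := rad_sin a b0; rewrite r0 !mul0r => /esym/eqP.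
  rewrite mulf_eq0 (gt_eqF st) orbF => /eqP h; rewrite /a h mul0r addr0 => ?; lra.
split=> //; have /andP[_ h] := arg_in a b; rewrite lt_neqAle h andbT; apply/eqP => e.
have := rad_cos a b; have := rad_sin a b0; rewrite e sinpi cospi mulr0 => /esym/eqP.
by rewrite mulf_eq0 (gt_eqF st) orbF => /eqP h2; have := rad_ge0 a b; rewrite {3}/a h2 mul0r addr0 => ? ?; lra.
Qed.

Lemma line_arg_le S th l : 0 < th < pi -> 0 < l < th -> 0 <= S <= sin l / sin (th - l) ->
  arg (1 + S * cos th) (S * sin th) <= l.
Proof.
move=> hth /andP[l0 lth] /andP[S0 SS]; have /andP[th0 thp] := hth.
have [r0 ap] := line_arg hth S0; have st := sin_gt0_pi hth.
have sd : 0 < sin (th - l) by apply: sin_gt0_pi; apply/andP; split; lra.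
have /andP[a0 _] := arg_in (1 + S * cos th) (S * sin th).
apply: sin_ge0_le; rewrite ?a0 ?(ltW l0) //=; first lra.
rewrite -(pmulr_rge0 _ r0) sinB.
have b0 : 0 <= S * sin th by rewrite mulr_ge0 // ltW.
have -> : forall r s c, r * (sin l * c - cos l * s) = sin l * (r * c) - cos l * (r * s).
  by move=> *; ring.
rewrite rad_cos rad_sin //.
have -> : sin l * (1 + S * cos th) - cos l * (S * sin th) = sin l - S * sin (th - l).
  by rewrite sinB; ring.
by rewrite subr_ge0 -ler_pdivlMr.
Qed.

Lemma line_end th l : 0 < th < pi -> 0 < l < th -> let S := sin l / sin (th - l) in
  let r := sin th / sin (th - l) in [/\ 0 < S, 0 < r, 1 + S * cos th = r * cos l & S * sin th = r * sin l].
Proof.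
move=> hth /andP[l0 lth] S r; have /andP[th0 thp] := hth; have st := sin_gt0_pi hth.
have sd : 0 < sin (th - l) by apply: sin_gt0_pi; apply/andP; split; lra.
have sl : 0 < sin l by apply: sin_gt0_pi; apply/andP; split; lra.
rewrite /S /r; split; rewrite ?divr_gt0 //; last by field; rewrite gt_eqF.
have -> : 1 + sin l / sin (th - l) * cos th = (sin (th - l) + sin l * cos th) / sin (th - l).
  by field; rewrite gt_eqF.
by rewrite [in X in X / _]sinB; field; rewrite gt_eqF.
Qed.

Lemma cos_norm t : cos `|t| = cos t.
Proof. by have [_|_] := ger0P t; rewrite ?cosN. Qed.
End polar.

Section geodesic_dichotomy.
Context {R : realType} {X : metricType R}.

Lemma geodesic_btw (q : X) (G : geodesic q) u v : 0 <= u <= v -> v <= glen G ->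
  btw q (gpath G u) (gpath G v).
Proof.
move=> /andP[u0 uv] vG; rewrite /btw !gpath_dist ?u0 ?(le_trans u0) ?(le_trans uv) //.
rewrite gpath_isometry ?u0 ?(le_trans uv) ?(le_trans u0) // distrC ger0_norm ?subr_ge0 //; ring.
Qed.

Lemma geodesic_dich (q : X) (G : geodesic q) : ray_space X ->
  ext q (gend G) \/ exists2 u, 0 < u < glen G & ext (gpath G u) q.
Proof.
move=> RX; have l0 := glen_gt0 G.
pose u k : R := glen G / 2 * k.+1%:R^-1.
have u0 k : 0 < u k by rewrite mulr_gt0 ?Uinv_gt0 // divr_gt0.
have ug k : u k < glen G.
  by apply: (@le_lt_trans _ _ (glen G / 2)); [rewrite ler_piMr ?Uscale_le1 // divr_ge0 // ltW|lra].
have hu k : 0 < u k <= glen G by rewrite u0 ltW.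
have mq : ucv (fun k => gpath G (u k)) q.
  apply: (@ucv_le _ _ (fun=> q) _ q u); first exact: ucv_cst.
    by rewrite -(mulr0 (glen G / 2)); exact: UM (Ucst _) Uinv.
  by apply: filterE => k /=; rewrite geodesic_dist.
have [||k E|h|[j h]] := ext_dich RX mq (a := gend G).
- by move=> k; apply: geodesic_btw; rewrite ?lexx // !ltW.
- by move=> k; exact: gpath_neq (hu k).
- have := geodesic_dist (hu k); rewrite E geodesic_dist ?l0 ?lexx // => e.
  by have := ug k; rewrite -e ltxx.
- by left.
- by right; exists (u j); rewrite // u0 ug.
Qed.
End geodesic_dichotomy.

Section sector.
Context {R : realType} {C Y : metricType R} {o : C} {c : R * Y -> C}.
Hypothesis CO : cone_over o c.
Implicit Types (a b r s t l S th : R).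

(* The point with plane coordinates [(a, b)], where [b >= 0], in the sector of the cone spanned by a geodesic. *)
Definition sector (p : Y) (g : geodesic p) a b := c (rad a b, gpath g (arg a b)).

Lemma sector_dist2 (p : Y) (g h : geodesic p) a b a' b' :
  d (sector g a b) (sector h a' b') ^+ 2 = a ^+ 2 + b ^+ 2 + a' ^+ 2 + b' ^+ 2
    - 2 * rad a b * rad a' b' * cos (d (gpath g (arg a b)) (gpath h (arg a' b'))).
Proof. by rewrite /sector (cone_dist2 CO) ?rad_ge0 // !rad_sq; ring. Qed.

Lemma sector_isometry (p : Y) (g : geodesic p) a b a' b' : 0 <= b -> 0 <= b' ->
  arg a b <= glen g -> arg a' b' <= glen g ->
  d (sector g a b) (sector g a' b') ^+ 2 = (a - a') ^+ 2 + (b - b') ^+ 2.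
Proof.
move=> b0 b0' ag ag'; have /andP[a0 _] := arg_in a b; have /andP[a0' _] := arg_in a' b'.
rewrite sector_dist2 gpath_isometry ?a0 ?a0' // cos_norm cosB.
have -> : 2 * rad a b * rad a' b' * (cos (arg a b) * cos (arg a' b') + sin (arg a b) * sin (arg a' b')) =
  2 * ((rad a b * cos (arg a b)) * (rad a' b' * cos (arg a' b')) + (rad a b * sin (arg a b)) * (rad a' b' * sin (arg a' b'))) by ring.
by rewrite !rad_cos !rad_sin //; ring.
Qed.

Lemma sector_polar (p : Y) (g : geodesic p) r t : 0 < r -> 0 <= t <= pi ->
  sector g (r * cos t) (r * sin t) = c (r, gpath g t).
Proof. by move=> r0 ht; rewrite /sector rad_polar ?ltW // arg_polar. Qed.

Lemma sector10 (p : Y) (g : geodesic p) : sector g 1 0 = c (1, p).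
Proof. by rewrite /sector arg10 gpath0 /rad expr1n expr0n addr0 sqrtr1. Qed.

Lemma sector_line (p : Y) (g : geodesic p) S T th : 0 < th < pi -> 0 <= S -> 0 <= T ->
  arg (1 + S * cos th) (S * sin th) <= glen g -> arg (1 + T * cos th) (T * sin th) <= glen g ->
  d (sector g (1 + S * cos th) (S * sin th)) (sector g (1 + T * cos th) (T * sin th)) = `|S - T|.
Proof.
move=> hth S0 T0 hS hT; have st := sin_gt0_pi hth.
apply/eqP; rewrite -(@eqrXn2 _ 2) ?mdist_ge0 // sector_isometry ?mulr_ge0 ?(ltW st) // real_normK ?num_real //.
have := cos2Dsin2 th => h; apply/eqP.
have -> : (1 + S * cos th - (1 + T * cos th)) ^+ 2 + (S * sin th - T * sin th) ^+ 2 =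
  (S - T) ^+ 2 * (cos th ^+ 2 + sin th ^+ 2) by ring.
by rewrite h mulr1.
Qed.

(** The sector over g is isometric to a plane sector. The lift is the straight line that leaves the
    point (1, 0) at angle th with the radius; its length is that at which the polar angle reaches
    l. *)
Lemma lift (p : Y) (g : geodesic p) th l : 0 < th < pi -> 0 < l < th -> l <= glen g ->
  exists G : geodesic (c (1, p)), [/\ glen G = sin l / sin (th - l),
    gend G = c (sin th / sin (th - l), gpath g l) &
    forall S, 0 <= S <= glen G -> gpath G S = sector g (1 + S * cos th) (S * sin th)].
Proof.
move=> hth hl lg; have [S0 r0 e1 e2] := line_end hth hl.
have [/andP[l0 lth] /andP[th0 thp]] := (hl, hth).
set S := _ / _ in S0 e1 e2.
have f0 : sector g (1 + 0 * cos th) (0 * sin th) = c (1, p) by rewrite !mul0r addr0 sector10.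
have fi s t : 0 <= s <= S -> 0 <= t <= S -> d (sector g (1 + s * cos th) (s * sin th))
    (sector g (1 + t * cos th) (t * sin th)) = `|s - t|.
  move=> hs ht; have [/andP[s0 _] /andP[t0 _]] := (hs, ht).
  by apply: sector_line => //; apply: le_trans lg; exact: line_arg_le.
exists (@Geodesic _ _ _ _ (fun s => sector g (1 + s * cos th) (s * sin th)) S0 f0 fi); split=> //.
by rewrite /gend /= e1 e2 sector_polar //; lra.
Qed.

(** The dichotomy is applied to the lift of g at angle th. Followed forwards to infinity, the polar
    angle of a plane line tends to th, so g is prolonged to all lengths below th. Followed backwards
    beyond the unit point over p, it tends to pi - th on the other side and yields geodesics
    opposite to g. *)
Lemma sector_dich (p : Y) (g : geodesic p) th : ray_space C -> 0 < th < pi ->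
  (forall r, r < th -> exists h : geodesic p, r <= glen h /\
     exists t0, [/\ 0 < t0, t0 <= glen g, t0 <= glen h & forall t, 0 <= t <= t0 -> gpath h t = gpath g t]) \/
  (forall r, r < pi - th -> exists h : geodesic p, r <= glen h /\ opposite h g).
Proof.
move=> RC hth; have /andP[th0 thp] := hth; have st := sin_gt0_pi hth.
have segC := rs_segment RC.
pose l := Num.min (glen g) (th / 2).
have lg : l <= glen g by rewrite ge_min lexx.
have l0 : 0 < l by rewrite lt_min glen_gt0 divr_gt0.
have lth : l < th by rewrite gt_min; apply/orP; right; lra.
have hl : 0 < l < th by rewrite l0.
have [G [lG eG pG]] := lift hth hl lg; have [S0 r20 e1 e2] := line_end hth hl.
rewrite -lG in S0 e1 e2; set r2 := sin th / _ in r20 e1 e2 eG.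
have q1 : d o (c (1, p)) = 1 by rewrite (cone_dist_apex CO).
have dqa : d (c (1, p)) (gend G) = glen G by rewrite geodesic_dist // S0 lexx.
have [E|[u hu E]] := geodesic_dich G RC; [left|right] => r1 hr1.
  pose r := Num.max r1 (th / 2).
  have rth : r < th by rewrite gt_max hr1; lra.
  have r0 : 0 < r by rewrite lt_max; apply/orP; right; lra.
  have sr : 0 < sin (th - r) by apply: sin_gt0_pi; apply/andP; split; lra.
  have srr : 0 < sin r by apply: sin_gt0_pi; apply/andP; split; lra.
  (* At length sin r / sin (th - r) the line has polar angle r, so continuing by [L] leads beyond
     r. *)
  pose L := 1 + sin r / sin (th - r).
  have L1 : 1 < L by rewrite ltrDl divr_gt0.
  have [w [w1 w2]] := E L (ltW (lt_trans ltr01 L1)); rewrite dqa in w1.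
  have wo : w <> o by move=> e; move: w1; rewrite e metric_sym q1; lra.
  have [ro [y [ro0 wE]]] := cone_point CO wo.
  have bt : btw (c (1, p)) (c (r2, gpath g l)) (c (ro, y)).
    by rewrite -eG -wE /btw dqa w1 w2.
  have [D1 D2 D3 _] := cone_btw CO ltr01 r20 ro0 bt.
  have dl : d p (gpath g l) = l by rewrite geodesic_dist // l0.
  rewrite -eG -wE dqa w2 dl -e1 -e2 in D2 D3.
  set D := d p y in D1 D2 D3; pose S := glen G + L.
  have S0n : glen G != 0 by rewrite gt_eqF.
  have c1 : ro * cos D = 1 + S * cos th.
    by apply: (mulfI S0n); rewrite /S; lra.
  have c2 : ro * sin D = S * sin th by apply: (mulfI S0n); rewrite /S; lra.
  have hD := angle_in CO p y; rewrite -/D in hD.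
  have SL : L < S by rewrite /S; lra.
  have rD : r < D.
    apply: sin_pos_of_lt => //; first by apply/andP; split; lra.
    rewrite -(pmulr_rgt0 _ ro0) sinB.
    have -> : ro * (sin D * cos r - cos D * sin r) = (ro * sin D) * cos r - (ro * cos D) * sin r by ring.
    rewrite c1 c2.
    have -> : S * sin th * cos r - (1 + S * cos th) * sin r = S * sin (th - r) - sin r by rewrite sinB; ring.
    rewrite subr_gt0 -ltr_pdivrMr //; apply: lt_trans SL; rewrite /L; lra.
  have Dpi : D < pi.
    case/andP: hD => _; rewrite le_eqVlt => /predU1P[e|//].
    have : 0 < S * sin th by rewrite mulr_gt0 // (lt_trans _ SL) // (lt_trans ltr01).
    by rewrite -c2 e sinpi mulr0 !ltxx.
  have [g1 [lg1 pg1]] := geodesic_restrict (ltac:(by rewrite l0 lg) : 0 < l <= glen g).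
  have eg1 : gend g1 = gpath g l by rewrite /gend lg1 pg1.
  have [||h [lh eh ph]] := @geodesic_concat _ _ p g1 y.
  - apply: (cone_segment CO segC); rewrite eg1.
    by move: D1; rewrite dl; lra.
  - by rewrite /btw eg1 dl -/D D1 dl.
  exists h; rewrite lh -/D; split; first by apply: le_trans (ltW rD); rewrite le_max lexx.
  exists l; split=> //; first by rewrite D1 dl lerDl mdist_ge0.
  by move=> t ht; rewrite ph ?lg1 // pg1.
pose r := Num.max r1 ((pi - th) / 2).
have rth : r < pi - th by rewrite gt_max hr1; lra.
have r0 : 0 < r by rewrite lt_max; apply/orP; right; lra.
have sr : 0 < sin (th + r) by apply: sin_gt0_pi; apply/andP; split; lra.
have srr : 0 < sin r by apply: sin_gt0_pi; apply/andP; split; lra.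
have /andP[u0 uG] := hu.
(* The corresponding length for the backward line, whose angle with the radius is pi - th. *)
pose L := 1 + sin r / sin (th + r).
have L1 : 1 < L by rewrite ltrDl divr_gt0.
have dqm : d (c (1, p)) (gpath G u) = u by rewrite geodesic_dist // u0 ltW.
have [w [w1 w2]] := E L (ltW (lt_trans ltr01 L1)); rewrite (metric_sym (gpath G u) (c (1, p))) dqm in w1.
have wo : w <> o by move=> e; move: w2; rewrite e metric_sym q1; lra.
have [ro [y [ro0 wE]]] := cone_point CO wo.
have mE : gpath G u = sector g (1 + u * cos th) (u * sin th) by rewrite pG // !ltW.
have [rm0 _] := line_arg hth (ltW u0).
have at1 : arg (1 + u * cos th) (u * sin th) <= l by apply: line_arg_le => //; rewrite -lG !ltW.
move: mE rm0 at1; rewrite /sector; set t := arg _ _; set rm := rad _ _ => mE rm0 tl.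
have c1 : rm * cos t = 1 + u * cos th by exact: rad_cos.
have c2 : rm * sin t = u * sin th by apply: rad_sin; rewrite mulr_ge0 // ltW.
have ht := arg_in (1 + u * cos th) (u * sin th); rewrite -/t in ht; have /andP[t0 tpi] := ht.
have tp : 0 < t.
  rewrite lt_neqAle t0 andbT; apply/eqP => e.
  have : 0 < u * sin th by rewrite mulr_gt0.
  by rewrite -c2 -e sin0 mulr0 ltxx.
have hgt : 0 < t <= glen g by rewrite tp (le_trans tl).
have bt : btw (c (rm, gpath g t)) (c (1, p)) (c (ro, y)).
  by rewrite -mE -wE /btw (metric_sym (gpath G u)) dqm w1 w2.
have [D1 _ _ [D2 D3]] := cone_btw CO rm0 ltr01 ro0 bt.
have dt : d (gpath g t) p = t by rewrite metric_sym geodesic_dist.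
rewrite -mE -wE w2 (metric_sym (gpath G u)) dqm dt in D2 D3; rewrite dt in D1.
set B := d p y in D1 D2 D3; have un : u != 0 by rewrite gt_eqF.
have b1 : ro * cos B = 1 - L * cos th by apply: (mulfI un); move: D2; rewrite c1; lra.
have b2 : ro * sin B = L * sin th by apply: (mulfI un); move: D3; rewrite c2; lra.
have hB := angle_in CO p y; rewrite -/B in hB.
have rB : r < B.
  apply: sin_pos_of_lt => //; first by apply/andP; split; lra.
  rewrite -(pmulr_rgt0 _ ro0) sinB.
  have -> : ro * (sin B * cos r - cos B * sin r) = (ro * sin B) * cos r - (ro * cos B) * sin r by ring.
  rewrite b1 b2.
  have -> : L * sin th * cos r - (1 - L * cos th) * sin r = L * sin (th + r) - sin r by rewrite sinD; ring.
  rewrite subr_gt0 -ltr_pdivrMr // /L; lra.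
have B0 : 0 < B by lra.
have Bpi : B < pi by have := angle_in CO (gpath g t) y; rewrite D1; lra.
have py : p <> y by move=> e; move: B0; rewrite /B e mdistxx ltxx.
have [f sf] := cone_segment CO segC Bpi; have [h [lh eh ph]] := geodesic_of_segment sf py.
exists h; rewrite lh -/B; split; first by apply: le_trans (ltW rB); rewrite le_max lexx.
exists (Num.min t B); first by rewrite lt_min tp.
move=> s /andP[s0]; rewrite le_min => /andP[st' sB].
have sg : s <= glen g by case/andP: hgt => _; exact: le_trans.
rewrite lh; split=> //.
have h1 : d (gpath g s) (gpath g t) = t - s.
  rewrite gpath_isometry ?(ltW s0) ?(ltW tp) //=; last by case/andP: hgt.
  by rewrite distrC ger0_norm ?subr_ge0.
have h2 : d (gpath h s) y = B - s.
  rewrite -eh /gend gpath_isometry ?(ltW s0) ?lexx ?(ltW (glen_gt0 h)) ?lh //=.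
  by rewrite distrC ger0_norm ?subr_ge0.
have t1 := metric_triangle (gpath g t) (gpath g s) y; have t2 := metric_triangle (gpath g s) (gpath h s) y.
have t3 := metric_triangle (gpath h s) p (gpath g s).
rewrite (metric_sym (gpath g t) (gpath g s)) h1 D1 in t1; rewrite h2 (metric_sym (gpath g s) (gpath h s)) in t2.
rewrite (metric_sym (gpath h s) p) !geodesic_dist ?s0 ?lh // in t3.
by apply/eqP; rewrite eq_le; apply/andP; split; lra.
Qed.
End sector.

(** * Angles and geodesics in the base of a cone *)

Section comparison.
Context {R : realType}.
Implicit Types (s t dd e x : R).

Lemma cos_near e : 0 < e -> exists2 n : R, 0 < n & forall x, 0 <= x <= n -> 1 - e <= cos x.
Proof.
move=> e0; have /cvgrPdist_lt /(_ e e0) := @continuous_cos R 0.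
rewrite cos0 => /nbhs_ballP [n /= n0 h]; exists (n / 2); first by rewrite divr_gt0.
move=> x /andP[x0 xn]; have := h x; rewrite /ball /= sub0r normrN ger0_norm //.
by move=> /(_ (ltac:(lra))); rewrite ltr_norml => /andP[_]; lra.
Qed.

Lemma one_sub_cos x : 1 - cos x = 2 * sin (x / 2) ^+ 2.
Proof.
have -> : cos x = cos (x / 2 + x / 2) by congr cos; field.
by have := cos2Dsin2 (x / 2); rewrite cosD; lra.
Qed.

(* Both sides, increased by 1, factor through (s + t + dd) / 2 and (s + t - dd) / 2, in sines and in lengths. *)
Lemma kappa_close s t dd e : 0 < s -> 0 < t -> `|s - t| <= dd -> dd <= s + t -> s + t <= pi / 2 ->
  0 <= e <= 1 -> (forall x, 0 <= x <= s + t -> 1 - e <= cos x) ->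
  let kE := (s ^+ 2 + t ^+ 2 - dd ^+ 2) / (2 * s * t) in
  let kS := (cos dd - cos s * cos t) / (sin s * sin t) in
  kE <= 1 -> kS <= 1 -> `|kE - kS| <= 4 * e.
Proof.
move=> s0 t0; rewrite ler_norml => /andP[d1 d2] d3 stp /andP[e0 e1] hc kE kS kE1 kS1.
pose a := (s + t + dd) / 2; pose b := (s + t - dd) / 2.
have a0 : 0 <= a by rewrite /a; lra.
have b0 : 0 <= b by rewrite /b; lra.
have pp := pi_gt0 R.
have sb x : 0 <= x <= s + t -> x * (1 - e) <= sin x.
  move=> hx; have /andP[x0 x1] := hx; apply: le_trans (sin_ge (_ : 0 <= x <= pi)); last by rewrite x0; lra.
  by apply: ler_wpM2l => //; exact: hc.
have ha : 0 <= a <= s + t by rewrite a0 /a; lra.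
have hb : 0 <= b <= s + t by rewrite b0 /b; lra.
have hs : 0 <= s <= s + t by apply/andP; split; lra.
have ht : 0 <= t <= s + t by apply/andP; split; lra.
have ss : 0 < sin s by apply: sin_gt0_pi; rewrite s0; lra.
have st : 0 < sin t by apply: sin_gt0_pi; rewrite t0; lra.
have sa0 : 0 <= sin a by apply: sin_ge0_pi; rewrite a0 /a; lra.
have sb0 : 0 <= sin b by apply: sin_ge0_pi; rewrite b0 /b; lra.
have E1 : (kE + 1) * (s * t) = 2 * (a * b).
  by rewrite /kE /a /b; field; rewrite !gt_eqF.
have E2 : (kS + 1) * (sin s * sin t) = 2 * (sin a * sin b).
  have -> : (kS + 1) * (sin s * sin t) = cos dd - cos (s + t).
    by rewrite cosD /kS; field; rewrite !gt_eqF.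
  have -> : dd = a - b by rewrite /a /b; field.
  have -> : s + t = a + b by rewrite /a /b; field.
  by rewrite cosB cosD; ring.
have q0 : 0 <= 1 - e by lra.
have st0 : 0 < s * t by rewrite mulr_gt0.
have sst0 : 0 < sin s * sin t by rewrite mulr_gt0.
have ab : (a * b) * (1 - e) ^+ 2 <= sin a * sin b.
  have -> : a * b * (1 - e) ^+ 2 = a * (1 - e) * (b * (1 - e)) by ring.
  by apply: ler_pM; [exact: mulr_ge0|exact: mulr_ge0|exact: sb|exact: sb].
have ab' : sin a * sin b <= a * b by apply: ler_pM => //; exact: sin_le.
have stl : (s * t) * (1 - e) ^+ 2 <= sin s * sin t.
  have -> : s * t * (1 - e) ^+ 2 = s * (1 - e) * (t * (1 - e)) by ring.
  by apply: ler_pM; [exact: mulr_ge0 (ltW _) _|exact: mulr_ge0 (ltW _) _|exact: sb|exact: sb].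
have stu : sin s * sin t <= s * t by apply: ler_pM; [exact: ltW|exact: ltW|exact: sin_le (ltW _)|exact: sin_le (ltW _)].
have m0 : 0 <= kS + 1 by rewrite -(pmulr_lge0 _ sst0) E2; apply: mulr_ge0 => //; exact: mulr_ge0.
have k0 : 0 <= kE + 1 by rewrite -(pmulr_lge0 _ st0) E1; apply: mulr_ge0 => //; exact: mulr_ge0.
have L1 : (kE + 1) * (1 - e) ^+ 2 <= kS + 1.
  rewrite -(ler_pM2r st0); apply: le_trans (_ : (kS + 1) * (sin s * sin t) <= _); last exact: ler_wpM2l.
  rewrite E2; have -> : (kE + 1) * (1 - e) ^+ 2 * (s * t) = (1 - e) ^+ 2 * (2 * (a * b)) by rewrite -E1; ring.
  lra.
have L2 : (kS + 1) * (1 - e) ^+ 2 <= kE + 1.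
  rewrite -(ler_pM2r st0) E1.
  apply: le_trans (_ : (kS + 1) * (sin s * sin t) <= _); last by rewrite E2; lra.
  by rewrite -mulrA; apply: ler_wpM2l => //; rewrite mulrC.
have e2 : 1 - 2 * e <= (1 - e) ^+ 2 by have := sqr_ge0 e; lra.
have := ler_wpM2l m0 e2; have := ler_wpM2l k0 e2.
have := ler_wpM2r e0 kE1; have := ler_wpM2r e0 kS1.
by rewrite ler_norml => *; apply/andP; split; lra.
Qed.
End comparison.

Lemma stewart_agree {R : realType} {X : metricType R} (p : X) (g h : geodesic p) s : stewart X ->
  dir g = dir h -> 0 < s <= glen g -> s <= glen h -> gpath g s = gpath h s.
Proof.
move=> St gh hs sh; have /andP[s0 sg] := hs; have hh : 0 < s <= glen h by rewrite s0.
have a0 : angle g h = 0 by rewrite -dir_dist_angle ?gh ?mdistxx //; exact: angled_stewart.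
have := angle_hinge St hs hh; rewrite a0 cos0 => k1.
apply: mdist_positivity; apply/eqP; rewrite -sqrf_eq0 eq_le sqr_ge0 andbT kap_dist //.
have s2 : 0 <= s * s by rewrite mulr_ge0 // ltW.
have := ler_wpM2l s2 k1; rewrite !expr2; lra.
Qed.

Section cone_base.
Context {R : realType} {C Y : metricType R} {o : C} {c : R * Y -> C}.
Hypothesis CO : cone_over o c.
Hypothesis RC : ray_space C.
Implicit Types (p : Y) (s t l : R).

Lemma half_lt_pihalf : 1 / 2 < pi / 2 :> R.
Proof. by have := pi_ge2 R; lra. Qed.

(** The lift perpendicular to the radius: polar angle s is reached at length tan s and at distance 1
    / cos s from the apex. The cap 1 / 2 keeps these quantities under control. *)
Definition perp_lift_of p (g : geodesic p) (G : geodesic (c (1, p))) :=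
  forall s, 0 < s <= Num.min (glen g) (1 / 2) ->
    0 < sin s / cos s <= glen G /\ gpath G (sin s / cos s) = c ((cos s)^-1, gpath g s).

Lemma perp_lift p (g : geodesic p) : exists G, perp_lift_of g G.
Proof.
have pp := half_lt_pihalf.
pose l := Num.min (glen g) (1 / 2).
have lg : l <= glen g by rewrite ge_min lexx.
have l1 : l <= 1 / 2 by rewrite ge_min lexx orbT.
have l0 : 0 < l by rewrite lt_min glen_gt0; lra.
have hth : 0 < (pi / 2 : R) < pi by apply/andP; split; lra.
have hl : 0 < l < pi / 2 by rewrite l0; lra.
have [G [lG _ pG]] := lift CO hth hl lg.
have tri s : 0 < s <= l -> 0 < sin s /\ 0 < cos s.
  move=> /andP[s0 sl]; split; first by apply: sin_gt0_pi; rewrite s0; lra.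
  by apply: cos_gt0_pihalf; apply/andP; split; lra.
have [sl cl] := tri l (ltac:(by rewrite l0 lexx)).
have cE : sin (pi / 2 - l) = cos l by rewrite sinB sin_pihalf cos_pihalf; ring.
rewrite cE in lG.
exists G => s; rewrite -/l => hs; have [ss cs] := tri s hs; have /andP[s0 sl'] := hs.
have hS : 0 < sin s / cos s <= glen G.
  rewrite divr_gt0 //= lG ler_pdivrMr // mulrAC ler_pdivlMr // -subr_ge0.
  have -> : sin l * cos s - sin s * cos l = sin (l - s) by rewrite sinB; ring.
  by apply: sin_ge0_pi; apply/andP; split; lra.
split=> //; have /andP[S0 S1] := hS; rewrite pG ?(ltW S0) // cos_pihalf sin_pihalf mulr0 addr0 mulr1.
have e1 : (cos s)^-1 * cos s = 1 by rewrite mulVf // gt_eqF.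
rewrite (mulrC (sin s)) -[X in sector _ X _]e1.
by rewrite sector_polar ?invr_gt0 //; lra.
Qed.

(** The law of cosines in the cone turns the Euclidean comparison cosine of the lifts into the
    spherical comparison cosine of the geodesics below. *)
Lemma perp_kap p (g h : geodesic p) (G H : geodesic (c (1, p))) s t : 0 < s <= 1 / 2 -> 0 < t <= 1 / 2 ->
  0 < sin s / cos s <= glen G -> 0 < sin t / cos t <= glen H ->
  gpath G (sin s / cos s) = c ((cos s)^-1, gpath g s) -> gpath H (sin t / cos t) = c ((cos t)^-1, gpath h t) ->
  kap G H (sin s / cos s) (sin t / cos t) =
    (cos (d (gpath g s) (gpath h t)) - cos s * cos t) / (sin s * sin t).
Proof.
move=> hs ht hS hT eG eH; rewrite kapE // eG eH (cone_dist2 CO); last 2 first.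
- by rewrite invr_ge0 cos_ge0_pihalf //; have := half_lt_pihalf; case/andP: hs => *; apply/andP; split; lra.
- by rewrite invr_ge0 cos_ge0_pihalf //; have := half_lt_pihalf; case/andP: ht => *; apply/andP; split; lra.
have pp := half_lt_pihalf.
have tri (x : R) : 0 < x <= 1 / 2 -> sin x != 0 /\ cos x != 0.
  move=> /andP[x0 x1]; rewrite !gt_eqF //; first by apply: cos_gt0_pihalf; apply/andP; split; lra.
  by apply: sin_gt0_pi; apply/andP; split; lra.
have [s1 c1] := tri s hs; have [s2 c2] := tri t ht.
have e1 : (sin s / cos s) ^+ 2 = (cos s)^-1 ^+ 2 - 1.
  have h1 : sin s ^+ 2 = 1 - cos s ^+ 2 by rewrite -(cos2Dsin2 s); ring.
  by rewrite expr_div_n h1; field.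
have e2 : (sin t / cos t) ^+ 2 = (cos t)^-1 ^+ 2 - 1.
  have h1 : sin t ^+ 2 = 1 - cos t ^+ 2 by rewrite -(cos2Dsin2 t); ring.
  by rewrite expr_div_n h1; field.
by rewrite e1 e2; field; rewrite s1 s2 c1 c2.
Qed.

(** Spherical and Euclidean comparison cosines agree for short sides by [kappa_close], and the
    former are those of the lifts, whose angle exists in the cone. So angles in the base exist and
    equal the angles of the lifts. *)
Lemma perp_angle p (g h : geodesic p) (G H : geodesic (c (1, p))) :
  perp_lift_of g G -> perp_lift_of h H -> tends_kap g h (cos (angle G H)).
Proof.
move=> hG hH e e0.
have short (k : geodesic p) : exists l, [/\ Num.min (glen k) (1 / 2) = l, 0 < l, l <= glen k & l <= 1 / 2].
  exists (Num.min (glen k) (1 / 2)); split=> //; first by rewrite lt_min glen_gt0; lra.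
    by rewrite ge_min lexx.
  by rewrite ge_min lexx orbT.
have [l [lE l0 lg l1]] := short g; have [l' [lE' l0' lh l1']] := short h.
rewrite /perp_lift_of lE in hG; rewrite /perp_lift_of lE' in hH.
have e160 : 0 < Num.min 1 (e / 16) by rewrite lt_min ltr01 divr_gt0.
have [n n0 hn] := cos_near e160.
have e2 : 0 < e / 2 by rewrite divr_gt0.
have [S0 [S00 _ _ hS]] := @angled_stewart _ _ _ (rs_stewart RC) G H _ e2.
pose s0 := Num.min (Num.min l l') (Num.min (n / 2) (S0 / 2)).
have s00 : 0 < s0 by rewrite !lt_min l0 l0' !divr_gt0.
have sl : s0 <= l by rewrite !ge_min lexx.
have sl' : s0 <= l' by rewrite !ge_min lexx orbT.
have sn : s0 <= n / 2 by rewrite !ge_min lexx !orbT.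
have sS : s0 <= S0 / 2 by rewrite !ge_min lexx !orbT.
have pp := half_lt_pihalf.
exists s0; split; [exact: s00|exact: le_trans sl lg|exact: le_trans sl' lh|].
move=> s t /andP[sp ss] /andP[tp tt].
have hs : 0 < s <= l by rewrite sp (le_trans ss).
have ht : 0 < t <= l' by rewrite tp (le_trans tt).
have [G1 G2] := hG s hs; have [H1 H2] := hH t ht.
have hs1 : 0 < s <= 1 / 2 by rewrite sp; lra.
have ht1 : 0 < t <= 1 / 2 by rewrite tp; lra.
have K := perp_kap hs1 ht1 G1 H1 G2 H2.
have tanb (x : R) : 0 < x <= 1 / 2 -> sin x / cos x <= 2 * x.
  move=> /andP[x0 x1]; have cx : 1 / 2 <= cos x.
    have sx : 0 <= sin (x / 2) <= 1 / 4.
      rewrite sin_ge0_pi /=; last by apply/andP; split; lra.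
      by apply: le_trans (sin_le _) _; lra.
    have := one_sub_cos x; have /andP[q1 q2] := sx; have := ler_pM q1 q1 q2 q2; rewrite expr2; lra.
  have c0 : 0 < cos x by lra.
  rewrite ler_pdivrMr //; have := sin_le (ltW x0); have := ler_wpM2l (ltW x0) cx; lra.
have near : `|kap G H (sin s / cos s) (sin t / cos t) - cos (angle G H)| < e / 2.
  apply: hS; [case/andP: G1 => -> _|case/andP: H1 => -> _] => /=.
    by apply: le_trans (tanb s hs1) _; lra.
  by apply: le_trans (tanb t ht1) _; lra.
have hsg : 0 < s <= glen g by rewrite sp; lra.
have hth : 0 < t <= glen h by rewrite tp; lra.
have kS1 : kap G H (sin s / cos s) (sin t / cos t) <= 1 by have /andP[] := kap_bound G1 H1.
have kE1 : kap g h s t <= 1 by have /andP[] := kap_bound hsg hth.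
have ds := geodesic_dist hsg; have dt := geodesic_dist hth.
have t1 := metric_triangle (gpath g s) p (gpath h t).
have t2 := metric_triangle p (gpath g s) (gpath h t); have t3 := metric_triangle p (gpath h t) (gpath g s).
rewrite (metric_sym (gpath g s) p) ds dt in t1; rewrite ds dt in t2.
rewrite (metric_sym (gpath h t)) ds dt in t3.
rewrite K in near kS1; rewrite kapE // in kE1 *.
have ee : 0 <= Num.min 1 (e / 16) <= 1 by rewrite ltW //= ge_min lexx.
have := @kappa_close R s t (d (gpath g s) (gpath h t)) (Num.min 1 (e / 16)) sp tp _ t1 _ ee _ kE1 kS1.
have e16 : Num.min 1 (e / 16) <= e / 16 by rewrite ge_min lexx orbT.
have c1 : `|s - t| <= d (gpath g s) (gpath h t) by rewrite ler_norml; apply/andP; split; lra.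
have c2 : s + t <= pi / 2 by have := pi_ge2 R; lra.
have c3 x : 0 <= x <= s + t -> 1 - Num.min 1 (e / 16) <= cos x.
  by move=> /andP[x0 x1]; apply: hn; rewrite x0; lra.
move=> /(_ c1 c2 c3).
set kE := _ / _; set kS := _ / (_ * _) in near *.
move: near; rewrite ltr_norml ler_norml => /andP[n1 n2] /andP[m1 m2].
by rewrite ltr_norml; apply/andP; split; lra.
Qed.

Lemma cone_angled p : angled p.
Proof.
move=> g h; have [G hG] := perp_lift g; have [H hH] := perp_lift h.
by have T := perp_angle hG hH; rewrite (angle_eq T).
Qed.

(** At small distances the base and the unit sphere of the cone are bi-Lipschitz; 81 / 100 is the
    square of 9 / 10, a lower bound for sin x / x near 0. *)
Lemma unit_dist_close : exists2 n : R, 0 < n & forall x y : Y, d x y <= n ->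
  81 / 100 * d x y ^+ 2 <= 2 - 2 * cos (d x y).
Proof.
have t0 : 0 < (1 / 10 : R) by rewrite divr_gt0.
have [n n0 hn] := cos_near t0.
exists n => // x y xy; have D0 := mdist_ge0 x y; have Dp := co_pi CO x y.
set D := d x y in xy D0 Dp *.
have -> : 2 - 2 * cos D = 2 * (1 - cos D) by ring.
rewrite one_sub_cos; have h1 : D / 2 * (9 / 10) <= sin (D / 2).
  apply: le_trans (sin_ge (_ : 0 <= D / 2 <= pi)); last by apply/andP; split; lra.
  by apply: ler_wpM2l; [lra|have := hn (D / 2); move=> /(_ (ltac:(apply/andP; split; lra))); lra].
have h0 : 0 <= D / 2 * (9 / 10) by lra.
by have := ler_pM h0 h0 h1 h1; rewrite !expr2; lra.
Qed.

Lemma cone_tame p : tame p.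
Proof.
split; [exact: cone_angled|exact: cone_proper CO (rs_proper RC)|].
have [n n0 hn] := unit_dist_close.
exists (Num.min (n / 2) (1 / 2)); first by rewrite lt_min !divr_gt0.
move=> g h s /andP[s0]; rewrite le_min => /andP[sn s1] sg sh.
have [G hG] := perp_lift g; have [H hH] := perp_lift h.
have hs : 0 < s <= 1 / 2 by rewrite s0.
have [G1 G2] := hG s (ltac:(by rewrite s0 le_min sg)); have [H1 H2] := hH s (ltac:(by rewrite s0 le_min sh)).
have := angle_hinge (rs_stewart RC) G1 H1; rewrite (perp_kap hs hs G1 H1 G2 H2).
rewrite -(angle_eq (perp_angle hG hH)); set A := cos _; set D := d _ _.
have pp := half_lt_pihalf.
have ss : 0 < sin s by apply: sin_gt0_pi; rewrite s0; lra.
rewrite ler_pdivlMr ?mulr_gt0 // => h1.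
have h2 : D <= n.
  apply: le_trans (metric_triangle _ p _) _; rewrite (metric_sym _ p) !geodesic_dist ?s0 //; lra.
have h3 := hn _ _ h2; rewrite -/D in h3.
have A1 : 0 <= 1 - A by rewrite subr_ge0 cos_le1.
have h4 : sin s ^+ 2 * (1 - A) <= s ^+ 2 * (1 - A).
  by apply: ler_wpM2r => //; have q := sin_le (ltW s0); rewrite !expr2; exact: (ler_pM (ltW ss) (ltW ss) q q).
have h5 := cos2Dsin2 s.
have h6 : 0 <= s ^+ 2 * (1 - A) by rewrite mulr_ge0 ?sqr_ge0.
by rewrite !expr2 in h3 h4 h5 h6 *; lra.
Qed.

Lemma cone_pack p : uniform_packing C -> pack_at p.
Proof.
move=> pk e e0; have [n n0 hn] := unit_dist_close.
have e4 : 0 < e / 4 by rewrite divr_gt0.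
have [K hK] := pk _ e4; exists K, (n / 2); first by rewrite divr_gt0.
move=> s /andP[s0 sn] N y ys sep.
have s2 : 0 < 2 * s by rewrite mulr_gt0.
apply: (hK (c (1, p)) (2 * s) s2 N (fun i => c (1, y i))) => [i|i j ij].
  rewrite -ltr_sqr ?nnegrE ?mdist_ge0 ?(ltW s2) // (unit_dist2 CO).
  have -> : 2 - 2 * cos (d p (y i)) = 2 * (1 - cos (d p (y i))) by ring.
  rewrite one_sub_cos; have D0 := mdist_ge0 p (y i); have Dp := co_pi CO p (y i).
  have s0' : 0 <= sin (d p (y i) / 2) by apply: sin_ge0_pi; apply/andP; split; lra.
  have s1' : sin (d p (y i) / 2) <= s / 2 by apply: le_trans (sin_le _) _; have := ys i; lra.
  have := ler_pM s0' s0' s1' s1'; have := mulr_gt0 s0 s0; rewrite !expr2; lra.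
have close : d (y i) (y j) <= n.
  by apply: le_trans (metric_triangle _ p _) _; rewrite (metric_sym _ p); have := ys i; have := ys j; lra.
have h1 := hn _ _ close; have h2 := sep i j ij.
have q0 : 0 <= e / 4 * (2 * s) by rewrite mulr_ge0 // ltW.
rewrite -ltr_sqr ?nnegrE ?mdist_ge0 // (unit_dist2 CO).
have es : 0 < e * s by rewrite mulr_gt0.
have := ler_pM (ltW es) (ltW es) (ltW h2) (ltW h2); have := mulr_gt0 es es; rewrite !expr2 in h1 *; lra.
Qed.

(** The geodesics agree near p because p is tame. Their lifts at an angle th between s and pi then
    agree near the start, hence to the end by hinge comparison in the cone, and the ends lie over
    the points at distance s. *)
Lemma cone_agree p (g h : geodesic p) s : dir g = dir h -> 0 < s <= glen g -> s <= glen h -> s < pi ->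
  gpath g s = gpath h s.
Proof.
move=> gh /andP[s0 sg] sh sp.
pose th := (s + pi) / 2.
have hth : 0 < th < pi by rewrite /th; apply/andP; split; lra.
have hl : 0 < s < th by rewrite s0 /th; lra.
have [G [lG eG pG]] := lift CO hth hl sg; have [H [lH eH pH]] := lift CO hth hl sh.
have [s1 s10 agr] := dir_eq_agree (cone_tame p).
pose l := Num.min s1 s.
have ls : l <= s by rewrite ge_min lexx orbT.
have ls1 : l <= s1 by rewrite ge_min lexx.
have l0 : 0 < l by rewrite lt_min s10.
have hl' : 0 < l < th by rewrite l0 /th; lra.
have [S0 _ _ _] := line_end hth hl'; have [S1 r0 _ _] := line_end hth hl.
set S := sin l / _ in S0.
have GH : dir G = dir H.
  apply: (@angle_agree _ _ _ G H (Num.min S (glen G))).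
  - exact: angled_stewart (rs_stewart RC).
  - by rewrite lt_min S0 glen_gt0.
  - by rewrite ge_min lexx orbT.
  - by rewrite ge_min lH -lG lexx orbT.
  move=> t /andP[t0]; rewrite le_min => /andP[tS tG].
  rewrite pG ?t0 // pH ?t0 ?lH -?lG //; rewrite /sector.
  have al : arg (1 + t * cos th) (t * sin th) <= l by apply: line_arg_le; rewrite ?t0.
  have /andP[a0 _] := arg_in (1 + t * cos th) (t * sin th).
  move: al a0; rewrite le_eqVlt orbC; set a := arg _ _ => _al.
  rewrite le_eqVlt => /predU1P[<-|a0]; first by rewrite !gpath0.
  have al : a <= l by case/orP: _al => [/ltW|/eqP ->].
  by rewrite (agr g h a gh) // ?a0 ?(le_trans al) // (le_trans ls).
have hG : 0 < glen G <= glen G by rewrite glen_gt0 lexx.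
have := stewart_agree (rs_stewart RC) GH hG (ltac:(by rewrite lH -lG)).
rewrite -/(gend G) lG -lH -/(gend H) eG eH => E.
apply: mdist_positivity; apply: cos_ge1; first exact: angle_in CO _ _.
set r := sin th / _ in r0 E.
have := cone_dist2 CO (gpath g s) (gpath h s) (ltW r0) (ltW r0); rewrite E mdistxx expr0n /= => e.
have r2 : 0 < r * r by rewrite mulr_gt0.
by rewrite -(ler_pM2l r2) mulr1; move: e; rewrite !expr2; lra.
Qed.
End cone_base.

(** * The one-side injectivity radius of the ideal boundary *)

Section one_side.
Context {R : realType} {C Y : metricType R} {o : C} {c : R * Y -> C}.
Hypothesis CO : cone_over o c.
Hypothesis RC : ray_space C.

(** The perpendicular lifts of opposite geodesics are opposite in the cone, where adjacent angles
    are controlled by Stewart's inequality. *)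
Lemma cone_opposite_sum (p : Y) (k g h : geodesic p) : opposite g h -> angle k g + angle k h = pi.
Proof.
move=> op; apply: opposite_sum_adjacent => //; first exact: (cone_angled CO RC).
have [K hK] := perp_lift CO k; have [G hG] := perp_lift CO g; have [H hH] := perp_lift CO h.
rewrite (angle_eq (perp_angle CO RC hK hG)) (angle_eq (perp_angle CO RC hK hH)).
apply: adjacent_cos; first by exists 1 => // u v w y _ _ _ _; exact: (rs_stewart RC).
have [t0 t00 ht] := op.
pose s := Num.min t0 (1 / 2).
have s0 : 0 < s by rewrite lt_min t00; lra.
have st : s <= t0 by rewrite ge_min lexx.
have s1 : s <= 1 / 2 by rewrite ge_min lexx orbT.
have [sg sh ds] := ht s (ltac:(by rewrite s0)).
have [/andP[S0 SG] eG] := hG s (ltac:(by rewrite s0 le_min sg)).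
have [/andP[_ SH] eH] := hH s (ltac:(by rewrite s0 le_min sh)).
set S := sin s / cos s in S0 SG SH eG eH.
have p2 := half_lt_pihalf (R := R).
have cs : 0 < cos s by apply: cos_gt0_pihalf; apply/andP; split; lra.
have DS : d (gpath G S) (gpath H S) = 2 * S.
  have S20 : 0 <= 2 * S by lra.
  have cv : 0 <= (cos s)^-1 by rewrite invr_ge0 ltW.
  apply/eqP; rewrite -(@eqrXn2 _ 2) ?mdist_ge0 //; apply/eqP.
  rewrite eG eH (cone_dist2 CO) // ds /S.
  have -> : cos (2 * s) = cos (s + s) by congr cos; ring.
  have h1 : sin s * sin s = 1 - cos s * cos s by have := cos2Dsin2 s; rewrite !expr2; lra.
  rewrite cosD exprMn expr_div_n [sin s ^+ 2]expr2 h1; field; exact: lt0r_neq0.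
exists S => // t /andP[tp tS]; split; [exact: le_trans SG|exact: le_trans SH|].
have e1 : d (gpath G t) (gpath G S) = S - t.
  by rewrite gpath_isometry ?(ltW tp) ?(ltW S0) ?(le_trans tS) // distrC ger0_norm ?subr_ge0.
have e2 : d (gpath H t) (gpath H S) = S - t.
  by rewrite gpath_isometry ?(ltW tp) ?(ltW S0) ?(le_trans tS) // distrC ger0_norm ?subr_ge0.
have e3 : d (c (1, p)) (gpath G t) = t by rewrite geodesic_dist // tp (le_trans tS).
have e4 : d (c (1, p)) (gpath H t) = t by rewrite geodesic_dist // tp (le_trans tS).
have t1 := metric_triangle (gpath G t) (c (1, p)) (gpath H t).
have t2 := metric_triangle (gpath G S) (gpath G t) (gpath H S).
have t3 := metric_triangle (gpath G t) (gpath H t) (gpath H S).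
rewrite (metric_sym (gpath G t) (c (1, p))) e3 e4 in t1.
rewrite DS (metric_sym (gpath G S) (gpath G t)) e1 in t2; rewrite e2 in t3.
by apply/eqP; rewrite eq_le; apply/andP; split; lra.
Qed.

(** Here [sector_dich] is used at the right angle. If xi is not a limit of directions extending to
    length r, then geodesics with directions close to xi fall into the second alternative and have
    opposites of length at least r. Adjacent angles add up to pi, so these opposites converge to an
    antipode of xi, which extends to length r by [tame_limit_extends]. *)
Lemma cone_one_side (p : Y) (xi : directions p) (r : R) : 0 < r < pi / 2 ->
  extends_to xi r \/ exists2 eta : directions p, mdist xi eta = pi & extends_to eta r.
Proof.
move=> /andP[r0 rp]; have An : angled p by exact: (cone_angled CO RC).
have [A|nA] := pselect (forall e : R, 0 < e -> exists h : geodesic p, r <= glen h /\ d xi (dir h) <= e).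
  by left; exact: tame_limit_extends (cone_tame CO RC p) r0 A.
right; have [e0 [e00 he0]] : exists e0 : R, 0 < e0 /\ forall h : geodesic p, r <= glen h -> ~ (d xi (dir h) <= e0).
  apply: contrapT => H; apply: nA => e e1; apply: contrapT => H2; apply: H; exists e; split=> // h rh xh.
  by apply: H2; exists h.
have hth : 0 < (pi / 2 : R) < pi by have := pi_gt0 R => ?; apply/andP; split; lra.
have B (e : R) : 0 < e -> exists g h : geodesic p, [/\ d xi (dir g) <= e, r <= glen h & opposite h g].
  move=> e1; have m0 : 0 < Num.min e e0 by rewrite lt_min e1.
  have [g hg] := dir_approx xi m0; rewrite le_min in hg; have /andP[ge ge0] := hg.
  have [/(_ r rp) [h [rh [t0 [t00 tg th hgt]]]] | /(_ r)] := sector_dich CO g RC hth.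
    have hd : dir h = dir g by apply: (@angle_agree _ _ _ h g t0).
    by case: (he0 h rh); rewrite hd.
  move=> /(_ (ltac:(lra))) [h [rh op]]; by exists g, h.
(* The angle function of the antipode of xi. *)
pose f (k : geodesic p) := pi - dir_angle xi k.
have anti (g h : geodesic p) e : d xi (dir g) <= e -> opposite h g -> forall k, `|f k - angle h k| <= e.
  move=> ge op k; have := cone_opposite_sum k op; rewrite (angleC k h) // (angleC k g) // => s.
  have -> : f k - angle h k = angle g k - dir_angle xi k by rewrite /f -s; ring.
  by rewrite distrC; apply: le_trans ge; exact: (dir_dist_ge xi (dir g) k).
have fc e : 0 < e -> exists h : geodesic p, forall k, `|f k - angle h k| <= e.
  by move=> /B [g [h [ge _ op]]]; exists h; exact: anti ge op.
pose eta := Direction fc.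
exists eta.
  apply/eqP; rewrite eq_le dir_dist_pi //=; apply/ler_addgt0Pr => e e1.
  have e2 : 0 < e / 2 by rewrite divr_gt0.
  have [g hg] := dir_approx xi e2.
  have := dir_dist_ge xi eta g; rewrite /= /f -direction_angle // => h1.
  have : `|d xi (dir g) - (pi - d xi (dir g))| <= d xi eta := h1.
  by rewrite ler_norml => /andP[h2 _]; lra.
apply: (tame_limit_extends (cone_tame CO RC p) r0) => e e1; have [g [h [ge rh op]]] := B e e1.
by exists h; split=> //; apply: dir_dist_le; exact: anti ge op.
Qed.
End one_side.

Lemma one_side_inj_ideal {R : realType} (n : nat) (X N : metricType R) : alexandrov_nonneg n X ->
  ray_space X -> is_ideal_boundary X N -> ((pi / 2)%:E <= one_side_inj N)%E.
Proof.
move=> AX RX [Npi [C [p [q [AC [v [c [c1 c2 c3]]]]]]]].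
have RC := asymptotic_cone_ray_space RX (alexandrov_packing AX (rs_stewart RX)) AC.
have CO : cone_over v c by split.
have low (r : R) : 0 < r < pi / 2 -> (r%:E <= one_side_inj N)%E.
  move=> hr; have /andP[r0 rp] := hr; apply: ereal_sup_ubound; exists r => //; split; first exact: ltW.
  by move=> _ y xi; exact: (cone_one_side CO RC).
have pp := pi_gt0 R; have := low (pi / 4) (ltac:(apply/andP; split; lra)).
case: (one_side_inj N) low => [l low|_ _|_]; [|by rewrite leey|by rewrite leeNy_eq].
rewrite !lee_fin => l4; rewrite leNgt; apply/negP => lt.
by have := low ((l + pi / 2) / 2) (ltac:(apply/andP; split; lra)); rewrite lee_fin; lra.
Qed.

(** * Construction of the Euclidean cone, with apex [None] *)

Definition eucl_cone (R : realType) (Y : metricType R) : Type := option {u : R * Y | 0 < u.1}.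

HB.instance Definition _ (R : realType) (Y : metricType R) := gen_eqMixin (eucl_cone Y).
HB.instance Definition _ (R : realType) (Y : metricType R) := gen_choiceMixin (eucl_cone Y).

Section cone_metric.
Context {R : realType} {Y : metricType R}.
Implicit Types (u v w : eucl_cone Y).

(** If A + B is at most pi, this is the triangle inequality of the plane with the sectors laid side
    by side. Otherwise the path over the middle point is at least as long as the one through the
    apex. *)
Lemma cone_triangle_law (x y z r1 r2 r3 A B D : R) : 0 <= x -> 0 <= y -> 0 <= z ->
  0 <= r1 -> 0 <= r2 -> 0 <= r3 -> 0 <= A <= pi -> 0 <= B <= pi -> 0 <= D <= pi -> D <= A + B ->
  x ^+ 2 = r1 ^+ 2 + r2 ^+ 2 - 2 * r1 * r2 * cos A ->
  y ^+ 2 = r2 ^+ 2 + r3 ^+ 2 - 2 * r2 * r3 * cos B ->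
  z ^+ 2 = r1 ^+ 2 + r3 ^+ 2 - 2 * r1 * r3 * cos D -> z <= x + y.
Proof.
move=> x0 y0 z0 r10 r20 r30 hA hB hD DAB hx hy hz.
have /andP[A0 A1] := hA; have /andP[B0 B1] := hB; have /andP[D0 D1] := hD.
have sA : sin A ^+ 2 = 1 - cos A ^+ 2 by have := cos2Dsin2 A; lra.
have sB : sin B ^+ 2 = 1 - cos B ^+ 2 by have := cos2Dsin2 B; lra.
have [AB|AB] := leP (A + B) pi.
  have hAB : 0 <= A + B <= pi by apply/andP; split; lra.
  have := @plane_cauchy R x y (r1 * cos A - r2) (- (r1 * sin A)) (r3 * cos B - r2) (r3 * sin B) x0 y0.
  rewrite hx hy sqrrN !sqrrB !exprMn sA sB => /(_ (ltac:(ring)) (ltac:(ring))) h.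
  have h2 := ler_wpM2l (mulr_ge0 r10 r30) (cos_decr hAB hD DAB); rewrite cosD in h2.
  rewrite -ler_sqr ?nnegrE ?addr_ge0 // sqrrD hx hy hz; lra.
have cAB : cos A <= - cos B.
  have -> : - cos B = cos (pi - B) by rewrite cosB cospi sinpi; ring.
  by apply: cos_decr => //; [apply/andP; split; lra|lra].
have px : r1 - r2 * cos A <= x.
  have [h|/ltW h] := leP (r1 - r2 * cos A) 0; first exact: le_trans h x0.
  rewrite -ler_sqr ?nnegrE // hx; have := mulr_ge0 (sqr_ge0 r2) (sqr_ge0 (sin A)).
  by rewrite sA; lra.
have py : r3 - r2 * cos B <= y.
  have [h|/ltW h] := leP (r3 - r2 * cos B) 0; first exact: le_trans h y0.
  rewrite -ler_sqr ?nnegrE // hy; have := mulr_ge0 (sqr_ge0 r2) (sqr_ge0 (sin B)).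
  by rewrite sB; lra.
have pz : z <= r1 + r3.
  rewrite -ler_sqr ?nnegrE ?addr_ge0 // hz.
  have c1 : 0 <= 1 + cos D by have := cos_geN1 D; lra.
  have := mulr_ge0 (mulr_ge0 r10 r30) c1; lra.
have c0 : 0 <= - cos B - cos A by lra.
by have := mulr_ge0 r20 c0; lra.
Qed.

Definition eucl_cone_dist u v : R :=
  match u, v with
  | None, None => 0
  | None, Some b => (val b).1
  | Some a, None => (val a).1
  | Some a, Some b => cone_dist (val a) (val b)
  end.

Let ang (x y : Y) := Num.min (d x y) pi.

Let ang_in x y : 0 <= ang x y <= pi.
Proof. by rewrite le_min mdist_ge0 pi_ge0 ge_min lexx orbT. Qed.

Lemma cone_dist_sq (u v : R * Y) : 0 <= u.1 -> 0 <= v.1 ->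
  cone_dist u v ^+ 2 = u.1 ^+ 2 + v.1 ^+ 2 - 2 * u.1 * v.1 * cos (Num.min (d u.2 v.2) pi).
Proof.
move=> u0 v0; rewrite sqr_sqrtr //; set k := cos _.
have k1 : 0 <= 1 - k by rewrite subr_ge0 cos_le1.
by have := mulr_ge0 (mulr_ge0 u0 v0) k1; have := sqr_ge0 (u.1 - v.1); lra.
Qed.

Lemma cone_dist_ge0 (u v : R * Y) : 0 <= cone_dist u v. Proof. exact: sqrtr_ge0. Qed.

Lemma eucl_cone_distxx u : eucl_cone_dist u u = 0.
Proof.
case: u => [[u u0]|] //=; rewrite /cone_dist mdistxx min_l ?pi_ge0 // cos0 mulr1.
have -> : u.1 ^+ 2 + u.1 ^+ 2 - 2 * u.1 * u.1 = 0 by ring.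
exact: sqrtr0.
Qed.

Lemma eucl_cone_dist_eq0 u v : eucl_cone_dist u v = 0 -> u = v.
Proof.
case: u v => [[u u0]|] [[v v0]|] //=; [|by move=> e; exfalso; have := u0; rewrite e ltxx|by move=> e; exfalso; have := v0; rewrite e ltxx].
move=> e; have := cone_dist_sq (ltW u0) (ltW v0); rewrite e expr0n /=; set k := cos _ => h.
have k1 : 0 <= 1 - k by rewrite subr_ge0 cos_le1.
have uv := mulr_gt0 u0 v0; have p1 := mulr_ge0 (ltW uv) k1.
have s0 : (u.1 - v.1) ^+ 2 = 0 by apply/eqP; rewrite eq_le sqr_ge0 andbT; lra.
have e1 : u.1 = v.1 by move/eqP: s0; rewrite sqrf_eq0 subr_eq0 => /eqP.
have k0 : u.1 * v.1 * (1 - k) = 0 by apply/eqP; rewrite eq_le p1 andbT; lra.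
have k2 : 1 <= k by move/eqP: k0; rewrite mulf_eq0 (gt_eqF uv) /= subr_eq0 => /eqP ->.
have a0 := cos_ge1 (ang_in u.2 v.2) k2.
have e2 : u.2 = v.2.
  apply: mdist_positivity; move: a0; rewrite /ang; have [//|_ h1] := leP (d u.2 v.2) pi.
  by have := pi_gt0 R; rewrite h1 ltxx.
by congr Some; apply: val_inj => /=; case: u v e1 e2 {u0 v0 e k h k1 uv p1 s0 k0 k2 a0} => [a b] [a' b'] /= -> ->.
Qed.

Lemma eucl_cone_dist_sym u v : eucl_cone_dist u v = eucl_cone_dist v u.
Proof.
case: u v => [[u u0]|] [[v v0]|] //=; rewrite /cone_dist (metric_sym v.2).
by congr Num.sqrt; ring.
Qed.

Lemma eucl_cone_dist_triangle v u w : eucl_cone_dist u w <= eucl_cone_dist u v + eucl_cone_dist v w.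
Proof.
have p0 : 0 <= (0 : R) <= pi by rewrite lexx pi_ge0.
have add (x y z : Y) : ang x z <= ang x y + ang y z.
  have t := metric_triangle x y z; have p1 := pi_ge0 R; have h1 := mdist_ge0 x y; have h2 := mdist_ge0 y z.
  rewrite /ang; have [?|?] := leP (d x y) pi; have [?|?] := leP (d y z) pi; have [?|?] := leP (d x z) pi; lra.
case: u v w => [[u u0]|] [[v v0]|] [[w w0]|] //=; rewrite ?addr0 ?add0r //.
- apply: (cone_triangle_law (cone_dist_ge0 _ _) (cone_dist_ge0 _ _) (cone_dist_ge0 _ _)
    (ltW u0) (ltW v0) (ltW w0) (ang_in u.2 v.2) (ang_in v.2 w.2) (ang_in u.2 w.2)); rewrite ?cone_dist_sq ?(ltW u0) ?(ltW v0) ?(ltW w0) //.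
- apply: (cone_triangle_law (cone_dist_ge0 u v) (ltW v0) (ltW u0) (ltW u0) (ltW v0) (lexx 0) (ang_in u.2 v.2) p0 (ang_in u.2 v.2)); rewrite ?cone_dist_sq ?(ltW u0) ?(ltW v0) //; [by rewrite addr0|ring|ring].
- have := cone_dist_sq (ltW u0) (ltW w0); set k := cos _ => h.
  have c1 : 0 <= 1 + k by have := cos_geN1 (Num.min (d u.2 w.2) pi); rewrite /k; lra.
  rewrite -ler_sqr ?nnegrE ?cone_dist_ge0 ?addr_ge0 ?(ltW u0) ?(ltW w0) // h.
  by have := mulr_ge0 (mulr_ge0 (ltW u0) (ltW w0)) c1; lra.
- apply: (cone_triangle_law (ltW v0) (cone_dist_ge0 v w) (ltW w0) (lexx 0) (ltW v0) (ltW w0) p0 (ang_in v.2 w.2) (ang_in v.2 w.2)); rewrite ?cone_dist_sq ?(ltW w0) ?(ltW v0) //; [by rewrite add0r|ring|ring].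
- by rewrite addr_ge0 // ltW.
Qed.

HB.instance Definition _ := isMetric.Build R (eucl_cone Y)
  eucl_cone_distxx eucl_cone_dist_eq0 eucl_cone_dist_sym eucl_cone_dist_triangle.

Definition cone_pair (u : R * Y) : eucl_cone Y :=
  if pselect (0 < u.1) is left h then Some (exist _ u h) else None.

Lemma eucl_cone_over : (forall x y : Y, d x y <= pi) -> cone_over (None : eucl_cone Y) cone_pair.
Proof.
move=> Ypi; split=> //.
- by move=> x; rewrite /cone_pair; case: pselect => //= h; exfalso; have := h; rewrite ltxx.
- move=> [r x] [s y] /= r0 s0; rewrite /cone_pair.
  have neg (t : R) : 0 <= t -> ~ 0 < t -> t = 0 by move=> t0 /negP; rewrite -leNgt => t1; apply/eqP; rewrite eq_le t1.
  case: pselect => /= [h|/neg -> //]; case: pselect => /= [h'|/neg -> //] //.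
  + rewrite /cone_dist /= expr0n mulr0 mul0r subr0 addr0.
    by rewrite -[LHS]/(r) sqrtr_sqr ger0_norm.
  + rewrite /cone_dist /= expr0n mulr0 !mul0r subr0 add0r.
    by rewrite -[LHS]/(s) sqrtr_sqr ger0_norm.
  + by rewrite /cone_dist /= expr0n mulr0 !mul0r subr0 addr0 sqrtr0.
- move=> [[u u0]|]; [right|by left].
  by exists u; [exact: ltW|rewrite /cone_pair; case: pselect => // h; congr Some; exact: val_inj].
Qed.
End cone_metric.

Section cone_limits.
Context {R : realType} {C Y : metricType R} {o : C} {c : R * Y -> C}.
Hypothesis CO : cone_over o c.

Lemma cone_apex_Ulim (r : nat -> R) (y : nat -> Y) z : (forall k, 0 <= r k) ->
  ucv (fun k => c (r k, y k)) z -> Ulim r (d o z).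
Proof.
move=> r0 h; apply: Ueq (ucv_d (ucv_cst o) h) => k; by rewrite (cone_dist_apex CO).
Qed.

Lemma ucv_cone_base (r : nat -> R) (y : nat -> Y) (r0 : R) (y0 : Y) : (forall k, 0 <= r k) -> 0 < r0 ->
  ucv (fun k => c (r k, y k)) (c (r0, y0)) -> ucv y y0.
Proof.
move=> rk r00 h; have rl := cone_apex_Ulim rk h; rewrite (cone_dist_apex CO) ?ltW // in rl.
have rp : ulf [set k | 0 < r k] := Ugt rl r00.
have U : Ulim (fun k => (r0 ^+ 2 + r k ^+ 2 - d (c (r0, y0)) (c (r k, y k)) ^+ 2) / (2 * r0 * r k)) 1.
  have e1 : (r0 ^+ 2 + r0 ^+ 2 - 0 ^+ 2) / (2 * r0 * r0) = 1 by field; rewrite gt_eqF.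
  rewrite -[X in Ulim _ X]e1.
  apply: UM; first by apply: UD; [apply: UD; [exact: Ucst|exact: UX]|exact/UN/UX].
  have n0 : 2 * r0 * r0 != 0 by rewrite gt_eqF // mulr_gt0 // mulr_gt0.
  exact: (UV n0 (UM (Ucst (2 * r0)) rl)).
apply/ucvP => e e0.
have [ep|pe] := ltP pi e; first by apply: filterE => k /=; apply: le_lt_trans ep; exact: co_pi CO _ _.
have he : 0 <= e <= pi by rewrite ltW.
have c1 : cos e < 1 by rewrite -cos0 ltr_cos ?in_itv //= lexx pi_ge0.
apply: filterS (filterI (Ugt U c1) rp) => k /= [h1 h2].
rewrite (cone_dist2 CO) ?(ltW h2) ?(ltW r00) // in h1.
have e1 : (r0 ^+ 2 + r k ^+ 2 - (r0 ^+ 2 + r k ^+ 2 - 2 * r0 * r k * cos (d y0 (y k)))) / (2 * r0 * r k)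
   = cos (d y0 (y k)) by field; rewrite !gt_eqF.
rewrite e1 in h1; rewrite ltNge; apply/negP => h3.
by have := cos_decr (angle_in CO y0 (y k)) he h3; lra.
Qed.

Lemma ucv_cone (r : nat -> R) (y : nat -> Y) (r0 : R) (y0 : Y) : (forall k, 0 <= r k) -> 0 <= r0 ->
  Ulim r r0 -> ucv y y0 -> ucv (fun k => c (r k, y k)) (c (r0, y0)).
Proof.
move=> rk r00 rl yl.
have U : Ulim (fun k => Num.sqrt (r0 ^+ 2 + r k ^+ 2 - 2 * r0 * r k * cos (d y0 (y k)))) 0.
  have e0 : Num.sqrt (r0 ^+ 2 + r0 ^+ 2 - 2 * r0 * r0 * cos 0) = 0.
    by rewrite cos0 (_ : _ - _ = 0) ?sqrtr0 //; ring.
  rewrite -[X in Ulim _ X]e0.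
  apply: Usqrt; apply: UD; first by apply: UD; [exact: Ucst|exact: UX].
  apply/UN/UM; first exact: (UM (Ucst (2 * r0)) rl).
  by apply: Ucomp => //; exact: continuous_cos.
by apply: Ueq U => k; rewrite -(cone_dist2 CO) // sqrtr_sqr ger0_norm ?mdist_ge0.
Qed.

Lemma cone_proper_of_compact : (forall u : nat -> Y, exists y, ucv u y) -> proper_metric C.
Proof.
move=> cY u x r ur.
have [[y0]|nY] := pselect (inhabited Y); last first.
  exists o; suff E : forall k, u k = o by apply: Ueq (ucv_cst o) => k; rewrite E.
  move=> k; apply: contrapT => /(cone_point CO) [s [y _]]; by apply: nY; exists.
have /choice [sy syP] : forall k, exists sy : R * Y, 0 <= sy.1 /\ u k = c sy.
  move=> k; have [->|[v v0 vE]] := co_surj CO (u k); last by exists v.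
  by exists (0, y0); rewrite (co_apex CO).
have [k|s sl /andP[s0 _]] := @Ubnd R (fun k => (sy k).1) 0 (d o x + r).
  have [h1 h2] := syP k; rewrite h1 /=; apply: le_trans (_ : d o (u k) <= _).
    by rewrite h2; case: (sy k) h1 => a b /= h1; rewrite (cone_dist_apex CO).
  by apply: le_trans (metric_triangle _ x _) _; rewrite lerD2l.
have [y yl] := cY (fun k => (sy k).2).
exists (c (s, y)).
have H := ucv_cone (fun k => (syP k).1) s0 sl yl.
by apply: Ueq H => k; have [_ ->] := syP k; case: (sy k).
Qed.
End cone_limits.

(** * Tangent cones as blow-ups *)

Section tangent.
Context {R : realType} {Z : metricType R} {p : Z}.
Hypothesis T : tame p.
Hypothesis PK : pack_at p.

Let An := tm_angled T.
Definition tcone := eucl_cone (directions p).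
Local Notation tc := (@cone_pair R (directions p)).
Local Notation tapex := (None : tcone).

Lemma tangent_cone_over : cone_over tapex tc.
Proof. by apply: eucl_cone_over => x y; exact: dir_dist_pi. Qed.
Let CO := tangent_cone_over.

Lemma tangent_cone_proper : proper_metric tcone.
Proof. by apply: (cone_proper_of_compact CO) => u; exact: directions_ulim. Qed.

Definition blow (k : nat) : R := k.+1%:R.

Lemma blow_gt0 k : 0 < blow k. Proof. by []. Qed.

(** Representation in polar coordinates: the geodesic from p to the k-th point may vary with k, and
    its direction together with the rescaled distance must converge in the tangent cone. *)
Definition trep (x : nat -> Z) (z : tcone) := exists (g : nat -> geodesic p) (s : nat -> R),
  (forall k, 0 <= s k <= glen (g k) /\ x k = gpath (g k) (s k)) /\
  ucv (fun k => tc (blow k * s k, dir (g k))) z.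

Lemma Ublow_inv : Ulim (fun k => (blow k)^-1) 0. Proof. exact: Uinv. Qed.

Lemma scaled_small (s : nat -> R) (S : R) : Ulim (fun k => blow k * s k) S -> Ulim s 0.
Proof.
move=> h; have := UM h Ublow_inv; rewrite mulr0; apply: Ueq => k.
by rewrite mulrAC divff ?mul1r // gt_eqF ?blow_gt0.
Qed.

Lemma trep_bounded (x : nat -> Z) (B : R) : geodesic p ->
  (forall k, p <> x k -> exists f, segment p (x k) f) ->
  ulf [set k | blow k * d p (x k) <= B] -> exists z, trep x z.
Proof.
move=> g0 seg hB.
have /choice [g gP] : forall k, exists g : geodesic p, 0 <= d p (x k) <= glen g /\ x k = gpath g (d p (x k)).
  move=> k; have [<-|px] := pselect (p = x k).
    by exists g0; rewrite mdistxx lexx ltW ?glen_gt0 // gpath0.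
  have [f sf] := seg k px; have [g [lg eg _]] := geodesic_of_segment sf px.
  by exists g; rewrite lg lexx mdist_ge0 -lg -/(gend g) eg.
have [|v vb||z hz] := @ucv_eventually _ _ [set z | d tapex z <= `|B|] (fun k => tc (blow k * d p (x k), dir (g k))).
- by exists tapex; rewrite /= mdistxx.
- exact: (tangent_cone_proper vb).
- apply: filterS hB => k /= hk.
  by rewrite (cone_dist_apex CO) ?mulr_ge0 ?mdist_ge0 // (le_trans hk) // ler_norm.
by exists z, g, (fun k => d p (x k)).
Qed.

Lemma trep_apex_dist (x : nat -> Z) z : trep x z -> Ulim (fun k => blow k * d p (x k)) (d tapex z).
Proof.
move=> [g [s [gs h]]]; have := cone_apex_Ulim CO _ h => H.
have e k : blow k * s k = blow k * d p (x k) by have [hs ->] := gs k; rewrite gpath_dist.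
apply: Ueq e _; apply: H => k; have [/andP[s0 _] _] := gs k; by rewrite mulr_ge0.
Qed.

(** A direction need not be that of a geodesic, and geodesics close to it may be short. So at each
    scale one takes a geodesic that is long enough to reach rescaled distance r and whose direction
    is closest to xi up to 1 / (k + 1); every fixed geodesic is eventually long enough to
    compete. *)
Lemma trep_ex z : geodesic p -> exists x, trep x z.
Proof.
move=> g0; have [->|[[r xi] /= r0 <-]] := co_surj CO z.
  exists (fun=> p), (fun=> g0), (fun=> 0); split.
    by move=> k; rewrite lexx ltW ?glen_gt0 // gpath0.
  by under eq_fun do rewrite mulr0 (co_apex CO); exact: ucv_cst.
pose good k (g : geodesic p) := r <= blow k * glen g.
have /choice [g gP] : forall k, exists g : geodesic p,
    (exists g', good k g') -> good k g /\ forall g', good k g' -> d xi (dir g) <= d xi (dir g') + k.+1%:R^-1.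
  move=> k; have [[g1 gg1]|] := pselect (exists g', good k g'); last by exists g0.
  pose S := [set a : R | exists2 g', good k g' & a = d xi (dir g')].
  have Si : has_inf S.
    by split; [exists (d xi (dir g1)), g1|exists 0 => _ [g' _ ->]; exact: mdist_ge0].
  have [_ [g gg ->] lt] := inf_adherent (Uinv_gt0 (R := R) k) Si.
  exists g => _; split=> // g' gg'; apply: le_trans (ltW lt) _; rewrite lerD2r.
  by apply: ge_inf; [case: Si|exists g'].
have glarge (g' : geodesic p) : ulf [set k | good k g'].
  have := ulf_large (r / glen g'); apply: filterS => k /=; rewrite ltr_pdivrMr ?glen_gt0 // => h.
  rewrite /good /blow -natr1 mulrDl mul1r; have := glen_gt0 g'; lra.
pose s k := if `[< good k (g k) >] then r / blow k else 0.
exists (fun k => gpath (g k) (s k)), g, s; split.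
  move=> k; split=> //; rewrite /s; case: asboolP => h; last by rewrite lexx ltW ?glen_gt0.
  by rewrite divr_ge0 //= ler_pdivrMr ?blow_gt0 // mulrC.
have sE : ulf [set k | blow k * s k = r].
  apply: filterS (glarge g0) => k /= gg; have [h _] := gP k (ex_intro _ g0 gg).
  by rewrite /s; case: asboolP => // _; rewrite mulrC divfK // gt_eqF ?blow_gt0.
apply: (ucv_cone CO) => //.
- by move=> k; rewrite /s mulr_ge0 //; case: asboolP => // _; rewrite divr_ge0.
- by apply: (Usq (Ucst r) (Ucst r)); apply: filterS sE => k /= ->; rewrite lexx.
- apply/ucvP => e e0; have e2 : 0 < e / 2 by rewrite divr_gt0.
  have e4 : 0 < e / 4 by rewrite divr_gt0.
  have [g' hg'] := dir_approx xi e4.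
  apply: filterS (filterI (glarge g') (Ule0 (Uinv (R := R)) e2)) => k /= [gg].
  have [_ /(_ g' gg)] := gP k (ex_intro _ g' gg); set ek := _^-1; lra.
Qed.

Lemma Ulim_le (u v : nat -> R) a b (e : R) : Ulim u a -> Ulim v b ->
  ulf [set k | `|u k - v k| <= e] -> `|a - b| <= e.
Proof.
move=> ua vb h; have U := UD ua (UN vb); rewrite ler_norml; apply/andP; split.
  by apply: (Ule (Ucst _) U); apply: filterS h => k /=; rewrite ler_norml => /andP[].
by apply: (Ule U (Ucst _)); apply: filterS h => k /=; rewrite ler_norml => /andP[].
Qed.

(** The varying geodesics are compared with two fixed ones g1 and h1, at a cost bounded by the hinge
    inequality of tame points. For fixed geodesics the rescaled distances converge by the definition
    of the angle. Then g1 and h1 are moved towards the two limit directions. *)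
Lemma trep_dist (x y : nat -> Z) z w : trep x z -> trep y w -> Ulim (fun k => blow k * d (x k) (y k)) (d z w).
Proof.
move=> rx ry; have ax := trep_apex_dist rx; have ay := trep_apex_dist ry.
have [zo|zo] := pselect (z = tapex).
  rewrite zo in ax *; rewrite mdistxx in ax.
  have L := UD ay (UN ax); rewrite subr0 in L; have L2 := UD ay ax; rewrite addr0 in L2.
  apply: (Usq L L2); apply: filterE => k /=; rewrite -mulrBr -mulrDr !ler_pM2l ?blow_gt0 //.
  have := metric_triangle p (x k) (y k); have := metric_triangle (x k) p (y k).
  by rewrite (metric_sym (x k) p) => *; apply/andP; split; lra.
have [wo|wo] := pselect (w = tapex).
  rewrite wo in ay *; rewrite mdistxx in ay; rewrite (metric_sym z).
  have L := UD ax (UN ay); rewrite subr0 in L; have L2 := UD ax ay; rewrite addr0 in L2.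
  apply: (Usq L L2); apply: filterE => k /=; rewrite -mulrBr -mulrDr !ler_pM2l ?blow_gt0 //.
  have := metric_triangle p (y k) (x k); have := metric_triangle (x k) p (y k).
  by rewrite (metric_sym (x k) p) (metric_sym (y k) (x k)) => *; apply/andP; split; lra.
have [S [xi [S0 zE]]] := cone_point CO zo; have [V [zeta [V0 wE]]] := cone_point CO wo.
have [g [s [gs hz]]] := rx; have [h [t [ht hw]]] := ry.
have s0 k : 0 <= blow k * s k by have [/andP[a _] _] := gs k; rewrite mulr_ge0.
have t0 k : 0 <= blow k * t k by have [/andP[a _] _] := ht k; rewrite mulr_ge0.
have sl := cone_apex_Ulim CO s0 hz; have tl := cone_apex_Ulim CO t0 hw.
rewrite zE (cone_dist_apex CO) ?(ltW S0) // in sl; rewrite wE (cone_dist_apex CO) ?(ltW V0) // in tl.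
rewrite zE in hz; rewrite wE in hw.
have gx := ucv_cone_base CO s0 S0 hz; have hy := ucv_cone_base CO t0 V0 hw.
have ss := scaled_small sl; have tt := scaled_small tl.
have spos : ulf [set k | 0 < s k] by apply: filterS (Ugt sl S0) => k /=; rewrite pmulr_rgt0.
have tpos : ulf [set k | 0 < t k] by apply: filterS (Ugt tl V0) => k /=; rewrite pmulr_rgt0.
have [k|D DL _] := @Ubnd R (fun k => Num.min (blow k * d (x k) (y k)) (S + V + 1)) 0 (S + V + 1).
  by rewrite le_min mulr_ge0 ?mdist_ge0 //= ge_min lexx orbT; lra.
have DL2 : Ulim (fun k => blow k * d (x k) (y k)) D.
  apply: (Usq DL DL); have L := UD sl tl; have lt1 : - (S + V + 1) < - (S + V) by lra.
  apply: filterS (Ugt (UN L) lt1) => k /=; rewrite ltrN2 => h1.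
  have h2 : blow k * d (x k) (y k) <= S + V + 1.
    apply: le_trans (ltW h1); rewrite -mulrDr ler_pM2l ?blow_gt0 //.
    have [hs ->] := gs k; have [ht' ->] := ht k.
    by apply: le_trans (metric_triangle _ p _) _; rewrite (metric_sym _ p) !gpath_dist.
  by rewrite min_l // lexx.
suff -> : d z w = D by [].
have [s1 s10 hinge] := tm_hinge T.
(* The rescaled distance, at unit length, allowed by [tm_hinge] between geodesics at angle a. *)
pose cc (a : R) := Num.sqrt (5 * (1 - cos a)).
have ccU (u : nat -> R) a : Ulim u a -> Ulim (fun k => cc (u k)) (cc a).
  move=> ul; apply: Usqrt; apply: UM; first exact: Ucst.
  by apply: UD; [exact: Ucst|apply/UN/Ucomp => //; exact: continuous_cos].
have near (f : nat -> geodesic p) (r : nat -> R) (Q : R) eta (f0 : geodesic p) : Ulim (fun k => blow k * r k) Q ->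
    ulf [set k | 0 < r k] -> (forall k, r k <= glen (f k)) -> ucv (fun k => dir (f k)) eta ->
    exists2 v, Ulim v (Q * cc (d (dir f0) eta)) &
    ulf [set k | blow k * d (gpath (f k) (r k)) (gpath f0 (r k)) <= v k].
  move=> rQ rp rf feta; exists (fun k => blow k * r k * cc (angle (f k) f0)).
    apply: UM => //; apply: ccU; apply: Ueq (ucv_d (ucv_cst (dir f0)) feta) => k.
    by rewrite dir_dist_angle // angleC.
  have rs := scaled_small rQ.
  apply: filterS (filterI rp (filterI (Ule0 rs s10) (Ule0 rs (glen_gt0 f0)))) => k /= [r0 [r1 r2]].
  rewrite -mulrA ler_pM2l ?blow_gt0 //.
  have c0 : 0 <= 5 * (1 - cos (angle (f k) f0)) by rewrite mulr_ge0 // subr_ge0 cos_le1.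
  rewrite -ler_sqr ?nnegrE ?mdist_ge0 ?mulr_ge0 ?sqrtr_ge0 ?(ltW r0) // exprMn sqr_sqrtr //.
  by have := hinge (f k) f0 (r k) (ltac:(by rewrite r0)) (rf k) r2; lra.
pose Dc a := Num.sqrt (S ^+ 2 + V ^+ 2 - 2 * S * V * cos a).
have est (g1 h1 : geodesic p) : `|D - Dc (angle g1 h1)| <= S * cc (d (dir g1) xi) + V * cc (d (dir h1) zeta).
  have [v vl vb] := near g s S xi g1 sl spos (fun k => (andP (gs k).1).2) gx.
  have [v' vl' vb'] := near h t V zeta h1 tl tpos (fun k => (andP (ht k).1).2) hy.
  have ML : Ulim (fun k => blow k * d (gpath g1 (s k)) (gpath h1 (t k))) (Dc (angle g1 h1)).
    have KL : Ulim (fun k => kap g1 h1 (s k) (t k)) (cos (angle g1 h1)).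
      apply/UP => e e0; have [n [n0 _ _ hn]] := An g1 h1 e0.
      apply: filterS (filterI (filterI spos tpos) (filterI (Ule0 ss n0) (Ule0 tt n0))) => k /= [[a b] [a' b']].
      by rewrite distrC; apply: hn; rewrite ?a ?b.
    have := Usqrt (UD (UD (UX 2 sl) (UX 2 tl)) (UN (UM (UM (UM (Ucst 2) sl) tl) KL))) => L.
    apply: (Usq L L); apply: filterS (filterI (filterI spos tpos)
       (filterI (Ule0 ss (glen_gt0 g1)) (Ule0 tt (glen_gt0 h1)))) => k /= [[a b] [a' b']].
    have hs : 0 < s k <= glen g1 by rewrite a. have ht' : 0 < t k <= glen h1 by rewrite b.
    have -> : (blow k * s k) ^+ 2 + (blow k * t k) ^+ 2 - 2 * (blow k * s k) * (blow k * t k) * kap g1 h1 (s k) (t k)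
       = (blow k * d (gpath g1 (s k)) (gpath h1 (t k))) ^+ 2 by rewrite [RHS]exprMn kap_dist //; ring.
    by rewrite sqrtr_sqr ger0_norm ?lexx // mulr_ge0 ?mdist_ge0.
  have U1 := UD DL2 (UN ML); have U2 := UD vl vl'.
  have bnd : ulf [set k | `|blow k * d (x k) (y k) - blow k * d (gpath g1 (s k)) (gpath h1 (t k))| <= v k + v' k].
    apply: filterS (filterI vb vb') => k /= [b1 b2].
    rewrite -mulrBr normrM (gtr0_norm (blow_gt0 k)); apply: le_trans (lerD b1 b2).
    rewrite -mulrDr ler_pM2l ?blow_gt0 //.
    have [_ ->] := gs k; have [_ ->] := ht k.
    set a := gpath (g k) _; set b := gpath (h k) _; set a' := gpath g1 _; set b' := gpath h1 _.
    have := metric_triangle a a' b; have := metric_triangle a' b' b.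
    have := metric_triangle a' a b'; have := metric_triangle a b b'.
    rewrite (metric_sym a' a) (metric_sym b' b) ler_norml => *; apply/andP; split; lra.
  rewrite ler_norml; apply/andP; split.
    apply: (Ule (UN U2) U1); apply: filterS bnd => k /=; by rewrite ler_norml => /andP[].
  by apply: (Ule U1 U2); apply: filterS bnd => k /=; rewrite ler_norml => /andP[].
have /choice [G hG] : forall j : nat, exists g1 : geodesic p, d xi (dir g1) <= j.+1%:R^-1.
  by move=> j; apply: dir_approx; exact: Uinv_gt0.
have /choice [H hH] : forall j : nat, exists h1 : geodesic p, d zeta (dir h1) <= j.+1%:R^-1.
  by move=> j; apply: dir_approx; exact: Uinv_gt0.
have Gl : ucv (fun j => dir (G j)) xi.
  by apply: (@ucv_le _ _ (fun=> xi) _ xi (fun k => k.+1%:R^-1)); [exact: ucv_cst|exact: Uinv|exact: filterE].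
have Hl : ucv (fun j => dir (H j)) zeta.
  by apply: (@ucv_le _ _ (fun=> zeta) _ zeta (fun k => k.+1%:R^-1)); [exact: ucv_cst|exact: Uinv|exact: filterE].
have cc0 : cc 0 = 0 by rewrite /cc cos0 subrr mulr0 sqrtr0.
have R1 := UD (UM (Ucst S) (ccU _ _ (ucv_d Gl (ucv_cst xi)))) (UM (Ucst V) (ccU _ _ (ucv_d Hl (ucv_cst zeta)))).
rewrite !mdistxx cc0 !mulr0 addr0 in R1.
have R2 : Ulim (fun j => Dc (angle (G j) (H j))) (Dc (d xi zeta)).
  apply: Usqrt; apply: UD; first exact: Ucst; apply/UN/UM; first exact: Ucst.
  apply: Ucomp; first exact: continuous_cos.
  by apply: Ueq (ucv_d Gl Hl) => j; rewrite dir_dist_angle.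
have : D - Dc (d xi zeta) = 0.
  have U1 := UD (Ucst D) (UN R2); have U2 := UN R1; rewrite oppr0 in U2.
  by apply: (Uuniq U1); apply: (Usq U2 R1); apply: filterE => j /=; rewrite -ler_norml; exact: est.
move/eqP; rewrite subr_eq0 => /eqP ->.
by rewrite /Dc zE wE -(cone_dist2 CO) ?ltW // sqrtr_sqr ger0_norm ?mdist_ge0.
Qed.
End tangent.

Section tangent_of_stewart.
Context {R : realType} {X : metricType R} (p : X).
Hypothesis RX : ray_space X.
Hypothesis PX : uniform_packing X.

Lemma pack_at_of_uniform : pack_at p.
Proof.
move=> e e0; have e2 : 0 < e / 2 by rewrite divr_gt0.
have [K hK] := PX e2; exists K, 1 => // s /andP[s0 _] N y ys sep.
have s2 : 0 < 2 * s by rewrite mulr_gt0.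
apply: (hK p (2 * s) s2 N y) => [i|i j ij]; first by have := ys i; lra.
by have := sep i j ij; lra.
Qed.

Lemma ray_space_tame : tame p.
Proof. exact: tame_stewart (rs_stewart RX) (rs_proper RX). Qed.
Let T := ray_space_tame.
Let PK := pack_at_of_uniform.

Hypothesis g0 : geodesic p.

Lemma tangent_limit_system : @limit_system R X (tcone (p := p)) blow trep.
Proof. by split; [exact: blow_gt0|move=> z; exact: (trep_ex T)|move=> *; exact: (trep_dist T)]. Qed.

Lemma tangent_ray_space : ray_space (tcone (p := p)).
Proof.
apply: (limit_ray_space tangent_limit_system) RX (tangent_cone_proper T PK).
have small (x : nat -> X) (z : tcone (p := p)) : trep x z -> exists B, ulf [set k | blow k * d p (x k) <= B].
  move=> hx; have h := trep_apex_dist T hx; exists (d (None : tcone (p := p)) z + 1).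
  have lt1 : - (d (None : tcone (p := p)) z + 1) < - d (None : tcone (p := p)) z by lra.
  by apply: filterS (Ugt (UN h) lt1) => k /=; rewrite ltrN2; exact: ltW.
have seg (x : nat -> X) k : p <> x k -> exists f, segment p (x k) f by move=> _; exact: (rs_segment RX).
split=> [x y m z w /small [B hB] /small [B' hB'] bt|x y m z w L _ /small [B hB] _ bt hL].
  apply: (trep_bounded T PK (B := B + (B + B')) g0 (seg m)).
  apply: filterS (filterI hB hB') => k /= [h1 h2].
  have t1 := metric_triangle p (x k) (m k); have t2 := metric_triangle (x k) p (y k).
  have t3 := bt k; rewrite /btw (metric_sym (x k) p) in t2 t3.
  have t4 : d p (m k) <= d p (x k) + (d p (x k) + d p (y k)) by have := mdist_ge0 (m k) (y k); lra.
  have := ler_wpM2l (ltW (blow_gt0 (R := R) k)) t4; rewrite !mulrDr; lra.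
apply: (trep_bounded T PK (B := B + L) g0 (seg m)).
apply: filterS hB => k /= h1; have t1 := metric_triangle p (y k) (m k).
have := ler_wpM2l (ltW (blow_gt0 (R := R) k)) t1; rewrite !mulrDr; have := hL k; lra.
Qed.

Lemma tangent_packing : uniform_packing (tcone (p := p)).
Proof. exact: limit_packing tangent_limit_system PX. Qed.
End tangent_of_stewart.

(** * Tangent cones of the base of a cone *)

Section tangent_of_cone.
Context {R : realType} {C Y : metricType R} {o : C} {c : R * Y -> C} (p : Y).
Hypothesis CO : cone_over o c.
Hypothesis RC : ray_space C.
Hypothesis PC : uniform_packing C.
Hypothesis g0 : geodesic p.
Let T := cone_tame CO RC p.
Let PK := cone_pack CO p PC.

(* Points of the cone near the unit sphere, which is a copy of [Y]. *)
Definition crep (x : nat -> C) (z : tcone (p := p)) := exists y : nat -> Y,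
  trep y z /\ Ulim (fun k => blow k * d (x k) (c (1, y k))) 0.

Lemma unit_dist_ge (x y : Y) : exists2 t, 0 <= t <= d x y / 2 & d (c (1, x)) (c (1, y)) = d x y * cos t.
Proof.
have D0 : 0 <= d x y / 2 by rewrite divr_ge0 ?mdist_ge0.
have [t ht st] := sin_mean D0; exists t => //.
have Dp := co_pi CO x y; have s0 : 0 <= sin (d x y / 2) by apply: sin_ge0_pi; rewrite D0 /=; lra.
have -> : d x y * cos t = 2 * sin (d x y / 2) by rewrite st; field.
apply/eqP; rewrite -(@eqrXn2 _ 2) ?mdist_ge0 ?mulr_ge0 //; apply/eqP.
by rewrite (unit_dist2 CO); have := one_sub_cos (d x y); lra.
Qed.

Lemma crep_limit_system : limit_system blow crep.
Proof.
split; first exact: blow_gt0.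
  move=> z; have [y hy] := trep_ex T z g0; exists (fun k => c (1, y k)), y; split=> //.
  by under eq_fun do rewrite mdistxx mulr0; exact: Ucst.
move=> x x' z w [y [hy xy]] [y' [hy' xy']].
have L := trep_dist T hy hy'.
have Dl : Ulim (fun k => d (y k) (y' k)) 0 := scaled_small L.
have /choice [t tP] : forall k, exists t, 0 <= t <= d (y k) (y' k) / 2 /\
    d (c (1, y k)) (c (1, y' k)) = d (y k) (y' k) * cos t.
  by move=> k; have [t h1 h2] := unit_dist_ge (y k) (y' k); exists t.
have t0 : Ulim t 0.
  have H := UM Dl (Ucst 2^-1); rewrite mul0r in H.
  by apply: (Usq (Ucst 0) H); apply: filterE => k /=; have [] := tP k.
have cl : Ulim (fun k => cos (t k)) 1 by rewrite -[X in Ulim _ X]cos0; apply: Ucomp t0; exact: continuous_cos.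
have L1 := UM L cl; rewrite mulr1 in L1.
have LL := UD L1 (UN (UD xy xy')); rewrite addr0 subr0 in LL.
have LU := UD L1 (UD xy xy'); rewrite !addr0 in LU.
apply: (Usq LL LU); apply: filterE => k /=; have [_ e] := tP k.
rewrite -mulrA -e -mulrDr -mulrDr -mulrN -mulrDr !ler_pM2l ?blow_gt0 //.
set a := x k; set b := x' k; set a' := c (1, y k); set b' := c (1, y' k).
have := metric_triangle a a' b; have := metric_triangle a' b' b.
have := metric_triangle a' a b'; have := metric_triangle a b b'.
by rewrite (metric_sym a' a) (metric_sym b' b) => *; apply/andP; split; lra.
Qed.

(** Stewart's relation with respect to the apex is an equality, as the triangle spanned by the apex
    and a segment is flat. *)
Lemma cone_stewart_eq (u v w : C) : btw u v w ->
  u <> o -> v <> o -> w <> o ->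
  (d u v + d v w) * d o v ^+ 2 = d v w * d o u ^+ 2 + d u v * d o w ^+ 2 - d u v * d v w * (d u v + d v w).
Proof.
move=> bt /(cone_point CO) [r1 [x1 [r10 uE]]] /(cone_point CO) [r2 [x2 [r20 vE]]] /(cone_point CO) [r3 [x3 [r30 wE]]].
rewrite uE vE wE in bt *; rewrite !(cone_dist_apex CO) ?ltW //.
have [_ h2 h3 _] := cone_btw CO r10 r20 r30 bt.
have hx := cone_dist2 CO x1 x2 (ltW r10) (ltW r20).
have hz := cone_dist2 CO x1 x3 (ltW r10) (ltW r30).
have hz' := hz; rewrite -bt in hz.
set x := d (c (r1, x1)) _ in h2 h3 hx hz *; set y := d (c (r2, x2)) _ in h2 h3 hz *.
set A := d x1 x2 in h2 h3 hx; set D := d x1 x3 in h2 h3 hz.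
have [z0|z0] := eqVneq (x + y) 0.
  have x0 : x = 0 by have := mdist_ge0 (c (r1, x1)) (c (r2, x2)); have := mdist_ge0 (c (r2, x2)) (c (r3, x3)); rewrite -/x -/y; lra.
  have y0 : y = 0 by lra.
  by rewrite z0 x0 y0; ring.
apply: (mulfI z0).
have eA : r2 ^+ 2 = (r2 * cos A) ^+ 2 + (r2 * sin A) ^+ 2 by rewrite !exprMn -mulrDr cos2Dsin2 mulr1.
have eD : r3 ^+ 2 = (r3 * cos D) ^+ 2 + (r3 * sin D) ^+ 2 by rewrite !exprMn -mulrDr cos2Dsin2 mulr1.
have -> : (x + y) * ((x + y) * r2 ^+ 2) = ((x + y) * (r2 * cos A - r1) + (x + y) * r1) ^+ 2 + ((x + y) * (r2 * sin A)) ^+ 2.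
  by rewrite eA; ring.
rewrite h2 h3.
have -> : (x * (r3 * cos D - r1) + (x + y) * r1) ^+ 2 + (x * (r3 * sin D)) ^+ 2 =
  x ^+ 2 * ((r3 * cos D) ^+ 2 + (r3 * sin D) ^+ 2) + y ^+ 2 * r1 ^+ 2 + x * y * (2 * r1 * r3 * cos D) by ring.
rewrite -eD; have -> : 2 * r1 * r3 * cos D = r1 ^+ 2 + r3 ^+ 2 - (x + y) ^+ 2 by rewrite hz; ring.
by ring.
Qed.

Lemma Uabs0 (u : nat -> R) : Ulim u 0 -> Ulim (fun k => `|u k|) 0.
Proof.
move=> /UP h; apply/UP => e /h; apply: filterS => k /=.
by rewrite !sub0r !normrN normr_id.
Qed.

Lemma Ubound0 (u v : nat -> R) : Ulim v 0 -> ulf [set k | `|u k| <= v k] -> Ulim u 0.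
Proof.
move=> v0 h; have nv0 := UN v0; rewrite oppr0 in nv0.
by apply: (Usq nv0 v0); apply: filterS h => k /=; rewrite ler_norml.
Qed.

Lemma unit_dist_le (x y : Y) : d (c (1, x)) (c (1, y)) <= d x y.
Proof.
by have [t _ ->] := unit_dist_ge x y; rewrite ler_piMr ?mdist_ge0 // cos_le1.
Qed.

Lemma crep_close (x : nat -> C) (B : R) : ulf [set k | blow k * d (x k) (c (1, p)) <= B] ->
  ucv x (c (1, p)).
Proof.
move=> hB; have L := UM (Ucst B) (Ublow_inv (R := R)); rewrite mulr0 in L.
apply: (@ucv_le _ _ (fun=> c (1, p)) x _ (fun k => B * (blow k)^-1)) => //; first exact: ucv_cst.
apply: filterS hB => k /= h.
by rewrite metric_sym ler_pdivlMr ?blow_gt0 // mulrC.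
Qed.

Lemma crep_neq_apex (x : nat -> C) (B : R) : ulf [set k | blow k * d (x k) (c (1, p)) <= B] ->
  ulf [set k | x k <> o].
Proof.
move=> /crep_close h; have L := ucv_d (ucv_cst o) h; rewrite (cone_dist_apex CO) // in L.
by apply: filterS (Ugt L ltr01) => k /= h1 E; move: h1; rewrite E mdistxx ltxx.
Qed.

(** Projecting a point of radius r to the unit sphere moves it by the absolute value of r - 1, which
    the second hypothesis makes negligible against the scale 1 / (k + 1). The projected points have
    bounded polar coordinates at p. *)
Lemma crep_bounded (x : nat -> C) (B : R) :
  ulf [set k | blow k * d (x k) (c (1, p)) <= B] -> Ulim (fun k => blow k * (d o (x k) ^+ 2 - 1)) 0 ->
  exists z, crep x z.
Proof.
move=> hB hs.
have /choice [y yP] : forall k, exists y : Y, x k <> o -> d (x k) (c (1, y)) <= `|d o (x k) ^+ 2 - 1|.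
  move=> k; have [->|xo] := pselect (x k = o); first by exists p.
  have [r [v [r0 E]]] := cone_point CO xo; exists v => _.
  rewrite E (cone_dist_apex CO) ?(ltW r0) //.
  have -> : d (c (r, v)) (c (1, v)) = `|r - 1|.
    apply/eqP; rewrite -(@eqrXn2 _ 2) ?mdist_ge0 // (cone_dist2 CO) ?(ltW r0) // mdistxx cos0.
    by rewrite real_normK ?num_real //; apply/eqP; ring.
  have -> : r ^+ 2 - 1 = (r - 1) * (r + 1) by ring.
  by rewrite normrM; apply: ler_peMr => //; rewrite ger0_norm; lra.
have xo := crep_neq_apex hB; have xc := crep_close hB.
have near : ulf [set k | d (x k) (c (1, y k)) <= `|d o (x k) ^+ 2 - 1|].
  by apply: filterS xo => k /= /yP.
have hs' := Uabs0 hs.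
have xy : Ulim (fun k => blow k * d (x k) (c (1, y k))) 0.
  apply: (Ubound0 hs'); apply: filterS near => k /= h.
  rewrite !normrM (gtr0_norm (blow_gt0 _)) ler_pM2l ?blow_gt0 // ger0_norm ?mdist_ge0 //.
have yc : ucv (fun k => c (1, y k)) (c (1, p)).
  apply: (@ucv_le _ _ x _ _ (fun k => d (x k) (c (1, y k))) xc); first exact: scaled_small xy.
  by apply: filterE => k /=.
have yp := ucv_unit CO yc.
have [n n0 hn] := unit_dist_close CO.
pose y' k := if `[< d p (y k) < pi >] then y k else p.
have yE : ulf [set k | y' k = y k].
  move/ucvP: yp => /(_ _ (pi_gt0 R)); apply: filterS => k /= h.
  by rewrite /y'; case: asboolP.
have [| |z hz] := @trep_bounded _ _ _ T PK y' (2 * (B + 1)) g0.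
- move=> k pk; apply: (cone_segment CO (rs_segment RC)).
  by rewrite /y'; case: asboolP => // _; rewrite mdistxx pi_gt0.
- apply: filterS (filterI (filterI hB (Ule0 xy (ltr01 : 0 < 1 :> R))) (filterI yE (Ule0 yp n0))) => k /= [[h1 h2] [-> h4]].
  have h5 := hn _ _ h4.
  have h6 : d p (y k) <= 2 * d (c (1, p)) (c (1, y k)).
    rewrite -ler_sqr ?nnegrE ?mulr_ge0 ?mdist_ge0 // exprMn (unit_dist2 CO).
    have := sqr_ge0 (d p (y k)); lra.
  have h7 := metric_triangle (c (1, p)) (x k) (c (1, y k)).
  rewrite (metric_sym (c (1, p)) (x k)) in h7.
  have h8 : d p (y k) <= 2 * (d (x k) (c (1, p)) + d (x k) (c (1, y k))) by lra.
  by have := ler_wpM2l (ltW (blow_gt0 (R := R) k)) h8; lra.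
exists z, y'; split=> //.
apply: (Usq xy xy); apply: filterS yE => k /= ->; by rewrite lexx.
Qed.

Lemma crep_small (x : nat -> C) z : crep x z ->
  (exists B, ulf [set k | blow k * d (x k) (c (1, p)) <= B]) /\ Ulim (fun k => blow k * (d o (x k) ^+ 2 - 1)) 0.
Proof.
move=> [y [hy xy]]; have L := trep_apex_dist T hy; split.
  pose D := d (None : tcone (p := p)) z; exists (1 + (D + 1)).
  have lt1 : - (D + 1) < - D by lra.
  apply: filterS (filterI (Ule0 xy (ltr01 : 0 < 1 :> R)) (Ugt (UN L) lt1)) => k /= [h1].
  rewrite ltrN2 => /ltW h2; apply: le_trans (lerD h1 h2); rewrite -mulrDr ler_pM2l ?blow_gt0 //.
  apply: le_trans (metric_triangle _ (c (1, y k)) _) _; rewrite lerD2l metric_sym; exact: unit_dist_le.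
have small := scaled_small xy.
have L2 := UM xy (UD (Ucst 2) small); rewrite mul0r in L2.
apply: (Ubound0 L2); apply: filterE => k /=; rewrite normrM (gtr0_norm (blow_gt0 _)) -mulrA ler_pM2l ?blow_gt0 //.
have e1 : d o (c (1, y k)) = 1 by rewrite (cone_dist_apex CO).
have t1 := metric_triangle o (x k) (c (1, y k)); have t2 := metric_triangle o (c (1, y k)) (x k).
rewrite (metric_sym (c (1, y k))) in t2; rewrite e1 in t1 t2.
have -> : d o (x k) ^+ 2 - 1 = (d o (x k) - 1) * (d o (x k) + 1) by ring.
have r0 := mdist_ge0 o (x k).
rewrite normrM; apply: ler_pM => //; first by rewrite ler_norml; apply/andP; split; lra.
by rewrite ger0_norm; lra.
Qed.

(** Here a, b and m stand for squared distances to the apex of two end points and of a point between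
    them, related by [cone_stewart_eq]. The deviation from 1 grows only by the square of the
    length. *)
Lemma between_sphere_bound (x y a b m : R) : 0 <= x -> 0 <= y -> (x + y = 0 -> m = a) ->
  (x + y) * m = y * a + x * b - x * y * (x + y) -> `|m - 1| <= `|a - 1| + `|b - 1| + (x + y) ^+ 2.
Proof.
move=> x0 y0 deg h; have [z0|z0] := eqVneq (x + y) 0.
  by rewrite (deg z0) -addrA lerDl addr_ge0 ?sqr_ge0.
have zp : 0 < x + y by rewrite lt_neqAle eq_sym z0 addr_ge0.
have n1 := normr_ge0 (a - 1); have n2 := normr_ge0 (b - 1).
rewrite -(ler_pM2l zp) -[X in X * `|_| <= _](gtr0_norm zp) -normrM.
have -> : (x + y) * (m - 1) = y * (a - 1) + x * (b - 1) - x * y * (x + y) by rewrite mulrBr h; ring.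
apply: le_trans (ler_normB _ _) _; apply: le_trans (_ : y * `|a - 1| + x * `|b - 1| + x * y * (x + y) <= _).
  apply: lerD; last by rewrite ger0_norm // !mulr_ge0 // ltW.
  by apply: le_trans (ler_normD _ _) _; rewrite !normrM (ger0_norm x0) (ger0_norm y0).
have := mulr_ge0 x0 n1; have := mulr_ge0 y0 n2.
have : x * y * (x + y) <= (x + y) * (x + y) ^+ 2.
  by rewrite mulrC ler_pM2l //; have := sqr_ge0 x; have := sqr_ge0 y; have := mulr_ge0 x0 y0; lra.
lra.
Qed.

Lemma beyond_sphere_bound (x y a b m Q : R) : 0 < x -> 0 <= y -> y <= Q * x ->
  (x + y) * b = y * a + x * m - x * y * (x + y) ->
  `|m - 1| <= (1 + Q) * `|b - 1| + Q * `|a - 1| + y * (x + y).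
Proof.
move=> x0 y0 yQ h.
have n1 := normr_ge0 (a - 1); have n2 := normr_ge0 (b - 1).
rewrite -(ler_pM2l x0) -[X in X * `|_| <= _](gtr0_norm x0) -normrM.
have -> : x * (m - 1) = (x + y) * (b - 1) - y * (a - 1) + x * y * (x + y).
  by rewrite [(x + y) * (b - 1)]mulrBr h; ring.
apply: le_trans (ler_normD _ _) _; rewrite [`|x * y * (x + y)|]ger0_norm; last by rewrite !mulr_ge0 ?addr_ge0 // ltW.
have : `|(x + y) * (b - 1) - y * (a - 1)| <= (x + y) * `|b - 1| + y * `|a - 1|.
  by apply: le_trans (ler_normB _ _) _; rewrite !normrM (ger0_norm y0) gtr0_norm // ltr_pwDl.
have := ler_wpM2r n1 yQ; have := ler_wpM2r n2 yQ; lra.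
Qed.

(** The unit sphere is not convex in the cone, but on a segment whose length is of the order of the
    scale the squared radius deviates from 1 only to second order, apart from the deviation at the
    given points. After blow-up this disappears, for points between and for points beyond. *)
Lemma crep_convex : convex_limit blow crep.
Proof.
have LS := ls_dist crep_limit_system.
split=> [x w m z z' hx hw bt|x y m z w L hx hy zw bt hL].
  have [[B hB] sx] := crep_small hx; have [[B' hB'] sw] := crep_small hw.
  have D := LS _ _ _ _ hx hw; have Ds := scaled_small D.
  have hM : ulf [set k | blow k * d (m k) (c (1, p)) <= B + (B + B')].
    apply: filterS (filterI hB hB') => k /= [h1 h2].
    have t1 := metric_triangle (m k) (x k) (c (1, p)); have t2 := metric_triangle (x k) (c (1, p)) (w k).
    have t3 := bt k; rewrite /btw in t3; have := mdist_ge0 (m k) (w k) => t4.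
    rewrite (metric_sym (m k) (x k)) in t1; rewrite (metric_sym (c (1, p)) (w k)) in t2.
    have t5 : d (m k) (c (1, p)) <= d (x k) (c (1, p)) + (d (x k) (c (1, p)) + d (w k) (c (1, p))) by lra.
    by have := ler_wpM2l (ltW (blow_gt0 (R := R) k)) t5; rewrite !mulrDr; lra.
  apply: (crep_bounded hM).
  have V := UD (UD (Uabs0 sx) (Uabs0 sw)) (UM D Ds); rewrite mulr0 !addr0 in V.
  apply: (Ubound0 V); apply: filterS (filterI (crep_neq_apex hM) (filterI (crep_neq_apex hB) (crep_neq_apex hB'))) => k /= [mo [xo wo]].
  have e := cone_stewart_eq (bt k) xo mo wo.
  have b := between_sphere_bound (mdist_ge0 (x k) (m k)) (mdist_ge0 (m k) (w k)) _ e.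
  rewrite !normrM (gtr0_norm (blow_gt0 k)) -mulrA -!mulrDr ler_pM2l ?blow_gt0 //.
  rewrite -expr2 -(bt k); apply: b => z0.
  suff -> : x k = m k by [].
  by apply: mdist_positivity; have := mdist_ge0 (x k) (m k); have := mdist_ge0 (m k) (w k); lra.
have [[B hB] sx] := crep_small hx; have [[B' hB'] sy] := crep_small hy.
have D := LS _ _ _ _ hx hy; have Ds := scaled_small D; have dzw := d_gt0 zw.
have hM : ulf [set k | blow k * d (m k) (c (1, p)) <= L + B'].
  apply: filterS hB' => k /= h1; have t1 := metric_triangle (m k) (y k) (c (1, p)).
  rewrite (metric_sym (m k) (y k)) in t1.
  by have := ler_wpM2l (ltW (blow_gt0 (R := R) k)) t1; rewrite !mulrDr; have := hL k; lra.
apply: (crep_bounded hM).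
pose dl := d z w / 2; have dl0 : 0 < dl by rewrite divr_gt0.
have L0 : 0 <= L by apply: le_trans (hL 0%N); rewrite mulr_ge0 ?mdist_ge0.
pose Q := L / dl; have Q0 : 0 <= Q by rewrite divr_ge0 // ltW.
have yl : Ulim (fun k => d (y k) (m k)) 0.
  have H := UM (Ucst L) (Ublow_inv (R := R)); rewrite mulr0 in H.
  apply: (Usq (Ucst 0) H); apply: filterE => k /=; rewrite mdist_ge0 /=.
  by rewrite ler_pdivlMr ?blow_gt0 // mulrC; exact: hL.
have V := UD (UD (UM (Ucst (1 + Q)) (Uabs0 sy)) (UM (Ucst Q) (Uabs0 sx))) (UM (Ucst L) (UD Ds yl)).
rewrite !mulr0 !addr0 mulr0 addr0 in V.
have dll : dl < d z w by rewrite /dl; lra.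
apply: (Ubound0 V); apply: filterS (filterI (Ugt D dll) (filterI (crep_neq_apex hM)
  (filterI (crep_neq_apex hB) (crep_neq_apex hB')))) => k /= [xd [mo [xo yo]]].
have e := cone_stewart_eq (bt k) xo yo mo.
have bk := blow_gt0 (R := R) k.
have x0 : 0 < d (x k) (y k) by rewrite -(pmulr_rgt0 _ bk) (lt_trans dl0).
have yQ : d (y k) (m k) <= Q * d (x k) (y k).
  have e3 : Q * dl = L by rewrite /Q divfK // gt_eqF.
  rewrite -(ler_pM2l bk); apply: le_trans (hL k) _; rewrite mulrCA -e3.
  by apply: ler_wpM2l => //; exact: ltW.
have b := beyond_sphere_bound x0 (mdist_ge0 _ _) yQ e.
rewrite !normrM (gtr0_norm bk).
have := ler_wpM2l (ltW bk) b.
have xy0 : 0 <= d (x k) (y k) + d (y k) (m k) by rewrite addr_ge0 ?mdist_ge0.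
have := ler_wpM2r xy0 (hL k); lra.
Qed.

(** The dichotomy is known for the cone and not for its base. Representing the tangent cone of the
    base by points of the cone near the unit sphere lets the dichotomy of the cone descend. *)
Lemma cone_tangent_ray_space : ray_space (tcone (p := p)).
Proof. exact: (limit_ray_space crep_limit_system crep_convex RC (tangent_cone_proper T PK)). Qed.

Lemma cone_tangent_packing : uniform_packing (tcone (p := p)).
Proof. exact: limit_packing crep_limit_system PC. Qed.
End tangent_of_cone.

(** * Rigidity of exponential maps *)

Section cone_rigidity.
Context {R : realType} {n : nat} {X : metricType R}.
Variables (n0 : 'rV[R]_n) (e : 'rV[R]_n -> X).
Hypothesis RX : ray_space X.
Hypothesis n01 : dot n0 n0 = 1.
Hypothesis e_ray : forall V s t, 0 <= dot V n0 -> 0 <= s -> 0 <= t -> d (e (s *: V)) (e (t *: V)) = `|s - t| * nv V.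
Hypothesis e_inf : forall V W, 0 <= dot V n0 -> 0 <= dot W n0 ->
  Ulim (fun k => d (e (k.+1%:R^-1 *: V)) (e (k.+1%:R^-1 *: W)) / k.+1%:R^-1) (nv (V - W)).
Hypothesis e_onto : forall x, exists2 V, 0 <= dot V n0 & e V = x.

Let e_rad V : 0 <= dot V n0 -> d (e 0) (e V) = nv V.
Proof.
move=> hV; have := e_ray hV (lexx 0) ler01; rewrite scale0r scale1r => ->.
by rewrite sub0r normrN normr1 mul1r.
Qed.

Let e_geodesic V : 0 <= dot V n0 -> 0 < nv V -> exists g : geodesic (e 0), glen g = nv V /\
  forall s, gpath g s = e ((s / nv V) *: V).
Proof.
move=> hV V0; have p0 : e ((0 / nv V) *: V) = e 0 by rewrite mul0r scale0r.
have pi s t : 0 <= s <= nv V -> 0 <= t <= nv V ->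
    d (e ((s / nv V) *: V)) (e ((t / nv V) *: V)) = `|s - t|.
  move=> /andP[s0 _] /andP[t0 _]; rewrite e_ray ?divr_ge0 ?nv_ge0 //.
  by rewrite -mulrBl normrM (ger0_norm (_ : 0 <= (nv V)^-1)) ?invr_ge0 ?nv_ge0 // divfK // gt_eqF.
by exists (@Geodesic _ _ _ _ (fun s => e ((s / nv V) *: V)) V0 p0 pi).
Qed.

(** Comparison cosines along two radial geodesics increase with the sides, and at the origin they
    are the Euclidean ones by [e_inf]. *)
Let e_lip V W : 0 <= dot V n0 -> 0 <= dot W n0 -> d (e V) (e W) <= nv (V - W).
Proof.
move=> hV hW.
have zero (U : 'rV[R]_n) : ~ 0 < nv U -> U = 0.
  move=> /negP; rewrite -leNgt => h; apply: dot_eq0; rewrite -nv_sq.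
  by rewrite (_ : nv U = 0) ?expr0n //; apply/eqP; rewrite eq_le h nv_ge0.
have [V0|/zero ->] := pselect (0 < nv V); last by rewrite sub0r nvN e_rad.
have [W0|/zero ->] := pselect (0 < nv W); last by rewrite subr0 metric_sym e_rad.
have [g [lg pg]] := e_geodesic hV V0; have [h [lh ph]] := e_geodesic hW W0.
have m : mono_hinge g h (glen g) (glen h).
  by apply: (@stewart_mono _ _ setT) => //; rewrite ?glen_gt0 ?lexx // => a q b x _ _ _ _; exact: (rs_stewart RX).
have [_ _ mono] := m.
apply: (Ule (Ucst _) (e_inf hV hW)); apply: filterE => k /=.
set u : R := k.+1%:R^-1; have u0 : 0 < u := Uinv_gt0 k; have u1 : u <= 1 := Uscale_le1 k.
have k1 := mono (u * nv V) (nv V) (u * nv W) (nv W).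
have gV : gpath g (nv V) = e V by rewrite pg divff ?gt_eqF // scale1r.
have hW1 : gpath h (nv W) = e W by rewrite ph divff ?gt_eqF // scale1r.
have gu : gpath g (u * nv V) = e (u *: V) by rewrite pg mulfK ?gt_eqF.
have hu : gpath h (u * nv W) = e (u *: W) by rewrite ph mulfK ?gt_eqF.
have uV : 0 < u * nv V <= glen g by rewrite mulr_gt0 //= lg ler_piMl ?nv_ge0.
have uW : 0 < u * nv W <= glen h by rewrite mulr_gt0 //= lh ler_piMl ?nv_ge0.
have VV : 0 < nv V <= glen g by rewrite V0 lg lexx.
have WW : 0 < nv W <= glen h by rewrite W0 lh lexx.
have {}k1 : kap g h (u * nv V) (u * nv W) <= kap g h (nv V) (nv W).
  by apply: k1; rewrite ?lg ?lh ?lexx ?mulr_gt0 ?ler_piMl ?nv_ge0.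
rewrite ler_pdivlMr // -ler_sqr ?nnegrE ?mulr_ge0 ?mdist_ge0 ?(ltW u0) // exprMn.
rewrite -gV -hW1 -gu -hu !kap_dist //.
have q0 : 0 <= 2 * nv V * nv W * u ^+ 2 by rewrite mulr_ge0 ?sqr_ge0 // mulr_ge0 ?nv_ge0 // mulr_ge0 ?nv_ge0.
by have := ler_wpM2l q0 k1; lra.
Qed.

(** Radial geodesics continue beyond every point, so the shortest path from e 0 to a common image is
    unique. The two radial paths then coincide, and [e_inf] shows that V - W is 0. *)
Let e_inj V W : 0 <= dot V n0 -> 0 <= dot W n0 -> e V = e W -> V = W.
Proof.
move=> hV hW E; have VW : nv V = nv W by rewrite -!e_rad // E.
have zero (U : 'rV[R]_n) : nv U = 0 -> U = 0 by move=> h; apply: dot_eq0; rewrite -nv_sq h expr0n.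
have [V0|V0] := eqVneq (nv V) 0; first by rewrite (zero V V0) (zero W) // -VW.
have Vp : 0 < nv V by rewrite lt_neqAle eq_sym V0 nv_ge0.
have btw_e (U : 'rV[R]_n) a b : 0 <= dot U n0 -> 0 <= a <= b -> btw (e 0) (e (a *: U)) (e (b *: U)).
  move=> hU /andP[a0 ab]; have b0 := le_trans a0 ab.
  have r (s : R) : 0 <= s -> d (e 0) (e (s *: U)) = s * nv U.
    by move=> s0; have := e_ray hU (lexx 0) s0; rewrite scale0r => ->; rewrite sub0r normrN ger0_norm.
  by rewrite /btw !r // e_ray // distrC ger0_norm ?subr_ge0 //; ring.
have same (u : R) : 0 <= u <= 1 -> e (u *: V) = e (u *: W).
  move=> /andP[u0 u1].
  have bt : btw (e 0) (e (1 *: V)) (e (2%:R *: V)) by apply: btw_e => //; rewrite ler01; lra.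
  have b1 : btw (e 0) (e (u *: V)) (e (1 *: V)) by apply: btw_e => //; rewrite u0.
  have b2 : btw (e 0) (e (u *: W)) (e (1 *: V)).
    by rewrite scale1r E -[W in X in btw _ _ X]scale1r; apply: btw_e => //; rewrite u0.
  apply: (unique_of_btw (rs_stewart RX) bt _ b1 b2).
    move=> F; have := e_ray hV ler01 (ler0n R 2); rewrite -F mdistxx.
    have -> : `|1 - 2| = 1 :> R by rewrite distrC ger0_norm; lra.
    by rewrite mul1r => F2; move: V0; rewrite -F2 eqxx.
  have r (U : 'rV[R]_n) : 0 <= dot U n0 -> d (e 0) (e (u *: U)) = u * nv U.
    by move=> hU; have := e_ray hU (lexx 0) u0; rewrite scale0r => ->; rewrite sub0r normrN ger0_norm.
  by rewrite !r // VW.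
have L := e_inf hV hW.
have L0 : Ulim (fun k => d (e (k.+1%:R^-1 *: V)) (e (k.+1%:R^-1 *: W)) / k.+1%:R^-1) 0.
  by apply: Ueq (Ucst 0) => k; rewrite same ?mdistxx ?mul0r // Uscale_le1 ltW ?Uinv_gt0.
by apply/eqP; rewrite -subr_eq0; apply/eqP/zero; exact: Uuniq L L0.
Qed.

Lemma cone_rigidity V W : 0 <= dot V n0 -> 0 <= dot W n0 -> d (e V) (e W) = nv (V - W).
Proof. by move=> hV hW; apply: (half_space_rigidity RX n01 e_lip e_rad e_onto e_inj). Qed.
End cone_rigidity.

(** * Unit hemispheres as spaces of directions *)

Section hemisphere.
Context {R : realType}.

Lemma dot_sq_le {n} (z n0 : 'rV[R]_n) : dot n0 n0 = 1 -> dot z n0 ^+ 2 <= dot z z.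
Proof.
move=> n01; have := dot_ge0 (z - dot z n0 *: n0).
by rewrite !dotE (dotC n0 z) n01; lra.
Qed.

(* [Y] is isometric to the closed unit hemisphere of R^n with pole [n0]. *)
Definition hemisphere (n : nat) (Y : metricType R) (n0 : 'rV[R]_n) (psi : Y -> 'rV[R]_n) :=
  [/\ dot n0 n0 = 1, forall y, dot (psi y) (psi y) = 1 /\ 0 <= dot (psi y) n0,
      forall v, dot v v = 1 -> 0 <= dot v n0 -> exists y, psi y = v
    & forall x y, cos (d x y) = dot (psi x) (psi y)].

(** The direction is first pushed towards the pole, which makes its height positive, and then
    approximated by a geodesic closely enough to keep it positive. The antipode of a vector of
    positive height is outside the hemisphere. *)
Lemma hemisphere_interior (n : nat) (X : metricType R) (p : X) n0 (psi : directions p -> 'rV[R]_n) :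
  tame p -> hemisphere n0 psi -> forall xi (e : R), 0 < e ->
  exists g : geodesic p, d xi (dir g) <= e /\ forall eta, d (dir g) eta <> pi.
Proof.
move=> T [n01 unit onto cosE] xi e e0; have An := tm_angled T.
have pp := pi_gt0 R.
pose e' := Num.min (e / 2) (pi / 2).
have e'0 : 0 < e' by rewrite lt_min !divr_gt0.
have e'e : e' <= e / 2 by rewrite ge_min lexx.
have e'p : e' <= pi / 2 by rewrite ge_min lexx orbT.
have [v1 vn] := unit xi; set v := psi xi in v1 vn; set a := dot v n0 in vn.
pose t := sin e'; have t0 : 0 < t by apply: sin_gt0_pi; rewrite e'0; lra.
have ct : cos e' ^+ 2 = 1 - t ^+ 2 by have := cos2Dsin2 e'; rewrite -/t; lra.
have c0 : 0 <= cos e' by apply: cos_ge0_pihalf; apply/andP; split; lra.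
have [w wE] : exists w, w = v + t *: n0 by eexists.
have ww : dot w w = 1 + 2 * t * a + t ^+ 2.
  by rewrite wE !dotE (dotC n0 v) n01 v1 -/a; ring.
have vw : dot v w = 1 + t * a by rewrite wE !dotE v1 -/a.
have wn : dot w n0 = a + t by rewrite wE !dotE n01 -/a mulr1.
have ta : 0 <= t * a by rewrite mulr_ge0 // ltW.
have w0 : 0 < nv w.
  by rewrite sqrtr_gt0 ww; have := sqr_ge0 t; lra.
have [||xi' hxi'] := onto ((nv w)^-1 *: w).
- by rewrite !dotE -nv_sq mulrA -expr2 -exprMn mulVf ?expr1n // gt_eqF.
- by rewrite !dotE wn mulr_ge0 ?invr_ge0 ?(ltW w0) // addr_ge0 // ltW.
have near1 : d xi xi' <= e'.
  have he' : 0 <= e' <= pi by rewrite (ltW e'0); lra.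
  apply: cos_anti => //; first by rewrite mdist_ge0 dir_dist_pi.
  rewrite cosE hxi' !dotE vw mulrC ler_pdivlMr // -ler_sqr ?nnegrE ?mulr_ge0 ?(ltW w0) //; last lra.
  rewrite exprMn nv_sq ww ct.
  have := sqr_ge0 (t * a); have := mulr_ge0 ta (sqr_ge0 t); have := sqr_ge0 (t ^+ 2); lra.
pose b := dot (psi xi') n0.
have b0 : 0 < b by rewrite /b hxi' !dotE wn mulr_gt0 ?invr_gt0 // ltr_wpDl.
have b2 : 0 < b ^+ 2 / 4 by rewrite divr_gt0 // exprn_gt0.
have [r r0 hr] := cos_near b2.
have m0 : 0 < Num.min r (e / 2) by rewrite lt_min r0 divr_gt0.
have [g hg] := dir_approx xi' m0; rewrite le_min in hg; have /andP[gr ge] := hg.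
exists g; split; first by have := metric_triangle xi xi' (dir g); lra.
have [g1 _] := unit (dir g); have [x1 _] := unit xi'.
have gn : 0 < dot (psi (dir g)) n0.
  rewrite ltNge; apply/negP => neg.
  have := dot_sq_le (psi xi' - psi (dir g)) n01; rewrite !dotE g1 x1 (dotC (psi (dir g)) (psi xi')) -cosE -/b.
  have c1 : 1 - b ^+ 2 / 4 <= cos (d xi' (dir g)) by apply: hr; rewrite mdist_ge0.
  have : b ^+ 2 <= (b - dot (psi (dir g)) n0) ^+ 2.
    by rewrite ler_sqr ?nnegrE ?(ltW b0) //; lra.
  have : 0 < b ^+ 2 by rewrite exprn_gt0.
  lra.
move=> eta he; have [h1 hn] := unit eta.
have := cosE (dir g) eta; rewrite he cospi => m1.
have : dot (psi (dir g) + psi eta) (psi (dir g) + psi eta) = 0.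
  by rewrite !dotE g1 h1 (dotC (psi eta)) -m1; ring.
move/dot_eq0/(congr1 (fun x => dot x n0)); rewrite !dotE; lra.
Qed.

Lemma hemisphere_geodesic (n : nat) (X : metricType R) (p : X) n0 (psi : directions p -> 'rV[R]_n) :
  tame p -> hemisphere n0 psi -> inhabited (geodesic p).
Proof.
move=> T [n01 _ onto _].
have [xi _] : exists xi, psi xi = n0 by apply: onto; rewrite ?n01.
by have [g _] := dir_approx xi ltr01; exists.
Qed.
End hemisphere.

Section unit_vectors.
Context {R : realType} {n : nat}.
Implicit Types (V W : 'rV[R]_n) (s : R).

Definition unitv V := (nv V)^-1 *: V.

Lemma unitvZ s V : 0 < s -> unitv (s *: V) = unitv V.
Proof.
move=> s0; rewrite /unitv nvZ (gtr0_norm s0) scalerA; congr (_ *: _).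
have [->|V0] := eqVneq (nv V) 0; first by rewrite mulr0 !invr0 mul0r.
by field; rewrite V0 gt_eqF.
Qed.

Lemma unitv_id V : dot V V = 1 -> unitv V = V.
Proof. by move=> h; rewrite /unitv /nv h sqrtr1 invr1 scale1r. Qed.

Lemma unitv_dot V W : 0 < nv V -> 0 < nv W -> nv V * nv W * dot (unitv V) (unitv W) = dot V W.
Proof. by move=> V0 W0; rewrite /unitv !dotE; field; rewrite !gt_eqF. Qed.

Lemma unitv_unit V : 0 < nv V -> dot (unitv V) (unitv V) = 1.
Proof. by move=> V0; rewrite /unitv !dotE -nv_sq; field; rewrite gt_eqF. Qed.

Lemma nv_eq0 V : ~ 0 < nv V -> V = 0.
Proof.
move=> /negP; rewrite -leNgt => h; apply: dot_eq0; rewrite -nv_sq.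
by rewrite (_ : nv V = 0) ?expr0n //; apply/eqP; rewrite eq_le h nv_ge0.
Qed.

Lemma nv0 : nv (0 : 'rV[R]_n) = 0.
Proof. by rewrite /nv dot0l sqrtr0. Qed.
End unit_vectors.

Section hemisphere_directions.
Context {R : realType} {n : nat} {Y : metricType R} {n0 : 'rV[R]_n} {psi : Y -> 'rV[R]_n}.
Hypothesis H : hemisphere n0 psi.
Hypothesis Ypi : forall x y : Y, d x y <= pi.

Lemma hemisphere_inj x y : psi x = psi y -> x = y.
Proof.
have [_ unit _ cosE] := H.
move=> e; apply: mdist_positivity; apply: cos_ge1; first by rewrite mdist_ge0 Ypi.
by rewrite cosE e; have [-> _] := unit y.
Qed.

Lemma hemisphere_section : exists f : 'rV[R]_n -> Y,
  forall V, 0 < nv V -> 0 <= dot V n0 -> psi (f (unitv V)) = unitv V.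
Proof.
have [n01 unit onto cosE] := H.
have [y0 _] : exists y, psi y = n0 by apply: onto; rewrite ?n01.
have /choice [f fP] : forall v, exists y, dot v v = 1 -> 0 <= dot v n0 -> psi y = v.
  move=> v; have [[h1 h2]|h] := pselect (dot v v = 1 /\ 0 <= dot v n0).
    by have [y hy] := onto v h1 h2; exists y.
  by exists y0 => h1 h2; case: h.
exists f => V V0 Vn; apply: fP; first exact: unitv_unit.
by rewrite /unitv dotZl mulr_ge0 // invr_ge0 nv_ge0.
Qed.
End hemisphere_directions.

(** * A ray space with a hemisphere of directions is a half space *)

Section ray_space_half_space.
Context {R : realType} {n : nat} {X : metricType R} {p : X} {n0 : 'rV[R]_n} {psi : directions p -> 'rV[R]_n}.
Hypothesis RX : ray_space X.
Hypothesis H : hemisphere n0 psi.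

Let T : tame p := tame_stewart p (rs_stewart RX) (rs_proper RX).
Let An := tm_angled T.

(** For a geodesic whose direction has no antipode, a backward continuation beyond p is impossible,
    so the dichotomy prolongs it to any length. Such geodesics approximate every direction, and
    limits of geodesics of length at least L reach length L. *)
Lemma ray_extends (xi : directions p) (L : R) : 0 < L -> extends_to xi L.
Proof.
move=> L0; apply: (tame_limit_extends T L0) => e e0.
have [g [ge anti]] := hemisphere_interior T H xi e0.
have lg := glen_gt0 g.
have dg : d p (gend g) = glen g by rewrite geodesic_dist // lg lexx.
have [E|[u hu E]] := geodesic_dich g RX.
  have [w [w1 w2]] := E L (ltW L0); rewrite dg in w1.
  have [||h [lh eh ph]] := @geodesic_concat _ _ p g w; first exact: (rs_segment RX).
    by rewrite /btw dg w1 w2.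
  exists h; rewrite lh w1; split; first by lra.
  rewrite (@angle_agree _ _ _ h g (glen g)) // lh w1; lra.
have [w [w1 w2]] := E 1 ler01.
have hul : 0 < u <= glen g by case/andP: hu => -> /ltW.
have [g1 [lg1 pg1]] := geodesic_restrict hul.
have du : d p (gpath g u) = u by rewrite geodesic_dist.
have bt : btw (gpath g u) p w by rewrite /btw w1 w2.
have pw : p <> w by move=> e1; move: w2; rewrite -e1 mdistxx; lra.
have up : gpath g u <> p by move/esym; exact: gpath_neq.
have [h [lh eh]] := geodesic_to (rs_segment RX) pw.
have op : opposite g1 h.
  by apply: (opposite_of_btw bt up pw) => //; rewrite ?lg1 ?du // /gend lg1 pg1.
case: (anti (dir h)); have -> : dir g = dir g1.
  apply: (@angle_agree _ _ _ g g1 u) => //; [by case/andP: hul|by case/andP: hul|by rewrite lg1|].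
  by move=> t _; rewrite pg1.
by rewrite dir_dist_angle // opposite_angle.
Qed.

(** [e] is the exponential map at p in the coordinates of the hemisphere. It is independent of the
    chosen geodesics because geodesics with the same direction agree, and it is infinitesimally
    isometric because angles at p are those of the vectors. *)
Lemma ray_space_half_space : exists e : 'rV[R]_n -> X,
  (forall V W, 0 <= dot V n0 -> 0 <= dot W n0 -> d (e V) (e W) = nv (V - W)) /\
  (forall x, exists2 V, 0 <= dot V n0 & e V = x).
Proof.
have [n01 unit onto cosE] := H.
have dpi (x y : directions p) : d x y <= pi by exact: dir_dist_pi.
have [f fP] := hemisphere_section H.
have /choice [G GP] : forall xL : directions p * R, exists g : geodesic p, dir g = xL.1 /\ `|xL.2| + 1 <= glen g.
  move=> [xi L]; have L0 : 0 < `|L| + 1 by rewrite ltr_wpDl.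
  by have [g g1 g2] := ray_extends xi L0; exists g.
pose e (V : 'rV[R]_n) := gpath (G (f (unitv V), nv V)) (nv V).
have agree (g h : geodesic p) s : dir g = dir h -> 0 <= s -> s <= glen g -> s <= glen h -> gpath g s = gpath h s.
  move=> gh; rewrite le_eqVlt => /predU1P[<-|s0] sg sh; first by rewrite !gpath0.
  by apply: (stewart_agree (rs_stewart RX) gh) => //; rewrite s0.
have e0 (g : geodesic p) : e 0 = gpath g 0 by rewrite /e nv0 !gpath0.
have eE V s (g : geodesic p) : 0 <= s -> dir g = f (unitv V) -> s * nv V <= glen g -> e (s *: V) = gpath g (s * nv V).
  rewrite le_eqVlt => /predU1P[<-|s0] gV sg; first by rewrite scale0r mul0r -e0.
  rewrite /e nvZ (gtr0_norm s0) unitvZ //; have [h1 h2] := GP (f (unitv V), s * nv V).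
  apply: agree => //; first by rewrite h1.
    by rewrite mulr_ge0 ?nv_ge0 // ltW.
  by apply: le_trans h2; rewrite /= ler_wpDr // ler_norm.
have e_ray V s t : 0 <= dot V n0 -> 0 <= s -> 0 <= t -> d (e (s *: V)) (e (t *: V)) = `|s - t| * nv V.
  move=> _ s0 t0; have [h1 h2] := GP (f (unitv V), (s + t) * nv V); set g := G _ in h1 h2.
  have V0 := nv_ge0 V; have sV := mulr_ge0 s0 V0; have tV := mulr_ge0 t0 V0.
  have l : s * nv V + t * nv V + 1 <= glen g by apply: le_trans h2; rewrite /= lerD2r mulrDl ler_norm.
  rewrite (eE V s g) ?(eE V t g) //; [|lra|lra].
  rewrite gpath_isometry; [|rewrite sV; lra|rewrite tV; lra].
  by rewrite -mulrBl normrM (ger0_norm V0).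
have e_rad V : 0 <= dot V n0 -> forall s, 0 <= s -> d (e 0) (e (s *: V)) = s * nv V.
  by move=> hV s s0; have := e_ray V 0 s hV (lexx 0) s0; rewrite scale0r sub0r normrN ger0_norm.
have e_inf V W : 0 <= dot V n0 -> 0 <= dot W n0 ->
    Ulim (fun k => d (e (k.+1%:R^-1 *: V)) (e (k.+1%:R^-1 *: W)) / k.+1%:R^-1) (nv (V - W)).
  move=> hV hW.
  have [V0|/nv_eq0 ->] := pselect (0 < nv V); last first.
    rewrite sub0r nvN; apply: Ueq (Ucst (nv W)) => k.
    by rewrite scaler0 e_rad // ?ltW ?Uinv_gt0 // mulrAC divff ?mul1r // gt_eqF ?Uinv_gt0.
  have [W0|/nv_eq0 ->] := pselect (0 < nv W); last first.
    rewrite subr0; apply: Ueq (Ucst (nv V)) => k.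
    by rewrite scaler0 metric_sym e_rad // ?ltW ?Uinv_gt0 // mulrAC divff ?mul1r // gt_eqF ?Uinv_gt0.
  have [g1 g2] := GP (f (unitv V), nv V); set g := G _ in g1 g2.
  have [h1 h2] := GP (f (unitv W), nv W); set h := G _ in h1 h2.
  have L := tangent_dist (An g h) V0 W0 (Uinv_gt0 (R := R)) (Uinv (R := R)).
  have E : nv V ^+ 2 + nv W ^+ 2 - 2 * nv V * nv W * cos (angle g h) = dot (V - W) (V - W).
    rewrite -dir_dist_angle // g1 h1 cosE !fP //; have := unitv_dot V0 W0.
    by move: (dot (unitv V) (unitv W)) => q qE; rewrite !dotE (dotC W V) -qE !nv_sq; ring.
  rewrite E in L; apply: Ueq L => k.
  have u0 := Uinv_gt0 (R := R) k; have u1 := Uscale_le1 (R := R) k.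
  rewrite (eE V _ g) ?(ltW u0) ?(eE W _ h) ?(ltW u0) //.
  - by rewrite ![_^-1 * nv _]mulrC.
  - by apply: le_trans h2; rewrite /= ger0_norm ?nv_ge0 // ler_wpDr // ler_piMl ?nv_ge0.
  - by apply: le_trans g2; rewrite /= ger0_norm ?nv_ge0 // ler_wpDr // ler_piMl ?nv_ge0.
have e_onto x : exists2 V, 0 <= dot V n0 & e V = x.
  have [px|px] := pselect (p = x).
    by exists 0; [rewrite dot0l|rewrite /e nv0 gpath0].
  have [g [lg eg]] := geodesic_to (rs_segment RX) px; have D0 := d_gt0 px.
  have [v1 vn] := unit (dir g); set v := psi (dir g) in v1 vn.
  have nvv : nv v = 1 by rewrite /nv v1 sqrtr1.
  exists (d p x *: v); first by rewrite dotZl mulr_ge0 // ltW.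
  rewrite (eE v _ g) ?(ltW D0) ?nvv ?mulr1 ?lg //; first by rewrite -lg.
  by apply: (hemisphere_inj H dpi); rewrite fP ?nvv ?unitv_id.
exists e; split=> // V W; exact: (cone_rigidity RX n01 e_ray e_inf e_onto).
Qed.
End ray_space_half_space.

(** * From a hemisphere of directions to a hemisphere one dimension higher *)

Section split_vectors.
Context {R : realType} {k : nat}.
Implicit Types (V W : 'rV[R]_(1 + k)).

Definition x0 V : R := V 0 (lshift k ord0).
Definition xr V : 'rV[R]_k := rsubmx V.

Lemma dot_split V W : dot V W = x0 V * x0 W + dot (xr V) (xr W).
Proof.
rewrite /dot big_split_ord big_ord1 /=; congr (_ + _).
by apply: eq_bigr => i _; rewrite !mxE.
Qed.

Definition joinv (a : R) (v : 'rV[R]_k) : 'rV[R]_(1 + k) := row_mx (\row_(j < 1) a) v.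
Lemma x0_join a v : x0 (joinv a v) = a. Proof. by rewrite /x0 /joinv row_mxEl mxE. Qed.
Lemma xr_join a v : xr (joinv a v) = v. Proof. by rewrite /xr /joinv row_mxKr. Qed.
Lemma x0Z s V : x0 (s *: V) = s * x0 V. Proof. by rewrite /x0 mxE. Qed.
Lemma xrZ s V : xr (s *: V) = s *: xr V. Proof. by apply/rowP => i; rewrite !mxE. Qed.
Lemma x0D V W : x0 (V + W) = x0 V + x0 W. Proof. by rewrite /x0 mxE. Qed.
Lemma xrD V W : xr (V + W) = xr V + xr W. Proof. by apply/rowP => i; rewrite !mxE. Qed.
Lemma x0N V : x0 (- V) = - x0 V. Proof. by rewrite /x0 mxE. Qed.
Lemma xrN V : xr (- V) = - xr V. Proof. by apply/rowP => i; rewrite !mxE. Qed.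
End split_vectors.

Lemma Ucos0 {R : realType} (s : nat -> R) : (forall k, 0 <= s k <= pi) -> Ulim (fun k => cos (s k)) 1 -> Ulim s 0.
Proof.
move=> hs h; apply/UP => e e0; have [ep|pe] := ltP pi e.
  by apply: filterE => k /=; rewrite sub0r normrN ger0_norm; case/andP: (hs k) => // _ /le_lt_trans; apply.
have he : 0 <= e <= pi by rewrite ltW.
have c1 : cos e < 1 by rewrite -cos0 ltr_cos ?in_itv //= lexx pi_ge0.
apply: filterS (Ugt h c1) => k /= h1; have /andP[s0 _] := hs k; rewrite sub0r normrN ger0_norm //.
by rewrite ltNge; apply/negP => h3; have := cos_decr (hs k) he h3; lra.
Qed.

(** In the cone, the paths from the unit point over x to those over y and z both pass through the
    apex, where they cannot branch. *)
Lemma antipode_unique {R : realType} {C Y : metricType R} {o : C} {c : R * Y -> C} (x y z : Y) :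
  cone_over o c -> ray_space C -> d x y = pi -> d x z = pi -> y = z.
Proof.
move=> CO RC dy dz.
have bt v : d x v = pi -> btw (c (1, x)) o (c (1, v)).
  move=> hv; rewrite /btw (metric_sym _ o) !(cone_dist_apex CO) //.
  apply/eqP; rewrite -(@eqrXn2 _ 2) ?mdist_ge0 ?addr_ge0 // (unit_dist2 CO) hv cospi; apply/eqP; ring.
apply: (unit_inj CO); apply: (nonbranching (rs_stewart RC) (bt _ dy) (bt _ dz)).
  by move=> E; have := cone_dist_apex CO x ler01; rewrite E mdistxx => /esym/eqP; rewrite oner_eq0.
by rewrite !(cone_dist_apex CO).
Qed.

Section sphere_step.
Context {R : realType} {k : nat} {C Y : metricType R} {o : C} {c : R * Y -> C} {p : Y}.
Context {n0 : 'rV[R]_k} {psi : directions p -> 'rV[R]_k}.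
Hypothesis CO : cone_over o c.
Hypothesis RC : ray_space C.
Hypothesis H : hemisphere n0 psi.

Let T : tame p := cone_tame CO RC p.
Let An := tm_angled T.

(** As in a ray space, with [sector_dich] at an angle between r and pi: its second alternative would
    produce an antipode. *)
Lemma sphere_extends (eta : directions p) (r : R) : 0 < r < pi -> extends_to eta r.
Proof.
move=> /andP[r0 rp]; apply: (tame_limit_extends T r0) => e e0.
have [g [ge anti]] := hemisphere_interior T H eta e0.
have hth : 0 < (r + pi) / 2 < pi by apply/andP; split; lra.
have [/(_ r (ltac:(lra))) [h [rh [t0 [t00 tg th hgt]]]]|/(_ 0 (ltac:(lra))) [h [_ op]]] := sector_dich CO g RC hth.
  by exists h; split=> //; rewrite (@angle_agree _ _ _ h g t0).
by case: (anti (dir h)); rewrite metric_sym dir_dist_angle // opposite_angle.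
Qed.

(** Geodesics of lengths below pi in the same direction agree by [cone_agree], so they fit together;
    a limit point is added as the end at distance pi. *)
Lemma sphere_geodesic (eta : directions p) : exists g : geodesic p, glen g = pi /\ dir g = eta.
Proof.
have pp := pi_gt0 R.
have agree (g h : geodesic p) s : dir g = dir h -> 0 <= s < pi -> s <= glen g -> s <= glen h -> gpath g s = gpath h s.
  move=> gh /andP[]; rewrite le_eqVlt => /predU1P[<- _ _ _|s0 sp sg sh]; first by rewrite !gpath0.
  by apply: (cone_agree CO RC gh) => //; rewrite s0.
have /choice [G GP] : forall s, exists g : geodesic p, 0 <= s < pi -> dir g = eta /\ s < glen g.
  move=> s; have hr (t : R) : 0 <= t < pi -> 0 < (t + pi) / 2 < pi by move=> /andP[? ?]; apply/andP; split; lra.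
  have [hs|] := pselect (0 <= s < pi).
    have [g g1 g2] := sphere_extends eta (hr s hs); exists g => _; split=> //.
    by apply: lt_le_trans g2; case/andP: hs => ? ?; lra.
  have h0 : 0 <= (0 : R) < pi by rewrite lexx.
  by have [g _ _] := sphere_extends eta (hr 0 h0); exists g.
pose F s := gpath (G s) s.
have FE g s : dir g = eta -> 0 <= s < pi -> s <= glen g -> F s = gpath g s.
  by move=> ge hs sg; have [h1 h2] := GP s hs; apply: agree; rewrite ?h1 ?ge // ltW.
have Fd s t : 0 <= s < pi -> 0 <= t < pi -> d (F s) (F t) = `|s - t|.
  have main s1 t1 : 0 <= s1 -> s1 <= t1 -> t1 < pi -> d (F s1) (F t1) = `|s1 - t1|.
    move=> s0 st tp; have ht : 0 <= t1 < pi by rewrite (le_trans s0).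
    have [h1 h2] := GP t1 ht; rewrite (FE (G t1) s1) ?h1 //; [|by rewrite s0 (le_lt_trans st)|by lra].
    by rewrite gpath_isometry; [|rewrite s0; lra|rewrite (le_trans s0 st); lra].
  move=> /andP[s0 sp] /andP[t0 tp]; have [st|/ltW ts] := leP s t; first exact: main.
  by rewrite metric_sym distrC main.
pose r (j : nat) : R := pi * (1 - j.+1%:R^-1 / 2).
have hr j : 0 <= r j < pi.
  have := Uinv_gt0 (R := R) j; have := Uscale_le1 (R := R) j; set u := _^-1 => u1 u0.
  by rewrite /r -/u mulr_ge0 ?(ltW pp) //=; [rewrite gtr_pMr //; lra|lra].
have rl : Ulim r pi.
  have := UM (Ucst (pi : R)) (UD (Ucst 1) (UN (UM (Uinv (R := R)) (Ucst 2^-1)))).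
  by rewrite mul0r subr0 mulr1.
have F0 : F 0 = p by rewrite /F gpath0.
have [|z hz] := @tm_proper _ _ _ T (fun j => F (r j)) p pi.
  move=> j; rewrite -{1}F0 Fd ?lexx // sub0r normrN; have /andP[a b] := hr j.
  by rewrite ger0_norm // ltW.
have Fz s : 0 <= s < pi -> d (F s) z = pi - s.
  move=> hs; apply: (Uuniq (ucv_d (ucv_cst (F s)) hz)).
  have L := UD rl (Ucst (- s)); apply: (Usq L L).
  case/andP: (hs) => _ sp; apply: filterS (Ugt rl sp) => j /= h.
  by rewrite Fd // distrC ger0_norm ?lexx // subr_ge0 ltW.
pose P s := if s < pi then F s else z.
have P0 : P 0 = p by rewrite /P pp.
have Pd s t : 0 <= s <= pi -> 0 <= t <= pi -> d (P s) (P t) = `|s - t|.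
  move=> /andP[s0 sp] /andP[t0 tp]; rewrite /P.
  have [s1|s1] := ltP s pi; have [t1|t1] := ltP t pi.
  - by rewrite Fd ?s0 ?t0.
  - by rewrite Fz ?s0 // distrC (_ : t = pi) ?ger0_norm ?subr_ge0 //; apply/eqP; rewrite eq_le tp.
  - by rewrite metric_sym Fz ?t0 // (_ : s = pi) ?ger0_norm ?subr_ge0 //; apply/eqP; rewrite eq_le sp.
  - have -> : s = pi by apply/eqP; rewrite eq_le sp.
    have -> : t = pi by apply/eqP; rewrite eq_le tp.
    by rewrite mdistxx subrr normr0.
exists (Geodesic pp P0 Pd); split=> //.
have h1 : 0 <= (1 : R) < pi by rewrite ler01 /=; have := pi_ge2 R; lra.
have [g1 g2] := GP 1 h1; rewrite -g1.
apply: (@angle_agree _ _ _ _ (G 1) 1) => //=; [by case/andP: h1 => _ /ltW|exact: ltW|].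
move=> t /andP[t0 t1]; have tp : t < pi by case/andP: h1; lra.
by rewrite /P tp; apply: FE => //; [rewrite t0|lra].
Qed.

Lemma kappa_Ulim (g h : geodesic p) (s t : nat -> R) : (forall j, 0 <= s j) -> (forall j, 0 <= t j) ->
  ulf [set j | 0 < s j] -> ulf [set j | 0 < t j] -> Ulim s 0 -> Ulim t 0 ->
  Ulim (fun j => (cos (d (gpath g (s j)) (gpath h (t j))) - cos (s j) * cos (t j)) / (sin (s j) * sin (t j)))
    (cos (angle g h)).
Proof.
move=> s0 t0 sp tp sl tl; have [G hG] := perp_lift CO g; have [K hK] := perp_lift CO h.
rewrite (angle_eq (perp_angle CO RC hG hK)).
have half0 : 0 < (1 / 2 : R) by lra.
have mg : 0 < Num.min (glen g) (1 / 2) by rewrite lt_min glen_gt0.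
have mh : 0 < Num.min (glen h) (1 / 2) by rewrite lt_min glen_gt0.
have tanl (u : nat -> R) : Ulim u 0 -> Ulim (fun j => sin (u j) / cos (u j)) 0.
  move=> ul; have S : Ulim (fun j => sin (u j)) 0.
    by rewrite -[X in Ulim _ X]sin0; apply: Ucomp ul; exact: continuous_sin.
  have D : Ulim (fun j => cos (u j)) 1.
    by rewrite -[X in Ulim _ X]cos0; apply: Ucomp ul; exact: continuous_cos.
  by have := UM S (UV (oner_neq0 R) D); rewrite mul0r.
apply/UP => e e0; have [n [np _ _ hn]] := angled_stewart (rs_stewart RC) G K e0.
apply: filterS (filterI (filterI sp tp) (filterI (filterI (Ule0 sl mg) (Ule0 tl mh))
  (filterI (Ule0 (tanl s sl) np) (Ule0 (tanl t tl) np)))) => j /= [[a b] [[a1 b1] [a2 b2]]].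
have [G1 G2] := hG (s j) (ltac:(by rewrite a)); have [K1 K2] := hK (t j) (ltac:(by rewrite b)).
have hs : 0 < s j <= 1 / 2 by rewrite a; move: a1; rewrite le_min => /andP[].
have ht : 0 < t j <= 1 / 2 by rewrite b; move: b1; rewrite le_min => /andP[].
rewrite -(perp_kap CO hs ht G1 K1 G2 K2) distrC; apply: hn.
  by case/andP: G1 => -> _.
by case/andP: K1 => -> _.
Qed.

Lemma ray_args (a b : R) (u : nat -> R) : 0 < b -> (forall j, 0 < u j) -> Ulim u 0 ->
  let s j := arg (1 + u j * a) (u j * b) in [/\ forall j, 0 < s j, forall j, 0 <= s j <= pi & Ulim s 0].
Proof.
move=> b0 u0 ul s; have hs j : 0 <= s j <= pi := arg_in _ _.
have A : Ulim (fun j => 1 + u j * a) 1.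
  by have := UD (Ucst 1) (UM ul (Ucst a)); rewrite mul0r addr0.
have B : Ulim (fun j => u j * b) 0 by have := UM ul (Ucst b); rewrite mul0r.
have Rl : Ulim (fun j => rad (1 + u j * a) (u j * b)) 1.
  have := Usqrt (UD (UX 2 A) (UX 2 B)); by rewrite expr1n expr0n addr0 sqrtr1.
split=> // [j|].
  have /andP[s0 _] := hs j; rewrite lt_neqAle s0 andbT; apply/eqP => e.
  have := rad_sin (1 + u j * a) (mulr_ge0 (ltW (u0 j)) (ltW b0)); rewrite -/(s j) -e sin0 mulr0 => /esym/eqP.
  by rewrite gt_eqF // mulr_gt0.
apply: Ucos0 => //; have := UM A (UV (oner_neq0 R) Rl); rewrite invr1 mulr1; apply: Ueq => j.
by rewrite /s /arg acosK // in_itv /= arg_div.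
Qed.

(** The cone over Y is a half space, by [cone_rigidity] for the exponential map at the unit point
    over p. Its unit sphere about the apex, which lies on the edge, is the wanted hemisphere. *)
Lemma hemisphere_step : exists m0 phi, @hemisphere R (1 + k) Y m0 phi.
Proof.
have [n01 unit onto cosE] := H.
have dpi (x y : directions p) : d x y <= pi by exact: dir_dist_pi.
have [f fP] := hemisphere_section H.
have /choice [G GP] : forall v, exists g : geodesic p, glen g = pi /\ dir g = f v by move=> v; exact: sphere_geodesic.
pose m0 : 'rV[R]_(1 + k) := joinv 0 n0.
have mV V : dot V m0 = dot (xr V) n0 by rewrite dot_split x0_join xr_join mulr0 add0r.
have m01 : dot m0 m0 = 1 by rewrite mV xr_join n01.
(* The first coordinate runs along the radius, counted from the unit point over p; the others choose
   the geodesic of length pi whose flat sector contains the image. The apex corresponds to first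
   coordinate -1. *)
pose e V := @sector _ _ _ c _ (G (unitv (xr V))) (1 + x0 V) (nv (xr V)).
have argG v a b : arg a b <= glen (G v) by have [-> _] := GP v; case/andP: (arg_in a b).
have secd v a b a' b' : 0 <= b -> 0 <= b' ->
    d (@sector _ _ _ c _ (G v) a b) (@sector _ _ _ c _ (G v) a' b') ^+ 2 = (a - a') ^+ 2 + (b - b') ^+ 2.
  by move=> b0 b0'; apply: (sector_isometry CO); rewrite ?argG.
have axis v w (a : R) : 0 < a -> @sector _ _ _ c _ (G v) a 0 = @sector _ _ _ c _ (G w) a 0.
  move=> a0; have h0 : 0 <= (0 : R) <= pi by rewrite lexx pi_ge0.
  have E z : @sector _ _ _ c _ (G z) a 0 = c (a, p).
    by have := @sector_polar _ _ _ c _ (G z) a 0 a0 h0; rewrite cos0 sin0 mulr1 mulr0 gpath0.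
  by rewrite !E.
have eZ V s : 0 <= s -> e (s *: V) = @sector _ _ _ c _ (G (unitv (xr V))) (1 + s * x0 V) (s * nv (xr V)).
  rewrite le_eqVlt => /predU1P[<-|s0].
    by rewrite /e x0Z xrZ !mul0r addr0 scale0r nv0; exact: axis.
  by rewrite /e x0Z xrZ unitvZ // nvZ (gtr0_norm s0).
have e_ray V s t : 0 <= dot V m0 -> 0 <= s -> 0 <= t -> d (e (s *: V)) (e (t *: V)) = `|s - t| * nv V.
  move=> _ s0 t0; apply/eqP; rewrite -(@eqrXn2 _ 2) ?mdist_ge0 ?mulr_ge0 ?nv_ge0 //; apply/eqP.
  rewrite !eZ // secd ?mulr_ge0 ?nv_ge0 // exprMn real_normK ?num_real // nv_sq dot_split -(nv_sq (xr V)); ring.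
have nvB V W : nv (V - W) ^+ 2 = (x0 V - x0 W) ^+ 2 + (nv (xr V) ^+ 2 + nv (xr W) ^+ 2 - 2 * dot (xr V) (xr W)).
  rewrite nv_sq dot_split x0D x0N xrD xrN !nv_sq !dotE (dotC (xr W)); ring.
have e_inf V W : 0 <= dot V m0 -> 0 <= dot W m0 ->
    Ulim (fun j => d (e (j.+1%:R^-1 *: V)) (e (j.+1%:R^-1 *: W)) / j.+1%:R^-1) (nv (V - W)).
  move=> hV hW; pose u (j : nat) : R := j.+1%:R^-1.
  have u0 j : 0 < u j := Uinv_gt0 j; have ul : Ulim u 0 := Uinv.
  change (Ulim (fun j => d (e (u j *: V)) (e (u j *: W)) / u j) (nv (V - W))).
  have flat V' W' : nv (xr V') = 0 ->
      Ulim (fun j => d (e (u j *: V')) (e (u j *: W')) / u j) (nv (V' - W')).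
    move=> b0; have A : Ulim (fun j => 1 + u j * x0 V') 1.
      by have := UD (Ucst 1) (UM ul (Ucst (x0 V'))); rewrite mul0r addr0.
    apply: (Usq (Ucst (nv (V' - W'))) (Ucst (nv (V' - W')))); apply: filterS (Ugt A ltr01) => j /= a0.
    suff -> : d (e (u j *: V')) (e (u j *: W')) = u j * nv (V' - W').
      by rewrite mulrAC divff ?mul1r ?lexx // gt_eqF.
    apply/eqP; rewrite -(@eqrXn2 _ 2) ?mdist_ge0 ?mulr_ge0 ?nv_ge0 ?(ltW (u0 j)) //; apply/eqP.
    rewrite !eZ ?(ltW (u0 j)) // b0 mulr0 (axis _ (unitv (xr W')) _ a0) secd ?mulr_ge0 ?nv_ge0 ?(ltW (u0 j)) //.
    have z0 : xr V' = 0 by apply: dot_eq0; rewrite -nv_sq b0 expr0n.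
    by rewrite exprMn nvB b0 z0 dot0l; ring.
  have [bV|bV] := eqVneq (nv (xr V)) 0; first exact: flat.
  have [bW|bW] := eqVneq (nv (xr W)) 0.
    have -> : nv (V - W) = nv (W - V) by rewrite -nvN opprB.
    by apply: Ueq (flat W V bW) => j; rewrite metric_sym.
  have bV0 : 0 < nv (xr V) by rewrite lt_neqAle eq_sym bV nv_ge0.
  have bW0 : 0 < nv (xr W) by rewrite lt_neqAle eq_sym bW nv_ge0.
  set g := G (unitv (xr V)); set h := G (unitv (xr W)).
  have [s0 hs sl] := ray_args (x0 V) bV0 u0 ul; have [t0 ht tl] := ray_args (x0 W) bW0 u0 ul.
  set s := (fun j => _) in s0 hs sl; set t := (fun j => _) in t0 ht tl.
  have sp0 : ulf [set j | 0 < s j] by apply: filterE.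
  have tp0 : ulf [set j | 0 < t j] by apply: filterE.
  have K := @kappa_Ulim g h s t (fun j => (andP (hs j)).1) (fun j => (andP (ht j)).1) sp0 tp0 sl tl.
  have [g1 g2] := GP (unitv (xr V)); have [h1 h2] := GP (unitv (xr W)).
  have ca : nv (xr V) * nv (xr W) * cos (angle g h) = dot (xr V) (xr W).
    rewrite -(unitv_dot bV0 bW0) -dir_dist_angle // g2 h2 cosE !fP // -?mV //.
  have := Usqrt (UD (Ucst ((x0 V - x0 W) ^+ 2 + (nv (xr V) ^+ 2 + nv (xr W) ^+ 2)))
    (UN (UM (Ucst (2 * nv (xr V) * nv (xr W))) K))).
  have -> : (x0 V - x0 W) ^+ 2 + (nv (xr V) ^+ 2 + nv (xr W) ^+ 2) - 2 * nv (xr V) * nv (xr W) * cos (angle g h)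
     = nv (V - W) ^+ 2 by rewrite nvB -ca; ring.
  rewrite sqrtr_sqr (ger0_norm (nv_ge0 _)) => L; apply: (Usq L L).
  have half0 : 0 < (pi : R) by exact: pi_gt0.
  have spi : ulf [set j | s j <= pi / 2] by apply: (Ule0 sl); lra.
  have tpi : ulf [set j | t j <= pi / 2] by apply: (Ule0 tl); lra.
  apply: filterS (filterI spi tpi) => j /= [sp tp].
  have ss : 0 < sin (s j) by apply: sin_gt0_pi; rewrite s0; lra.
  have st : 0 < sin (t j) by apply: sin_gt0_pi; rewrite t0; lra.
  set ka := (_ - _) / _.
  suff -> : d (e (u j *: V)) (e (u j *: W)) = u j * Num.sqrt ((x0 V - x0 W) ^+ 2 + (nv (xr V) ^+ 2 + nv (xr W) ^+ 2) -
      2 * nv (xr V) * nv (xr W) * ka) by rewrite (mulrAC (u j)) divff ?mul1r ?lexx // gt_eqF.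
  rewrite -[X in X * Num.sqrt _](ger0_norm (ltW (u0 j))) -sqrtr_sqr -sqrtrM ?sqr_ge0 //.
  rewrite -[LHS](ger0_norm (mdist_ge0 _ _)) -sqrtr_sqr; congr Num.sqrt.
  rewrite !eZ ?(ltW (u0 j)) // (sector_dist2 CO) -/g -/h -/(s j) -/(t j).
  have kaE : cos (d (gpath g (s j)) (gpath h (t j))) = cos (s j) * cos (t j) + sin (s j) * sin (t j) * ka.
    by rewrite /ka; field; rewrite !gt_eqF.
  rewrite kaE.
  set r1 := rad _ _; set r2 := rad _ _.
  have c1 : r1 * cos (s j) = 1 + u j * x0 V by exact: rad_cos.
  have c2 : r2 * cos (t j) = 1 + u j * x0 W by exact: rad_cos.
  have c3 : r1 * sin (s j) = u j * nv (xr V) by apply: rad_sin; rewrite mulr_ge0 ?nv_ge0 // ltW.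
  have c4 : r2 * sin (t j) = u j * nv (xr W) by apply: rad_sin; rewrite mulr_ge0 ?nv_ge0 // ltW.
  have -> : 2 * r1 * r2 * (cos (s j) * cos (t j) + sin (s j) * sin (t j) * ka) =
    2 * ((r1 * cos (s j)) * (r2 * cos (t j)) + (r1 * sin (s j)) * (r2 * sin (t j)) * ka) by ring.
  by rewrite c1 c2 c3 c4; ring.
have e_onto z : exists2 V, 0 <= dot V m0 & e V = z.
  have [->|zo] := pselect (z = o).
    exists (joinv (-1) 0); first by rewrite mV xr_join dot0l.
    by rewrite /e x0_join xr_join nv0 subrr /sector /rad !expr0n addr0 sqrtr0 (co_apex CO).
  have [r [y [r0 zE]]] := cone_point CO zo; have hy := angle_in CO p y.
  (* All geodesics of length pi from p end at the same antipode, so any of them may be used to reach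
     it. *)
  have [dy|dy] := eqVneq (d p y) pi.
    exists (joinv (- 1 - r) 0); first by rewrite mV xr_join dot0l.
    rewrite /e x0_join xr_join nv0.
    have -> : 1 + (- 1 - r) = r * cos pi by rewrite cospi; ring.
    have -> : 0 = r * sin pi by rewrite sinpi mulr0.
    rewrite sector_polar ?lexx ?pi_ge0 // zE; congr (c (r, _)).
    have [l1 _] := GP (unitv 0); set z' := gpath _ pi.
    have dz : d p z' = pi by rewrite /z' geodesic_dist // l1 pi_gt0 lexx.
    exact: (antipode_unique CO RC dz dy).
  have yp : d p y < pi by case/andP: hy => _ h; rewrite lt_neqAle dy.
  have [py|py] := pselect (p = y).
    exists (joinv (r - 1) 0); first by rewrite mV xr_join dot0l.
    rewrite /e x0_join xr_join nv0 zE -py addrC subrK.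
    have h0 : 0 <= (0 : R) <= pi by rewrite lexx pi_ge0.
    by have := @sector_polar _ _ _ c _ (G (unitv 0)) r 0 r0 h0; rewrite cos0 sin0 mulr1 mulr0 gpath0.
  have [q sq] := cone_segment CO (rs_segment RC) yp; have [g [lg eg _]] := geodesic_of_segment sq py.
  have D0 := d_gt0 py; have [v1 vn] := unit (dir g); set v := psi (dir g) in v1 vn.
  have nvv : nv v = 1 by rewrite /nv v1 sqrtr1.
  have sD : 0 < sin (d p y) by apply: sin_gt0_pi; rewrite D0.
  have rs : 0 < r * sin (d p y) by rewrite mulr_gt0.
  exists (joinv (r * cos (d p y) - 1) ((r * sin (d p y)) *: v)).
    by rewrite mV xr_join dotZl mulr_ge0 // ltW.
  rewrite /e x0_join xr_join unitvZ // unitv_id // nvZ (gtr0_norm rs) nvv mulr1 addrC subrK sector_polar //.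
  rewrite zE -[in RHS]eg /gend lg; congr (c (r, _)).
  have [l1 l2] := GP v.
  apply: (cone_agree CO RC) => //; [|by rewrite D0 l1 ltW|by rewrite lg].
  by rewrite l2; apply: (hemisphere_inj H dpi); rewrite -{1}(unitv_id v1) fP ?nvv // unitv_id.
have iso V W : 0 <= dot V m0 -> 0 <= dot W m0 -> d (e V) (e W) = nv (V - W).
  exact: (cone_rigidity RC m01 e_ray e_inf e_onto).
pose E1 : 'rV[R]_(1 + k) := joinv 1 0.
have /choice [ph phP] : forall y, exists V, 0 <= dot V m0 /\ e V = c (1, y).
  by move=> y; have [V h1 h2] := e_onto (c (1, y)); exists V.
have eo V : d o (e V) ^+ 2 = dot (V + E1) (V + E1).
  rewrite /e /sector (cone_dist_apex CO) ?rad_ge0 // rad_sq nv_sq dot_split x0D xrD x0_join xr_join addr0; ring.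
have E1m : dot E1 m0 = 0 by rewrite mV xr_join dot0l.
exists m0, (fun y => ph y + E1); split=> //.
- move=> y; have [h1 h2] := phP y; rewrite -eo h2 (cone_dist_apex CO) // expr1n; split=> //.
  by rewrite dotDl E1m addr0.
- move=> v v1 vm; have vE : v - E1 + E1 = v by rewrite subrK.
  have hv : 0 <= dot (v - E1) m0 by rewrite dotDl dotNl E1m subr0.
  have d1 : d o (e (v - E1)) = 1.
    by apply/eqP; rewrite -(@eqrXn2 _ 2) ?mdist_ge0 // eo vE v1 expr1n.
  have zo : e (v - E1) <> o by move=> E; move: d1; rewrite E mdistxx => /esym/eqP; rewrite oner_eq0.
  have [r [y [r0 zE]]] := cone_point CO zo.
  have r1 : r = 1 by rewrite -d1 zE (cone_dist_apex CO) // ltW.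
  exists y; have [h1 h2] := phP y.
  have : nv (ph y - (v - E1)) = 0 by rewrite -iso // h2 zE r1 mdistxx.
  move=> h0; have : ph y - (v - E1) = 0 by apply: dot_eq0; rewrite -nv_sq h0 expr0n.
  by move/eqP; rewrite subr_eq0 => /eqP ->.
- move=> x y; have [h1 h2] := phP x; have [h3 h4] := phP y.
  have := unit_dist2 CO x y; rewrite -h2 -h4 iso // nv_sq.
  have a1 : dot (ph x + E1) (ph x + E1) = 1 by rewrite -eo h2 (cone_dist_apex CO) // expr1n.
  have a2 : dot (ph y + E1) (ph y + E1) = 1 by rewrite -eo h4 (cone_dist_apex CO) // expr1n.
  have -> : ph x - ph y = (ph x + E1) - (ph y + E1) by rewrite opprD addrACA subrr addr0.
  move: a1 a2; move: (ph x + E1) (ph y + E1) => U V a1 a2.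
  by rewrite !dotE a1 a2 (dotC V U); lra.
Qed.
End sphere_step.

(** * Boundary points of 1-manifolds *)

Section base.
Context {R : realType} {X : metricType R}.

Lemma interval_gap (A B : R -> Prop) (T : R) : 0 <= T -> A 0 -> B T ->
  (forall t, 0 <= t <= T -> A t -> exists2 e : R, 0 < e & forall t', 0 <= t' <= T -> `|t - t'| < e -> A t') ->
  (forall t, 0 <= t <= T -> B t -> exists2 e : R, 0 < e & forall t', 0 <= t' <= T -> `|t - t'| < e -> B t') ->
  (forall t, A t -> ~ B t) -> exists t, [/\ 0 <= t <= T, ~ A t & ~ B t].
Proof.
move=> T0 A0 BT oA oB AB.
pose S := [set t : R | 0 <= t <= T /\ A t].
have S0 : S 0 by split=> //; rewrite lexx.
have Ss : has_sup S by split; [exists 0|exists T => t [/andP[]]].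
pose m := sup S.
have m0 : 0 <= m by apply: ub_le_sup => //; case: Ss.
have mT : m <= T by apply: ge_sup; [exists 0|move=> t [/andP[]]].
have hm : 0 <= m <= T by rewrite m0.
exists m; split=> // [Am|Bm].
  have [e e0 he] := oA m hm Am.
  have [Tm|Tm] := leP T m.
    by apply: (AB m Am); have -> : m = T by apply/eqP; rewrite eq_le mT.
  pose t := Num.min T (m + e / 2).
  have mt : m < t by rewrite lt_min Tm; lra.
  have tT : t <= T by rewrite ge_min lexx.
  have te : t <= m + e / 2 by rewrite ge_min lexx orbT.
  have At : A t by apply: he; [rewrite tT andbT; lra|rewrite distrC ger0_norm; lra].
  have : t <= m by apply: ub_le_sup; [case: Ss|split=> //; rewrite tT andbT; lra].
  lra.
have [e e0 he] := oB m hm Bm.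
have [t [/andP[t0 tT] At] lt] := sup_adherent e0 Ss.
have tm : t <= m by apply: ub_le_sup; [case: Ss|split=> //; rewrite t0].
apply: (AB t At); apply: he; first by rewrite t0.
by rewrite ger0_norm ?subr_ge0 //; rewrite -/m in lt; lra.
Qed.

Lemma open_near (A : set X) x : open A -> A x -> exists2 e : R, 0 < e & forall y, d x y < e -> A y.
Proof.
move=> oA Ax; have : nbhs x A by exact: open_nbhs_nbhs.
move=> /nbhs_ballP [e /= e0 h]; exists e => // y xy; apply: h.
by rewrite ballEmdist.
Qed.

Lemma geodesic_open (p : X) (g : geodesic p) (T : R) (A : set X) : T <= glen g -> open A ->
  forall t, 0 <= t <= T -> A (gpath g t) ->
  exists2 e : R, 0 < e & forall t', 0 <= t' <= T -> `|t - t'| < e -> A (gpath g t').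
Proof.
move=> Tg oA t /andP[t0 tT] At; have [e e0 he] := open_near oA At; exists e => // t' /andP[t0' tT'] h.
by apply: he; rewrite gpath_isometry ?t0 ?t0' //; [exact: le_trans tT Tg|exact: le_trans tT' Tg].
Qed.

(** Near p the space is a half-open arc. A geodesic from p that reaches a later point of the arc
    cannot skip an earlier one, since the points before and after it would split an interval into
    two open sets ([interval_gap]). It meets the earlier point at its distance from p, so the two
    geodesics coincide near p. *)
Lemma boundary1_dir (p : X) (g h : geodesic p) : tame p -> boundary_point1 p -> dir g = dir h.
Proof.
move=> T [f [f0 _ finj fopen]].
pose I := [set` `[0, 1[] : set R.
have It (t : R) : I t = (0 <= t < 1) :> Prop by rewrite /I /= in_itv.
have o1 (a : R) : open (f @` ([set t | t < a] `&` I)) by apply: fopen; exact: open_lt.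
have o2 (a : R) : open (f @` ([set t | a < t] `&` I)) by apply: fopen; exact: open_gt.
have Up : (f @` ([set t | t < 1] `&` I)) p.
  by exists 0 => //; split; [exact: ltr01|rewrite It lexx ltr01].
have [e e0 he] := open_near (o1 1) Up.
pose s1 := Num.min (e / 2) (Num.min (glen g) (glen h)).
have s10 : 0 < s1 by rewrite !lt_min !glen_gt0 divr_gt0.
have s1e : s1 < e by rewrite gt_min; apply/orP; left; lra.
have s1g : s1 <= glen g by rewrite !ge_min lexx orbT.
have s1h : s1 <= glen h by rewrite !ge_min lexx !orbT.
have inU (k : geodesic p) t : s1 <= glen k -> 0 <= t <= s1 -> exists2 a, 0 <= a < 1 & f a = gpath k t.
  move=> kl /andP[t0 ts]; have [|a [_ Ia] E] := he (gpath k t).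
    by rewrite gpath_dist ?t0 ?(le_trans ts) // (le_lt_trans ts).
  by exists a => //; rewrite -It.
have half (g1 g2 : geodesic p) s a b : s1 <= glen g1 -> s1 <= glen g2 -> 0 < s <= s1 -> 0 <= a < 1 -> 0 <= b < 1 ->
    f a = gpath g1 s -> f b = gpath g2 s -> a < b -> gpath g1 s = gpath g2 s.
  move=> l1 l2 /andP[sp ss] ha hb fa fb ab.
  have ap : 0 < a.
    rewrite lt_neqAle; case/andP: ha => -> _; rewrite andbT; apply/eqP => a0.
    have := geodesic_dist (_ : 0 < s <= glen g1); rewrite sp (le_trans ss) // => /(_ isT).
    by rewrite -fa -a0 f0 mdistxx => s0; move: sp; rewrite -s0 ltxx.
  have ssg : s <= glen g2 by exact: le_trans l2.
  have [| | | | |t [/andP[t0 ts] nA nB]] := @interval_gap (fun t => (f @` ([set u | u < a] `&` I)) (gpath g2 t))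
      (fun t => (f @` ([set u | a < u] `&` I)) (gpath g2 t)) s (ltW sp).
  - by exists 0; [split=> //; rewrite It lexx ltr01|rewrite gpath0].
  - by exists b; [split=> //; rewrite It|].
  - exact: geodesic_open.
  - exact: geodesic_open.
  - move=> t [u [/= ua Iu] fu] [v [/= av Iv] fv].
    have uv : u = v by apply: finj; rewrite ?inE // fu.
    by move: ua; rewrite uv ltNge ltW.
  have ht : 0 <= t <= s1 by rewrite t0 (le_trans ts).
  have [u hu fu] := inU g2 t l2 ht.
  have ua : u = a.
    apply/eqP; rewrite eq_le; apply/andP; split; rewrite leNgt; apply/negP => lt.
      by apply: nB; exists u => //; split=> //; rewrite It.
    by apply: nA; exists u => //; split=> //; rewrite It.
  have E : gpath g2 t = gpath g1 s by rewrite -fu ua.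
  have t1 : d p (gpath g2 t) = t by rewrite gpath_dist // t0 (le_trans ts).
  have t2 : d p (gpath g1 s) = s by rewrite geodesic_dist // sp (le_trans ss).
  by rewrite -E; congr gpath; rewrite -t1 E t2.
apply: (@angle_agree _ _ _ g h s1 (tm_angled T)) => // t /andP[t0 ts].
move: t0; rewrite le_eqVlt => /predU1P[<-|t0]; first by rewrite !gpath0.
have ht : 0 <= t <= s1 by rewrite ltW.
have ht' : 0 < t <= s1 by rewrite t0.
have [a ha fa] := inU g t s1g ht; have [b hb fb] := inU h t s1h ht.
have [ab|ba|ab] := ltgtP a b.
- exact: (half g h t a b).
- by apply/esym; exact: (half h g t b a).
- by rewrite -fa ab.
Qed.

(** There is only one direction, and the unit hemisphere of the real line consists of its pole
    alone. *)
Lemma boundary1_hemisphere (p : X) (g0 : geodesic p) : tame p -> boundary_point1 p ->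
  exists n0 psi, @hemisphere R 1 (directions p) n0 psi.
Proof.
move=> T bp.
have one (xi : directions p) : xi = dir g0.
  apply: mdist_positivity; apply/eqP; rewrite eq_le mdist_ge0 andbT; apply/ler_addgt0Pr => e e0.
  by rewrite add0r; have [g hg] := dir_approx xi e0; rewrite (boundary1_dir g0 g T bp).
have dot1 (v w : 'rV[R]_1) : dot v w = v 0 0 * w 0 0 by rewrite /dot big_ord1.
exists (\row_(j < 1) 1), (fun=> \row_(j < 1) 1); split.
- by rewrite dot1 !mxE mulr1.
- by move=> y; rewrite dot1 !mxE mulr1.
- move=> v; rewrite !dot1 !mxE mulr1 => v1 v0; exists (dir g0).
  apply/rowP => i; rewrite (ord1 i) !mxE; apply/esym/eqP; rewrite -(@eqrXn2 _ 2) // expr1n expr2 v1 //.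
- by move=> x y; rewrite (one x) (one y) mdistxx cos0 dot1 !mxE mulr1.
Qed.
End base.

(** * Directions at boundary points of any dimension *)

Section boundary.
Context {R : realType}.

(** Induction follows the definition of the boundary. A boundary direction z at p makes the space of
    directions at p a hemisphere, by induction applied to it as the base of the tangent cone at p;
    [hemisphere_step] carries this to Y. *)
Lemma boundary_hemisphere (k : nat) : forall (C Y : metricType R) (o : C) (c : R * Y -> C) (p : Y),
  cone_over o c -> ray_space C -> uniform_packing C -> boundary_point k.+1 p ->
  exists n0 psi, @hemisphere R k.+2 Y n0 psi.
Proof.
elim: k => [|k IH] C Y o c p CO RC PC.
  move=> /= bp; have T := cone_tame CO RC p.
  have [f [f0 _ finj _]] := bp.
  (* Segments of Y are available at distances below pi. Two distinct points of the arc cannot both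
     be at distance pi from p, since the antipode is unique. *)
  have [g0] : inhabited (geodesic p).
    have far t : 0 < t < 1 -> p <> f t.
      move=> /andP[t0 t1] E; have : 0 = t; last by move=> e; move: t0; rewrite -e ltxx.
      by apply: finj; rewrite ?in_itv /= ?lexx ?ltr01 ?t1 ?ltW // f0.
    have near y : p <> y -> d p y < pi -> inhabited (geodesic p).
      move=> py h; have [q sq] := cone_segment CO (rs_segment RC) h.
      by have [g _] := geodesic_of_segment sq py; exists.
    have h1 : 0 < (1 / 2 : R) < 1 by apply/andP; split; lra.
    have h2 : 0 < (1 / 4 : R) < 1 by apply/andP; split; lra.
    have [l1|l1] := ltP (d p (f (1 / 2))) pi; first exact: near (far _ h1) l1.
    have [l2|l2] := ltP (d p (f (1 / 4))) pi; first exact: near (far _ h2) l2.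
    have e1 : d p (f (1 / 2)) = pi by apply/eqP; rewrite eq_le l1 (co_pi CO).
    have e2 : d p (f (1 / 4)) = pi by apply/eqP; rewrite eq_le l2 (co_pi CO).
    have := antipode_unique CO RC e1 e2 => E.
    have : (1 / 2 : R) = 1 / 4 by apply: finj; rewrite ?in_itv //=; lra.
    by lra.
  have [n0 [psi H]] := boundary1_hemisphere g0 T bp.
  exact: (hemisphere_step CO RC H).
move=> [z bz]; have T := cone_tame CO RC p.
have [g0 _] := dir_approx z ltr01.
have [n0 [psi H]] := IH _ _ _ _ z (tangent_cone_over T) (cone_tangent_ray_space CO RC PC g0)
  (cone_tangent_packing CO RC PC g0) bz.
exact: (hemisphere_step CO RC H).
Qed.

Lemma boundary_directions_hemisphere (n : nat) (X : metricType R) (p : X) : ray_space X -> uniform_packing X ->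
  boundary_point n p -> exists n0 psi, @hemisphere R n (directions p) n0 psi.
Proof.
move=> RX PX; have T := ray_space_tame p RX.
case: n => [//|[|k]] bp.
  have [f [f0 _ finj _]] := bp.
  have pf : p <> f (1 / 2).
    move=> E; have : 0 = 1 / 2 :> R by apply: finj; rewrite ?in_itv /= ?lexx ?ltr01 ?f0 //; lra.
    by lra.
  have [g0 _] := geodesic_to (rs_segment RX) pf.
  exact: boundary1_hemisphere.
case: bp => z bz; have [g0 _] := dir_approx z ltr01.
exact: (boundary_hemisphere (tangent_cone_over T) (tangent_ray_space RX PX g0) (tangent_packing RX PX g0) bz).
Qed.
End boundary.

(** * Normalizing the half space *)

Section householder.
Context {R : realType} {n : nat} (a b : 'rV[R]_n).
Hypothesis a1 : dot a a = 1.
Hypothesis b1 : dot b b = 1.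

(** The reflection that exchanges the unit vectors a and b, and the identity when they are equal. It
    moves the pole of the half space to the last coordinate vector. *)
Definition householder (x : 'rV[R]_n) := x - (2 * dot x (a - b) / dot (a - b) (a - b)) *: (a - b).

Let ww : dot (a - b) (a - b) = 2 - 2 * dot a b.
Proof. by rewrite !dotE a1 b1 (dotC b a); ring. Qed.

Lemma householder_dot x y : dot (householder x) (householder y) = dot x y.
Proof.
rewrite /householder; have [w wE] : exists w, w = a - b by eexists.
rewrite -wE; have [w0|w0] := eqVneq (dot w w) 0.
  by rewrite w0 !invr0 !mulr0 !scale0r !subr0.
by rewrite !dotE (dotC w y); field.
Qed.

Lemma householderK x : householder (householder x) = x.
Proof.
rewrite {1}/householder; have [w0|w0] := eqVneq (dot (a - b) (a - b)) 0.
  by rewrite /householder w0 !invr0 !mulr0 !scale0r !subr0.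
have -> : dot (householder x) (a - b) = - dot x (a - b).
  rewrite /householder; move: w0; have [w wE] : exists w, w = a - b by eexists.
  by rewrite -wE => w0; rewrite !dotE; field.
by rewrite /householder mulrN mulNr scaleNr opprK subrK.
Qed.

Lemma householder_pole x : dot (householder x) b = dot x a.
Proof.
rewrite /householder; have [w0|w0] := eqVneq (dot (a - b) (a - b)) 0.
  rewrite w0 invr0 mulr0 scale0r subr0.
  by have /eqP := dot_eq0 w0; rewrite subr_eq0 => /eqP ->.
have wb : dot (a - b) b = - dot (a - b) (a - b) / 2 by rewrite ww !dotE b1; field.
have -> : dot (x - (2 * dot x (a - b) / dot (a - b) (a - b)) *: (a - b)) b =
   dot x b - 2 * dot x (a - b) / dot (a - b) (a - b) * dot (a - b) b by rewrite dotDl dotNl dotZl.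
rewrite wb; have -> : dot x a = dot x b + dot x (a - b) by rewrite dotDr dotNr; ring.
by field.
Qed.

Lemma householderB x y : householder x - householder y = householder (x - y).
Proof.
rewrite /householder; set w := a - b.
by apply/rowP => i; rewrite dotDl dotNl !mxE; ring.
Qed.
End householder.

Lemma euclidean_distE {R : realType} {n : nat} (v w : 'rV[R]_n) : euclidean_dist v w = nv (v - w).
Proof. by congr Num.sqrt; apply: eq_bigr => i _; rewrite !mxE expr2. Qed.

Lemma half_space_of_hemisphere {R : realType} (n : nat) (X : metricType R) (p : X) n0 psi :
  ray_space X -> @hemisphere R n (directions p) n0 psi -> isometric_to_half_space n X.
Proof.
move=> RX H; have [e [iso onto]] := ray_space_half_space RX H; have [n01 _ _ _] := H.
case: n n0 psi H e iso onto n01 => [|m] n0 psi H e iso onto n01.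
  by exfalso; move: n01; rewrite /dot big_ord0 => /esym/eqP; rewrite oner_eq0.
pose u : 'rV[R]_m.+1 := delta_mx 0 ord_max.
have du v : dot v u = v 0 ord_max.
  rewrite /dot (bigD1 ord_max) //= big1 ?addr0; first by rewrite mxE !eqxx mulr1.
  by move=> i /negbTE ni; rewrite mxE ni andbF mulr0.
have u1 : dot u u = 1 by rewrite du mxE !eqxx.
have /choice [V VP] : forall x, exists V, 0 <= dot V n0 /\ e V = x.
  by move=> x; have [V h1 h2] := onto x; exists V.
pose Q := householder n0 u.
exists (fun x => Q (V x)); split.
  move=> x y; have [h1 h2] := VP x; have [h3 h4] := VP y.
  by rewrite euclidean_distE householderB /nv householder_dot -/(nv _) -iso // h2 h4.
apply/seteqP; split=> [_ [x _ <-] i|v hv] /=.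
  move=> [im]; have -> : i = ord_max by apply: val_inj.
  by have [h1 _] := VP x; rewrite -du householder_pole.
have hQ : 0 <= dot (Q v) n0.
  by rewrite -(householder_pole n01 u1) householderK du; exact: hv.
exists (e (Q v)) => //; have [h1 h2] := VP (e (Q v)).
have : nv (V (e (Q v)) - Q v) = 0 by rewrite -iso // h2 mdistxx.
move=> h0; have : V (e (Q v)) - Q v = 0 by apply: dot_eq0; rewrite -nv_sq h0 expr0n.
by move/eqP; rewrite subr_eq0 => /eqP ->; rewrite /Q householderK.
Qed.

Theorem theorem1p7 (R : realType) (n : nat) (M : metricType R)
    (M_alexandrov : alexandrov_nonneg n M)
    (M_noncompact : ~ compact [set: M])
    (M_ob : ob_infty_space M = (pi / 2)%:E) :
  (boundary n M = set0 ->
    forall N : metricType R, is_ideal_boundary M N ->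
      ((pi / 2)%:E <= one_side_inj N)%E) /\
  (boundary n M !=set0 -> isometric_to_half_space n M).

Proof.
have St := alexandrov_stewart M_alexandrov.
have RM := ray_space_of_obtuse M_ob (alexandrov_proper M_alexandrov)
  (alexandrov_segment M_alexandrov) St.
split=> [_ N|[p bp]]; first exact: (one_side_inj_ideal M_alexandrov RM).
have [n0 [psi H]] := boundary_directions_hemisphere RM (alexandrov_packing M_alexandrov St) bp.
exact: (half_space_of_hemisphere RM H).
Qed.
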